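(* Let $k$ be an algebraically closed field of characteristic $p>0$, let $X$ be a smooth connected projective curve over $k$, let $\Sigma \subset X$ be a non-empty finite set of closed points of $X$, and let $C = X - \Sigma$. Then the étale fundamental group $\pi_1(C)$ is almost $\omega$-free.
   Context: A finite embedding problem $\mathcal{E}$ for a profinite group $\Pi$ is a pair of surjective (continuous) homomorphisms $(\alpha:\Pi \to G, f:\Gamma \to G)$ where $\Gamma$ and $G$ are finite groups. A weak solution to $\mathcal{E}$ is a (continuous) homomorphism $\gamma:\Pi \to \Gamma$ with $f\circ\gamma = \alpha$; it is a proper solution if in addition $\gamma$ is surjective. If $H \subset \Pi$ is an open subgroup such that $\alpha|_H: H \to G$ is surjective, then $\mathcal{E}_H = (\alpha|_H: H\to G, f:\Gamma\to G)$ is the induced embedding problem for $H$. The profinite group $\Pi$ is called almost $\omega$-free if for every finite embedding problem $\mathcal{E} = (\alpha:\Pi\to G, f:\Gamma\to G)$ for $\Pi$ there is an open subgroup $H\subset \Pi$ such that $\alpha|_H: H\to G$ is surjective and the induced embedding problem $\mathcal{E}_H$ has a proper solution. *)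

(* Defs.v *)
From HB Require Import structures.
From mathcomp Require Import all_boot all_order all_algebra all_fingroup.
From mathcomp Require Import all_classical topology.
From mathcomp Require mpoly.

Set Implicit Arguments.
Unset Strict Implicit.
Unset Printing Implicit Defensive.

Import GRing.Theory.
Local Open Scope classical_set_scope.
Local Open Scope ring_scope.

Definition prime_ideal (A : comPzRingType) (P : set A) : Prop :=
  [/\ P 0,
      (forall a b, P a -> P b -> P (a + b)),
      (forall a b, P b -> P (a * b)),
      ~ P 1 &
      forall a b, P (a * b) -> P a \/ P b].

(* [mpoly.mmap] with a target that may be the zero ring (the sections over
   the empty set). *)
Definition poly_eval (k : fieldType) (B : comPzRingType) (phi : k -> B)
    (n : nat) (b : 'I_n -> B) (P : mpoly.mpoly n k) : B :=
  \sum_(m <- mpoly.msupp P)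
    phi (mpoly.mcoeff m P) *
    \prod_(i < n) b i ^+ mpoly.fun_of_multinom m i.

Definition polynomial_algebra (k : fieldType) (B : comPzRingType)
    (phi : k -> B) (n : nat) (b : 'I_n -> B) : Prop :=
  bijective (poly_eval phi b).

Definition finite_type_algebra (k : fieldType) (B : comPzRingType)
    (phi : k -> B) : Prop :=
  exists (n : nat) (b : 'I_n -> B), forall x, exists P, x = poly_eval phi b P.

Definition formally_smooth (A B : comPzRingType) (phi : A -> B) : Prop :=
  forall (R S : comPzRingType) (q : {rmorphism R -> S})
         (u : {rmorphism A -> R}) (v : {rmorphism B -> S}),
    (forall s, exists r, q r = s) ->
    (forall a b, q a = 0 -> q b = 0 -> a * b = 0) ->
    (forall a, v (phi a) = q (u a)) ->
    exists w : {rmorphism B -> R},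
      (forall b, q (w b) = v b) /\ (forall a, w (phi a) = u a).

(* B is free of finite rank over A, with basis e, and its trace form is
   nondegenerate.  The matrix [c i] is that of the multiplication by [e i], so
   that the entry (i, j) of the matrix whose determinant is required to be a
   unit is Tr (e i * e j). *)
Definition free_separable (A B : comPzRingType) (phi : A -> B) : Prop :=
  exists (n : nat) (e : 'I_n -> B) (c : 'I_n -> 'M[A]_n),
    [/\ (forall b, exists! a : {ffun 'I_n -> A}, b = \sum_i phi (a i) * e i),
        (forall i j, e i * e j = \sum_l phi (c i j l) * e l) &
        exists d, \det (\matrix_(i, j) \sum_l c i j l * \tr (c l)) * d = 1].

Record opens (X : topologicalType) := Opens {
  oset :> set X;
  osetP : open oset }.

Definition in_opens (X : topologicalType) (U : opens X) (x : X) : Prop :=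
  oset U x.
Coercion in_opens : opens >-> Funclass.

Definition opens_full (X : topologicalType) : opens X := Opens (@openT X).

Definition opens_preim (X Y : topologicalType) (f : X -> Y)
    (cf : continuous f) (V : opens Y) : opens X :=
  Opens (open_comp (fun x _ => cf x) (osetP V)).

Lemma opens_preimS (X Y : topologicalType) (f : X -> Y) (cf : continuous f)
    (V W : opens Y) :
  W `<=` V -> opens_preim cf W `<=` opens_preim cf V.
Proof. by move=> WV x /WV. Qed.

Arguments opens_preimS {X Y f} cf {V W}.

Record ringed_space := RingedSpace {
  rs_space :> topologicalType;
  sec : opens rs_space -> comPzRingType;
  res : forall U V : opens rs_space, V `<=` U -> {rmorphism sec U -> sec V};
  res_id : forall (U : opens rs_space) (h : U `<=` U) s, res h s = s;
  res_comp : forall (U V W : opens rs_space) (hV : V `<=` U) (hW : W `<=` V)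
    (hWU : W `<=` U) s, res hWU s = res hW (res hV s);
  glue : forall (I : Type) (U : opens rs_space) (V : I -> opens rs_space)
    (hV : forall i, V i `<=` U) (s : forall i, sec (V i)),
    (forall x, U x -> exists i, V i x) ->
    (forall i j (W : opens rs_space) (hi : W `<=` V i) (hj : W `<=` V j),
       res hi (s i) = res hj (s j)) ->
    exists! t : sec U, forall i, res (hV i) t = s i }.

Arguments sec {r} U.
Arguments res {r U V} h.

(* The germ of s at x is a unit of the stalk at x. *)
Definition unit_at (X : ringed_space) (U : opens X) (s : sec U) (x : X) :
    Prop :=
  exists (V : opens X) (h : V `<=` U) (t : sec V), V x /\ res h s * t = 1.

Lemma open_unit_at (X : ringed_space) (U : opens X) (s : sec U) :
  open [set x | unit_at s x].
Proof.
rewrite openE => x [V [h [t [Vx st]]]].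
apply: filterS (open_nbhs_nbhs (conj (osetP V) Vx)) => y Vy.
by exists V, h, t.
Qed.

Definition basic (X : ringed_space) (U : opens X) (s : sec U) : opens X :=
  Opens (open_unit_at s).

Lemma basicS (X : ringed_space) (U : opens X) (s : sec U) : basic s `<=` U.
Proof. by move=> x [V [h [t [Vx _]]]]; exact: h. Qed.

(* The stalk at x is a local ring: it is nonzero, and one of a and 1 - a is a
   unit for each of its elements a. *)
Definition local_stalk (X : ringed_space) (x : X) : Prop :=
  forall (U : opens X), U x ->
    ~ unit_at (0 : sec U) x /\
    forall s : sec U, unit_at s x \/ unit_at (1 - s) x.

(* The open subspace U is isomorphic to the spectrum of A := sec U: sending x
   to the ideal of the functions that are not invertible at x is a
   homeomorphism of U onto the set of prime ideals of A with the topology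
   generated by the sets D(s), and the sections over D(s) are the localization
   A_s. *)
Definition affine (X : ringed_space) (U : opens X) : Prop :=
  [/\ (forall x, U x -> prime_ideal [set s : sec U | ~ unit_at s x]),
      (forall P : set (sec U), prime_ideal P ->
         exists! x, U x /\ P = [set s : sec U | ~ unit_at s x]),
      (forall (W : opens X) x, W `<=` U -> W x ->
         exists s : sec U, basic s x /\ basic s `<=` W) &
      forall s : sec U,
        [/\ (exists t, res (@basicS X U s) s * t = 1),
            (forall t : sec (basic s), exists (n : nat) (a : sec U),
               res (@basicS X U s) s ^+ n * t = res (@basicS X U s) a) &
            forall a : sec U, res (@basicS X U s) a = 0 ->
               exists n : nat, s ^+ n * a = 0]].

Record scheme := Scheme {
  sch_rs :> ringed_space;
  sch_local : forall x : sch_rs, local_stalk x;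
  sch_affine : forall x : sch_rs, exists U : opens sch_rs, U x /\ affine U }.

(* [pull_local]: the map induced on stalks at x is a local homomorphism. *)
Record scheme_morphism (X Y : scheme) := SchemeMorphism {
  mfun :> X -> Y;
  mcont : continuous mfun;
  pull : forall V : opens Y,
    {rmorphism sec V -> sec (opens_preim mcont V)};
  pull_res : forall (V W : opens Y) (h : W `<=` V) (s : sec V),
    pull W (res h s) = res (opens_preimS mcont h) (pull V s);
  pull_local : forall (V : opens Y) (s : sec V) (x : X),
    V (mfun x) -> unit_at (pull V s) x -> unit_at s (mfun x) }.

Arguments pull {X Y} f V : rename.

Definition mpreim (X Y : scheme) (f : scheme_morphism X Y) (V : opens Y) :
    opens X :=
  opens_preim (@mcont X Y f) V.

(* g \o f = h, as morphisms of schemes. *)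
Definition factors (X Y Z : scheme) (f : scheme_morphism X Y)
    (g : scheme_morphism Y Z)
    (h : scheme_morphism X Z) : Prop :=
  (forall x, g (f x) = h x) /\
  (forall (V : opens Z) (W : opens X)
     (hgf : W `<=` mpreim f (mpreim g V)) (hh : W `<=` mpreim h V)
     (s : sec V),
     res hgf (pull f (mpreim g V) (pull g V s)) = res hh (pull h V s)).

Definition open_immersion (X Y : scheme) (f : scheme_morphism X Y) : Prop :=
  [/\ injective f,
      (forall W : opens X, open (f @` W)) &
      forall V : opens Y, V `<=` range f -> bijective (pull f V)].

Definition closed_immersion (X Y : scheme) (f : scheme_morphism X Y) : Prop :=
  [/\ injective f,
      (forall Z : set X, closed Z -> closed (f @` Z)) &
      forall (V : opens Y) (s : sec (mpreim f V)) (y : Y), V y ->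
        exists (W : opens Y) (h : W `<=` V) (t : sec W),
          W y /\ pull f W t = res (opens_preimS (@mcont X Y f) h) s].

(* Locally on the target, the spectrum of a free separable algebra
   (H. W. Lenstra, Galois theory for schemes). *)
Definition finite_etale (X Y : scheme) (f : scheme_morphism X Y) : Prop :=
  forall y : Y, exists V : opens Y,
    [/\ V y, affine V, affine (mpreim f V) & free_separable (pull f V)].

Definition closed_point (X : topologicalType) (x : X) : Prop :=
  closed [set x].

Definition irreducible_closed (X : topologicalType) (Z : set X) : Prop :=
  [/\ closed Z, Z !=set0 &
      forall A B : set X, closed A -> closed B -> Z `<=` A `|` B ->
        Z `<=` A \/ Z `<=` B].

Definition irreducible_chain (X : topologicalType) (n : nat) : Prop :=
  exists Z : nat -> set X,
    (forall i, (i <= n)%N -> irreducible_closed (Z i)) /\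
    (forall i, (i < n)%N -> Z i `<` Z i.+1).

Definition krull_dim (X : topologicalType) (n : nat) : Prop :=
  irreducible_chain X n /\ ~ irreducible_chain X n.+1.

(* A morphism from X to the spectrum of k amounts to a ring morphism from k to
   the global sections of X. *)
Record kscheme (k : fieldType) := KScheme {
  ksch :> scheme;
  kstr : {rmorphism k -> sec (opens_full ksch)} }.

Arguments kstr {k} X : rename.

Lemma sub_full (X : topologicalType) (U : opens X) : U `<=` opens_full X.
Proof. by []. Qed.

Definition kalg (k : fieldType) (X : kscheme k) (U : opens X) (a : k) :
    sec U :=
  res (@sub_full X U) (kstr X a).

Definition kmorphism (k : fieldType) (X Y : kscheme k)
    (f : scheme_morphism X Y) : Prop :=
  forall a : k,
    res (@sub_full X (mpreim f (opens_full Y))) (kstr X a) =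
    pull f (opens_full Y) (kstr Y a).

(* P is the projective n-space over k: it is glued from affine n-spaces U i,
   where t i j is the coordinate x_j / x_i. *)
Definition projective_space (k : fieldType) (n : nat) (P : kscheme k) : Prop :=
  exists (U : 'I_n.+1 -> opens P) (t : forall i, 'I_n.+1 -> sec (U i)),
    [/\ (forall x, exists i, U i x),
        (forall i, affine (U i)),
        (forall i, t i i = 1 /\
           polynomial_algebra (@kalg k P (U i))
             (fun j : 'I_n => t i (lift i j))),
        (forall i j x, U i x -> (U j x <-> unit_at (t i j) x)) &
        forall i j l (W : opens P) (hi : W `<=` U i) (hj : W `<=` U j),
          res hj (t j l) * res hi (t i j) = res hi (t i l)].

Definition projective (k : fieldType) (X : kscheme k) : Prop :=
  exists (n : nat) (P : kscheme k) (f : scheme_morphism X P),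
    [/\ projective_space n P, kmorphism f & closed_immersion f].

(* Smooth: formally smooth and locally of finite presentation; over a field the
   latter means locally of finite type. *)
Definition smooth (k : fieldType) (X : kscheme k) : Prop :=
  forall x : X, exists U : opens X,
    [/\ U x, affine U, finite_type_algebra (@kalg k X U) &
        formally_smooth (@kalg k X U)].

Definition smooth_connected_projective_curve (k : fieldType) (X : kscheme k) :
    Prop :=
  [/\ smooth X, connected [set: X], projective X & krull_dim X 1].

(* The fundamental group of a scheme below acts on the fibres of all covers of
   that scheme.  It therefore lives in a universe above that of the carriers
   of the MathComp structures, and can be given neither a [choiceType] nor a
   [topologicalType] structure. *)
Record topgroup := TopGroup {
  tg :> Type;
  tg1 : tg;
  tgM : tg -> tg -> tg;
  tgV : tg -> tg;
  tgMA : forall x y z, tgM x (tgM y z) = tgM (tgM x y) z;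
  tg1M : forall x, tgM tg1 x = x;
  tgVM : forall x, tgM (tgV x) x = tg1;
  tgopen : (tg -> Prop) -> Prop;
  tgopenT : tgopen (fun _ => True);
  tgopenI : forall U V, tgopen U -> tgopen V -> tgopen (fun x => U x /\ V x);
  tgopenU : forall F : (tg -> Prop) -> Prop, (forall U, F U -> tgopen U) ->
    tgopen (fun x => exists2 U, F U & U x);
  tgV_cont : forall U, tgopen U -> tgopen (fun x => U (tgV x));
  tgM_cont : forall U x y, tgopen U -> U (tgM x y) ->
    exists V W, [/\ tgopen V, tgopen W, V x, W y &
      forall a b, V a -> W b -> U (tgM a b)] }.

Record open_subgroup (P : topgroup) := OpenSubgroup {
  osg :> P -> Prop;
  osg_open : tgopen osg;
  osg1 : osg (tg1 P);
  osgM : forall x y, osg x -> osg y -> osg (tgM x y);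
  osgV : forall x, osg x -> osg (tgV x) }.

Section SubgroupTopGroup.
Variables (P : topgroup) (H : open_subgroup P).

Definition osg_carrier : Type := {x : P | H x}.

Lemma osg_inj (x y : osg_carrier) : proj1_sig x = proj1_sig y -> x = y.
Proof.
case: x y => [x Hx] [y Hy] /= xy; case: y / xy Hy => Hy.
by rewrite (Prop_irrelevance Hx Hy).
Qed.

Definition osg_tg1 : osg_carrier := exist _ (tg1 P) (osg1 H).
Definition osg_tgM (x y : osg_carrier) : osg_carrier :=
  exist _ (tgM (proj1_sig x) (proj1_sig y))
    (osgM (proj2_sig x) (proj2_sig y)).
Definition osg_tgV (x : osg_carrier) : osg_carrier :=
  exist _ (tgV (proj1_sig x)) (osgV (proj2_sig x)).
Definition osg_tgopen (V : osg_carrier -> Prop) : Prop :=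
  exists2 U : P -> Prop, tgopen U & forall x, V x <-> U (proj1_sig x).

Lemma osg_tgMA x y z : osg_tgM x (osg_tgM y z) = osg_tgM (osg_tgM x y) z.
Proof. by apply: osg_inj => /=; rewrite tgMA. Qed.

Lemma osg_tg1M x : osg_tgM osg_tg1 x = x.
Proof. by apply: osg_inj => /=; rewrite tg1M. Qed.

Lemma osg_tgVM x : osg_tgM (osg_tgV x) x = osg_tg1.
Proof. by apply: osg_inj => /=; rewrite tgVM. Qed.

Lemma osg_tgopenT : osg_tgopen (fun _ => True).
Proof. by exists (fun _ => True) => //; exact: tgopenT. Qed.

Lemma osg_tgopenI U V : osg_tgopen U -> osg_tgopen V ->
  osg_tgopen (fun x => U x /\ V x).
Proof.
move=> [U' oU' UU'] [V' oV' VV']; exists (fun x => U' x /\ V' x).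
  exact: tgopenI.
by move=> x; split=> -[/UU' ? /VV' ?].
Qed.

Lemma osg_tgopenU (F : (osg_carrier -> Prop) -> Prop) :
  (forall U, F U -> osg_tgopen U) ->
  osg_tgopen (fun x => exists2 U, F U & U x).
Proof.
move=> oF.
pose F' (U' : P -> Prop) := tgopen U' /\
  exists2 U, F U & forall x, U x <-> U' (proj1_sig x).
exists (fun x => exists2 U', F' U' & U' x); first by apply: tgopenU => U' [].
move=> x; split=> [[U FU Ux]|[U' [oU' [U FU UU']] U'x]].
  have [U' oU' UU'] := oF _ FU.
  by exists U'; [split=> //; exists U | exact/UU'].
by exists U => //; exact/UU'.
Qed.

Lemma osg_tgV_cont U : osg_tgopen U -> osg_tgopen (fun x => U (osg_tgV x)).
Proof.
move=> [U' oU' UU']; exists (fun x => U' (tgV x)); first exact: tgV_cont.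
by move=> x; exact: UU'.
Qed.

Lemma osg_tgM_cont U x y : osg_tgopen U -> U (osg_tgM x y) ->
  exists V W, [/\ osg_tgopen V, osg_tgopen W, V x, W y &
    forall a b, V a -> W b -> U (osg_tgM a b)].
Proof.
move=> [U' oU' UU'] /UU' /(tgM_cont oU')[V [W [oV oW Vx Wy VW]]].
exists (fun a => V (proj1_sig a)), (fun b => W (proj1_sig b)); split=> //.
- by exists V.
- by exists W.
- by move=> a b Va Wb; apply/UU'/VW.
Qed.

Definition subgroup_topgroup : topgroup :=
  TopGroup osg_tgMA osg_tg1M osg_tgVM osg_tgopenT osg_tgopenI osg_tgopenU
    osg_tgV_cont osg_tgM_cont.

End SubgroupTopGroup.

Definition hom_to_finite (P : topgroup) (G : finGroupType) (a : P -> G) :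
    Prop :=
  (forall x y, a (tgM x y) = (a x * a y)%g) /\
  (forall A : set G, tgopen (fun x => A (a x))).

Record embedding_problem (P : topgroup) := EmbeddingProblem {
  ep_G : finGroupType;
  ep_Gamma : finGroupType;
  ep_alpha : P -> ep_G;
  ep_f : ep_Gamma -> ep_G;
  ep_alpha_hom : hom_to_finite ep_alpha;
  ep_alpha_surj : forall g, exists x, ep_alpha x = g;
  ep_f_hom : {morph ep_f : x y / (x * y)%g};
  ep_f_surj : forall g, exists x, ep_f x = g }.

Definition weak_solution (P : topgroup) (E : embedding_problem P)
    (gamma : P -> ep_Gamma E) : Prop :=
  hom_to_finite gamma /\ forall x, ep_f (gamma x) = ep_alpha E x.

Definition proper_solution (P : topgroup) (E : embedding_problem P)
    (gamma : P -> ep_Gamma E) : Prop :=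
  weak_solution gamma /\ forall g, exists x, gamma x = g.

Section Induced.
Variables (P : topgroup) (E : embedding_problem P) (H : open_subgroup P).

Definition alpha_restr (x : subgroup_topgroup H) : ep_G E :=
  ep_alpha E (proj1_sig x).

Lemma alpha_restr_hom : hom_to_finite alpha_restr.
Proof.
have [aM aC] := ep_alpha_hom E; split=> [x y|A]; first exact: aM.
by exists (fun x => A (ep_alpha E x)); first exact: aC.
Qed.

Definition induced_problem (hs : forall g, exists x, alpha_restr x = g) :
    embedding_problem (subgroup_topgroup H) :=
  EmbeddingProblem alpha_restr_hom hs (@ep_f_hom P E) (@ep_f_surj P E).

End Induced.

Definition almost_omega_free (P : topgroup) : Prop :=
  forall E : embedding_problem P,
    exists (H : open_subgroup P)
           (hs : forall g, exists x, @alpha_restr P E H x = g)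
           (gamma : subgroup_topgroup H -> ep_Gamma (induced_problem hs)),
      proper_solution gamma.

Record etale_cover (C : scheme) := EtaleCover {
  cov :> scheme;
  cov_map : scheme_morphism cov C;
  cov_fe : finite_etale cov_map }.

Record cover_morphism (C : scheme) (Y Z : etale_cover C) := CoverMorphism {
  cm :> scheme_morphism Y Z;
  cm_over : factors cm (@cov_map C Z) (@cov_map C Y) }.

(* The points of the scheme Y above c.  When the residue field of c is
   separably closed, they are the geometric points of Y above c, so that
   [fibre] is the fibre functor at the geometric point c. *)
Definition fibre (C : scheme) (c : C) (Y : etale_cover C) : Type :=
  {y : Y | cov_map Y y = c}.

Record fibre_aut (C : scheme) (c : C) := FibreAut {
  fa : forall Y : etale_cover C, fibre c Y -> fibre c Y;
  fai : forall Y : etale_cover C, fibre c Y -> fibre c Y;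
  faK : forall Y (y : fibre c Y), fai (fa y) = y;
  faiK : forall Y (y : fibre c Y), fa (fai y) = y;
  fa_nat : forall (Y Z : etale_cover C) (g : cover_morphism Y Z)
    (y : fibre c Y) (z : fibre c Z),
    proj1_sig z = g (proj1_sig y) ->
    proj1_sig (fa z) = g (proj1_sig (fa y)) }.

Section Pi1.
Variables (C : scheme) (c : C).
Local Notation aut := (fibre_aut c).

Lemma fibre_inj (Y : etale_cover C) (y z : fibre c Y) :
  proj1_sig y = proj1_sig z -> y = z.
Proof.
case: y z => [y hy] [z hz] /= yz; case: z / yz hz => hz.
by rewrite (Prop_irrelevance hy hz).
Qed.

Lemma fibre_aut_ext (a b : aut) :
  (forall Y (y : fibre c Y), fa a y = fa b y) -> a = b.
Proof.
case: a b => [a ai aK aiK aN] [b bi bK biK bN] /= ab.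
have eab : a = b.
  by apply: functional_extensionality_dep => Y;
     apply: functional_extensionality_dep => y; exact: ab.
have eabi : ai = bi.
  apply: functional_extensionality_dep => Y.
  apply: functional_extensionality_dep => y.
  by rewrite -[LHS]bK -ab aiK.
case: b / eab bK biK bN {ab} => bK biK bN.
case: bi / eabi bK biK => bK biK.
by rewrite (Prop_irrelevance aK bK) (Prop_irrelevance aiK biK)
  (Prop_irrelevance aN bN).
Qed.

Definition fibre_aut1 : aut.
Proof. by exists (fun _ y => y) (fun _ y => y). Defined.

Definition fibre_autM (a b : aut) : aut.
Proof.
exists (fun Y y => fa a (fa b y)) (fun Y y => fai b (fai a y)).
- by move=> Y y; rewrite !faK.
- by move=> Y y; rewrite !faiK.
- by move=> Y Z g y z zy; do 2 apply: fa_nat.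
Defined.

Lemma fai_nat (a : aut) (Y Z : etale_cover C) (g : cover_morphism Y Z)
    (y : fibre c Y) (z : fibre c Z) :
  proj1_sig z = g (proj1_sig y) ->
  proj1_sig (fai a z) = g (proj1_sig (fai a y)).
Proof.
move=> zy.
have hw : cov_map Z (g (proj1_sig (fai a y))) = c.
  by rewrite (cm_over g).1 (proj2_sig (fai a y)).
pose w : fibre c Z := exist _ _ hw.
have /= aw : proj1_sig (fa a w) = g (proj1_sig (fa a (fai a y))).
  exact: fa_nat.
rewrite faiK -zy in aw.
by rewrite -(fibre_inj aw) faK.
Qed.

Definition fibre_autV (a : aut) : aut.
Proof.
exists (fun Y y => fai a y) (fun Y y => fa a y).
- by move=> Y y; rewrite faiK.
- by move=> Y y; rewrite faK.
- by move=> Y Z g y z zy; exact: fai_nat.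
Defined.

Definition agree_on (n : nat) (Y : 'I_n -> etale_cover C) (a b : aut) : Prop :=
  forall i (y : fibre c (Y i)), fa a y = fa b y.

(* The topology of the action on the discrete fibres. *)
Definition fibre_aut_open (U : aut -> Prop) : Prop :=
  forall a, U a -> exists (n : nat) (Y : 'I_n -> etale_cover C),
    forall b, agree_on Y a b -> U b.

Lemma agree_on_open n (Y : 'I_n -> etale_cover C) a :
  fibre_aut_open (agree_on Y a).
Proof.
by move=> b ab; exists n, Y => d bd i y; rewrite (ab i y) (bd i y).
Qed.

Lemma fibre_autMA x y z :
  fibre_autM x (fibre_autM y z) = fibre_autM (fibre_autM x y) z.
Proof. exact: fibre_aut_ext. Qed.

Lemma fibre_aut1M x : fibre_autM fibre_aut1 x = x.
Proof. exact: fibre_aut_ext. Qed.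

Lemma fibre_autVM x : fibre_autM (fibre_autV x) x = fibre_aut1.
Proof. by apply: fibre_aut_ext => Y y /=; rewrite faK. Qed.

Lemma fibre_aut_openT : fibre_aut_open (fun _ => True).
Proof.
move=> a _.
by exists 0%N, (fun i : 'I_0 => False_rect _ (notF (ltn_ord i))).
Qed.

Lemma fibre_aut_openI U V : fibre_aut_open U -> fibre_aut_open V ->
  fibre_aut_open (fun x => U x /\ V x).
Proof.
move=> oU oV a [/oU[m [Y YU]] /oV[n [Z ZV]]].
exists (m + n)%N, (fun i => match fintype.split i with
                            | inl j => Y j
                            | inr j => Z j
                            end).
move=> b ab; split.
  by apply: YU => i; have := ab (unsplit (inl i)); rewrite unsplitK.
by apply: ZV => i; have := ab (unsplit (inr i)); rewrite unsplitK.
Qed.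

Lemma fibre_aut_openU (F : (aut -> Prop) -> Prop) :
  (forall U, F U -> fibre_aut_open U) ->
  fibre_aut_open (fun x => exists2 U, F U & U x).
Proof.
move=> oF a [U FU /(oF _ FU)[n [Y YU]]].
by exists n, Y => b /YU Ub; exists U.
Qed.

Lemma fibre_autV_cont U : fibre_aut_open U ->
  fibre_aut_open (fun x => U (fibre_autV x)).
Proof.
move=> oU a /oU[n [Y YU]]; exists n, Y => b ab; apply: YU => i y /=.
by rewrite -[LHS](faK b) -ab faiK.
Qed.

Lemma fibre_autM_cont U x y : fibre_aut_open U -> U (fibre_autM x y) ->
  exists V W, [/\ fibre_aut_open V, fibre_aut_open W, V x, W y &
    forall a b, V a -> W b -> U (fibre_autM a b)].
Proof.
move=> oU /oU[n [Y YU]].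
exists (agree_on Y x), (agree_on Y y); split=> //.
- exact: agree_on_open.
- exact: agree_on_open.
- by move=> a b xa yb; apply: YU => i u /=; rewrite (yb i u) (xa i).
Qed.

Definition etale_pi1 : topgroup :=
  TopGroup fibre_autMA fibre_aut1M fibre_autVM fibre_aut_openT fibre_aut_openI
    fibre_aut_openU fibre_autV_cont fibre_autM_cont.

End Pi1.

(* Main.v *)
From HB Require Import structures.
From mathcomp Require Import all_boot all_order all_algebra.
From mathcomp Require Import all_fingroup all_solvable all_field.
From mathcomp Require Import all_classical topology.
From mathcomp Require Import ring.
Require Import Defs.

(** Let t be a function on C that is transcendental over k, and let n = l + s,
where l is a prime other than p and p divides s.  The equation
y^n - t y^s + 1 = 0 makes y a unit, and its derivative n y^(n-1) is a unit as
well, so that it defines a finite étale cover E of C.  At a pole of t, l of the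
roots behave like t^(1/l): the inertia group contains an element of order l
that permutes these cyclically and fixes the s other roots.  If l is large, the
monodromy group of E is therefore (s + 1)-transitive.  If moreover n is prime to
the orders of the monodromy groups of given covers Y_i of C, this remains true
of the subgroup that acts trivially on the fibres of the Y_i.

Given an embedding problem (alpha, f : Gamma -> G), the kernel of alpha contains
the subgroup that acts trivially on the fibres of some such Y_i.  Embed Gamma in
the fibre of E, for s at least the order of Gamma, and let H be the open
subgroup of those x that act on the image of Gamma as the left translation by
some g in Gamma with f g = alpha x.  Mapping x to g is the proper solution: by
transitivity every g is the image of some x, which also shows that alpha is
surjective on H. *)

Set Implicit Arguments.
Unset Strict Implicit.
Unset Printing Implicit Defensive.

Import GRing.Theory.
Local Open Scope classical_set_scope.
Local Open Scope ring_scope.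

(** * Commutative algebra *)

(** Since [etale_pi1] acts on the fibres of all covers at once, an element of a Galois group has to
    be extended to every cover. No absolute Galois group is formed: for each finite list of
    polynomials over the function field K, a finite Galois extension that splits its separable
    members is taken, with a place above [c]. It acts on the fibre of every cover whose chart it
    splits, a point of the fibre being the centre of a morphism over K into the extension. An
    ultrafilter on the lists glues these actions.

    The geometry is reduced to K and its local rings at closed points. Smoothness and dimension 1
    make these discrete valuation rings, and a dimension count yields t, without poles outside a
    removed point. The equation is irreducible over k(t) because it can be solved for t, and over K
    because n is prime to [K : k(t)]; the inertia of order l survives over K because l exceeds
    [K : k(1/t)]. These degrees, and the ranks of the Y_i, are known before s and l are chosen. *)

Lemma zorn_above (T : Type) (Q : set (set T)) (I : set T) :
  Q I ->
  (forall F : set (set T), F !=set0 -> F `<=` Q -> total_on F subset ->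
     Q (\bigcup_(X in F) X)) ->
  exists A, [/\ Q A, I `<=` A & forall B, Q B -> A `<=` B -> B `<=` A].
Proof.
move=> QI Qch.
have [F FP Ftot|A [PA Amax]] := @Zorn_bigcup T [set J | Q (I `|` J)].
  (* [Zorn_bigcup] also asks about the empty chain, whose union is empty; there the property is
     [Q I] itself. *)
  have [->|F0] := eqVneq F set0; first by rewrite /= bigcup_set0 setU0.
  pose G := [set I `|` X | X in F].
  have -> : [set J | Q (I `|` J)] (\bigcup_(X in F) X) = Q (\bigcup_(X in G) X).
    rewrite /=; congr Q; apply/seteqP; split=> [x [Ix|[X FX Xx]]|x [_ [X FX <-]]].
    - by move/set0P: F0 => [X FX]; exists (I `|` X); [exists X|left].
    - by exists (I `|` X); [exists X|right].
    - by case=> [Ix|Xx]; [left|right; exists X].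
  apply: Qch.
  - by move/set0P: F0 => [X FX]; exists (I `|` X), X.
  - by move=> _ [X FX <-]; exact: FP.
  - move=> _ _ [X FX <-] [Y FY <-].
    by have [XY|YX] := Ftot _ _ FX FY; [left|right]; apply: setUS.
exists (I `|` A); split=> //.
move=> B QB IAB x Bx; right; apply: contrapT => nAx.
apply: (Amax B); last first.
  by rewrite /=; congr Q : QB; apply/esym/setUidPr => y Iy; apply: IAB; left.
by rewrite properEneq; split; [apply/eqP => AB; apply: nAx; rewrite AB|
  move=> y Ay; apply: IAB; right].
Qed.

Definition ideal (B : comPzRingType) (I : set B) : Prop :=
  [/\ I 0, (forall a b, I a -> I b -> I (a + b)) &
      forall a b, I b -> I (a * b)].

Section Ideals.
Variable B : comPzRingType.
Implicit Types (I P : set B).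

Lemma idealN I a : ideal I -> I a -> I (- a).
Proof. by move=> [_ _ IM] Ia; rewrite -mulN1r; apply: IM. Qed.

Lemma idealB I a b : ideal I -> I a -> I b -> I (a - b).
Proof. by move=> iI Ia Ib; case: (iI) => _ ID _; apply: ID => //; apply: idealN. Qed.

Lemma idealMl I a b : ideal I -> I a -> I (a * b).
Proof. by move=> [_ _ IM] Ia; rewrite mulrC; apply: IM. Qed.

Lemma ideal_sum I (J : Type) (r : seq J) (P : pred J) (F : J -> B) :
  ideal I -> (forall j, P j -> I (F j)) -> I (\sum_(j <- r | P j) F j).
Proof. by move=> [I0 ID _] IF; elim/big_ind: _. Qed.

Lemma prime_ideal_ideal P : prime_ideal P -> ideal P.
Proof. by case. Qed.

Lemma prime_idealX P a n : prime_ideal P -> P (a ^+ n) -> P a.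
Proof.
case=> _ _ _ P1 PM; elim: n => [|n IH]; first by rewrite expr0.
by rewrite exprS => /PM[].
Qed.

Definition principal (a : B) : set B := [set x | exists c, x = c * a].

Lemma principal_ideal a : ideal (principal a).
Proof.
split; first by exists 0; rewrite mul0r.
  by move=> _ _ [c ->] [d ->]; exists (c + d); rewrite mulrDl.
by move=> x _ [c ->]; exists (x * c); rewrite mulrA.
Qed.

Definition ideal_add I (a : B) : set B :=
  [set x | exists i c, I i /\ x = i + c * a].

Lemma ideal_add_ideal I a : ideal I -> ideal (ideal_add I a).
Proof.
move=> [I0 ID IM]; split.
- by exists 0, 0; rewrite mul0r addr0.
- move=> _ _ [i [c [Ii ->]]] [j [d [Ij ->]]].
  by exists (i + j), (c + d); split; [exact: ID | rewrite mulrDl addrACA].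
- move=> x _ [i [c [Ii ->]]]; exists (x * i), (x * c).
  by split; [exact: IM | rewrite mulrDr mulrA].
Qed.

(** Krull: an ideal maximal among those avoiding [S] is prime. If [a] and [b] lie outside, adding
    either one makes the ideal meet [S], and the product of the two elements of [S] lies in the
    ideal as soon as [a * b] does. *)
Lemma prime_avoiding I (S : set B) :
  ideal I -> S 1 -> (forall a b, S a -> S b -> S (a * b)) ->
  (forall s, S s -> ~ I s) ->
  exists P, [/\ prime_ideal P, I `<=` P & forall s, S s -> ~ P s].
Proof.
move=> iI S1 SM IS.
pose Q := [set J : set B | ideal J /\ forall s, S s -> ~ J s].
have [//|F [X0 FX0] FQ Ftot|P [[iP PS] IP Pmax]] := @zorn_above B Q I.
  split.
    split.
    - by exists X0 => //; case: (FQ _ FX0) => -[].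
    - move=> a b [X FX Xa] [Y FY Yb].
      by have [XY|YX] := Ftot _ _ FX FY;
        [exists Y => //; case: (FQ _ FY) => -[_ YD _] _; apply: YD => //; apply: XY
        |exists X => //; case: (FQ _ FX) => -[_ XD _] _; apply: XD => //; apply: YX].
    - by move=> a b [X FX Xb]; exists X => //; case: (FQ _ FX) => -[_ _ XM] _; apply: XM.
  by move=> s Ss [X FX Xs]; case: (FQ _ FX) => _ /(_ _ Ss).
exists P; split=> //; case: (iP) => P0 PD PM; split=> //; first exact: PS.
move=> a b Pab; apply: contrapT => /not_orP[nPa nPb].
have meet c : ~ P c -> exists s d, S s /\ P (s - d * c).
  move=> nPc; apply: contrapT => nS; apply: nPc.
  apply: (Pmax (ideal_add P c)).
  - split; first exact: ideal_add_ideal.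
    move=> s Ss [i [d [Pi sE]]]; apply: nS; exists s, d; split=> //.
    by rewrite sE addrK.
  - by move=> x Px; exists x, 0; rewrite mul0r addr0.
  - by exists 0, 1; rewrite mul1r add0r.
have [s [d [Ss Psd]]] := meet a nPa.
have [s' [d' [Ss' Psd']]] := meet b nPb.
apply: (PS _ (SM _ _ Ss Ss')).
have -> : s * s' = s' * (s - d * a) + d * a * (s' - d' * b) + d * d' * (a * b).
  by ring.
by apply: (PD); [apply: (PD)|]; apply: PM.
Qed.

Definition maximal_ideal (M : set B) : Prop :=
  prime_ideal M /\ forall a, ~ M a -> exists c, M (1 - c * a).

Lemma maximal_above I : ideal I -> ~ I 1 -> exists M, maximal_ideal M /\ I `<=` M.
Proof.
move=> iI I1.
pose Q := [set J : set B | ideal J /\ ~ J 1].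
have [//|F [X0 FX0] FQ Ftot|M [[iM M1] IM Mmax]] := @zorn_above B Q I.
  split; last by move=> [X FX X1]; case: (FQ _ FX).
  split.
  - by exists X0 => //; case: (FQ _ FX0) => -[].
  - move=> a b [X FX Xa] [Y FY Yb].
    by have [XY|YX] := Ftot _ _ FX FY;
      [exists Y => //; case: (FQ _ FY) => -[_ YD _] _; apply: YD => //; apply: XY
      |exists X => //; case: (FQ _ FX) => -[_ XD _] _; apply: XD => //; apply: YX].
  - by move=> a b [X FX Xb]; exists X => //; case: (FQ _ FX) => -[_ _ XM] _; apply: XM.
case: (iM) => M0 MD MM.
have inv a : ~ M a -> exists c, M (1 - c * a).
  move=> nMa; apply: contrapT => nc; apply: nMa; apply: (Mmax (ideal_add M a)).
  - split; first exact: ideal_add_ideal.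
    by move=> [i [c [Mi E]]]; apply: nc; exists c; rewrite E addrK.
  - by move=> x Mx; exists x, 0; rewrite mul0r addr0.
  - by exists 0, 1; rewrite mul1r add0r.
exists M; split=> //; split=> //; split=> //.
move=> a b Mab; apply: contrapT => /not_orP[/inv[c Mc] nMb]; apply: nMb.
have -> : b = b * (1 - c * a) + c * (a * b) by ring.
by apply: (MD); apply: MM.
Qed.

End Ideals.

(** * Quotient rings and residue fields *)

Section Quotient.
Variables (B : comPzRingType) (I : set B) (iI : ideal I).

(** [xget] only sees the coset of [x] as a set, and congruent elements have equal cosets by
    extensionality. One representative per class is thus singled out, and the quotient is the set of
    these representatives. *)
Definition qrepr (x : B) : B := xget 0 [set y | I (y - x)].

Lemma qreprP x : I (qrepr x - x).
Proof.
by apply: (@xgetI _ 0 [set y | I (y - x)] x); rewrite /= subrr; case: (iI).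
Qed.

Lemma qrepr_eq x y : I (x - y) -> qrepr x = qrepr y.
Proof.
move=> Ixy; rewrite /qrepr; congr xget; apply/seteqP; split=> z /= Iz.
  have -> : z - y = (z - x) + (x - y) by rewrite addrA subrK.
  by case: (iI) => _ ID _; apply: ID.
have -> : z - x = (z - y) - (x - y) by rewrite opprB addrA subrK.
exact: idealB.
Qed.

(** The proof that [I] is an ideal is an argument of the type, so that the ring structure that
    depends on it can be inferred. *)
Definition quot of ideal I : Type := {x : B | qrepr x == x}.
Local Notation Q := (quot iI).
HB.instance Definition _ := Choice.on Q.

Lemma qrepr_id x : qrepr (qrepr x) == qrepr x.
Proof. by apply/eqP/qrepr_eq/qreprP. Qed.

Definition qpi (x : B) : Q := exist _ (qrepr x) (qrepr_id x).

Lemma qpi_eq x y : (qpi x = qpi y) <-> I (x - y).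
Proof.
split=> [[]|Ixy]; last by apply/val_inj/qrepr_eq.
move=> E; have -> : x - y = (qrepr y - y) - (qrepr x - x).
  by rewrite E; ring.
by apply: idealB => //; apply: qreprP.
Qed.

Lemma qpi_val (u : Q) : qpi (val u) = u.
Proof. by apply: val_inj => /=; apply/eqP; exact: (valP u). Qed.

Definition qadd (u v : Q) := qpi (val u + val v).
Definition qopp (u : Q) := qpi (- val u).
Definition qmul (u v : Q) := qpi (val u * val v).

Lemma val_qpi x : I (val (qpi x) - x).
Proof. exact: qreprP. Qed.

Lemma qpiD x y : qpi (x + y) = qadd (qpi x) (qpi y).
Proof.
apply/esym/qpi_eq; rewrite opprD addrACA.
by case: (iI) => _ ID _; apply: ID; apply: val_qpi.
Qed.

Lemma qpiN x : qpi (- x) = qopp (qpi x).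
Proof.
by apply/esym/qpi_eq; rewrite -opprD; apply: idealN => //; apply: val_qpi.
Qed.

Lemma qpiM x y : qpi (x * y) = qmul (qpi x) (qpi y).
Proof.
apply/esym/qpi_eq.
have -> : val (qpi x) * val (qpi y) - x * y =
  val (qpi x) * (val (qpi y) - y) + y * (val (qpi x) - x) by ring.
by case: (iI) => _ ID IM; apply: (ID); apply: IM; apply: val_qpi.
Qed.

Let qaddA : associative qadd.
Proof.
move=> u v w; rewrite -(qpi_val u) -(qpi_val v) -(qpi_val w).
by rewrite -!qpiD addrA.
Qed.
Let qaddC : commutative qadd.
Proof. by move=> u v; rewrite -(qpi_val u) -(qpi_val v) -!qpiD addrC. Qed.
Let qadd0 : left_id (qpi 0) qadd.
Proof. by move=> u; rewrite -(qpi_val u) -qpiD add0r. Qed.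
Let qaddN : left_inverse (qpi 0) qopp qadd.
Proof. by move=> u; rewrite -(qpi_val u) -qpiN -qpiD addNr. Qed.
HB.instance Definition _ := GRing.isZmodule.Build Q qaddA qaddC qadd0 qaddN.

Let qmulA : associative qmul.
Proof.
move=> u v w; rewrite -(qpi_val u) -(qpi_val v) -(qpi_val w).
by rewrite -!qpiM mulrA.
Qed.
Let qmulC : commutative qmul.
Proof. by move=> u v; rewrite -(qpi_val u) -(qpi_val v) -!qpiM mulrC. Qed.
Let qmul1 : left_id (qpi 1) qmul.
Proof. by move=> u; rewrite -(qpi_val u) -qpiM mul1r. Qed.
Let qmulD : left_distributive qmul qadd.
Proof.
move=> u v w; rewrite -(qpi_val u) -(qpi_val v) -(qpi_val w).
by rewrite -qpiD -!qpiM -qpiD mulrDl.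
Qed.
HB.instance Definition _ :=
  GRing.Zmodule_isComPzRing.Build Q qmulA qmulC qmul1 qmulD.

Let qpi_additive : zmod_morphism qpi.
Proof. by move=> x y; rewrite qpiD qpiN. Qed.
Let qpi_multiplicative : monoid_morphism qpi.
Proof. by split=> // x y; exact: qpiM. Qed.
HB.instance Definition _ := GRing.isZmodMorphism.Build B Q qpi qpi_additive.
HB.instance Definition _ := GRing.isMonoidMorphism.Build B Q qpi qpi_multiplicative.

Lemma qpi_surj (u : Q) : exists x, u = qpi x.
Proof. by exists (val u); rewrite qpi_val. Qed.

Lemma qpi_eq0 x : (qpi x = 0) <-> I x.
Proof. by rewrite -(rmorph0 qpi); split=> [/qpi_eq|Ix]; [|apply/qpi_eq]; rewrite subr0. Qed.

End Quotient.

Lemma fractionP (R : idomainType) (x : {fraction R}) :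
  exists a b, b != 0 /\ x = tofrac a / tofrac b.
Proof.
elim/quotW: x => r; exists (r : ratio R).1, (r : ratio R).2.
have d0 := denom_ratioP r; split=> //.
apply/(canRL (mulfK _)); first by rewrite tofrac_eq0.
rewrite /GRing.mul /=; unlock tofrac; rewrite !piE.
apply/eqmodP; rewrite /= FracField.equivfE /FracField.mulf.
by rewrite !numden_Ratio ?oner_neq0 ?mulr1 ?mulf_neq0 ?oner_neq0 // mulrC.
Qed.

Section PrimeQuotient.
Variables (B : comPzRingType) (P : set B) (hP : prime_ideal P).

Definition pquot : Type := quot (prime_ideal_ideal hP).
Local Notation Q := pquot.
HB.instance Definition _ := GRing.ComPzRing.on Q.

Let piP : B -> Q := @qpi B P (prime_ideal_ideal hP).

Let pquot_neq0 : (1 : Q) != 0.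
Proof.
by apply/eqP => /(qpi_eq0 (prime_ideal_ideal hP)); case: hP => _ _ _ h _ /h.
Qed.
HB.instance Definition _ := GRing.PzSemiRing_isNonZero.Build Q pquot_neq0.

Let punit : pred Q := fun x => `[< exists y, y * x = 1 >].
Let pinv (x : Q) : Q := xget x [set y | y * x = 1].

Let pmulVx : {in punit, left_inverse 1 pinv *%R}.
Proof. by move=> x /asboolP[y yx]; exact: (@xgetI _ x [set y | y * x = 1] y). Qed.
Let punitPl (x y : Q) : y * x = 1 -> punit x.
Proof. by move=> yx; apply/asboolP; exists y. Qed.
Let pinv_out : {in [predC punit], pinv =1 id}.
Proof.
move=> x /asboolP nx; rewrite /pinv; apply: xgetPN => y yx.
by apply: nx; exists y.
Qed.
HB.instance Definition _ :=
  GRing.ComNzRing_hasMulInverse.Build Q pmulVx punitPl pinv_out.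

Let pquot_idomain (x y : Q) : x * y = 0 -> (x == 0) || (y == 0).
Proof.
move=> xy; have /qpi_eq0 : qpi (prime_ideal_ideal hP) (val x * val y) = 0.
  by rewrite rmorphM /= !qpi_val.
case: (hP) => _ _ _ _ h /h[] /(qpi_eq0 (prime_ideal_ideal hP)); rewrite qpi_val => E.
  by apply/orP; left; apply/eqP.
by apply/orP; right; apply/eqP.
Qed.
HB.instance Definition _ := GRing.ComUnitRing_isIntegral.Build Q pquot_idomain.

Definition residue_field : fieldType := {fraction Q}.

Definition to_residue (b : B) : residue_field := tofrac (piP b).

Let to_residue_additive : zmod_morphism to_residue.
Proof.
move=> x y; rewrite -tofracB; congr tofrac.
exact: (rmorphB (@qpi B P (prime_ideal_ideal hP))).
Qed.
Let to_residue_multiplicative : monoid_morphism to_residue.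
Proof.
split; first exact: (tofrac1 Q).
move=> x y; rewrite -tofracM; congr tofrac.
exact: (rmorphM (@qpi B P (prime_ideal_ideal hP))).
Qed.
HB.instance Definition _ :=
  GRing.isZmodMorphism.Build B (residue_field) to_residue to_residue_additive.
HB.instance Definition _ :=
  GRing.isMonoidMorphism.Build B (residue_field) to_residue to_residue_multiplicative.

Lemma to_residue_eq0 b : (to_residue b = 0) <-> P b.
Proof.
split=> [/eqP|Pb]; first by rewrite tofrac_eq0 => /eqP/(qpi_eq0 (prime_ideal_ideal hP)).
by apply/eqP; rewrite tofrac_eq0; apply/eqP/(qpi_eq0 (prime_ideal_ideal hP)).
Qed.

Lemma residue_fieldP (q : residue_field) :
  exists a b, ~ P b /\ q = to_residue a / to_residue b.
Proof.
have [x [y [y0 ->]]] := fractionP q.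
exists (val x), (val y); split.
  move=> /(qpi_eq0 (prime_ideal_ideal hP)); rewrite qpi_val => yE.
  by move: y0; rewrite yE eqxx.
by rewrite /to_residue /piP !qpi_val.
Qed.

End PrimeQuotient.

Lemma prime_residue (B : comPzRingType) (P : set B) : prime_ideal P ->
  exists (L : fieldType) (pr : {rmorphism B -> L}),
    (forall x, pr x = 0 <-> P x) /\
    forall q, exists a b, ~ P b /\ q = pr a / pr b.
Proof.
move=> hP; exists (residue_field hP), (to_residue hP).
by split; [exact: to_residue_eq0 | exact: residue_fieldP].
Qed.

Inductive subring_gen (B : comPzRingType) (A : set B) : B -> Prop :=
| SubringGen a : A a -> subring_gen A a
| SubringGen1 : subring_gen A 1
| SubringGenB a b : subring_gen A a -> subring_gen A b -> subring_gen A (a - b)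
| SubringGenM a b : subring_gen A a -> subring_gen A b -> subring_gen A (a * b).

Section SubringGen.
Variables (B : comPzRingType) (A : set B).

Lemma subring_gen0 : subring_gen A 0.
Proof. by rewrite -(subrr 1); apply: SubringGenB; apply: SubringGen1. Qed.

Lemma subring_genN a : subring_gen A a -> subring_gen A (- a).
Proof. by rewrite -sub0r; apply: SubringGenB; apply: subring_gen0. Qed.

Lemma subring_genD a b :
  subring_gen A a -> subring_gen A b -> subring_gen A (a + b).
Proof. by rewrite -{2}[b]opprK => ? /subring_genN; apply: SubringGenB. Qed.

Lemma subring_genX a n : subring_gen A a -> subring_gen A (a ^+ n).
Proof.
move=> Aa; elim: n => [|n IH]; first by rewrite expr0; apply: SubringGen1.
by rewrite exprS; apply: SubringGenM.
Qed.

Lemma subring_gen_sum (J : Type) (r : seq J) (P : pred J) (F : J -> B) :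
  (forall j, P j -> subring_gen A (F j)) ->
  subring_gen A (\sum_(j <- r | P j) F j).
Proof.
move=> AF; elim/big_ind: _ => //; first exact: subring_gen0.
exact: subring_genD.
Qed.

Lemma subring_gen_prod (J : Type) (r : seq J) (P : pred J) (F : J -> B) :
  (forall j, P j -> subring_gen A (F j)) ->
  subring_gen A (\prod_(j <- r | P j) F j).
Proof.
move=> AF; elim/big_ind: _ => //; first exact: SubringGen1.
exact: SubringGenM.
Qed.

Lemma subring_gen_sub (A' : set B) :
  (forall a, A a -> subring_gen A' a) ->
  forall a, subring_gen A a -> subring_gen A' a.
Proof.
move=> AA' a; elim=> [b /AA'|| b c _ ? _ ?| b c _ ? _ ?] //.
- exact: SubringGen1.
- exact: SubringGenB.
- exact: SubringGenM.
Qed.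

End SubringGen.

Section Subfield.
Variables (L : fieldType) (S : {pred L}) (hS : GRing.divring_closed S).

Definition subfield_pred of GRing.divring_closed S : {pred L} := S.
Local Notation S' := (subfield_pred hS).
HB.instance Definition _ := GRing.isDivringClosed.Build L S' hS.

Definition subfield : Type := {x : L | x \in S'}.
HB.instance Definition _ := SubType.on subfield.
HB.instance Definition _ := Choice.on subfield.
HB.instance Definition _ := [SubChoice_isSubComUnitRing of subfield by <:].
HB.instance Definition _ := [SubComUnitRing_isSubIntegralDomain of subfield by <:].
HB.instance Definition _ := [SubIntegralDomain_isSubField of subfield by <:].

Definition subfield_val (x : subfield) : L := val x.
HB.instance Definition _ := GRing.RMorphism.copy subfield_val (val : subfield -> L).

End Subfield.

(** * Fractions, integrality and Zariski's lemma *)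

Section FractionsIn.
Variables (R : comNzRingType) (L : fieldType) (e : {rmorphism R -> L}).

Definition fractions_in : {pred L} :=
  [pred y | `[< exists a b, e b != 0 /\ y = e a / e b >]].

Lemma fractions_inP y :
  reflect (exists a b, e b != 0 /\ y = e a / e b) (y \in fractions_in).
Proof. exact: asboolP. Qed.

Lemma fractions_in_divring : GRing.divring_closed fractions_in.
Proof.
split.
- by apply/fractions_inP; exists 1, 1; rewrite rmorph1 oner_neq0 divr1.
- move=> _ _ /fractions_inP[a [b [b0 ->]]] /fractions_inP[c [d [d0 ->]]].
  apply/fractions_inP; exists (a * d - c * b), (b * d).
  rewrite rmorphB !rmorphM mulf_neq0 //; split=> //.
  by field; rewrite b0 d0.
- move=> _ _ /fractions_inP[a [b [b0 ->]]] /fractions_inP[c [d [d0 ->]]].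
  apply/fractions_inP; have [c0|c0] := eqVneq (e c) 0.
    by exists 0, 1; rewrite rmorph1 rmorph0 oner_neq0 c0 mul0r invr0 mulr0 mul0r.
  exists (a * d), (b * c); rewrite !rmorphM mulf_neq0 //=.
  by rewrite invf_div mulf_div.
Qed.

(** The fraction field of the image of [e], realized inside [L]. For [e := evalp f x] it is the
    subfield F(x) of L. *)
Definition fraction_field := subfield fractions_in_divring.
Definition fraction_val : {rmorphism fraction_field -> L} :=
  @subfield_val L fractions_in fractions_in_divring.

Lemma fraction_valP (q : fraction_field) :
  exists a b, e b != 0 /\ fraction_val q = e a / e b.
Proof. by apply/fractions_inP; exact: (valP q). Qed.

Lemma fraction_in a b :
  e b != 0 -> exists q : fraction_field, fraction_val q = e a / e b.
Proof.
move=> b0; have h : e a / e b \in subfield_pred fractions_in_divring.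
  by apply/fractions_inP; exists a, b.
by exists (@exist L (fun x => x \in subfield_pred fractions_in_divring) _ h).
Qed.

Lemma fraction_in1 a : exists q : fraction_field, fraction_val q = e a.
Proof.
have [|q qE] := @fraction_in a 1; first by rewrite rmorph1 oner_neq0.
by exists q; rewrite qE rmorph1 divr1.
Qed.

(** Multiplying the monic relation of degree m by d^m, where d is a common denominator of its
    coefficients, turns it into a monic relation for [e d * y]: its i-th coefficient is d^(m-i) p_i,
    which has no denominator left for i < m. *)
Lemma common_denominator (y : L) :
  integralOver fraction_val y -> exists d, e d != 0 /\ integralOver e (e d * y).
Proof.
case=> p mp py0.
have /choice[den denP] : forall i : nat, exists d : R,
    e d != 0 /\ exists a, e d * fraction_val p`_i = e a.
  move=> i; have [a [b [b0 E]]] := fraction_valP p`_i.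
  by exists b; split=> //; exists a; rewrite E mulrC divfK.
pose m := (size p).-1.
pose d := \prod_(i < m) den i.
have d0 : e d != 0 by rewrite rmorph_prod prodf_seq_neq0; apply/allP => i _; case: (denP i).
exists d; split=> //.
pose q := \poly_(i < m.+1) (e d ^+ (m - i) * fraction_val p`_i).
have sp : size p = m.+1 by rewrite prednK // size_poly_gt0 monic_neq0.
have pm : p`_m = 1 by have /monicP := mp; rewrite lead_coefE -/m.
have qm : q \is monic.
  rewrite monicE lead_coefE; have -> : size q = m.+1.
    by rewrite size_poly_eq // subnn expr0 mul1r pm rmorph1 oner_neq0.
  by rewrite coef_poly ltnSn subnn expr0 mul1r pm rmorph1.
apply: (integral_root_monic qm).
  rewrite rootE horner_poly.
  have -> : \sum_(i < m.+1) e d ^+ (m - i) * fraction_val p`_i * (e d * y) ^+ i =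
    e d ^+ m * (map_poly fraction_val p).[y].
    rewrite (@horner_coef_wide _ m.+1) ?size_map_poly ?sp // mulr_sumr.
    apply: eq_bigr => i _; rewrite coef_map /= exprMn.
    have -> : e d ^+ m = e d ^+ (m - i) * e d ^+ i.
      by rewrite -exprD subnK // -ltnS.
    by ring.
  by rewrite (rootP py0) mulr0.
apply/integral_poly => i; rewrite coef_poly; case: ltnP => [im|_]; last exact: integral0.
have [->|im'] := eqVneq i m.
  by rewrite subnn expr0 mul1r pm rmorph1; apply: integral1.
have {im im'}im : (i < m)%N by rewrite ltn_neqAle im' -ltnS.
have [a aE] : exists a, e d * fraction_val p`_i = e a.
  rewrite /d (bigD1 (Ordinal im)) //= rmorphM mulrAC.
  have [_ [a ->]] := denP i.
  by eexists; rewrite -rmorphM.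
rewrite -(subnSK im) exprSr -mulrA aE -rmorphXn -rmorphM.
exact: integral_id.
Qed.

End FractionsIn.

Lemma algebraic_gen (F L : fieldType) (f : {rmorphism F -> L}) (A : set L) y :
  (forall a, A a -> algebraicOver f a) -> subring_gen A y -> algebraicOver f y.
Proof.
move=> Aalg; elim=> [a /Aalg|| a b _ ? _ ?| a b _ ? _ ?] //.
- exact: algebraic1.
- exact: algebraic_sub.
- exact: algebraic_mul.
Qed.

Section Eval.
Variables (F L : fieldType) (f : {rmorphism F -> L}) (x : L).

Definition evalp (P : {poly F}) : L := (map_poly f P).[x].

Let evalp_add : zmod_morphism evalp.
Proof. by move=> P Q; rewrite /evalp rmorphB hornerD hornerN. Qed.
Let evalp_mul : monoid_morphism evalp.
Proof.
by split=> [|P Q]; rewrite /evalp ?rmorph1 ?hornerC // rmorphM hornerM.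
Qed.
HB.instance Definition _ := GRing.isZmodMorphism.Build {poly F} L evalp evalp_add.
HB.instance Definition _ := GRing.isMonoidMorphism.Build {poly F} L evalp evalp_mul.

Lemma evalpX : evalp 'X = x.
Proof. by rewrite /evalp map_polyX hornerX. Qed.

Lemma evalpC c : evalp c%:P = f c.
Proof. by rewrite /evalp map_polyC hornerC. Qed.

Lemma evalp_eq0 P : ~ algebraicOver f x -> evalp P = 0 -> P = 0.
Proof.
move=> nx P0; apply: contrapT => /eqP nP; apply: nx; exists P => //.
exact/rootP.
Qed.

Lemma evalp_inj : ~ algebraicOver f x -> injective evalp.
Proof.
move=> nx P Q /eqP; rewrite -subr_eq0 -rmorphB => /eqP/(evalp_eq0 nx)/eqP.
by rewrite subr_eq0 => /eqP.
Qed.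

Lemma evalp_algebraic P : algebraicOver f x -> algebraicOver f (evalp P).
Proof.
move=> ax; apply/integral_algebraic; apply: integral_horner; last exact/integral_algebraic.
by apply/integral_poly => i; rewrite coef_map; apply: integral_id.
Qed.

End Eval.

(** The rational root argument: once the monic relation is multiplied by b^m, every term but a^m is
    a multiple of b. *)
Lemma integral_fraction_dvdp_exp (F L : fieldType) (e : {rmorphism {poly F} -> L})
    (a b : {poly F}) :
  injective e -> b != 0 -> integralOver e (e a / e b) -> exists m, b %| a ^+ m.
Proof.
move=> ei b0 [Q mQ /rootP Q0].
pose m := (size Q).-1; exists m.
have sQ : size Q = m.+1 by rewrite prednK // size_poly_gt0 monic_neq0.
have Qm : Q`_m = 1 by have /monicP := mQ; rewrite lead_coefE -/m.
have eb0 : e b != 0 by rewrite -(inj_eq ei) rmorph0 in b0.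
suff E : a ^+ m = - (b * \sum_(i < m) Q`_i * a ^+ i * b ^+ (m - i.+1)).
  by rewrite E -mulrN dvdp_mulr.
apply: (ei); apply/eqP; rewrite -subr_eq0 -rmorphB opprK; apply/eqP.
transitivity (e b ^+ m * (map_poly e Q).[e a / e b]); last by rewrite Q0 mulr0.
have eQm : (map_poly e Q)`_m = 1.
  by rewrite coef_map -[RHS](rmorph1 e); congr (e _).
rewrite (@horner_coef_wide _ m.+1); last first.
  by rewrite (size_map_inj_poly ei (rmorph0 e)) sQ.
rewrite big_ord_recr /= eQm mul1r mulrDr addrC rmorphD.
congr (_ + _); last by rewrite rmorphXn expr_div_n mulrC divfK ?expf_neq0.
rewrite rmorphM rmorph_sum !mulr_sumr; apply: eq_bigr => i _.
rewrite coef_map !rmorphM !rmorphXn /= expr_div_n.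
have -> : e b ^+ m = e b ^+ (m - i.+1) * e b * e b ^+ i.
  by rewrite -exprSr -exprD addSnnS subnK.
by field; rewrite expf_neq0.
Qed.

Lemma zariski (F L : fieldType) (f : {rmorphism F -> L}) (xs : seq L) :
  (forall y, subring_gen (range f `|` [set` xs]) y) ->
  forall y, algebraicOver f y.
Proof.
elim: xs F f => [|x xs IH] F f gen y.
  apply: algebraic_gen (gen y) => a [[c _ <-]|]; last by rewrite /= in_nil.
  exact: algebraic_id.
pose e : {rmorphism {poly F} -> L} := evalp f x.
have IH' := IH _ (fraction_val e).
have {IH'}alg' : forall y, algebraicOver (fraction_val e) y.
  apply: IH' => z; apply: subring_gen_sub (gen z) => a [[c _ <-]|].
    apply: SubringGen; left; have [q qE] := fraction_in1 e c%:P.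
    by exists q => //; rewrite qE; exact: evalpC.
  rewrite /= inE => /orP[/eqP->|axs]; last by apply: SubringGen; right.
  apply: SubringGen; left; have [q qE] := fraction_in1 e 'X.
  by exists q => //; rewrite qE; exact: evalpX.
have [ax|nax] := pselect (algebraicOver f x).
  have [p p0 py0] := alg' y.
  apply/integral_algebraic.
  apply: (@integral_root _ _ f (map_poly (fraction_val e) p)) => //.
    by rewrite map_poly_eq0.
  apply/integral_poly => i; rewrite coef_map.
  have [a [b [b0 E]]] := fraction_valP p`_i; rewrite [X in integralOver _ X]E.
  by apply/integral_algebraic/algebraic_div; apply: evalp_algebraic.
have ei : injective e := evalp_inj nax.
have e0 P : P != 0 -> e P != 0 by rewrite -(inj_eq ei) rmorph0.
(* With [x] transcendental, one polynomial [a] makes all the generators integral over F[x], so that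
   every element of L becomes integral after multiplication by a power of [a]. The inverse of
   [1 + x a] cannot, its denominator being prime to [a]. *)
exfalso.
have [a [a0 aI]] : exists a : {poly F}, a != 0 /\ forall z, z \in x :: xs -> integralOver e (e a * z).
  elim: (x :: xs) => [|z zs [a [a0 IHa]]].
    by exists 1; rewrite oner_neq0.
  have [d [d0 dz]] := common_denominator ((integral_algebraic _ _).1 (alg' z)).
  exists (d * a); split.
    by rewrite mulf_neq0 //; apply: contra_neq d0 => ->; rewrite rmorph0.
  move=> w; rewrite inE rmorphM => /orP[/eqP->|/IHa aw].
    by rewrite mulrAC; apply: integral_mul => //; apply: integral_id.
  by rewrite -mulrA; apply: integral_mul => //; apply: integral_id.
have aN z : exists N, integralOver e (e a ^+ N * z).
  elim: (gen z) => {z} [z [[c _ <-]|zx]|| u v _ [M uM] _ [N vN]|u v _ [M uM] _ [N vN]].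
  - by exists 0; rewrite expr0 mul1r -(evalpC f x); apply: integral_id.
  - by exists 1; rewrite expr1; apply: aI.
  - by exists 0; rewrite expr0 mul1r; apply: integral1.
  - exists (M + N)%N; rewrite mulrBr exprD; apply: integral_sub.
      by rewrite mulrAC mulrC; apply: integral_mul => //; rewrite -rmorphXn; apply: integral_id.
    by rewrite -mulrA; apply: integral_mul => //; rewrite -rmorphXn; apply: integral_id.
  - by exists (M + N)%N; rewrite exprD mulrACA; apply: integral_mul.
pose b := 1 + 'X * a.
have sb : (size b > 1)%N.
  by rewrite /b addrC size_polyDl mulrC size_mulX // ?size_poly1 ltnS size_poly_gt0.
have b0 : b != 0 by rewrite -size_poly_gt0 (ltn_trans _ sb).
have [N] := aN (e b)^-1.
rewrite -rmorphXn => /(integral_fraction_dvdp_exp ei b0)[m]; rewrite -exprM => bam.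
have cop : coprimep b a.
  apply/Bezout_eq1_coprimepP; exists (1, - 'X) => /=.
  by rewrite /b; ring.
have : b %| 1.
  by rewrite -(@Gauss_dvdpr _ _ (a ^+ (N * m))) ?mulr1 // coprimep_expr.
by rewrite dvdp1 => /eqP s1; rewrite s1 in sb.
Qed.

Section FiniteType.
Variables (k : closedFieldType) (B : comPzRingType) (phi : {rmorphism k -> B}).
Variable xs : seq B.
Hypothesis gen : forall b, subring_gen (range phi `|` [set` xs]) b.

Lemma algebraicOver_closed (L : fieldType) (f : {rmorphism k -> L}) y :
  algebraicOver f y -> exists c, y = f c.
Proof.
case=> p p0; have [rs ->] := closed_field_poly_normal p.
rewrite linearZ /= rootZ ?fmorph_eq0 ?lead_coef_eq0 // rmorph_prod /=.
rewrite /root horner_prod prodf_seq_eq0 => /hasP[r _].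
by rewrite /= map_polyXsubC hornerXsubC subr_eq0 => /eqP ->; exists r.
Qed.

(* The case f = 1 is the Nullstellensatz. *)
Lemma residue_constant (P : set B) (f : B) :
  prime_ideal P -> ~ P f ->
  (forall Q, prime_ideal Q -> P `<=` Q -> ~ Q f -> Q `<=` P) ->
  forall b, exists c, P (b - phi c).
Proof.
move=> hP Pf Pmax b; have [L [pr [pr0 prF]]] := prime_residue hP.
pose f' : {rmorphism k -> L} := pr \o phi.
(* If no power of [f] were in P + (a), a prime ideal containing this ideal and avoiding the powers
   of [f] would contradict the maximality of [P]. Hence 1/a lies in the ring generated by B/P and
   1/f: the residue field is finitely generated as a ring, and Zariski's lemma applies. *)
have inv a : ~ P a -> exists n c, (pr a)^-1 = pr c * (pr f)^-1 ^+ n.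
  move=> Pa; suff [n [i [c [Pi E]]]] : exists n, ideal_add P a (f ^+ n).
    exists n, c; have : pr (f ^+ n) = pr c * pr a.
      by rewrite E rmorphD rmorphM (pr0 i).2 // add0r.
    rewrite rmorphXn => E'; have fn0 : pr f ^+ n != 0.
      by apply/expf_neq0/eqP => /pr0.
    apply: (mulfI fn0); rewrite mulrCA exprVn divff // mulr1 E' mulfK //.
    by apply/eqP => /pr0.
  apply: contrapT => /forallNP nf; apply: Pa.
  have [||||Q [hQ PQ fQ]] := @prime_avoiding _ (ideal_add P a) [set f ^+ n | n in setT].
  - exact: ideal_add_ideal (prime_ideal_ideal hP).
  - by exists 0%N; rewrite ?expr0.
  - by move=> _ _ [m _ <-] [n _ <-]; exists (m + n)%N; rewrite ?exprD.
  - by move=> _ [n _ <-]; apply: nf.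
  apply: (Pmax Q) => //.
  - by move=> x Px; apply: PQ; exists x, 0; rewrite mul0r addr0.
  - by apply: fQ; exists 1%N; rewrite ?expr1.
  - by apply: PQ; exists 0, 1; rewrite mul1r add0r; case: hP.
have gen' y : subring_gen (range f' `|` [set` (pr f)^-1 :: map pr xs]) y.
  have genB a : subring_gen (range f' `|` [set` (pr f)^-1 :: map pr xs]) (pr a).
    elim: (gen a) => {a} [a [[c _ <-]|axs]|| u v _ U _ V|u v _ U _ V].
    - by apply: SubringGen; left; exists c.
    - by apply: SubringGen; right; rewrite /= inE map_f ?orbT.
    - by rewrite rmorph1; apply: SubringGen1.
    - by rewrite rmorphB; apply: SubringGenB.
    - by rewrite rmorphM; apply: SubringGenM.
  have [a [c [Pc ->]]] := prF y.
  have [n [d ->]] := inv c Pc.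
  apply: SubringGenM => //; apply: SubringGenM => //; apply: subring_genX.
  by apply: SubringGen; right; rewrite /= inE eqxx.
have [c E] := algebraicOver_closed (zariski gen' (pr b)).
exists c; apply/pr0; rewrite rmorphB; apply/eqP.
by rewrite subr_eq0; apply/eqP.
Qed.

End FiniteType.

(** * Noetherian rings and the determinant trick *)

Inductive mspan (B : comPzRingType) (A G : set B) : B -> Prop :=
| MSpan0 : mspan A G 0
| MSpanD a g x : A a -> G g -> mspan A G x -> mspan A G (a * g + x).

Record is_subring (B : comPzRingType) (A : set B) : Prop := IsSubring {
  isr1 : A 1;
  isrB : forall a b, A a -> A b -> A (a - b);
  isrM : forall a b, A a -> A b -> A (a * b) }.

Section Span.
Variables (B : comPzRingType) (A : set B) (hA : is_subring A).
Implicit Types (G : set B).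

Lemma isr0 : A 0.
Proof. by rewrite -(subrr 1); apply: isrB => //; apply: isr1. Qed.

Lemma isrN a : A a -> A (- a).
Proof. by rewrite -sub0r; apply: isrB => //; apply: isr0. Qed.

Lemma isrD a b : A a -> A b -> A (a + b).
Proof. by rewrite -{2}[b]opprK => ? /isrN; apply: isrB. Qed.

Lemma isr_sum (J : Type) (r : seq J) (P : pred J) (F : J -> B) :
  (forall j, P j -> A (F j)) -> A (\sum_(j <- r | P j) F j).
Proof. by move=> AF; elim/big_ind: _ => //; [exact: isr0 | exact: isrD]. Qed.

Lemma isrX a n : A a -> A (a ^+ n).
Proof.
move=> Aa; elim: n => [|n IH]; first by rewrite expr0; apply: isr1.
by rewrite exprS; apply: isrM.
Qed.

Lemma mspan_add G x y : mspan A G x -> mspan A G y -> mspan A G (x + y).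
Proof.
elim=> [|a g z Aa Gg _ IH] Gy; first by rewrite add0r.
by rewrite -addrA; apply: MSpanD => //; apply: IH.
Qed.

Lemma mspan_mul G a x : A a -> mspan A G x -> mspan A G (a * x).
Proof.
move=> Aa; elim=> [|c g z Ac Gg _ IH]; first by rewrite mulr0; apply: MSpan0.
by rewrite mulrDr mulrA; apply: MSpanD => //; apply: isrM.
Qed.

Lemma mspan_gen G g : G g -> mspan A G g.
Proof.
move=> Gg; rewrite -[g]addr0 -{1}[g]mul1r; apply: MSpanD => //; first exact: isr1.
exact: MSpan0.
Qed.

Lemma mspan_sub G G' x : G `<=` G' -> mspan A G x -> mspan A G' x.
Proof.
move=> GG'; elim=> [|c g z Ac /GG' Gg _ IH]; first exact: MSpan0.
exact: MSpanD.
Qed.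

Lemma mspan_sum G (J : Type) (r : seq J) (P : pred J) (F : J -> B) :
  (forall j, P j -> mspan A G (F j)) -> mspan A G (\sum_(j <- r | P j) F j).
Proof. by move=> AF; elim/big_ind: _ => //; [exact: MSpan0 | exact: mspan_add]. Qed.

End Span.

Lemma mspanP (B : comPzRingType) (A : set B) (gs : seq B) x :
  is_subring A -> mspan A [set` gs] x ->
  exists c : 'I_(size gs) -> B, (forall i, A (c i)) /\ x = \sum_i c i * gs`_i.
Proof.
move=> hA; elim=> [|a g z Aa /(nthP 0)[i ip gE] _ [c [Ac ->]]].
  exists (fun=> 0); split; first by move=> i; apply: isr0.
  by rewrite big1 // => i _; rewrite mul0r.
exists (fun j => (if j == Ordinal ip then a else 0) + c j); split.
  by move=> j; apply: isrD => //; case: ifP => // _; apply: isr0.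
under [RHS]eq_bigr => j _ do rewrite mulrDl.
rewrite big_split /=; congr (_ + _).
rewrite (bigD1 (Ordinal ip)) //= eqxx gE big1 ?addr0 // => j /negPf ->.
by rewrite mul0r.
Qed.

Definition submodule_of (B : comPzRingType) (A I : set B) : Prop :=
  [/\ I `<=` A, I 0, (forall a b, I a -> I b -> I (a + b)) &
      forall a b, A a -> I b -> I (a * b)].

(** The ring [A] is a subset of a fixed [B], so that the generators of an algebra can be adjoined
    one by one without changing the ambient ring. *)
Definition noetherian (B : comPzRingType) (A : set B) : Prop :=
  forall I, submodule_of A I -> exists gs : seq B,
    [set` gs] `<=` I /\ forall x, I x -> mspan A [set` gs] x.

Section Hilbert.
Variables (B : comPzRingType) (A : set B) (hA : is_subring A).
Hypothesis nA : noetherian A.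
Variable b : B.

Definition pval (p : nat -> B) n := \sum_(i < n.+1) p i * b ^+ i.

Definition adjoin : set B :=
  [set x | exists p n, (forall i, A (p i)) /\ x = pval p n].

Lemma pval_widen p n m : (n <= m)%N ->
  pval p n = pval (fun i => if (i <= n)%N then p i else 0) m.
Proof.
move=> nm; rewrite /pval (big_ord_widen m.+1 (fun i => p i * b ^+ i)) //.
rewrite [LHS]big_mkcond; apply: eq_bigr => i _; rewrite ltnS.
by case: ifP => // _; rewrite mul0r.
Qed.

Lemma pval_shift p n m :
  b ^+ m * pval p n = pval (fun i => if (m <= i)%N then p (i - m)%N else 0) (n + m).
Proof.
rewrite /pval -addSn addnC big_split_ord /= [X in _ = X + _]big1 ?add0r; last first.
  by move=> i _; rewrite leqNgt ltn_ord mul0r.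
rewrite mulr_sumr; apply: eq_bigr => i _.
by rewrite leq_addr addKn exprD mulrCA.
Qed.

Lemma adjoin_subring : is_subring adjoin.
Proof.
split.
- exists (fun i => if i == 0%N then 1 else 0), 0%N; split.
    by move=> i; case: ifP => _; [apply: isr1 | apply: isr0].
  by rewrite /pval big_ord1 eqxx expr0 mulr1.
- move=> _ _ [p [n [Ap ->]]] [q [m [Aq ->]]].
  rewrite (pval_widen p (leq_maxl n m)) (pval_widen q (leq_maxr n m)).
  eexists (fun i => (if (i <= n)%N then p i else 0) - (if (i <= m)%N then q i else 0)), (maxn n m).
  split; last by rewrite /pval -sumrB; apply: eq_bigr => i _; rewrite -mulrBl.
  by move=> i /=; apply: isrB => //; case: ifP => // _; apply: isr0.
- move=> _ _ [p [n [Ap ->]]] [q [m [Aq ->]]].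
  pose r i l := (if (i <= l)%N && (l <= i + m)%N then p i * q (l - i)%N else 0).
  exists (fun l => \sum_(i < n.+1) r i l), (n + m)%N; split.
    move=> l; apply: isr_sum => // i _; rewrite /r; case: ifP => _; last exact: isr0.
    exact: isrM.
  rewrite /pval mulr_suml.
  under [RHS]eq_bigr do rewrite mulr_suml; rewrite exchange_big /=.
  apply: eq_bigr => i _.
  rewrite -[X in X * _]/(p i * b ^+ i) -mulrA (pval_shift q m i) mulr_sumr.
  have im : (m + i < (n + m).+1)%N by rewrite addnC ltnS leq_add2r -ltnS.
  rewrite (big_ord_widen _ (fun l => p i * ((if (i <= l)%N then q (l - i)%N else 0) * b ^+ l)) im).
  rewrite big_mkcond; apply: eq_bigr => l _; rewrite /r ltnS (addnC m).
  by case: (leqP i l) => il /=; case: ifP => _; rewrite ?(mul0r, mulr0) ?mulrA.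
Qed.

(** Hilbert's basis theorem. As [b] may be algebraic, an element has no well-defined degree or
    leading coefficient: [lc n] collects the n-th coefficients of all the expressions of length n+1
    of elements of [I]. *)
Lemma adjoin_noetherian : noetherian adjoin.
Proof.
move=> I [IA I0 ID IM].
have AI a x : A a -> I x -> I (a * x).
  move=> Aa; apply: IM; exists (fun i => if i == 0%N then a else 0), 0%N; split.
    by move=> i; case: ifP => // _; apply: isr0.
  by rewrite /pval big_ord1 eqxx expr0 mulr1.
have Ab m : adjoin (b ^+ m).
  exists (fun i => if i == m then 1 else 0), m; split.
    by move=> i; case: ifP => // _; [apply: isr1|apply: isr0].
  rewrite /pval big_ord_recr /= eqxx mul1r big1 ?add0r // => i _.
  by rewrite ltn_eqF // mul0r.
pose lc n : set B := [set a | exists p, [/\ forall i, A (p i), I (pval p n) & a = p n]].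
have lcS n m : (n <= m)%N -> lc n `<=` lc m.
  move=> nm _ [p [Ap Ip ->]].
  exists (fun i => if (m - n <= i)%N then p (i - (m - n))%N else 0); split.
  - by move=> i; case: ifP => // _; apply: isr0.
  - by have := pval_shift p n (m - n); rewrite subnKC // => <-; apply: IM.
  - by rewrite leq_subr subKn.
have lcD n x y : lc n x -> lc n y -> lc n (x + y).
  move=> [p [Ap Ip ->]] [q [Aq Iq ->]]; exists (fun i => p i + q i); split=> //.
    by move=> i; apply: isrD.
  have -> : pval (fun i => p i + q i) n = pval p n + pval q n.
    by rewrite /pval -big_split; apply: eq_bigr => i _; rewrite mulrDl.
  exact: ID.
have lcM n a x : A a -> lc n x -> lc n (a * x).
  move=> Aa [p [Ap Ip ->]]; exists (fun i => a * p i); split=> //.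
    by move=> i; apply: isrM.
  have -> : pval (fun i => a * p i) n = a * pval p n.
    by rewrite /pval mulr_sumr; apply: eq_bigr => i _; rewrite mulrA.
  exact: AI.
have lc0 n : lc n 0.
  exists (fun=> 0); split=> //; first by move=> i; apply: isr0.
  by rewrite /pval big1 // => i _; rewrite mul0r.
have lcA n : lc n `<=` A by move=> _ [p [Ap _ ->]].
have [|gs [gsI gsP]] := nA (I := [set a | exists n, lc n a]).
  split.
  - by move=> a [n /lcA].
  - by exists 0%N.
  - move=> x y [n nx] [m my]; exists (maxn n m).
    by apply: lcD; [apply: lcS nx; apply: leq_maxl | apply: lcS my; apply: leq_maxr].
  - by move=> a x Aa [n nx]; exists n; apply: lcM.
have [N gsN] : exists N, forall g, g \in gs -> lc N g.
  elim: gs gsI {gsP} => [|g gs IH] gsI; first by exists 0%N.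
  have [|N HN] := IH; first by move=> x xs; apply: gsI; rewrite /= inE xs orbT.
  have [M HM] : exists n, lc n g by apply: gsI; rewrite /= inE eqxx.
  exists (maxn N M) => x; rewrite inE => /orP[/eqP->|/HN].
    exact: lcS (leq_maxr _ _) _ HM.
  by apply: lcS; apply: leq_maxl.
have /choice[low lowP] : forall n, exists hs : seq B, [set` hs] `<=` lc n /\
    forall x, lc n x -> mspan A [set` hs] x.
  move=> n; apply: nA; split=> //; [exact: lcD|exact: lcM].
have pv0 G n : mspan A G (pval (fun=> 0) n).
  have -> : pval (fun=> 0) n = 0 by rewrite /pval big1 // => i _; rewrite mul0r.
  exact: MSpan0.
have lift n (hs : seq B) : [set` hs] `<=` lc n -> exists fs : seq B,
    [set` fs] `<=` I /\ forall a, mspan A [set` hs] a -> exists p,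
      [/\ forall i, A (p i), p n = a & mspan A [set` fs] (pval p n)].
  elim: hs => [|h hs IH] hsn.
    exists [::]; split=> // a [|? ? ? ? //].
    by exists (fun=> 0); split=> // i; apply: isr0.
  have [|fs [fsI fsP]] := IH; first by move=> x xs; apply: hsn; rewrite /= inE xs orbT.
  have [q [Aq Iq hE]] : lc n h by apply: hsn; rewrite /= inE eqxx.
  exists (pval q n :: fs); split.
    by move=> x; rewrite /= inE => /orP[/eqP->|/fsI].
  move=> a; elim=> [|c g z Ac + _ [p [Ap <- pP]]].
    by exists (fun=> 0); split=> // i; apply: isr0.
  have comb r : (forall i, A (r i)) -> r n = g ->
      mspan A [set` pval q n :: fs] (pval r n) ->
      exists p0, [/\ forall i, A (p0 i), p0 n = c * g + p n &
        mspan A [set` pval q n :: fs] (pval p0 n)].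
    move=> Ar rg rP; exists (fun i => c * r i + p i); split.
    - by move=> i; apply: isrD => //; apply: isrM.
    - by rewrite rg.
    have -> : pval (fun i => c * r i + p i) n = c * pval r n + pval p n.
      rewrite /pval mulr_sumr -big_split; apply: eq_bigr => i _ /=.
      by rewrite mulrDl mulrA.
    by apply: mspan_add => //; apply: mspan_mul.
  rewrite /= inE => /orP[/eqP gh|ghs].
    apply: (comb q) => //; first by rewrite gh.
    by apply: mspan_gen => //; rewrite /= inE eqxx.
  have [r [Ar rg rP]] := fsP g (mspan_gen hA (ghs : [set` hs] g)).
  apply: (comb r) => //; apply: mspan_sub rP => x xfs.
  by rewrite /= inE (xfs : x \in fs) orbT.
have /choice[lf lfP] n := lift n (low n) (lowP n).1.
have [hf [hfI hfP]] := lift N gs gsN.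
(* Lifts of generators of [lc N] and of each [lc n] with n < N. From N on the [lc n] no longer grow,
   since [lc N] contains the generators [gs] of their union. The difference between an element and a
   combination of the lifts with the same n-th coefficient has a shorter expression. *)
pose fs := hf ++ flatten [seq lf i | i <- iota 0 N].
have A_adj a : A a -> adjoin a.
  move=> Aa; exists (fun i => if i == 0%N then a else 0), 0%N; split.
    by move=> i; case: ifP => // _; apply: isr0.
  by rewrite /pval big_ord1 eqxx expr0 mulr1.
have up G x : mspan A G x -> mspan adjoin G x.
  by elim=> [|a g z /A_adj Aa Gg _ IH]; [apply: MSpan0|apply: MSpanD].
have fsI : [set` fs] `<=` I.
  move=> x; rewrite /= mem_cat => /orP[/hfI //|/flattenP[s /mapP[i _ ->]]].
  by have [h _] := lfP i; apply: h.
exists fs; split=> // x Ix; have [p [n [Ap xE]]] := IA _ Ix.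
elim/ltn_ind: n x Ix p Ap xE => n IHn x Ix p Ap xE.
have lcx : lc n (p n) by exists p; split=> //; rewrite -xE.
suff [q [Aq qn qfs]] : exists q, [/\ forall i, A (q i), q n = p n &
    mspan adjoin [set` fs] (pval q n)].
  rewrite -(subrK (pval q n) x); apply: mspan_add => //.
  have Iq : I (pval q n).
    elim: qfs => [//|a g z Aa gfs _ Iz]; apply: ID => //; apply: IM => //.
    exact: fsI.
  have Ixq : I (x - pval q n).
    by apply: ID => //; rewrite -mulN1r; apply: AI => //; apply: isrN => //; apply: isr1.
  have E : x - pval q n = \sum_(i < n) (p i - q i) * b ^+ i.
    rewrite xE /pval -sumrB big_ord_recr /= qn -mulrBl subrr mul0r addr0.
    by apply: eq_bigr => i _; rewrite mulrBl.
  case: n IHn E {xE lcx qn qfs Iq} Ixq => [|n] IHn E Ixq.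
    by rewrite E big_ord0; apply: MSpan0.
  by apply: (IHn n) Ixq (fun i => p i - q i) _ E => // i; apply: isrB.
case: (ltnP n N) => nN.
  have [_ h] := lfP n; have [q [Aq qn qfs]] := h _ ((lowP n).2 _ lcx).
  exists q; split=> //; apply: mspan_sub (up _ _ qfs) => y ylf.
  rewrite /= mem_cat; apply/orP; right; apply/flattenP; exists (lf n) => //.
  by apply/mapP; exists n; rewrite // mem_iota.
have [|q [Aq qn qfs]] := hfP (p n); first by apply: gsP; exists n.
exists (fun i => if (n - N <= i)%N then q (i - (n - N))%N else 0); split.
- by move=> i; case: ifP => // _; apply: isr0.
- by rewrite leq_subr subKn.
- have := pval_shift q N (n - N); rewrite subnKC // => <-; apply: mspan_mul => //.
    exact: adjoin_subring.
  apply: mspan_sub (up _ _ qfs) => y yhf.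
  by rewrite /= mem_cat (yhf : y \in hf).
Qed.

End Hilbert.

Lemma noetherian_finite_type (k : fieldType) (B : comPzRingType)
    (phi : {rmorphism k -> B}) (xs : seq B) (I : set B) :
  (forall b, subring_gen (range phi `|` [set` xs]) b) -> ideal I ->
  exists gs : seq B, [set` gs] `<=` I /\
    forall x, I x -> exists c : 'I_(size gs) -> B, x = \sum_i c i * gs`_i.
Proof.
move=> gen [I0 ID IM].
have [A [hA nA At]] : exists A, [/\ is_subring A, noetherian A &
    range phi `|` [set` xs] `<=` A].
  elim: xs {gen} => [|x xs [A [hA nA At]]].
    exists (range phi); split.
    - split; first by exists 1; rewrite ?rmorph1.
        by move=> _ _ [a _ <-] [c _ <-]; exists (a - c); rewrite ?rmorphB.
      by move=> _ _ [a _ <-] [c _ <-]; exists (a * c); rewrite ?rmorphM.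
    - move=> J [JA J0 JD JM].
      have [J00|/existsNP[x /not_implyP[Jx x0]]] := pselect (forall x, J x -> x = 0).
        by exists [::]; split=> // x /J00 ->; apply: MSpan0.
      have [c _ cE] := JA _ Jx; exists [:: x]; split.
        by move=> y; rewrite /= inE => /eqP ->.
      move=> y /JA[d _ <-].
      have -> : phi d = phi (d / c) * x + 0.
        have c0 : c != 0 by apply: contra_notN x0 => /eqP c0; rewrite -cE c0 rmorph0.
        by rewrite -cE -rmorphM divfK // addr0.
      by apply: MSpanD; [exists (d / c)|rewrite /= inE|apply: MSpan0].
    - by move=> x [|].
  exists (adjoin A x); split; [exact: adjoin_subring|exact: adjoin_noetherian|].
  have A_adj a : A a -> adjoin A x a.
    move=> Aa; exists (fun i => if i == 0%N then a else 0), 0%N; split.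
      by move=> i; case: ifP => // _; apply: isr0.
    by rewrite /pval big_ord1 eqxx expr0 mulr1.
  move=> y [ry|]; first by apply/A_adj/At; left.
  rewrite /= inE => /orP[/eqP->|yxs]; last by apply/A_adj/At; right.
  exists (fun i => if i == 1%N then 1 else 0), 1%N; split.
    by move=> i; case: ifP => // _; [apply: isr1|apply: isr0].
  by rewrite /pval !big_ord_recr big_ord0 /= mul0r mul1r !add0r expr1.
have Aall y : A y.
  elim: (gen y) => [a /At||u v _ ? _ ?|u v _ ? _ ?] //.
  - exact: isr1.
  - exact: isrB.
  - exact: isrM.
have [|gs [gsI gsP]] := nA I; first by split=> // a c _; apply: IM.
exists gs; split=> // x /gsP/(mspanP hA)[c [_ ->]].
by exists c.
Qed.

(** Multiply by the adjugate of [M]. Together with [det_congr] this plays the role of Nakayama's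
    lemma at a prime ideal, without localizing. *)
Lemma det_trick (B : comPzRingType) (I : set B) n (M : 'M[B]_n) (g : 'I_n -> B) :
  ideal I -> (forall i, I (\sum_j M i j * g j)) -> forall i, I (\det M * g i).
Proof.
move=> iI MI i.
have -> : \det M * g i = \sum_l \adj M i l * (\sum_j M l j * g j).
  have /matrixP/(_ i 0) := congr1 (fun N => N *m (\col_j g j)) (mul_adj_mx M).
  rewrite -mulmxA mul_scalar_mx !mxE => <-.
  by apply: eq_bigr => l _; rewrite !mxE; congr (_ * _); apply: eq_bigr => j _; rewrite mxE.
by apply: ideal_sum => // l _; case: iI => _ _ IM; apply: IM.
Qed.

Lemma det_congr (B : comPzRingType) (I : set B) n (M : 'M[B]_n) (s : B) :
  ideal I -> (forall i j, I (M i j - (if i == j then s else 0))) ->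
  I (\det M - s ^+ n).
Proof.
move=> iI MI; apply/(qpi_eq iI); rewrite -det_map_mx rmorphXn /=.
rewrite -det_scalar; congr (\det _); apply/matrixP => i j; rewrite !mxE.
rewrite (_ : qpi iI (M i j) = qpi iI (if i == j then s else 0)); last exact/qpi_eq.
by case: eqP => _; rewrite ?mulr1n ?mulr0n ?rmorph0.
Qed.

Definition mk_rmorphism (A B : pzRingType) (f : A -> B)
    (fB : zmod_morphism f) (fM : monoid_morphism f) : {rmorphism A -> B} :=
  HB.pack f (GRing.isZmodMorphism.Build A B f fB)
    (GRing.isMonoidMorphism.Build A B f fM).

Lemma quot_map (B : comPzRingType) (I J : set B) (iI : ideal I) (iJ : ideal J) :
  I `<=` J ->
  exists q : {rmorphism quot iI -> quot iJ}, forall x, q (qpi iI x) = qpi iJ x.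
Proof.
move=> IJ; pose q (u : quot iI) := qpi iJ (val u).
have qE x : q (qpi iI x) = qpi iJ x by apply/qpi_eq/IJ/(val_qpi iI).
have qB : zmod_morphism q.
  move=> u v; have [[x ->] [y ->]] := (qpi_surj u, qpi_surj v).
  by rewrite -rmorphB !qE rmorphB.
have qM : monoid_morphism q.
  split; first exact: qE.
  move=> u v; have [[x ->] [y ->]] := (qpi_surj u, qpi_surj v).
  by rewrite -rmorphM !qE rmorphM.
by exists (mk_rmorphism qB qM).
Qed.

(** * Formal smoothness and tangent spaces *)

Inductive ideal_sq (B : comPzRingType) (P : set B) : B -> Prop :=
| IdealSq0 : ideal_sq P 0
| IdealSqD a b x : P a -> P b -> ideal_sq P x -> ideal_sq P (a * b + x).

Lemma ideal_sq_ideal (B : comPzRingType) (P : set B) : ideal P -> ideal (ideal_sq P).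
Proof.
move=> [P0 PD PM]; split; first exact: IdealSq0.
  move=> x y; elim=> [|a b z Pa Pb _ IH]; first by rewrite add0r.
  by move=> /IH; rewrite -addrA; apply: IdealSqD.
move=> c x; elim=> [|a b z Pa Pb _ IH]; first by rewrite mulr0; apply: IdealSq0.
by rewrite mulrDr mulrA; apply: IdealSqD => //; apply: PM.
Qed.

Lemma ideal_sq_mul (B : comPzRingType) (P : set B) a b :
  P a -> P b -> ideal_sq P (a * b).
Proof. by move=> Pa Pb; rewrite -[a * b]addr0; apply: IdealSqD => //; apply: IdealSq0. Qed.

Lemma ideal_sq_sub (B : comPzRingType) (P : set B) :
  ideal P -> ideal_sq P `<=` P.
Proof.
move=> [P0 PD PM] x; elim=> // a b z Pa Pb _ IH; apply: PD => //; exact: PM.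
Qed.

Lemma residue_morphism (k : fieldType) (B : comPzRingType)
    (phi : {rmorphism k -> B}) (P : set B) :
  prime_ideal P -> (forall b, exists c, P (b - phi c)) ->
  exists ev : {rmorphism B -> k},
    (forall b, P b <-> ev b = 0) /\ forall c, ev (phi c) = c.
Proof.
move=> hP /choice[ev evP]; have iP := prime_ideal_ideal hP.
have phiP c : P (phi c) -> c = 0.
  move=> Pc; apply: contrapT => /eqP c0; case: hP => _ _ PM P1 _; apply: P1.
  by rewrite -(rmorph1 phi) -(mulVf c0) rmorphM; apply: PM.
have evE b c : P (b - phi c) -> ev b = c.
  move=> bc; apply/eqP; rewrite -subr_eq0; apply/eqP/phiP; rewrite rmorphB.
  have -> : phi (ev b) - phi c = (b - phi c) - (b - phi (ev b)) by ring.
  exact: idealB.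
case: (hP) => P0 PD PM _ _.
have evB : zmod_morphism ev.
  move=> a b; apply: evE; rewrite rmorphB.
  have -> : a - b - (phi (ev a) - phi (ev b)) = (a - phi (ev a)) - (b - phi (ev b)) by ring.
  exact: idealB.
have evM : monoid_morphism ev.
  split=> [|a b]; apply: evE; first by rewrite rmorph1 subrr.
  have -> : a * b - phi (ev a * ev b) =
    a * (b - phi (ev b)) + phi (ev b) * (a - phi (ev a)) by rewrite rmorphM; ring.
  by apply: PD; apply: PM.
exists (mk_rmorphism evB evM); split=> [b|c] /=.
  split=> [Pb|eb]; first by apply: evE; rewrite rmorph0 subr0.
  by have := evP b; rewrite eb rmorph0 subr0.
by apply: evE; rewrite subrr.
Qed.

Section Functional.
Variables (k : fieldType) (B : comPzRingType) (phi : {rmorphism k -> B}).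

Definition subspace (W : set B) : Prop :=
  W 0 /\ forall c x y, W x -> W y -> W (phi c * x + y).

(** By Zorn's lemma [W] lies in a subspace maximal among those that avoid [g]. It is a hyperplane,
    and the functional is the coefficient of [g] modulo it. *)
Lemma separating_functional (W : set B) (g : B) :
  subspace W -> ~ W g ->
  exists l : B -> k, [/\ forall c x y, l (phi c * x + y) = c * l x + l y,
    forall x, W x -> l x = 0 & l g = 1].
Proof.
move=> sW Wg; pose Q := [set V : set B | subspace V /\ ~ V g].
have [//|F [X0 FX0] FQ Ftot|V [[[V0 VD] Vg] WV Vmax]] := @zorn_above B Q W.
  split; last by move=> [X FX Xg]; case: (FQ _ FX).
  split; first by exists X0 => //; case: (FQ _ FX0) => -[].
  move=> c x y [X FX Xx] [Y FY Yy].
  by have [XY|YX] := Ftot _ _ FX FY;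
    [exists Y => //; case: (FQ _ FY) => -[_ YD] _; apply: YD => //; apply: XY
    |exists X => //; case: (FQ _ FX) => -[_ XD] _; apply: XD => //; apply: YX].
have VM c x : V x -> V (phi c * x) by move=> Vx; rewrite -[_ * _]addr0; apply: VD.
have VB x y : V x -> V y -> V (x - y).
  by move=> Vx Vy; rewrite addrC -mulN1r -(rmorph1 phi) -rmorphN; apply: VD.
have /choice[l lP] : forall b, exists c, V (b - phi c * g).
  move=> b; have [Vb|Vb] := pselect (V b); first by exists 0; rewrite rmorph0 mul0r subr0.
  pose V' := [set x | exists v d, V v /\ x = v + phi d * b].
  have [[v [d [Vv gE]]]|nV'g] := pselect (V' g).
    have d0 : d != 0.
      by apply: contra_notN Vg => /eqP d0; rewrite gE d0 rmorph0 mul0r addr0.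
    exists d^-1; rewrite gE mulrDr mulrA -rmorphM mulVf // rmorph1 mul1r opprD addrCA subrr addr0.
    by rewrite -sub0r; apply: VB => //; apply: VM.
  exfalso; apply: Vb; apply: (Vmax V').
  - split=> //; split; first by exists 0, 0; rewrite rmorph0 mul0r addr0.
    move=> c _ _ [v [d [Vv ->]]] [v' [d' [Vv' ->]]].
    exists (phi c * v + v'), (c * d + d'); split; first exact: VD.
    by rewrite rmorphD rmorphM; ring.
  - by move=> x Vx; exists x, 0; rewrite rmorph0 mul0r addr0.
  - by exists 0, 1; rewrite rmorph1 mul1r add0r.
have lE b c : V (b - phi c * g) -> l b = c.
  move=> bc; apply: contrapT => /eqP lc; apply: Vg.
  have d0 : l b - c != 0 by rewrite subr_eq0.
  have -> : g = phi (l b - c)^-1 * ((b - phi c * g) - (b - phi (l b) * g)).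
    have -> : (b - phi c * g) - (b - phi (l b) * g) = phi (l b - c) * g.
      by rewrite rmorphB; ring.
    by rewrite mulrA -rmorphM mulVf // rmorph1 mul1r.
  by apply: VM; apply: VB.
exists l; split=> [c x y|x Wx|]; apply: lE.
- have -> : phi c * x + y - phi (c * l x + l y) * g =
    phi c * (x - phi (l x) * g) + (y - phi (l y) * g) by rewrite rmorphD rmorphM; ring.
  exact: VD.
- by rewrite rmorph0 mul0r subr0; apply: WV.
- by rewrite rmorph1 mul1r subrr.
Qed.

End Functional.

(* [c b j] plays the role of the coefficient of T^j in the image of b under a
   ring morphism to the power series D[[T]]. *)
Lemma series_kernel_prime (B : comPzRingType) (D : idomainType) (c : B -> nat -> D) :
  (forall a b j, c (a + b) j = c a j + c b j) ->
  (forall a b j, c (a * b) j = \sum_(i < j.+1) c a i * c b (j - i)%N) ->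
  c 1 0 != 0 -> prime_ideal [set b | forall j, c b j = 0].
Proof.
move=> cD cM c1.
have c0 j : c 0 j = 0.
  by have := cD 0 0 j; rewrite addr0 -[LHS]addr0 => /addrI <-.
split=> //.
- by move=> a b a0 b0 j; rewrite cD a0 b0 addr0.
- by move=> a b b0 j; rewrite cM big1 // => i _; rewrite b0 mulr0.
- by move=> /(_ 0)/eqP; apply/negP.
move=> a b ab0; apply: contrapT => /not_orP[/existsNP na /existsNP nb].
have {}na : exists j, c a j != 0 by case: na => j /eqP; exists j.
have {}nb : exists j, c b j != 0 by case: nb => j /eqP; exists j.
case: (ex_minnP na) => i ai imin; case: (ex_minnP nb) => j bj jmin.
have /eqP := ab0 (i + j)%N; rewrite cM.
have ii : (i < (i + j).+1)%N by rewrite ltnS leq_addr.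
rewrite (bigD1 (Ordinal ii)) //= addKn big1 ?addr0.
  by rewrite mulf_eq0 (negPf ai) (negPf bj).
move=> l; rewrite -val_eqE /= => li.
case: (ltnP l i) => [lti|lei].
  have [->|/imin] := eqVneq (c a l) 0; first by rewrite mul0r.
  by rewrite leqNgt lti.
have [->|/jmin] := eqVneq (c b (i + j - l)%N) 0; first by rewrite mulr0.
have lt : (i < l)%N by rewrite ltn_neqAle eq_sym li.
have lij : (l <= i + j)%N by rewrite -ltnS ltn_ord.
by rewrite leqNgt ltn_subLR // ltn_add2r lt.
Qed.

Section TruncatedSeries.
Variable D : comNzRingType.

Definition trunc_ideal (N : nat) : set {poly D} :=
  [set f | forall j, (j < N)%N -> f`_j = 0].

Lemma trunc_idealP N : ideal (trunc_ideal N).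
Proof.
split=> [j _|a b a0 b0 j jN|a b b0 j jN]; first by rewrite coef0.
  by rewrite coefD a0 // b0 // addr0.
rewrite coefM big1 // => i _; rewrite b0 ?mulr0 //.
exact: leq_ltn_trans (leq_subr _ _) jN.
Qed.

(** The ring D[T]/(T^N). *)
Definition trunc N := quot (trunc_idealP N).
Definition trpi N : {rmorphism {poly D} -> trunc N} := qpi (trunc_idealP N).

Lemma trunc_ideal_le N M : (N <= M)%N -> trunc_ideal M `<=` trunc_ideal N.
Proof. by move=> NM f f0 j /leq_trans/(_ NM)/f0. Qed.

Lemma trunc_ideal_mul N M f g :
  trunc_ideal N f -> trunc_ideal M g -> trunc_ideal (N + M) (f * g).
Proof.
move=> f0 g0 j jNM; rewrite coefM big1 // => i _.
case: (ltnP i N) => iN; first by rewrite f0 // mul0r.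
by rewrite g0 ?mulr0 // ltn_subLR ?(leq_trans jNM) ?leq_add2r // -ltnS.
Qed.

(** Meaningful for [j < N] only: beyond, it depends on the chosen representative. *)
Definition tcoef N (u : trunc N) j : D := (val u)`_j.

Lemma tcoef_pi N f j : (j < N)%N -> tcoef (trpi N f) j = f`_j.
Proof.
move=> jN; apply/eqP; rewrite -subr_eq0 -coefB.
by rewrite (val_qpi (trunc_idealP N) f).
Qed.

Lemma trunc_surj N (u : trunc N) : exists f, u = trpi N f.
Proof. exact: qpi_surj. Qed.

Lemma trpi_eq0 N f : (trpi N f = 0) <-> trunc_ideal N f.
Proof. exact: qpi_eq0. Qed.

Lemma tcoefD N (u v : trunc N) j : (j < N)%N ->
  tcoef (u + v) j = tcoef u j + tcoef v j.
Proof.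
move=> jN; have [[f ->] [g ->]] := (trunc_surj u, trunc_surj v).
by rewrite -rmorphD !tcoef_pi // coefD.
Qed.

Lemma tcoefM N (u v : trunc N) j : (j < N)%N ->
  tcoef (u * v) j = \sum_(i < j.+1) tcoef u i * tcoef v (j - i)%N.
Proof.
move=> jN; have [[f ->] [g ->]] := (trunc_surj u, trunc_surj v).
rewrite -rmorphM !tcoef_pi // coefM; apply: eq_bigr => i _.
rewrite !tcoef_pi //; first exact: leq_ltn_trans (leq_subr _ _) jN.
by apply: leq_ltn_trans jN; rewrite -ltnS.
Qed.

Lemma trunc_map N : exists q : {rmorphism trunc N.+1 -> trunc N},
  forall f, q (trpi N.+1 f) = trpi N f.
Proof. exact/quot_map/trunc_ideal_le. Qed.

End TruncatedSeries.

(* Were m/m^2 of dimension at least 2, formal smoothness would produce a ring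
   morphism B -> k[x][[T]] mapping two independent elements g and h of m to xT
   and to T + O(T^2).  Its kernel and the kernel of its specialization at x = 0
   would be two prime ideals strictly contained in m and in each other. *)
Section TangentDimension.
Variables (k : fieldType) (B : comPzRingType) (phi : {rmorphism k -> B}).
Hypothesis smB : formally_smooth phi.
Variables (P : set B) (hP : prime_ideal P) (ev : {rmorphism B -> k}).
Hypotheses (Pev : forall b, P b <-> ev b = 0) (evphi : forall c, ev (phi c) = c).
Hypothesis nochain : forall P0 P1, prime_ideal P0 -> prime_ideal P1 ->
  P0 `<=` P1 -> P1 `<=` P -> P1 `<=` P0 \/ P `<=` P1.
Variables (g h : B) (l1 l2 : B -> k).
Hypotheses (Pg : P g) (Ph : P h).
Hypothesis l1L : forall c x y, l1 (phi c * x + y) = c * l1 x + l1 y.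
Hypothesis l2L : forall c x y, l2 (phi c * x + y) = c * l2 x + l2 y.
Hypotheses (l1sq : forall x, ideal_sq P x -> l1 x = 0)
  (l2sq : forall x, ideal_sq P x -> l2 x = 0).
Hypotheses (l11 : l1 1 = 0) (l21 : l2 1 = 0).
Hypotheses (l1g : l1 g = 1) (l1h : l1 h = 0) (l2g : l2 g = 0) (l2h : l2 h = 1).

Local Notation D := {poly k}.

Lemma derivation_sub (l : B -> k) :
  (forall c x y, l (phi c * x + y) = c * l x + l y) ->
  forall x y, l (x - y) = l x - l y.
Proof.
move=> lL x y; rewrite [x - y]addrC -[- y]mulN1r -(rmorph1 phi) -rmorphN lL.
by rewrite mulN1r addrC.
Qed.

Lemma derivation_phi (l : B -> k) :
  (forall c x y, l (phi c * x + y) = c * l x + l y) -> l 1 = 0 ->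
  forall c, l (phi c) = 0.
Proof.
move=> lL l0 c; have l00 : l 0 = 0.
  by have := derivation_sub lL 0 0; rewrite !subrr.
by rewrite -[phi c]mulr1 -[X in l X]addr0 lL l0 l00 mulr0 addr0.
Qed.

Lemma derivation_mul (l : B -> k) :
  (forall c x y, l (phi c * x + y) = c * l x + l y) -> l 1 = 0 ->
  (forall x, ideal_sq P x -> l x = 0) ->
  forall a b, l (a * b) = ev a * l b + ev b * l a.
Proof.
move=> lL l0 lsq a b.
have -> : a * b = phi (ev a) * b + (phi (ev b) * a +
    ((a - phi (ev a)) * (b - phi (ev b)) - phi (ev a * ev b))).
  by rewrite rmorphM; ring.
rewrite !lL (derivation_sub lL) (derivation_phi lL l0) subr0 (lsq ((a - _) * _)) ?addr0 //.
by apply: ideal_sq_mul; apply/Pev; rewrite rmorphB evphi subrr.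
Qed.

Definition good N (w : {rmorphism B -> trunc D N}) : Prop :=
  [/\ forall c, w (phi c) = trpi D N c%:P%:P,
      w g = trpi D N ('X%:P * 'X),
      forall b, tcoef (w b) 0 = (ev b)%:P &
      forall b, tcoef (w b) 1 = l1 b *: 'X + (l2 b)%:P].

Lemma good2 : exists w : {rmorphism B -> trunc D 2}, good w.
Proof.
pose f b : {poly D} := (ev b)%:P%:P + (l1 b *: 'X + (l2 b)%:P)%:P * 'X.
have fc0 b : (f b)`_0 = (ev b)%:P by rewrite coefD coefC mulrC coefXM addr0.
have fc1 b : (f b)`_1 = l1 b *: 'X + (l2 b)%:P.
  by rewrite coefD coefC mulrC coefXM coefC add0r.
have eqP2 (u v : {poly D}) : u`_0 = v`_0 -> u`_1 = v`_1 -> trpi D 2 u = trpi D 2 v.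
  move=> uv0 uv1; apply/qpi_eq => -[|[|//]] _; rewrite coefB.
    by rewrite uv0 subrr.
  by rewrite uv1 subrr.
have wB : zmod_morphism (trpi D 2 \o f).
  move=> a b; rewrite /= -rmorphB; apply: eqP2; rewrite !coefB !(fc0, fc1).
    by rewrite rmorphB -polyCB.
  by rewrite (derivation_sub l1L) (derivation_sub l2L) polyCB scalerBl; ring.
have wM : monoid_morphism (trpi D 2 \o f).
  split=> [|a b]; rewrite /=.
    rewrite -[RHS](rmorph1 (trpi D 2)); apply: eqP2; rewrite !(fc0, fc1).
      by rewrite rmorph1 coefC.
    by rewrite l11 l21 coefC scale0r addr0.
  rewrite -rmorphM; apply: eqP2; rewrite coefM !big_ord_recr big_ord0 /= ?subn0 ?subnn !(fc0, fc1).
    by rewrite add0r rmorphM polyCM.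
  rewrite (derivation_mul l1L l11 l1sq) (derivation_mul l2L l21 l2sq) add0r.
  by rewrite -!mul_polyC !rmorphD !rmorphM /=; ring.
exists (mk_rmorphism wB wM); split=> [c||b|b] /=.
- apply: eqP2; rewrite !(fc0, fc1) coefC ?evphi //.
  by rewrite (derivation_phi l1L l11) (derivation_phi l2L l21) scale0r addr0.
- apply: eqP2; rewrite !(fc0, fc1) mulrC coefXM; first by rewrite ((Pev g).1 Pg).
  by rewrite coefC l1g l2g scale1r addr0.
- by rewrite tcoef_pi // fc0.
- by rewrite tcoef_pi // fc1.
Qed.

(** Formal smoothness lifts [w], but the image of [g] may miss xT by some [d] in the kernel, a
    multiple of T^N. As T kills [d], the map sending b to [l1 b] times [d] is a derivation along the
    lift, and subtracting it gives another lift, with the right value at [g] because [l1 g = 1]. *)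
Lemma good_lift N (w : {rmorphism B -> trunc D N}) : (1 < N)%N -> good w ->
  exists w' : {rmorphism B -> trunc D N.+1}, good w' /\
    forall b j, (j < N)%N -> tcoef (w' b) j = tcoef (w b) j.
Proof.
move=> N1 [wphi wg w0 w1]; have [q qE] := trunc_map D N.
have iota_B : zmod_morphism (fun c : k => trpi D N.+1 c%:P%:P).
  by move=> a b; rewrite !polyCB rmorphB.
have iota_M : monoid_morphism (fun c : k => trpi D N.+1 c%:P%:P).
  by split=> [|a b]; rewrite ?polyC1 ?rmorph1 // !polyCM rmorphM.
pose iota := mk_rmorphism iota_B iota_M.
have qker u : q u = 0 -> exists f, u = trpi D N.+1 f /\ trunc_ideal N f.
  have [f ->] := trunc_surj u; rewrite qE => /trpi_eq0 f0.
  by exists f.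
have [|||w' [qw' w'phi]] := smB (q := q) (u := iota) (v := w).
- by move=> s; have [f ->] := trunc_surj s; exists (trpi D N.+1 f).
- move=> a b /qker[f [-> f0]] /qker[f' [-> f'0]].
  rewrite -rmorphM; apply/trpi_eq0/(@trunc_ideal_le D N.+1 (N + N)).
    by rewrite -addn1 leq_add2l ltnW.
  exact: trunc_ideal_mul.
- by move=> c; rewrite /= qE wphi.
pose d := w' g - trpi D N.+1 ('X%:P * 'X).
have qd : q d = 0 by rewrite rmorphB /= qw' wg qE subrr.
have [e [dE e0]] := qker d qd.
have dT (f : {poly D}) : f`_0 = 0 -> d * trpi D N.+1 f = 0.
  move=> f0; rewrite dE -rmorphM; apply/trpi_eq0; rewrite -addn1.
  by apply: trunc_ideal_mul => // -[|//] _.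
have dw b : d * w' b = d * iota (ev b).
  apply/eqP; rewrite -subr_eq0 -mulrBr; have [f wf] := trunc_surj (w' b).
  rewrite wf /= -rmorphB dT // coefB coefC /=.
  have -> : f`_0 = tcoef (w b) 0.
    by rewrite -qw' wf qE tcoef_pi // (ltn_trans _ N1).
  by rewrite w0 subrr.
have dd : d * d = 0 by rewrite {2}dE dT // e0 // (ltn_trans _ N1).
pose W b := w' b - iota (l1 b) * d.
have WB : zmod_morphism W.
  by move=> a b; rewrite /W (derivation_sub l1L) !rmorphB /=; ring.
have WM : monoid_morphism W.
  split=> [|a b]; first by rewrite /W rmorph1 l11 rmorph0 mul0r subr0.
  rewrite /W (derivation_mul l1L l11 l1sq) rmorphM rmorphD !rmorphM.
  have -> : (w' a - iota (l1 a) * d) * (w' b - iota (l1 b) * d) =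
    w' a * w' b - iota (l1 b) * (d * w' a) - iota (l1 a) * (d * w' b) +
    iota (l1 a) * iota (l1 b) * (d * d) by ring.
  by rewrite !dw dd; ring.
have qW b : q (W b) = w b by rewrite rmorphB rmorphM /= qd mulr0 subr0 qw'.
have coefW b j : (j < N)%N -> tcoef (W b) j = tcoef (w b) j.
  move=> jN; have [f Wf] := trunc_surj (W b).
  by rewrite -qW Wf qE !tcoef_pi // ltnS ltnW.
exists (mk_rmorphism WB WM); split; last by move=> b j jN; exact: coefW.
split.
- move=> c; change (W (phi c) = trpi D N.+1 c%:P%:P).
  by rewrite /W w'phi (derivation_phi l1L l11) rmorph0 mul0r subr0.
- change (W g = trpi D N.+1 ('X%:P * 'X)).
  by rewrite /W l1g rmorph1 mul1r /d opprB addrC subrK.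
- move=> b; change (tcoef (W b) 0 = (ev b)%:P).
  by rewrite coefW ?w0 // (ltn_trans _ N1).
- move=> b; change (tcoef (W b) 1 = l1 b *: 'X + (l2 b)%:P).
  by rewrite coefW.
Qed.

Lemma no_two_tangents : False.
Proof.
pose T := {N : nat & {w : {rmorphism B -> trunc D N} | (1 < N)%N /\ good w}}.
have [w2 gw2] := good2.
have /choice[nxt nxtP] : forall s : T, exists s' : T, projT1 s' = (projT1 s).+1 /\
    forall b j, (j < projT1 s)%N ->
      tcoef (proj1_sig (projT2 s') b) j = tcoef (proj1_sig (projT2 s) b) j.
  move=> [N [w [N1 gw]]] /=; have [w' [gw' w'w]] := good_lift N1 gw.
  have h' : (1 < N.+1)%N /\ good w' by split=> //; rewrite ltnW.
  by exists (existT _ N.+1 (exist _ w' h')).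
pose s0 : T := existT _ 2 (exist _ w2 (conj (ltnSn 1) gw2)).
pose s n := iter n nxt s0.
have sN n : projT1 (s n) = n.+2 by elim: n => //= n IH; rewrite (nxtP (s n)).1 IH.
have stab n m b j : (n <= m)%N -> (j < n.+2)%N ->
    tcoef (proj1_sig (projT2 (s m)) b) j = tcoef (proj1_sig (projT2 (s n)) b) j.
  move=> nm jn; rewrite -(subnK nm); elim: (m - n)%N => // i IH.
  rewrite addSn /= (nxtP (s (i + n)%N)).2 ?IH // sN.
  by rewrite (leq_trans jn) // !ltnS leq_addl.
(* The j-th lift is known modulo T^(j+2), so that its coefficient of T^j is final. *)
pose c b j := tcoef (proj1_sig (projT2 (s j)) b) j.
have cE b j m : (j <= m)%N -> c b j = tcoef (proj1_sig (projT2 (s m)) b) j.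
  by move=> jm; rewrite /c (stab j m) // ltnW.
have cD a b j : c (a + b) j = c a j + c b j.
  by rewrite /c rmorphD tcoefD // sN ltnW.
have cM a b j : c (a * b) j = \sum_(i < j.+1) c a i * c b (j - i)%N.
  rewrite {1}/c rmorphM tcoefM ?sN 1?ltnW //; apply: eq_bigr => i _.
  have ij : (i <= j)%N by rewrite -ltnS ltn_ord.
  by rewrite (cE a i j) // (cE b _ j) // leq_subr.
have gs n : good (proj1_sig (projT2 (s n))) by case: (proj2_sig (projT2 (s n))).
have c0 b : c b 0 = (ev b)%:P by case: (gs 0%N) => _ _ h0 _; apply: h0.
have c1 b : c b 1 = l1 b *: 'X + (l2 b)%:P by case: (gs 1%N) => _ _ _ h1; apply: h1.
have cg j : c g j = ('X%:P * 'X)`_j.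
  by rewrite /c; case: (gs j) => _ -> _ _; rewrite tcoef_pi // sN ltnW.
pose P0 : set B := [set b | forall j, c b j = 0].
pose P1 : set B := [set b | forall j, (c b j).[0] = 0].
have hP0 : prime_ideal P0.
  by apply: series_kernel_prime => //; rewrite c0 rmorph1 polyC1 oner_neq0.
have hP1 : prime_ideal P1.
  apply: (@series_kernel_prime B k (fun b j => (c b j).[0])).
  - by move=> a b j; rewrite cD hornerD.
  - by move=> a b j; rewrite cM horner_sum; apply: eq_bigr => i _; rewrite hornerM.
  - by rewrite c0 rmorph1 hornerC oner_neq0.
have [||P10|PP1] := nochain hP0 hP1.
- by move=> b b0 j; rewrite b0 horner0.
- by move=> b /(_ 0%N); rewrite c0 hornerC => /Pev.
- have : P1 g.
    by move=> j; rewrite cg mulrC coefXM; case: eqP => _; rewrite ?horner0 // coefC;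
      case: eqP => _; rewrite ?horner0 // hornerX.
  move=> /P10/(_ 1%N); rewrite c1 l1g l2g scale1r addr0 => /eqP.
  by rewrite polyX_eq0.
- have /(_ 1%N) := PP1 _ Ph; rewrite c1 l1h l2h scale0r add0r hornerC => /eqP.
  by rewrite oner_eq0.
Qed.

End TangentDimension.

Lemma tangent_dimension_le1 (k : fieldType) (B : comPzRingType)
    (phi : {rmorphism k -> B}) (P : set B) (ev : {rmorphism B -> k}) :
  formally_smooth phi -> prime_ideal P ->
  (forall b, P b <-> ev b = 0) -> (forall c, ev (phi c) = c) ->
  (forall P0 P1, prime_ideal P0 -> prime_ideal P1 ->
     P0 `<=` P1 -> P1 `<=` P -> P1 `<=` P0 \/ P `<=` P1) ->
  exists t, P t /\ forall b, P b -> exists c, ideal_sq P (b - c * t).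
Proof.
move=> smB hP Pev evphi noch; have iP := prime_ideal_ideal hP.
have iQ := ideal_sq_ideal iP; case: (iQ) => Q0 QD QM.
have QP := ideal_sq_sub iP.
have [PQ|/existsNP[g /not_implyP[Pg Qg]]] := pselect (P `<=` ideal_sq P).
  by exists 0; split=> [|b /PQ Qb]; [case: iP | exists 0; rewrite mul0r subr0].
exists g; split=> // h Ph; apply: contrapT => nh.
have {}nh c : ~ ideal_sq P (h - phi c * g) by move=> hc; apply: nh; exists (phi c).
(* The functional dual to [g] has to vanish on P^2 + k + kh, and the one dual to [h] on P^2 + k +
   kg; both are thus derivations at [P]. *)
have sub v : P v -> subspace phi [set x | exists q a b,
    ideal_sq P q /\ x = q + phi a + phi b * v].
  move=> Pv; split; first by exists 0, 0, 0; rewrite rmorph0 mul0r !addr0.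
  move=> c _ _ [q [a [b [Qq ->]]]] [q' [a' [b' [Qq' ->]]]].
  exists (phi c * q + q'), (c * a + a'), (c * b + b').
  by split; [apply: QD => //; apply: QM | rewrite !rmorphD !rmorphM; ring].
have evsub u v q a b : P u -> P v -> ideal_sq P q -> u = q + phi a + phi b * v -> a = 0.
  move=> /Pev eu /Pev vu /QP/Pev eq0 /(congr1 ev).
  by rewrite eu !rmorphD rmorphM eq0 vu mulr0 add0r addr0 evphi.
have [|l1 [l1L l1W l1g]] := @separating_functional _ _ phi _ g (sub h Ph).
  move=> [q [a [b [Qq gE]]]]; have a0 := evsub _ _ _ _ _ Pg Ph Qq gE.
  have b0 : b != 0.
    apply: contra_notN Qg => /eqP b0.
    by rewrite gE a0 b0 rmorph0 mul0r !addr0.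
  apply: (nh b^-1); have -> : h - phi b^-1 * g = (- phi b^-1) * q.
    rewrite gE a0 rmorph0 addr0 mulrDr mulrA -rmorphM mulVf // rmorph1; ring.
  exact: QM.
have [|l2 [l2L l2W l2h]] := @separating_functional _ _ phi _ h (sub g Pg).
  move=> [q [a [b [Qq hE]]]]; have a0 := evsub _ _ _ _ _ Ph Pg Qq hE.
  by apply: (nh b); rewrite hE a0 rmorph0 addr0 addrK.
have W1 v (l : B -> k) : (forall x, (exists q a b,
    ideal_sq P q /\ x = q + phi a + phi b * v) -> l x = 0) ->
    [/\ forall x, ideal_sq P x -> l x = 0, l 1 = 0 & l v = 0].
  move=> lW; split=> [x Qx||]; apply: lW.
  - by exists x, 0, 0; rewrite rmorph0 mul0r !addr0.
  - by exists 0, 1, 0; rewrite rmorph0 rmorph1 mul0r addr0 add0r.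
  - by exists 0, 0, 1; rewrite rmorph0 rmorph1 mul1r addr0 add0r.
have [l1sq l11 l1h] := W1 _ _ l1W; have [l2sq l21 l2g] := W1 _ _ l2W.
by apply: (@no_two_tangents k B phi smB P ev Pev evphi noch g h l1 l2).
Qed.

(** * The function field of a smooth curve *)

Section RingedSpace.
Variable X : ringed_space.
Implicit Types U V W : opens X.

Definition opensI U V : opens X := Opens (openI (osetP U) (osetP V)).

Lemma opensIl U V : opensI U V `<=` U. Proof. by move=> x []. Qed.
Lemma opensIr U V : opensI U V `<=` V. Proof. by move=> x []. Qed.

Lemma res_irr U V (h h' : V `<=` U) (s : sec U) : res h s = res h' s.
Proof. by rewrite (Prop_irrelevance h h'). Qed.

Lemma res_res U V W (h : V `<=` U) (h' : W `<=` V) (h'' : W `<=` U) (s : sec U) :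
  res h' (res h s) = res h'' s.
Proof. by rewrite (res_comp h h' h''). Qed.

Lemma unit_at_in U (s : sec U) x : unit_at s x -> U x.
Proof. by case=> V [h [t [/h]]]. Qed.

Lemma unit_at_res U W (h : W `<=` U) (s : sec U) x :
  W x -> unit_at (res h s) x <-> unit_at s x.
Proof.
move=> Wx; split=> -[V [hV [t [Vx E]]]].
  exists V, (subset_trans hV h), t; split=> //.
  by rewrite -(res_res h hV).
exists (opensI V W), (@opensIr V W), (res (@opensIl V W) t); split=> //.
have hVU := subset_trans (@opensIl V W) hV.
rewrite (res_res _ _ hVU) -(res_res hV (@opensIl V W)) -rmorphM E.
exact: rmorph1.
Qed.

Lemma unit_atM U (s t : sec U) x :
  unit_at (s * t) x <-> unit_at s x /\ unit_at t x.
Proof.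
split=> [[V [h [u [Vx E]]]]|[[V [h [u [Vx E]]]] [W [g [v [Wx E']]]]]].
  rewrite rmorphM in E; split; exists V, h.
    by exists (res h t * u); rewrite mulrA.
  by exists (res h s * u); rewrite mulrCA mulrA.
pose hI := subset_trans (@opensIl V W) h.
exists (opensI V W), hI, (res (@opensIl V W) u * res (@opensIr V W) v).
split=> //; rewrite rmorphM mulrACA -(res_res h (@opensIl V W) hI s).
rewrite -(res_res g (@opensIr V W) hI t) -!rmorphM E E' !rmorph1.
exact: mulr1.
Qed.

Lemma unit_at1 U x : U x -> unit_at (1 : sec U) x.
Proof. by move=> Ux; exists U, (@subset_refl _ U), 1; rewrite rmorph1 mulr1. Qed.

Lemma unit_atX U (s : sec U) n x : unit_at s x -> unit_at (s ^+ n) x.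
Proof.
move=> sx; elim: n => [|n IH]; first by rewrite expr0; apply/unit_at1/(unit_at_in sx).
by rewrite exprS; apply/unit_atM.
Qed.

Lemma sec_unique U (I : Type) (V : I -> opens X) (hV : forall i, V i `<=` U) (s t : sec U) :
  (forall x, U x -> exists i, V i x) ->
  (forall i, res (hV i) s = res (hV i) t) -> s = t.
Proof.
move=> cov st; have [|r [_ r_uniq]] := @glue X I U V hV (fun i => res (hV i) s) cov.
  move=> i j W hi hj.
  by rewrite (res_res _ _ (subset_trans hi (hV i))) (res_res _ _ (subset_trans hi (hV i))).
by rewrite -(r_uniq s) // -(r_uniq t).
Qed.

Lemma sec_zero_local U (s : sec U) :
  (forall x, U x -> exists V (h : V `<=` U), V x /\ res h s = 0) -> s = 0.
Proof.
move=> loc; pose I := {V : opens X | exists h : V `<=` U, res h s = 0}.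
have hI (i : I) : proj1_sig i `<=` U by case: i => V [h].
apply: (@sec_unique U I (fun i => proj1_sig i) hI).
  move=> x /loc[V [h [Vx E]]].
  have hV : exists h : V `<=` U, res h s = 0 by exists h.
  by exists (exist _ V hV).
move=> [V [h E]] /=; rewrite rmorph0.
by rewrite (res_irr _ h).
Qed.

Definition point_ideal U x : set (sec U) := [set s | ~ unit_at s x].

End RingedSpace.

Arguments point_ideal {X} U x.

Section Affine.
Variable X : ringed_space.
Implicit Types V W : opens X.
Variables (U : opens X) (aU : affine U).

Lemma point_ideal_prime x : U x -> prime_ideal (point_ideal U x).
Proof. by case: aU => h _ _ _; apply: h. Qed.

Lemma point_ideal_inj x y : U x -> U y -> point_ideal U x = point_ideal U y -> x = y.
Proof.
case: aU => _ h _ _ Ux Uy E.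
have [z [_ zu]] := h _ (point_ideal_prime Ux).
by rewrite -(zu x) // -(zu y).
Qed.

Lemma prime_point P : prime_ideal P -> exists2 x, U x & P = point_ideal U x.
Proof. by case: aU => _ h _ _ /h[x [[Ux E] _]]; exists x. Qed.

Lemma basic_nbhd W x : U x -> W x -> exists s : sec U, basic s x /\ basic s `<=` W.
Proof.
case: aU => _ _ h _ Ux Wx.
have [|s [sx sW]] := h (opensI U W) x (@opensIl X U W); first by split.
by exists s; split=> // y /sW[].
Qed.

Lemma basic_inv (s : sec U) : exists t, res (@basicS X U s) s * t = 1.
Proof. by case: aU => _ _ _ /(_ s)[]. Qed.

Lemma basic_frac (s : sec U) (t : sec (basic s)) : exists n a,
  res (@basicS X U s) s ^+ n * t = res (@basicS X U s) a.
Proof. by case: aU => _ _ _ /(_ s)[]. Qed.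

Lemma basic_zero (s a : sec U) : res (@basicS X U s) a = 0 -> exists n, s ^+ n * a = 0.
Proof. by case: aU => _ _ _ /(_ s)[_ _]; apply. Qed.

Lemma nbhd_zero (W : opens X) (h : W `<=` U) (a : sec U) x :
  W x -> res h a = 0 -> exists s, ~ point_ideal U x s /\ s * a = 0.
Proof.
move=> Wx E; have [s [sx sW]] := basic_nbhd (h _ Wx) Wx.
have [|n sn] := @basic_zero s a.
  by rewrite -(res_res h sW) E rmorph0.
exists (s ^+ n); split=> //; apply; exact: unit_atX.
Qed.

Lemma specialization x y : U x -> U y ->
  point_ideal U x `<=` point_ideal U y <-> forall W, W y -> W x.
Proof.
move=> Ux Uy; split=> [xy W Wy|xy s nsx sy].
  have [s [sy sW]] := basic_nbhd Uy Wy.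
  by apply: sW; apply: contrapT => nsx; apply: (xy s nsx).
by apply: nsx; exact: (xy (basic s) sy).
Qed.

Lemma local_fraction (W : opens X) (s : sec W) x : U x -> W x ->
  exists (V : opens X) (hU : V `<=` U) (hW : V `<=` W) (a b : sec U),
    [/\ V x, unit_at b x & res hU b * res hW s = res hU a].
Proof.
move=> Ux Wx; have [f [fx fW]] := basic_nbhd Ux Wx.
have [n [a E]] := basic_frac (res fW s).
exists (basic f), (@basicS X U f), fW, a, (f ^+ n); split=> //.
  exact: unit_atX.
by rewrite rmorphXn.
Qed.

End Affine.

Lemma closure1_subset (T : topologicalType) (x y : T) :
  closure [set x] y <-> forall W : set T, open W -> W y -> W x.
Proof.
split=> [xy W oW Wy|xy A].
  by have [z [/= -> Wz]] := xy W (open_nbhs_nbhs (conj oW Wy)).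
rewrite nbhsE => -[W [oW Wy] WA]; exists x; split=> //.
exact: WA (xy _ oW Wy).
Qed.

Lemma closure1_irreducible (T : topologicalType) (x : T) :
  irreducible_closed (closure [set x]).
Proof.
have xx : closure [set x] x by apply: subset_closure.
split; [exact: closed_closure|by exists x|].
move=> A B cA cB AB.
by case: (AB x xx) => hx; [left; rewrite ((closure_id A).1 cA)|
  right; rewrite ((closure_id B).1 cB)]; apply: closure_subset => _ ->.
Qed.

Section NoChain.
Variables (X : ringed_space) (U : opens X) (aU : affine U).

(** Taking closures of points reverses the inclusion of their ideals, and the closure of a point is
    irreducible. *)
Lemma prime_chain (P0 P1 P2 : set (sec U)) :
  ~ irreducible_chain X 2 ->
  prime_ideal P0 -> prime_ideal P1 -> prime_ideal P2 ->
  P0 `<=` P1 -> P1 `<=` P2 -> P1 `<=` P0 \/ P2 `<=` P1.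
Proof.
move=> noch h0 h1 h2 P01 P12.
apply: contrapT => /not_orP[n10 n21]; apply: noch.
have [x0 U0 E0] := prime_point aU h0.
have [x1 U1 E1] := prime_point aU h1.
have [x2 U2 E2] := prime_point aU h2.
have cl x y : U x -> U y -> point_ideal U x `<=` point_ideal U y ->
    closure [set y] `<=` closure [set x].
  move=> Ux Uy /(specialization aU Ux Uy) xy z /closure1_subset yz.
  by apply/closure1_subset => W oW Wz; apply: (xy (Opens oW)); apply: yz.
have cl' x y : U x -> U y -> closure [set y] x -> point_ideal U x `<=` point_ideal U y ->
    point_ideal U y `<=` point_ideal U x.
  move=> Ux Uy /closure1_subset yx _; apply/(specialization aU Uy Ux) => W Wx.
  exact: (yx _ (osetP W)).
exists (fun n => closure [set nth x0 [:: x2; x1; x0] n]); split.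
  by move=> i _; exact: closure1_irreducible.
move=> [|[|//]] _ /=; split.
- by rewrite E1 E2 in P12; exact: cl.
- move=> x12; apply: n21; rewrite E1 E2; rewrite E1 E2 in P12.
  by apply: (cl' _ _ U1 U2) => //; apply: x12; apply: subset_closure.
- by rewrite E0 E1 in P01; exact: cl.
- move=> x01; apply: n10; rewrite E0 E1; rewrite E0 E1 in P01.
  by apply: (cl' _ _ U0 U1) => //; apply: x01; apply: subset_closure.
Qed.

Lemma closed_point_maximal x : U x -> closed [set x] -> maximal_ideal (point_ideal U x).
Proof.
move=> Ux cx; have hx := point_ideal_prime aU Ux.
have [||M [hM xM]] := @maximal_above _ (point_ideal U x).
- exact: prime_ideal_ideal.
- by case: hx.
have [y Uy E] := prime_point aU (proj1 hM).
suff -> : point_ideal U x = M by [].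
rewrite E in xM *; have xy := (specialization aU Ux Uy).1 xM.
suff -> : x = y by [].
apply: contrapT => nxy.
have oC : open (~` [set x]) by rewrite openC.
by have := xy (Opens oC); rewrite /in_opens /=; apply=> // yx; apply: nxy.
Qed.

End NoChain.

(** * Local rings with a principal maximal ideal *)

Section LocalRing.
Variables (B : comPzRingType) (P : set B) (hP : prime_ideal P).
Hypothesis noethB : forall I : set B, ideal I -> exists gs : seq B,
  [set` gs] `<=` I /\ forall x, I x -> exists c : 'I_(size gs) -> B, x = \sum_i c i * gs`_i.

Let iP := prime_ideal_ideal hP.

Let PM a b : ~ P a -> ~ P b -> ~ P (a * b).
Proof. by case: hP => _ _ _ _ h nPa nPb /h[]. Qed.

(** Nakayama's lemma: modulo t, the generators of [P] are combinations of themselves with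
    coefficients m in [P], so that det(1 - m), which is 1 modulo [P], multiplies each of them into
    (t). *)
Lemma tangent_generates (t : B) :
  P t -> (forall b, P b -> exists c, ideal_sq P (b - c * t)) ->
  exists s, ~ P s /\ forall b, P b -> exists c, s * b = c * t.
Proof.
move=> Pt sq; have [gs [gsP gsE]] := noethB iP.
have sqE x : ideal_sq P x -> exists m : 'I_(size gs) -> B,
    (forall i, P (m i)) /\ x = \sum_i m i * gs`_i.
  elim=> [|a b y Pa /gsE[c ->] _ [m [Pm ->]]].
    exists (fun=> 0); split; first by case: iP.
    by rewrite big1 // => i _; rewrite mul0r.
  exists (fun i => a * c i + m i); split.
    by move=> i; case: iP => _ D _; apply: D => //; apply: idealMl.
  by rewrite mulr_sumr -big_split; apply: eq_bigr => i _; rewrite mulrDl mulrA.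
have /choice[m mP] : forall i : 'I_(size gs), exists m : 'I_(size gs) -> B,
    (forall j, P (m j)) /\ exists c, gs`_i = c * t + \sum_j m j * gs`_j.
  move=> i; have [|c /sqE[m [Pm E]]] := sq gs`_i; first exact/gsP/mem_nth.
  by exists m; split=> //; exists c; rewrite -E addrC subrK.
pose M := \matrix_(i, j) ((if i == j then 1 else 0) - m i j) : 'M[B]_(size gs).
have PM1 : P (\det M - 1).
  rewrite -[1](expr1n _ (size gs)); apply: det_congr => // i j; rewrite mxE addrAC subrr add0r.
  by apply: idealN => //; case: (mP i).
have dt (i : 'I_(size gs)) : principal t (\det M * gs`_i).
  apply: (det_trick (g := fun j => gs`_j)); first exact: principal_ideal.
  move=> {}i; have [_ [c cE]] := mP i; exists c.
  under eq_bigr => j _ do rewrite mxE mulrBl.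
  rewrite sumrB (bigD1 i) //= eqxx mul1r big1 ?addr0; last first.
    by move=> j; rewrite eq_sym => /negPf ->; rewrite mul0r.
  by rewrite {1}cE addrK.
exists (\det M); split.
  move=> Pd; case: (hP) => _ _ _ P1 _; apply: P1.
  by rewrite -[1](subKr (\det M)); apply: idealB.
move=> b /gsE[c ->]; rewrite mulr_sumr.
have /choice[d dE] : forall i : 'I_(size gs), exists d, \det M * gs`_i = d * t by move=> i; exact: dt.
exists (\sum_i c i * d i); rewrite mulr_suml; apply: eq_bigr => i _.
by rewrite mulrCA dE mulrA.
Qed.

Variables (t s : B).
Hypotheses (Pt : P t) (Ps : ~ P s) (st : forall b, P b -> exists c, s * b = c * t).
Hypothesis t_nonnilp : forall n u, ~ P u -> u * t ^+ n <> 0.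

(** The elements whose image in the localization at [P] lies in every power of (t). *)
Definition infinitely_divisible : set B :=
  [set a | forall n, exists u c, ~ P u /\ u * a = c * t ^+ n].
Local Notation Q := infinitely_divisible.

Let PX a n : ~ P a -> ~ P (a ^+ n).
Proof. by move=> Pa /(prime_idealX hP). Qed.

Lemma valuationP y : ~ Q y -> exists n u v, [/\ ~ P u, ~ P v & u * y = v * t ^+ n].
Proof.
move=> /existsNP nQ; have exn : exists n, `[< ~ exists u c, ~ P u /\ u * y = c * t ^+ n >].
  by case: nQ => n hn; exists n; apply/asboolP.
case: (ex_minnP exn) => n /asboolP hn nmin; case: n hn nmin => [|n] hn nmin.
  exfalso; apply: hn; exists 1, y; rewrite expr0 mulr1 mul1r.
  by split=> //; case: hP.
have [u [c [Pu E]]] : exists u c, ~ P u /\ u * y = c * t ^+ n.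
  apply: contrapT => h; have /nmin : `[< ~ exists u c, ~ P u /\ u * y = c * t ^+ n >].
    exact/asboolP.
  by rewrite ltnn.
exists n, u, c; split=> // Pc; apply: hn; have [d dE] := st Pc.
exists (s * u), d; split; first exact: PM.
by rewrite -mulrA E mulrA dE exprS mulrA.
Qed.

Lemma infinitely_divisible_sub : Q `<=` P.
Proof.
move=> a /(_ 1)[u [c [Pu E]]]; case: (hP) => _ _ M _ h.
have : P (u * a) by rewrite E expr1; apply: M.
by case/h.
Qed.

(** Outside this set the order in [t] is finite by [valuationP], and it is additive since [t] is not
    nilpotent in the localization. *)
Lemma infinitely_divisible_prime : prime_ideal Q.
Proof.
have Q1 : ~ Q 1 by move=> /infinitely_divisible_sub; case: hP.
split=> //.
- move=> n; exists 1, 0; rewrite mulr0 mul0r.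
  by split=> //; case: hP.
- move=> a b Qa Qb n; have [u [c [Pu E]]] := Qa n; have [v [d [Pv F]]] := Qb n.
  exists (u * v), (v * c + u * d); split; first exact: PM.
  have -> : u * v * (a + b) = v * (u * a) + u * (v * b) by ring.
  by rewrite E F; ring.
- move=> a b Qb n; have [u [c [Pu E]]] := Qb n.
  by exists u, (a * c); split=> //; rewrite mulrCA E mulrA.
- move=> a b Qab; apply: contrapT => /not_orP[/valuationP[i [u [u' [Pu Pu' E]]]]].
  move=> /valuationP[j [v [v' [Pv Pv' F]]]].
  have [w [c [Pw G]]] := Qab (i + j).+1.
  apply: (@t_nonnilp (i + j) (w * u' * v' - u * v * c * t)).
    move=> H; apply: (PM (PM Pw Pu') Pv').
    rewrite -(subrK (u * v * c * t) (w * u' * v')); case: (iP) => _ D M.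
    by apply: (D) => //; apply: M.
  have -> : (w * u' * v' - u * v * c * t) * t ^+ (i + j) =
      w * (u' * t ^+ i) * (v' * t ^+ j) - u * v * (c * t ^+ (i + j).+1).
    by rewrite exprS exprD; ring.
  by rewrite -E -F -G; ring.
Qed.

(** Krull's intersection theorem: locally Q = tQ, so that the generators of [Q] are killed by the
    determinant of a matrix congruent modulo [P] to the scalar [w], which is not in [P]. *)
Lemma infinitely_divisible_killed : exists u, ~ P u /\ forall a, Q a -> u * a = 0.
Proof.
have hQ := infinitely_divisible_prime; have iQ := prime_ideal_ideal hQ.
have tQ y : Q (t * y) -> Q y.
  case: hQ => _ _ _ _ h /h[] // /(_ 2)[u [c [Pu E]]]; exfalso.
  apply: (@t_nonnilp 1 (u - c * t)); last by rewrite expr1 mulrBl E; ring.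
  move=> H; apply: Pu; rewrite -(subrK (c * t) u); case: (iP) => _ D M.
  by apply: (D) => //; apply: M.
have divQ a : Q a -> exists u c, [/\ ~ P u, Q c & u * a = c * t].
  move=> Qa; have [u [c [Pu E]]] := Qa 1%N; rewrite expr1 in E.
  exists u, c; split=> //; apply: tQ; rewrite mulrC -E; case: iQ => _ _ M; exact: M.
have [gs [gsQ gsE]] := noethB iQ.
have /choice[u uP] : forall i : 'I_(size gs), exists u, ~ P u /\ exists c, Q c /\ u * gs`_i = c * t.
  by move=> i; have [u [c [Pu Qc E]]] := divQ _ (gsQ _ (mem_nth 0 (ltn_ord i)));
     exists u; split=> //; exists c.
pose w := \prod_i u i.
have Pw : ~ P w by rewrite /w; elim/big_ind: _ => [||i _]; [case: hP|exact: PM|case: (uP i)].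
have /choice[m mP] : forall i : 'I_(size gs), exists m : 'I_(size gs) -> B,
    w * gs`_i = \sum_j t * m j * gs`_j.
  move=> i; have [_ [c [Qc E]]] := uP i; have [m mE] := gsE _ Qc.
  exists (fun j => (\prod_(l | l != i) u l) * m j).
  rewrite /w (bigD1 i) //=; set v := \prod_(_ | _) _.
  have -> : u i * v * gs`_i = v * (u i * gs`_i) by ring.
  by rewrite E mE mulr_suml mulr_sumr; apply: eq_bigr => j _; ring.
pose M := \matrix_(i, j) ((if i == j then w else 0) - t * m i j) : 'M[B]_(size gs).
have PMw : P (\det M - w ^+ size gs).
  apply: det_congr => // i j; rewrite mxE addrAC subrr add0r.
  by apply: idealN => //; apply: idealMl.
have d0 (i : 'I_(size gs)) : \det M * gs`_i = 0.
  have [||c cE] := @det_trick B (principal 0) (size gs) M (fun j => gs`_j) _ _ i.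
  - exact: principal_ideal.
  - move=> {}i; exists 0; rewrite mulr0.
    under eq_bigr => j _ do rewrite mxE mulrBl.
    rewrite sumrB -mP (bigD1 i) //= eqxx big1 ?addr0 ?subrr // => j.
    by rewrite eq_sym => /negPf ->; rewrite mul0r.
  - by rewrite cE mulr0.
exists (\det M); split.
  move=> Pd; apply: (@PX w (size gs)) => //.
  by rewrite -[_ ^+ _](subKr (\det M)); apply: idealB.
move=> a /gsE[c ->]; rewrite mulr_sumr big1 // => i _.
by rewrite mulrCA d0 mulr0.
Qed.

End LocalRing.

(** Any field that receives the sections injectively and compatibly with restrictions, at a point
    that belongs to all nonempty open sets. With the field left free in this way, an open subscheme
    can share the function field of the curve. *)
Record fun_field (Z : scheme) := FunField {
  ff :> fieldType;
  gpt : Z;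
  gptP : forall (V : opens Z) x, V x -> V gpt;
  germ : forall V : opens Z, V gpt -> {rmorphism sec V -> ff};
  germ_res : forall (V W : opens Z) (h : W `<=` V) (hV : V gpt) (hW : W gpt) s,
    germ hW (res h s) = germ hV s;
  germ_inj : forall (V : opens Z) (hV : V gpt) s, germ hV s = 0 -> s = 0 }.

Arguments germ {Z} f V _.
Arguments gptP {Z} f V x _.

Definition local_ring (Z : scheme) (F : fun_field Z) (x : Z) : set F :=
  [set q | exists (V : opens Z) (hV : V (gpt F)) (s : sec V), V x /\ q = germ F V hV s].

Arguments local_ring {Z} F x _.

(** A discrete valuation ring of [K] with uniformizer [pi] and residue field [k]. Two natural
    exponents in [dvr_val] stand for an integral one, and [dvr_res] says that every residue is a
    constant. *)
Record dvr (k K : fieldType) (kK : k -> K) (O : set K) (pi : K) : Prop := Dvr {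
  dvr_sub : is_subring O;
  dvr_const : forall c, O (kK c);
  dvr_pi : O pi;
  dvr_piV : ~ O pi^-1;
  dvr_val : forall q, q != 0 -> exists m n u,
    [/\ O u, O u^-1 & q * pi ^+ m = u * pi ^+ n];
  dvr_res : forall a, O a -> exists c, O ((a - kK c) / pi) }.

Definition kalgm (k : fieldType) (X : kscheme k) (U : opens X) :
  {rmorphism k -> sec U} := res (@sub_full X U) \o kstr X.

Lemma finite_type_gen (k : fieldType) (B : comPzRingType) (phi : k -> B) :
  finite_type_algebra phi ->
  exists xs : seq B, forall b, subring_gen (range phi `|` [set` xs]) b.
Proof.
case=> n [b bP]; exists [seq b i | i <- enum 'I_n] => x; have [Q ->] := bP x.
apply: subring_gen_sum => m _; apply: SubringGenM.
  by apply: SubringGen; left; exists (mpoly.mcoeff m Q).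
apply: subring_gen_prod => i _; apply: subring_genX; apply: SubringGen; right.
by apply/mapP; exists i; rewrite // mem_enum.
Qed.

Section SmoothCurve.
Variables (k : closedFieldType) (X : kscheme k).
Hypotheses (smX : smooth X) (connX : connected [set: X]) (dimX : krull_dim X 1).

Definition smooth_affine (U : opens X) : Prop :=
  [/\ affine U, finite_type_algebra (@kalg k X U) & formally_smooth (@kalg k X U)].

Lemma smooth_affine_nbhd (x : X) : exists U : opens X, U x /\ smooth_affine U.
Proof. by have [U [Ux aU ftU fsU]] := smX x; exists U. Qed.

Lemma curve_not_point (x : X) : [set x] <> [set: X].
Proof.
move=> E; have [[Z [Zirr Zlt]] _] := dimX.
have [_ [a Za] _] := Zirr 0%N isT.
have [le /existsNP[b /not_implyP[Zb nZb]]] := Zlt 0%N isT.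
have one (y : X) : y = x by have : [set: X] y by []; rewrite -E.
by apply: nZb; rewrite (one b) -(one a).
Qed.

Lemma specialize_ideal (U : opens X) (aU : affine U) x y : U x -> U y ->
  closure [set x] y -> point_ideal U x `<=` point_ideal U y.
Proof.
move=> Ux Uy /closure1_subset h; apply/(specialization aU Ux Uy) => W Wy.
exact: h (osetP W) Wy.
Qed.

(** An open point x would also be closed: in an affine neighbourhood of a specialization y of x, the
    Nullstellensatz on the basic open set {x} makes the residue field at x equal to k, so that the
    ideal of x is maximal and y = x. By connectedness X would be a single point, which has no chain
    of length 1. *)
Lemma no_isolated_point (x : X) : ~ open [set x].
Proof.
move=> ox; apply: (@curve_not_point x); apply: connX; first by exists x.
  by exists [set x]; rewrite ?setTI.
exists [set x]; rewrite ?setTI // => y xy.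
have [U [Uy [aU ftU fsU]]] := smooth_affine_nbhd y.
have Ux : U x := (closure1_subset _ _).1 xy _ (osetP U) Uy.
have xPy := specialize_ideal aU Ux Uy xy.
have hx := point_ideal_prime aU Ux; have hy := point_ideal_prime aU Uy.
have [f [fx fS]] := basic_nbhd aU Ux (erefl : Opens ox x).
have [xs gen] := finite_type_gen ftU.
have rc := @residue_constant k _ (kalgm U) xs gen _ f hx.
have {}rc : forall b, exists c, point_ideal U x (b - kalgm U c).
  apply: rc => [|Q hQ PQ Qf]; first by move=> h; apply: h.
  have [z Uz E] := prime_point aU hQ.
  rewrite E in Qf *; have /contrapT fz : ~ ~ unit_at f z := Qf.
  by have /= -> : z = x := fS z fz.
suff yx : point_ideal U y `<=` point_ideal U x.
  by apply/esym/(point_ideal_inj aU Ux Uy)/seteqP.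
move=> b yb; have [c xc] := rc b.
have yc : point_ideal U y (kalgm U c).
  rewrite -(subKr b (kalgm U c)).
  by apply: (@idealB _ (point_ideal U y)) => //; [exact: prime_ideal_ideal|exact: xPy].
have [c0|c0] := eqVneq c 0; first by move: xc; rewrite c0 rmorph0 subr0.
exfalso; case: hy => _ _ M h1 _; apply: h1.
by rewrite -(rmorph1 (kalgm U)) -(mulVf c0) rmorphM; apply: M.
Qed.

Lemma noetherian_affine (U : opens X) : smooth_affine U -> forall I : set (sec U),
  ideal I -> exists gs : seq (sec U),
  [set` gs] `<=` I /\ forall x, I x -> exists c : 'I_(size gs) -> sec U, x = \sum_i c i * gs`_i.
Proof.
case=> _ ftU _ I iI; have [xs gen] := finite_type_gen ftU.
exact: (@noetherian_finite_type k _ (kalgm U) xs I gen iI).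
Qed.

Lemma residue_constant_max (U : opens X) : smooth_affine U -> forall P : set (sec U),
  maximal_ideal P -> forall b, exists c, P (b - kalgm U c).
Proof.
case=> _ ftU _ P [hP mP]; have [xs gen] := finite_type_gen ftU.
apply: (@residue_constant k _ (kalgm U) xs gen P 1 hP); first by case: hP.
move=> Q hQ PQ _ b Qb; apply: contrapT => /mP[c Pc]; case: (hQ) => _ D M h1 _.
by apply: h1; rewrite -(subrK (c * b) 1); apply: (D); [exact: PQ|exact: M].
Qed.

Lemma chain_affine (U : opens X) (aU : affine U) (P P0 P1 : set (sec U)) :
  prime_ideal P -> prime_ideal P0 -> prime_ideal P1 ->
  P0 `<=` P1 -> P1 `<=` P -> P1 `<=` P0 \/ P `<=` P1.
Proof. by move=> hP h0 h1; apply: (prime_chain aU) => //; case: dimX. Qed.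

(** The parameter comes from the tangent space and Nakayama's lemma. If [u] times a power of [t]
    vanished, all points where [s * u] is a unit would contain [t] in their ideals, hence the whole
    ideal of [x], and [x] would be isolated. *)
Lemma local_parameter (U : opens X) x : smooth_affine U -> U x ->
  maximal_ideal (point_ideal U x) ->
  exists t s, let P := point_ideal U x in
    [/\ P t, ~ P s, (forall b, P b -> exists c, s * b = c * t) &
        forall n u, ~ P u -> u * t ^+ n <> 0].
Proof.
move=> saU Ux mP; have hP := mP.1; have [aU ftU fsU] := saU.
have rc := residue_constant_max saU mP.
have [ev [Pev evphi]] := residue_morphism hP rc.
have [t [Pt sq]] := @tangent_dimension_le1 k _ (kalgm U) _ ev fsU hP Pev evphi
  (fun P0 P1 h0 h1 => chain_affine aU hP h0 h1).
have [s [Ps st]] := tangent_generates hP (noetherian_affine saU) Pt sq.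
exists t, s; split=> // n u Pu ut0; apply: (@no_isolated_point x).
suff -> : [set x] = basic (s * u) by exact: osetP.
apply/seteqP; split=> [_ ->|y yD].
  by apply/unit_atM; split; apply: contrapT.
have [sy uy] : unit_at s y /\ unit_at u y by apply/unit_atM.
have Uy := unit_at_in sy; have hy := point_ideal_prime aU Uy.
have yt : point_ideal U y t.
  apply: (@prime_idealX _ _ _ n hy); case: (hy) => h0 _ _ _ h.
  have [|h'|//] := h u (t ^+ n); first by rewrite ut0.
  by case: h'.
have Py : point_ideal U x `<=` point_ideal U y.
  move=> b /st[c E]; case: (hy) => _ _ M _ h.
  have [|h'|//] := h s b; first by rewrite E; apply: M.
  by case: h'.
apply/esym/(point_ideal_inj aU Ux Uy)/seteqP; split=> // b yb.
apply: contrapT => /mP.2[c Pc]; case: (hy) => _ D M h1 _.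
by apply: h1; rewrite -(subrK (c * b) 1); apply: (D); [exact: Py|exact: M].
Qed.

(** At a maximal ideal containing that of [z], the infinitely divisible elements form a prime ideal
    killed by one [u] outside the maximal ideal. This prime is the least one wherever [u] is a
    unit. *)
Lemma local_generic (U : opens X) z : smooth_affine U -> U z ->
  exists (y : X) (u : sec U), [/\ U y, unit_at u z, unit_at u y &
    forall a, point_ideal U y a -> u * a = 0].
Proof.
move=> saU Uz; have [aU _ _] := saU; have hz := point_ideal_prime aU Uz.
have [||M [mM zM]] := @maximal_above _ (point_ideal U z).
- exact: prime_ideal_ideal.
- by case: hz.
have [x Ux E] := prime_point aU mM.1; rewrite E in mM zM.
have hx := mM.1.
have [t [s [Pt Ps st tn]]] := local_parameter saU Ux mM.
have hQ := infinitely_divisible_prime hx Pt Ps st tn.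
have [u [Pu uQ]] := infinitely_divisible_killed hx (noetherian_affine saU) Pt Ps st tn.
have QP := infinitely_divisible_sub hx Pt (t := t).
have [y Uy Ey] := prime_point aU hQ; exists y, u; split=> //.
- by apply: contrapT => uz; apply: Pu; apply: zM.
- apply: contrapT => uy; apply: Pu; apply: (QP u).
  by rewrite Ey.
- by move=> a ya; apply: uQ; rewrite Ey.
Qed.

Lemma locally_irreducible z : exists (W : opens X) (y : X),
  [/\ W z, W y & forall V : opens X, (exists x, V x /\ W x) -> V y].
Proof.
have [U [Uz saU]] := smooth_affine_nbhd z; have [aU _ _] := saU.
have [y [u [Uy uz uy uQ]]] := local_generic saU Uz.
exists (basic u), y; split=> // V [x [Vx ux]].
have Ux : U x := unit_at_in ux.
apply: ((specialization aU Uy Ux).1 _ V Vx) => a ya.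
have hx := point_ideal_prime aU Ux; case: (hx) => h0 _ _ _ h.
have [|h'|//] := h u a; first by rewrite uQ.
by case: h'.
Qed.

(** The points having a neighbourhood of which [y0] is the generic point form a set that is open and
    also closed, as two locally irreducible neighbourhoods that meet have the same generic point; X
    being connected, it is everything. *)
Lemma generic_point : exists y : X, forall (V : opens X) x, V x -> V y.
Proof.
have [[Z [Zirr _]] _] := dimX; have [_ [z0 _] _] := Zirr 0%N isT.
have [W0 [y0 [W0z W0y W0P]]] := locally_irreducible z0; exists y0.
pose T : set X := [set z | exists W : opens X,
  [/\ W z, W y0 & forall V : opens X, (exists x, V x /\ W x) -> V y0]].
suff TT : T = [set: X].
  move=> V x Vx; have [W [Wx _ WP]] : T x by rewrite TT.
  by apply: WP; exists x.
apply: connX; first by exists z0, W0.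
- exists T; rewrite ?setTI // openE => z [W [Wz Wy WP]].
  by apply: filterS (open_nbhs_nbhs (conj (osetP W) Wz)) => z' Wz'; exists W.
- exists T; rewrite ?setTI // -openC openE => z Tz.
  have [W [y [Wz Wy WP]]] := locally_irreducible z.
  apply: filterS (open_nbhs_nbhs (conj (osetP W) Wz)) => z' Wz' [W' [W'z' W'y0 W'P]].
  apply: Tz; exists W; split=> //; first by apply: W'P; exists z'.
  move=> V VW; apply: W'P; exists y; split; first exact: WP.
  by apply: WP; exists z'.
Qed.

Section FunctionField.
Variables (y0 : X) (y0P : forall (V : opens X) x, V x -> V y0).

Lemma generic_unit (U : opens X) (aU : affine U) x (a : sec U) :
  U x -> point_ideal U y0 a -> point_ideal U x a.
Proof.
move=> Ux; have Uy := y0P Ux.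
apply: (specialization aU Uy Ux).2 => W; exact: y0P.
Qed.

Lemma generic_killed (U : opens X) z : smooth_affine U -> U z ->
  exists u : sec U, [/\ unit_at u z, unit_at u y0 &
    forall a, point_ideal U y0 a -> u * a = 0].
Proof.
move=> saU Uz; have [aU _ _] := saU; have Uy0 := y0P Uz.
have [y [u [Uy uz uy uQ]]] := local_generic saU Uz.
exists u; split=> //; first exact: (y0P (V := basic u) uz).
move=> a a0; apply: uQ; exact: (generic_unit aU Uy).
Qed.

Lemma generic_zero (U : opens X) (W : opens X) (h : W `<=` U) (a : sec U) :
  smooth_affine U -> W y0 -> res h a = 0 -> point_ideal U y0 a.
Proof.
move=> [aU _ _] Wy a0; have [f [fy fa]] := nbhd_zero aU Wy a0.
have hy := point_ideal_prime aU (h _ Wy); case: (hy) => h0 _ _ _ hm.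
by have [|//|//] := hm f a; rewrite fa.
Qed.

(** Near each point the section is a fraction a/b whose numerator vanishes generically, and by
    [generic_killed] such numerators are killed by a unit there. *)
Lemma sec_zero_generic (V W : opens X) (h : W `<=` V) (s : sec V) :
  W y0 -> res h s = 0 -> s = 0.
Proof.
move=> Wy s0; apply: sec_zero_local => x Vx.
have [U [Ux saU]] := smooth_affine_nbhd x; have [aU _ _] := saU.
have [u [ux uy uQ]] := generic_killed saU Ux.
have [V' [hU [hV [a [b [V'x bx E]]]]]] := local_fraction aU s Ux Vx.
pose W' := opensI V' W.
have hW' := subset_trans (@opensIl X V' W) hU.
have hWV := subset_trans (@opensIr X V' W) h.
have ya : point_ideal U y0 a.
  apply: (generic_zero (W := W') (h := hW')) => //; first by split=> //; apply: y0P V'x.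
  rewrite -(res_res hU (@opensIl X V' W)) -E rmorphM.
  rewrite (res_res hV (@opensIl X V' W) hWV) -(res_res h (@opensIr X V' W)) s0 rmorph0.
  by rewrite mulr0.
have [W2 [h2 [r [W2x Er]]]] : unit_at (u * b) x by apply/unit_atM.
pose V2 := opensI V' W2; have hV2 := subset_trans (@opensIl X V' W2) hV.
exists V2, hV2; split; first by split.
have hU2 := subset_trans (@opensIl X V' W2) hU.
have Eu : res hU2 (u * b) * res (@opensIr X V' W2) r = 1.
  by rewrite -(res_res h2 (@opensIr X V' W2)) -rmorphM Er rmorph1.
have Es : res hU2 b * res hV2 s = res hU2 a.
  by rewrite -(res_res hV (@opensIl X V' W2)) -!(res_res hU (@opensIl X V' W2)) -rmorphM E.
rewrite -[res hV2 s]mul1r -Eu rmorphM.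
have -> : res hU2 u * res hU2 b * res (@opensIr X V' W2) r * res hV2 s =
  res (@opensIr X V' W2) r * (res hU2 u * (res hU2 b * res hV2 s)) by ring.
by rewrite Es -rmorphM uQ // rmorph0 mulr0.
Qed.

Lemma generic_ideal0 (U : opens X) (a : sec U) : smooth_affine U -> U y0 ->
  point_ideal U y0 a -> a = 0.
Proof.
move=> saU Uy ya; have [u [uz uy uQ]] := generic_killed saU Uy.
apply: (@sec_zero_generic U (basic u) (@basicS X U u)) => //.
have [aU _ _] := saU; have [r ur] := basic_inv aU u.
by rewrite -[res _ a]mul1r -ur mulrAC -rmorphM uQ // rmorph0 mul0r.
Qed.

End FunctionField.

Definition is_fun_field (F : fun_field X) : Prop :=
  forall (U : opens X), smooth_affine U -> forall (hU : U (gpt F)),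
    (forall a, point_ideal U (gpt F) a -> a = 0) /\
    forall q, exists a b : sec U,
      germ F U hU b != 0 /\ q = germ F U hU a / germ F U hU b.

Lemma exists_fun_field : exists F : fun_field X, is_fun_field F.
Proof.
have [y0 y0P] := generic_point.
have [U0 [U0y saU0]] := smooth_affine_nbhd y0; have [aU0 _ _] := saU0.
have hP := point_ideal_prime aU0 U0y.
have [K [pr [pr0 prF]]] := prime_residue hP.
have pr_eq0 a : pr a = 0 -> a = 0.
  by move=> /pr0; apply: generic_ideal0.
(* The germ of a section over any open set is the value of the fractions of sections of the fixed
   affine [U0] that represent it near [y0]. All such fractions have the same value, so that [rel] is
   the graph of a function. *)
pose rel (V : opens X) (s : sec V) q := exists (W : opens X) (h0 : W `<=` U0) (h : W `<=` V)
  (a b : sec U0), [/\ W y0, pr b != 0, res h0 b * res h s = res h0 a & q = pr a / pr b].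
have rel_ex (V : opens X) (s : sec V) : V y0 -> exists q, rel V s q.
  move=> Vy; have [W [h0 [h [a [b [Wy by0 E]]]]]] := local_fraction aU0 s U0y Vy.
  exists (pr a / pr b), W, h0, h, a, b; split=> //.
  by apply/eqP => /pr0; apply.
have rel_un (V : opens X) (s : sec V) q q' : rel V s q -> rel V s q' -> q = q'.
  move=> [W [h0 [h [a [b [Wy b0 E ->]]]]]] [W' [h0' [h' [a' [b' [Wy' b0' E' ->]]]]]].
  apply/eqP; rewrite eqr_div // -!rmorphM; apply/eqP; congr (pr _).
  pose I := opensI W W'; have hI0 := subset_trans (@opensIl X W W') h0.
  have hIV := subset_trans (@opensIl X W W') h.
  apply/eqP; rewrite -subr_eq0; apply/eqP.
  apply: (@sec_zero_generic _ y0P U0 I hI0); first by split.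
  rewrite rmorphB !rmorphM -!(res_res h0 (@opensIl X W W')) -E rmorphM.
  rewrite (res_res h (@opensIl X W W') hIV).
  rewrite !(res_res h0 (@opensIl X W W') hI0).
  rewrite -!(res_res h0' (@opensIr X W W') hI0) -E' rmorphM.
  by rewrite (res_res h' (@opensIr X W W') hIV); ring.
have /choice[g gP] : forall t : {V : opens X & ((V y0) * sec V)%type},
    exists q, rel (projT1 t) (projT2 t).2 q.
  by move=> [V [Vy s]]; apply: rel_ex.
have gE (V : opens X) (Vy : V y0) (s : sec V) q : rel V s q -> g (existT _ V (Vy, s)) = q.
  by apply: rel_un; apply: (gP (existT _ V (Vy, s))).
have germB (V : opens X) (Vy : V y0) : zmod_morphism (fun s : sec V => g (existT _ V (Vy, s))).
  move=> s s'; apply: gE.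
  have [W [h0 [h [a [b [Wy b0 E ->]]]]]] := gP (existT _ V (Vy, s)).
  have [W' [h0' [h' [a' [b' [Wy' b0' E' ->]]]]]] := gP (existT _ V (Vy, s')).
  rewrite /= in h E h' E'.
  pose I := opensI W W'; have hI0 := subset_trans (@opensIl X W W') h0.
  have hIV := subset_trans (@opensIl X W W') h.
  exists I, hI0, hIV, (a * b' - a' * b), (b * b'); split=> //.
  - by rewrite rmorphM mulf_neq0.
  - rewrite !rmorphB !rmorphM.
    rewrite -!(res_res h0 (@opensIl X W W') hI0) -E rmorphM (res_res h (@opensIl X W W') hIV).
    rewrite !(res_res h0 (@opensIl X W W') hI0).
    rewrite -!(res_res h0' (@opensIr X W W') hI0) -E' rmorphM (res_res h' (@opensIr X W W') hIV).
    by ring.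
  - by rewrite rmorphB !rmorphM; field; rewrite b0 b0'.
have germM (V : opens X) (Vy : V y0) : monoid_morphism (fun s : sec V => g (existT _ V (Vy, s))).
  split.
    apply: gE; exists (opensI U0 V), (@opensIl X U0 V), (@opensIr X U0 V), 1, 1.
    by rewrite !rmorph1 mulr1 oner_neq0 divr1; split.
  move=> s s'; apply: gE.
  have [W [h0 [h [a [b [Wy b0 E ->]]]]]] := gP (existT _ V (Vy, s)).
  have [W' [h0' [h' [a' [b' [Wy' b0' E' ->]]]]]] := gP (existT _ V (Vy, s')).
  rewrite /= in h E h' E'.
  pose I := opensI W W'; have hI0 := subset_trans (@opensIl X W W') h0.
  have hIV := subset_trans (@opensIl X W W') h.
  exists I, hI0, hIV, (a * a'), (b * b'); split=> //.
  - by rewrite rmorphM mulf_neq0.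
  - rewrite !rmorphM.
    rewrite -!(res_res h0 (@opensIl X W W') hI0) -E rmorphM (res_res h (@opensIl X W W') hIV).
    rewrite !(res_res h0 (@opensIl X W W') hI0).
    rewrite -!(res_res h0' (@opensIr X W W') hI0) -E' rmorphM (res_res h' (@opensIr X W W') hIV).
    by ring.
  - by rewrite !rmorphM; field; rewrite b0 b0'.
pose gm (V : opens X) (Vy : V y0) := mk_rmorphism (@germB V Vy) (@germM V Vy).
have gm_res (V W : opens X) (h : W `<=` V) (hV : V y0) (hW : W y0) s :
    gm W hW (res h s) = gm V hV s.
  apply: gE; have [W1 [h0 [h1 [a [b [Wy b0 E q]]]]]] := gP (existT _ V (hV, s)).
  rewrite /= in h1 E.
  pose I := opensI W W1; have hI0 := subset_trans (@opensIr X W W1) h0.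
  have hIV := subset_trans (@opensIr X W W1) h1.
  exists I, hI0, (@opensIl X W W1), a, b; split=> //.
  rewrite (res_res h (@opensIl X W W1) hIV) -!(res_res h0 (@opensIr X W W1) hI0) -E rmorphM.
  by rewrite (res_res h1 (@opensIr X W W1) hIV).
have gm_inj (V : opens X) (hV : V y0) s : gm V hV s = 0 -> s = 0.
  have [W [h0 [h [a [b [Wy b0 E q]]]]]] := gP (existT _ V (hV, s)).
  rewrite /= in h E q; rewrite /= q => /eqP; rewrite mulf_eq0 invr_eq0 (negPf b0) orbF.
  move=> /eqP/pr_eq0 a0; rewrite a0 rmorph0 in E.
  have by0 : unit_at b y0 by apply: contrapT => /pr0 b00; rewrite b00 eqxx in b0.
  have [W2 [h2 [r [W2x Er]]]] := by0.
  pose I := opensI W W2; have hIV := subset_trans (@opensIl X W W2) h.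
  apply: (@sec_zero_generic _ y0P V I hIV); first by split.
  have hI0 := subset_trans (@opensIl X W W2) h0.
  have Eb : res hI0 b * res (@opensIr X W W2) r = 1.
    by rewrite -(res_res h2 (@opensIr X W W2)) -rmorphM Er rmorph1.
  rewrite -[res hIV s]mul1r -Eb mulrAC.
  rewrite -(res_res h0 (@opensIl X W W2) hI0) -(res_res h (@opensIl X W W2) hIV).
  by rewrite -rmorphM E rmorph0 mul0r.
exists (FunField y0P gm_res gm_inj) => U saU hU.
split=> [a|q]; first exact: generic_ideal0.
change (exists a b : sec U, gm U hU b != 0 /\ q = gm U hU a / gm U hU b).
have [aU _ _] := saU.
have gmE a : gm U0 U0y a = pr a.
  apply: gE; exists U0, (@subset_refl _ U0), (@subset_refl _ U0), a, 1.
  by rewrite !rmorph1 mul1r oner_neq0 divr1; split.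
have frac a : exists c d : sec U, gm U hU d != 0 /\ pr a = gm U hU c / gm U hU d.
  have [W [hWU [hW0 [c [d [Wy dy E]]]]]] := local_fraction aU a hU U0y.
  exists c, d.
  have d0 : gm U hU d != 0.
    apply/eqP => /gm_inj d0; move: dy; rewrite d0 => -[W1 [h1 [r [W1y]]]].
    rewrite rmorph0 mul0r => /esym e1.
    have := @gm_inj U0 U0y 1; have := rmorph1 (gm W1 W1y); rewrite e1 rmorph0 => /esym/eqP.
    by rewrite oner_eq0.
  split=> //; apply/(canRL (mulfK d0)).
  have := congr1 (gm W Wy) E; rewrite rmorphM !(gm_res _ _ _ hU) (gm_res _ _ _ U0y) gmE.
  by rewrite mulrC.
have [a [b [Pb ->]]] := prF q.
have b0 : pr b != 0 by apply/eqP => /pr0.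
have [c [d [d0 aE]]] := frac a; have [c' [d' [d0' bE]]] := frac b.
exists (c * d'), (d * c').
have c0' : gm U hU c' != 0.
  by apply: contra_neq b0 => c0'; rewrite bE c0' mul0r.
rewrite (rmorphM (gm U hU)) (rmorphM (gm U hU)) mulf_neq0 //; split=> //.
by rewrite aE bE; field; rewrite d0 d0' c0'.
Qed.

Definition ff_const (F : fun_field X) : {rmorphism k -> F} :=
  germ F (opens_full X) I \o kstr X.

Lemma germ_const (F : fun_field X) (U : opens X) (hU : U (gpt F)) c :
  germ F U hU (kalgm U c) = ff_const F c.
Proof. exact: germ_res. Qed.

Lemma nongeneric_maximal (F : fun_field X) (U : opens X) x : is_fun_field F ->
  smooth_affine U -> U x -> x <> gpt F -> maximal_ideal (point_ideal U x).
Proof.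
move=> hF saU Ux xg; have [aU _ _] := saU; have hx := point_ideal_prime aU Ux.
have Ug : U (gpt F) := gptP F U x Ux; have hg := point_ideal_prime aU Ug.
have gx : point_ideal U (gpt F) `<=` point_ideal U x.
  by apply: (specialization aU Ug Ux).2 => W; apply: gptP.
have [||M [mM xM]] := @maximal_above _ (point_ideal U x).
- exact: prime_ideal_ideal.
- by case: hx.
have [xg'|Mx] := chain_affine aU mM.1 hg hx gx xM.
  by exfalso; apply: xg; apply: (point_ideal_inj aU Ux Ug); apply/seteqP.
by suff -> : point_ideal U x = M by []; apply/seteqP.
Qed.

End SmoothCurve.

Section LocalRings.
Variables (Z : scheme) (F : fun_field Z).

Lemma germ_unit_neq0 (U : opens Z) (hU : U (gpt F)) (b : sec U) x :
  unit_at b x -> germ F U hU b != 0.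
Proof.
move=> [W [h [t [Wx E]]]]; have Wg := gptP F W x Wx.
have /eqP := congr1 (germ F W Wg) E; rewrite rmorphM (germ_res _ hU) rmorph1.
by apply: contraL => /eqP ->; rewrite mul0r eq_sym oner_eq0.
Qed.

Lemma local_ringP (U : opens Z) (hU : U (gpt F)) x q : affine U -> U x ->
  local_ring F x q <-> exists a b : sec U, unit_at b x /\ q = germ F U hU a / germ F U hU b.
Proof.
move=> aU Ux; split=> [[V [hV [s [Vx ->]]]]|[a [b [bx ->]]]].
  have [W [hWU [hWV [a [b [Wx bx E]]]]]] := local_fraction aU s Ux Vx.
  exists a, b; split=> //; have Wg := gptP F W x Wx.
  apply/(canRL (mulfK (germ_unit_neq0 hU bx))).
  have := congr1 (germ F W Wg) E; rewrite rmorphM !(germ_res _ hU) (germ_res _ hV).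
  by rewrite mulrC.
have [W [h [t [Wx E]]]] := bx; have Wg := gptP F W x Wx.
exists W, Wg, (res h a * t); split=> //.
apply/esym/(canRL (mulfK (germ_unit_neq0 hU bx))).
have := congr1 (germ F W Wg) E; rewrite !rmorphM !(germ_res _ hU) rmorph1 => E'.
by rewrite -mulrA [_ * germ F U hU b]mulrC E' mulr1.
Qed.

Lemma local_ring_subring x : is_subring (local_ring F x).
Proof.
split.
- by exists (opens_full Z), I, 1; rewrite rmorph1.
- move=> _ _ [V [hV [s [Vx ->]]]] [W [hW [t [Wx ->]]]].
  have hI : opensI V W (gpt F) by split.
  exists (opensI V W), hI, (res (@opensIl Z V W) s - res (@opensIr Z V W) t).
  by rewrite rmorphB (germ_res _ hV) (germ_res _ hW).
- move=> _ _ [V [hV [s [Vx ->]]]] [W [hW [t [Wx ->]]]].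
  have hI : opensI V W (gpt F) by split.
  exists (opensI V W), hI, (res (@opensIl Z V W) s * res (@opensIr Z V W) t).
  by rewrite rmorphM (germ_res _ hV) (germ_res _ hW).
Qed.

Lemma germ_unit (U : opens Z) (hU : U (gpt F)) (s : sec U) x : U x ->
  unit_at s x <-> local_ring F x (germ F U hU s)^-1 /\ germ F U hU s != 0.
Proof.
move=> Ux; split=> [sx|[[V [hV [t [Vx E]]]] s0]].
  split; last exact: germ_unit_neq0 sx.
  have [W [h [t [Wx E]]]] := sx; have Wg := gptP F W x Wx.
  exists W, Wg, t; split=> //; apply: (mulfI (germ_unit_neq0 hU sx)).
  rewrite divff ?(germ_unit_neq0 hU sx) //.
  by have := congr1 (germ F W Wg) E; rewrite rmorphM (germ_res _ hU) rmorph1.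
have hI : opensI U V (gpt F) by split.
exists (opensI U V), (@opensIl Z U V), (res (@opensIr Z U V) t); split=> //.
apply/eqP; rewrite -subr_eq0; apply/eqP; apply: (@germ_inj _ F _ hI).
by rewrite rmorphB rmorphM (germ_res _ hU) (germ_res _ hV) -E divff // rmorph1 subrr.
Qed.

Lemma germ_glue (V : opens Z) (hV : V (gpt F)) q :
  (forall x, V x -> local_ring F x q) -> exists s, germ F V hV s = q.
Proof.
move=> loc.
have /choice[W WP] : forall i : {x | V x}, exists W : {W : opens Z & (W (gpt F) * sec W)%type},
    [/\ projT1 W (proj1_sig i), projT1 W `<=` V &
      germ F _ (projT2 W).1 (projT2 W).2 = q].
  move=> [x Vx]; have [W [hW [s [Wx ->]]]] := loc x Vx.
  have hI : opensI V W (gpt F) by split.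
  exists (existT _ (opensI V W) (hI, res (@opensIr Z V W) s)); split=> //.
  - exact: opensIl.
  - exact: germ_res.
have hW i : projT1 (W i) `<=` V by case: (WP i).
have [||t [tP _]] := @glue Z _ V (fun i => projT1 (W i)) hW (fun i => (projT2 (W i)).2).
- by move=> x Vx; exists (exist _ x Vx); case: (WP (exist _ x Vx)).
- move=> i j U hi hj; have [Ug|Ug] := pselect (U (gpt F)).
    apply/eqP; rewrite -subr_eq0; apply/eqP; apply: (@germ_inj _ F _ Ug).
    rewrite rmorphB !(germ_res _ (projT2 (W _)).1).
    have [_ _ ->] := WP i; have [_ _ ->] := WP j; exact: subrr.
  have z (u : sec U) : u = 0.
    by apply: sec_zero_local => x /(gptP F).
  by rewrite (z (res hi _)) (z (res hj _)).
have [x Vx] : exists x, V x by exists (gpt F).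
exists t; have [_ _ <-] := WP (exist _ x Vx).
rewrite -(tP (exist _ x Vx)); apply/esym/germ_res.
Qed.

End LocalRings.

Section CurveLocalRings.
Variables (k : closedFieldType) (X : kscheme k).
Hypotheses (smX : smooth X) (connX : connected [set: X]) (dimX : krull_dim X 1).
Variables (F : fun_field X) (hF : is_fun_field F).

(** The valuation is the order in the local parameter. [valuationP] applies to every section with
    nonzero germ, because the infinitely divisible ones are killed by an element with nonzero
    germ. *)
Lemma curve_dvr (x : X) : x <> gpt F -> exists pi, dvr (ff_const F) (local_ring F x) pi.
Proof.
move=> xg; have [U [Ux saU]] := smooth_affine_nbhd smX x; have [aU _ _] := saU.
have Ug : U (gpt F) := gptP F U x Ux.
have mP := nongeneric_maximal dimX hF saU Ux xg.
have [t [s [Pt Ps st tn]]] := local_parameter smX connX dimX saU Ux mP.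
have hx := mP.1; set P := point_ideal U x in Pt Ps st tn mP hx.
have nP a : ~ P a -> unit_at a x by move=> /contrapT.
have g0 a : ~ P a -> germ F U Ug a != 0 by move=> /nP; apply: germ_unit_neq0.
have [u0 [Pu0 u0Q]] := infinitely_divisible_killed hx (noetherian_affine saU) Pt Ps st tn.
have val a : germ F U Ug a != 0 -> exists n u v, [/\ ~ P u, ~ P v & u * a = v * t ^+ n].
  move=> a0; apply: (valuationP hx Ps st) => /u0Q /(congr1 (germ F U Ug))/eqP.
  by rewrite rmorphM rmorph0 mulf_eq0 (negPf a0) orbF (negPf (g0 _ Pu0)).
have inO a b : ~ P b -> local_ring F x (germ F U Ug a / germ F U Ug b).
  by move=> /nP bx; apply/(local_ringP Ug _ aU Ux); exists a, b.
have t0 : germ F U Ug t != 0.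
  have P1 : ~ P 1 by case: hx.
  by apply/eqP => /germ_inj t0; apply: (tn 1%N 1 P1); rewrite t0 mul1r.
exists (germ F U Ug t); split.
- exact: local_ring_subring.
- move=> c; exists (opens_full X), I, (kstr X c); split=> //.
- by exists U, Ug, t.
- move=> /(local_ringP Ug _ aU Ux)[a [b [bx E]]].
  have : t * a = b.
    apply/eqP; rewrite -subr_eq0; apply/eqP/(@germ_inj _ F U Ug).
    have b0 := germ_unit_neq0 Ug bx.
    by rewrite rmorphB rmorphM -[X in X * _]invrK E invf_div divfK ?subrr //;
      apply: contra_neq t0 => a0; rewrite -[LHS]invrK E a0 mul0r invr0.
  by move=> tab; apply: Pt; move: bx; rewrite -tab => /unit_atM[].
- move=> q q0; have [a [b [b0 qE]]] := (hF saU Ug).2 q.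
  have a0 : germ F U Ug a != 0 by apply: contra_neq q0 => a0; rewrite qE a0 mul0r.
  have [n [u [v [Pu Pv uE]]]] := val a a0.
  have [m [u' [v' [Pu' Pv' uE']]]] := val b b0.
  have hxM c d : ~ P c -> ~ P d -> ~ P (c * d).
    by case: hx => _ _ _ _ h nc nd /h[].
  exists m, n, (germ F U Ug (v * u') / germ F U Ug (u * v')); split.
  + by apply: inO; apply: hxM.
  + by rewrite invf_div; apply: inO; apply: hxM.
  have := congr1 (germ F U Ug) uE; have := congr1 (germ F U Ug) uE'.
  rewrite !rmorphM !rmorphXn /= => E' E.
  have gu0 := g0 _ Pu; have gv0 := g0 _ Pv'.
  rewrite qE; apply: (mulIf (mulf_neq0 b0 (mulf_neq0 gu0 gv0))).
  transitivity (germ F U Ug u * germ F U Ug a * (germ F U Ug v' * germ F U Ug t ^+ m)).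
    by field.
  by rewrite E -E'; field; rewrite gu0 gv0.
- move=> a /(local_ringP Ug _ aU Ux)[c [d [dx ->]]].
  have [ca Pc] := residue_constant_max saU mP c.
  have [da Pd] := residue_constant_max saU mP d.
  have d0 : da != 0.
    apply: contraPneq dx => d0; move: Pd; rewrite d0 rmorph0 subr0.
    exact.
  have [l PE] : exists l, P (c - kalgm U l * d).
    exists (ca / da).
    have -> : c - kalgm U (ca / da) * d = (c - kalgm U ca) - kalgm U (ca / da) * (d - kalgm U da).
      by rewrite mulrBr -rmorphM divfK //; ring.
    apply: (@idealB _ P) => //; first exact: prime_ideal_ideal.
    by case: hx => _ _ M _ _; apply: M.
  exists l; have [e eE] := st _ PE.
  have := inO e (s * d); have -> : germ F U Ug e / germ F U Ug (s * d) =
      (germ F U Ug c / germ F U Ug d - ff_const F l) / germ F U Ug t.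
    have := congr1 (germ F U Ug) eE.
    rewrite !rmorphM rmorphB rmorphM germ_const => E'.
    have -> : germ F U Ug e = germ F U Ug s * (germ F U Ug c -
        ff_const F l * germ F U Ug d) / germ F U Ug t by rewrite E' mulfK.
    field.
    by rewrite t0 (germ_unit_neq0 Ug dx) g0.
  apply; case: hx => _ _ _ _ h /h[//|]; exact.
Qed.

(** With z = c/a, the generators are those of the sections of an affine [U] together with 1/a. Were
    some 1/b missing, a prime containing b and avoiding the sections invertible in the generated
    ring would be a closed point; [z] takes a value l in k there, so that c - la is in the prime,
    although it equals (z - l)a and is invertible in that ring. *)
Lemma function_field_finite (z : F) : ~ algebraicOver (ff_const F) z ->
  exists ys : seq F, forall y,
    subring_gen (range (fraction_val (evalp (ff_const F) z)) `|` [set` ys]) y.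
Proof.
move=> tz; pose e : {rmorphism {poly k} -> F} := evalp (ff_const F) z.
have [U [Ug saU]] := smooth_affine_nbhd smX (gpt F); have [aU ftU _] := saU.
have [xs gen] := finite_type_gen ftU.
have [zero frac] := hF saU Ug.
pose g := germ F U Ug.
have [c [a [a0 zE]]] := frac z.
exists ((g a)^-1 :: map g xs).
set A := _ `|` _; pose A' := subring_gen A.
have Ak q : A' (fraction_val e q) by apply: SubringGen; left; exists q.
have Ae P : A' (e P) by have [q <-] := fraction_in1 e P.
have Ag s : A' (g s).
  elim: (gen s) => {s} [s [[d _ <-]|sxs]|| u v _ Hu _ Hv|u v _ Hu _ Hv].
  - have -> : g (kalg U d) = e d%:P by rewrite /e /= evalpC -(germ_const Ug).
    exact: Ae.
  - by apply: SubringGen; right; rewrite /= inE map_f ?orbT.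
  - by rewrite rmorph1; apply: SubringGen1.
  - by rewrite rmorphB; apply: SubringGenB.
  - by rewrite rmorphM; apply: SubringGenM.
pose S : set (sec U) := [set s | g s != 0 /\ A' (g s)^-1].
have inv b : g b != 0 -> A' (g b)^-1.
  move=> b0; apply: contrapT => nb.
  have [||||Q [hQ bQ QS]] := @prime_avoiding _ (principal b) S.
  - exact: principal_ideal.
  - by rewrite /S /= rmorph1 oner_neq0 invr1; split=> //; apply: SubringGen1.
  - move=> u v [u0 Au] [v0 Av]; rewrite /S /= rmorphM mulf_neq0 // invfM.
    by split=> //; apply: SubringGenM.
  - move=> s [s0 As] [d sE]; apply: nb.
    have -> : (g b)^-1 = g d * (g s)^-1.
      move: s0; rewrite sE rmorphM mulf_eq0 => /norP[d0 _].
      by rewrite invfM mulrA divff // mul1r.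
    by apply: (@SubringGenM _ A); [exact: Ag|exact: As].
  have [y Uy QE] := prime_point aU hQ.
  have yg : y <> gpt F.
    move=> yg; have /zero b00 : point_ideal U (gpt F) b.
      by rewrite -yg -QE; apply: bQ; exists 1; rewrite mul1r.
    by move: b0; rewrite b00 rmorph0 eqxx.
  have mQ := nongeneric_maximal dimX hF saU Uy yg; rewrite -QE in mQ.
  have aS : S a by split=> //; apply: SubringGen; right; rewrite /= inE eqxx.
  have [c0 Qc] := residue_constant_max saU mQ c.
  have [d0 Qd] := residue_constant_max saU mQ a.
  have d00 : d0 != 0.
    by apply: contra_notN (QS _ aS) => /eqP d00; move: Qd; rewrite d00 rmorph0 subr0.
  pose l := c0 / d0.
  have Ql : Q (c - kalgm U l * a).
    have -> : c - kalgm U l * a = (c - kalgm U c0) - kalgm U l * (a - kalgm U d0).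
      by rewrite mulrBr -rmorphM divfK //; ring.
    apply: idealB => //; first exact: prime_ideal_ideal.
    by case: hQ => _ _ M _ _; apply: M.
  apply: (QS _ _ Ql).
  have el : e ('X - l%:P) = z - ff_const F l by rewrite rmorphB /= evalpX evalpC.
  have zl : z - ff_const F l != 0.
    rewrite -el; apply/eqP => /(evalp_eq0 tz)/eqP.
    by rewrite polyXsubC_eq0.
  have gE : g (c - kalgm U l * a) = (z - ff_const F l) * g a.
    by rewrite rmorphB rmorphM /= germ_const mulrBl zE divfK.
  rewrite /S /= gE mulf_neq0 // invfM; split=> //; apply: SubringGenM; last exact: aS.2.
  have [|q qE] := @fraction_in _ _ e 1 ('X - l%:P); first by rewrite el.
  have -> : (z - ff_const F l)^-1 = fraction_val e q by rewrite qE rmorph1 div1r el.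
  exact: Ak.
move=> y; have [a1 [b1 [b10 ->]]] := frac y.
by apply: SubringGenM; [apply: Ag|apply: inv].
Qed.

End CurveLocalRings.

Import Order.TTheory.

Section Morphisms.
Variables (X Y : scheme) (f : scheme_morphism X Y).

Lemma pull_unit (V : opens Y) (s : sec V) x : unit_at s (f x) -> unit_at (pull f V s) x.
Proof.
move=> [W [h [t [Wx E]]]].
exists (mpreim f W), (opens_preimS (@mcont X Y f) h), (pull f W t); split=> //.
by rewrite -pull_res -rmorphM E rmorph1.
Qed.

Lemma pull_unitP (V : opens Y) (s : sec V) x : V (f x) ->
  unit_at (pull f V s) x <-> unit_at s (f x).
Proof. by move=> Vx; split; [exact: pull_local | exact: pull_unit]. Qed.

End Morphisms.

Section Separated.
Variables (k : closedFieldType) (X : kscheme k).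
Hypotheses (smX : smooth X) (dimX : krull_dim X 1).
Variables (F : fun_field X) (hF : is_fun_field F).

Lemma nongeneric_closed (x : X) : x <> gpt F -> closed [set x].
Proof.
move=> xg y xy; have [U [Uy saU]] := smooth_affine_nbhd smX y; have [aU _ _] := saU.
have Ux : U x := (closure1_subset _ _).1 xy _ (osetP U) Uy.
have sub := specialize_ideal aU Ux Uy xy.
have [hx mx] := nongeneric_maximal dimX hF saU Ux xg.
apply/esym/(point_ideal_inj aU Ux Uy)/seteqP; split=> // b yb.
apply: contrapT => /mx[c xc]; have := point_ideal_prime aU Uy; case=> _ D M h1 _.
by apply: h1; rewrite -(subrK (c * b) 1); apply: (D); [exact: sub|exact: M].
Qed.

(** If a standard chart of the projective space contains both images, [f] is a function vanishing at
    [x] and not at [y]. Otherwise [x] lies in U_i only and [y] in U_j only, and the coordinate x_j /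
    x_i vanishes at [x] while its inverse is regular at [y]. *)
Lemma curve_separated (x y : X) : projective X -> x <> gpt F -> y <> gpt F -> x <> y ->
  exists f : F, [/\ f != 0, local_ring F x f, ~ local_ring F x f^-1 & local_ring F y f^-1].
Proof.
move=> [n [P [f [[U [t [cov affU polyU inter cocycle]]] _ [finj fcl _]]]]] xg yg xy.
have closed_f z : z <> gpt F -> closed [set f z].
  move=> /nongeneric_closed/fcl; by rewrite image_set1.
have hg i z : U i (f z) -> mpreim f (U i) (gpt F) by apply: (gptP F (mpreim f (U i)) z).
have common i : U i (f x) -> U i (f y) -> exists g : F,
    [/\ g != 0, local_ring F x g, ~ local_ring F x g^-1 & local_ring F y g^-1].
  move=> Ux Uy.
  have mx := closed_point_maximal (affU i) Ux (closed_f _ xg).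
  have my := closed_point_maximal (affU i) Uy (closed_f _ yg).
  have [s [sx sy]] : exists s : sec (U i), ~ unit_at s (f x) /\ unit_at s (f y).
    apply: contrapT => ns; apply: xy; apply: finj.
    apply: (point_ideal_inj (affU i) Ux Uy).
    have sub : point_ideal (U i) (f x) `<=` point_ideal (U i) (f y).
      by move=> s sx sy; apply: ns; exists s.
    apply/seteqP; split=> // s sy; apply: contrapT => /mx.2[c xc].
    case: my => -[_ D M h1 _] _.
    by apply: h1; rewrite -(subrK (c * s) 1); apply: (D); [exact: sub|exact: M].
  have [g0 g1] := (germ_unit (hg i _ Ux) (pull f (U i) s) (x := y) Uy).1 (pull_unit sy).
  exists (germ F _ (hg i _ Ux) (pull f (U i) s)); split=> //.
    by exists (mpreim f (U i)), (hg i _ Ux), (pull f (U i) s).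
  move=> h; apply: sx; apply: (pull_local Ux).
  by apply/(germ_unit (hg i _ Ux)).
have [i Ux] := cov (f x); have [j Uy] := cov (f y).
have [Uiy|nUiy] := pselect (U i (f y)); first exact: (common i).
have [Ujx|nUjx] := pselect (U j (f x)); first exact: (common j).
have gi := hg i _ Ux; have gj := hg j _ Uy.
have prod1 : germ F _ gj (pull f (U j) (t j i)) * germ F _ gi (pull f (U i) (t i j)) = 1.
  pose W := opensI (U i) (U j).
  have hW : mpreim f W (gpt F) by split.
  have := cocycle i j i W (@opensIl _ (U i) (U j)) (@opensIr _ (U i) (U j)).
  move=> /(congr1 (fun s => germ F _ hW (pull f W s))).
  rewrite (polyU i).1 !rmorphM !pull_res !(germ_res _ gi) !(germ_res _ gj) => ->.
  by rewrite !rmorph1.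
have g0 : germ F _ gi (pull f (U i) (t i j)) != 0.
  by apply: contra_eq_neq prod1 => ->; rewrite mulr0 eq_sym oner_neq0.
have gV : (germ F _ gi (pull f (U i) (t i j)))^-1 = germ F _ gj (pull f (U j) (t j i)).
  by apply: (mulIf g0); rewrite mulVf.
exists (germ F _ gi (pull f (U i) (t i j))); split=> //.
- by exists (mpreim f (U i)), gi, (pull f (U i) (t i j)).
- move=> h; apply: nUjx; apply/(inter i j (f x) Ux); apply: (pull_local Ux).
  by apply/(germ_unit gi).
- by rewrite gV; exists (mpreim f (U j)), gj, (pull f (U j) (t j i)).
Qed.

End Separated.

(** * Valuations of function fields *)

Section Dvr.
Variables (k K : fieldType) (kK : {rmorphism k -> K}) (O : set K) (pi : K).
Hypothesis hO : dvr kK O pi.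

Let OS := dvr_sub hO.

(** The valuation of [q] is at least [n]. As a predicate it covers [q = 0] without an infinite
    value. *)
Definition vge (n : int) (q : K) : Prop := O (q * pi ^ (- n)).

Lemma dvr_pi_neq0 : pi != 0.
Proof. by apply: contra_notN (dvr_piV hO) => /eqP ->; rewrite invr0; apply: isr0. Qed.
Let pi0 := dvr_pi_neq0.

Lemma vge0 q : vge 0 q <-> O q.
Proof. by rewrite /vge oppr0 expr0z mulr1. Qed.

Lemma vge_zero n : vge n 0.
Proof. by rewrite /vge mul0r; apply: isr0. Qed.

Lemma vgeB n p q : vge n p -> vge n q -> vge n (p - q).
Proof. by rewrite /vge mulrBl; apply: isrB. Qed.

Lemma vgeN n q : vge n q -> vge n (- q).
Proof. by rewrite /vge mulNr; apply: isrN. Qed.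

Lemma vgeD n p q : vge n p -> vge n q -> vge n (p + q).
Proof. by rewrite /vge mulrDl; apply: isrD. Qed.

Lemma vgeM m n p q : vge m p -> vge n q -> vge (m + n) (p * q).
Proof.
rewrite /vge opprD expfzDr // => hp hq.
have -> : p * q * (pi ^ (- m) * pi ^ (- n)) = p * pi ^ (- m) * (q * pi ^ (- n)) by ring.
exact: isrM.
Qed.

Lemma vge_const0 c : vge 0 (kK c).
Proof. by apply/vge0; apply: dvr_const hO _. Qed.

Lemma vge_1 : vge 0 1.
Proof. by apply/vge0; apply: isr1. Qed.

Lemma vgeZ n c q : vge n q -> vge n (kK c * q).
Proof. by move=> hq; rewrite -[n]add0r; apply: vgeM => //; apply: vge_const0. Qed.

Lemma vge_sum n (J : Type) (r : seq J) (P : pred J) (G : J -> K) :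
  (forall j, P j -> vge n (G j)) -> vge n (\sum_(j <- r | P j) G j).
Proof. by move=> h; elim/big_ind: _ => //; [exact: vge_zero | exact: vgeD]. Qed.

Lemma vge_piz (n : int) : vge n (pi ^ n).
Proof. by rewrite /vge -expfzDr // subrr expr0z; apply: isr1. Qed.

Lemma vge_nat_pi (n : nat) : O (pi ^+ n).
Proof. by apply: isrX => //; apply: dvr_pi hO. Qed.

Lemma vge_le (m n : int) q : (m <= n)%R -> vge n q -> vge m q.
Proof.
move=> mn hq; rewrite /vge.
have -> : - m = - n + (n - m) by rewrite addrA addNr add0r.
rewrite expfzDr // mulrA; apply: isrM => //.
have : (0 <= n - m)%R by rewrite Num.Theory.subr_ge0.
by case: (n - m) => // i _; rewrite -exprnP; apply: vge_nat_pi.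
Qed.

Lemma vgeX (n : int) q i : vge n q -> vge (n *+ i) (q ^+ i).
Proof.
move=> hq; elim: i => [|i IH]; first by rewrite mulr0n expr0; apply: vge_1.
by rewrite mulrS exprS; apply: vgeM.
Qed.

Lemma vge_lead n q : vge n q -> exists c, vge (n + 1) (q - kK c * pi ^ n).
Proof.
move=> /(dvr_res hO)[c hc]; exists c; rewrite /vge opprD expfzDr // exprN1.
have -> : (q - kK c * pi ^ n) * (pi ^ (- n) * pi^-1) =
  (q * pi ^ (- n) - kK c * (pi ^ n * pi ^ (- n))) / pi by ring.
by rewrite -expfzDr // subrr expr0z mulr1.
Qed.

Lemma vge1_const c : vge 1 (kK c) -> c = 0.
Proof.
move=> h; apply: contrapT => /eqP c0; apply: (dvr_piV hO).
rewrite -[pi^-1]mul1r -(rmorph1 kK) -(mulVf c0) rmorphM -mulrA.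
by rewrite /vge exprN1 in h; apply: isrM => //; apply: dvr_const hO _.
Qed.

Lemma vge1_1 : ~ vge 1 1.
Proof. by rewrite -(rmorph1 kK) => /vge1_const/eqP; rewrite oner_eq0. Qed.

Lemma vge_val q : q != 0 -> exists n : int, [/\ vge n q, vge (- n) q^-1 & ~ vge (n + 1) q].
Proof.
move=> q0; have [m [n [u [hu huV E]]]] := dvr_val hO q0.
have u0 : u != 0.
  by apply: contra_neq q0 => u0; move: E; rewrite u0 mul0r => /eqP;
    rewrite mulf_eq0 expf_eq0 (negPf pi0) andbF orbF => /eqP.
have qE : q = u * pi ^ (n%:Z - m%:Z).
  by rewrite expfzDr // -exprnN mulrA -exprnP -E mulfK // expf_neq0.
have h1 : vge (n%:Z - m%:Z) q by rewrite qE -[X in vge X]add0r; apply: vgeM; [apply/vge0|apply: vge_piz].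
have h2 : vge (- (n%:Z - m%:Z)) q^-1.
  by rewrite qE invfM invr_expz -[X in vge X]add0r; apply: vgeM; [apply/vge0|apply: vge_piz].
exists (n%:Z - m%:Z); split=> // h; apply: vge1_1.
by rewrite -(divff q0) -[1](addrK (n%:Z - m%:Z)) [1 + _]addrC; apply: vgeM.
Qed.

Lemma vge_ex q : exists n : nat, vge (- n%:Z) q.
Proof.
have [->|/vge_val[n [h _ _]]] := eqVneq q 0; first by exists 0%N; apply: vge_zero.
exists `|n|%N; apply: vge_le h.
by rewrite abszE Num.Theory.lerNl Num.Theory.ler_normr lexx orbT.
Qed.

Lemma vge_inv (n : int) q : q != 0 -> ~ vge n q -> vge (1 - n) q^-1.
Proof.
move=> q0 nq; have [m [h1 h2 _]] := vge_val q0.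
have mn : (m < n)%R by rewrite ltNge; apply: contra_notN nq => /vge_le; apply.
apply: vge_le h2; rewrite Num.Theory.lerBlDr addrC Num.Theory.lerBrDr addrC.
by rewrite lezD1.
Qed.

Lemma vge_one_plus m : vge 1 m -> 1 + m != 0 /\ vge 0 (1 + m)^-1.
Proof.
move=> hm; have nz : ~ vge 1 (1 + m).
  by move=> h; apply: vge1_1; rewrite -(addrK m 1); apply: vgeB.
have n0 : 1 + m != 0 by apply: contra_notN nz => /eqP ->; apply: vge_zero.
by split=> //; rewrite -(subrr 1); apply: vge_inv.
Qed.

(** If [y] is not in [O] then 1/y is; the monic relation divided by a power of [y] then writes [y]
    as a polynomial in 1/y with coefficients in [O]. *)
Lemma dvr_integrally_closed (R : comNzRingType) (f : {rmorphism R -> K}) y :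
  (forall r, O (f r)) -> integralOver f y -> O y.
Proof.
move=> fO [p mp /rootP py0]; apply: contrapT => /vge0 nOy.
have y0 : y != 0 by apply: contra_notN nOy => /eqP ->; apply: vge_zero.
have yV : O y^-1 by apply/vge0; apply: (@vge_le 0 (1 - 0)) => //; apply: vge_inv.
apply: nOy; apply/vge0; pose m := (size p).-1.
have sp : size p = m.+1 by rewrite prednK // size_poly_gt0 monic_neq0.
have pm : p`_m = 1 by have /monicP := mp; rewrite lead_coefE -/m.
move: py0.
rewrite (@horner_coef_wide _ m.+1) ?size_map_poly_id0 ?sp //; last first.
  by rewrite (monicP mp) rmorph1 oner_neq0.
have fpm : (map_poly f p)`_m = 1 by rewrite coef_map pm [LHS]rmorph1.
rewrite big_ord_recr /= fpm mul1r addrC => /eqP.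
rewrite addr_eq0 => /eqP E.
case: m sp pm fpm E => [|m] sp pm fpm E.
  by move: E; rewrite big_ord0 expr0 oppr0 => /eqP; rewrite oner_eq0.
have -> : y = - \sum_(i < m.+1) (map_poly f p)`_i * y^-1 ^+ (m - i).
  apply: (mulIf (expf_neq0 m y0)); rewrite -exprS E mulNr mulr_suml; congr (- _).
  apply: eq_bigr => i _; rewrite -mulrA; congr (_ * _).
  have im : (i <= m)%N by rewrite -ltnS ltn_ord.
  have -> : y ^+ m = y ^+ (m - i) * y ^+ i by rewrite -exprD subnK.
  by rewrite mulrA exprVn mulVf ?mul1r ?expf_neq0.
apply: isrN => //; apply: isr_sum => // i _; apply: (isrM OS); last exact: (isrX OS).
by rewrite coef_map; apply: fO.
Qed.

End Dvr.

(** * Bases and linear independence over a subfield *)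

Section FiniteBasis.
Variables (F K : fieldType) (f : {rmorphism F -> K}).

Definition spans n (b : 'I_n -> K) := forall y, exists c : 'I_n -> F, y = \sum_i f (c i) * b i.
Definition indep (n : nat) (b : 'I_n -> K) :=
  forall c : 'I_n -> F, \sum_i f (c i) * b i = 0 -> forall i, c i = 0.

Let A : set K := range f.
Let hA : is_subring A.
Proof.
split; first by exists 1; rewrite ?rmorph1.
  by move=> _ _ [x _ <-] [y _ <-]; exists (x - y); rewrite ?rmorphB.
by move=> _ _ [x _ <-] [y _ <-]; exists (x * y); rewrite ?rmorphM.
Qed.

Lemma finite_spans (ys : seq K) : (forall y, algebraicOver f y) ->
  (forall y, subring_gen (range f `|` [set` ys]) y) -> exists n (b : 'I_n -> K), spans b.
Proof.
move=> alg gen.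
have [bs [b1 bM]] : exists bs : seq K, mspan A [set` bs] 1 /\
    forall y b, y \in ys -> b \in bs -> mspan A [set` bs] (y * b).
  elim: {gen} ys => [|y ys [bs [b1 bM]]].
    by exists [:: 1]; split=> //; apply: mspan_gen => //; rewrite /= inE.
  have /integral_algebraic[p mp /rootP py0] := alg y.
  pose m := (size p).-1.
  have sp : size p = m.+1 by rewrite prednK // size_poly_gt0 monic_neq0.
  have ym : y ^+ m = \sum_(i < m) f (- p`_i) * y ^+ i.
    move: py0; rewrite (@horner_coef_wide _ m.+1) ?size_map_poly ?sp //.
    have pm : p`_m = 1 by have /monicP := mp; rewrite lead_coefE -/m.
    have fpm : (map_poly f p)`_m = 1 by rewrite coef_map pm [LHS]rmorph1.
    rewrite big_ord_recr /= fpm mul1r addrC => /eqP; rewrite addr_eq0 => /eqP ->.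
    by rewrite -sumrN; apply: eq_bigr => i _; rewrite coef_map rmorphN mulNr.
  pose bs' := [seq b * y ^+ i | b <- bs, i <- iota 0 m].
  have inbs' b i : b \in bs -> (i < m)%N -> b * y ^+ i \in bs'.
    by move=> bb im; apply: allpairs_f; rewrite // mem_iota.
  have m0 : (0 < m)%N.
    case: m sp ym {bs' inbs'} => // sp; rewrite big_ord0 expr0 => /eqP.
    by rewrite oner_eq0.
  have sub x i : (i < m)%N -> mspan A [set` bs] x -> mspan A [set` bs'] (x * y ^+ i).
    move=> im; elim=> [|a g z Aa gbs _ IH]; first by rewrite mul0r; apply: MSpan0.
    by rewrite mulrDl -mulrA; apply: MSpanD => //; apply: inbs'.
  exists bs'; split; first by rewrite -[1]mulr1 -(expr0 y); apply: sub.
  move=> y' b + /allpairsP[[b0 i] /= [bb0]]; rewrite mem_iota add0n leq0n /= => yy im ->.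
  move: yy; rewrite inE => /orP[/eqP ->|yy]; last by rewrite mulrA; apply: sub => //; apply: bM.
  rewrite mulrCA -exprS; have [im1|] := ltnP i.+1 m.
    by apply: mspan_gen => //; apply: inbs'.
  move=> mi; have -> : i.+1 = m by apply/eqP; rewrite eqn_leq im mi.
  rewrite ym mulr_sumr; apply: mspan_sum => j _; rewrite mulrCA.
  by apply: mspan_mul => //; [exists (- p`_j)|apply: mspan_gen => //; apply: inbs'].
exists (size bs), (fun i => bs`_i) => y.
have stab a b : subring_gen (range f `|` [set` ys]) a -> mspan A [set` bs] b -> mspan A [set` bs] (a * b).
  move=> ga; elim: ga b => {a} [a [ra|ays]|| u v _ Hu _ Hv|u v _ Hu _ Hv] b hb.
  - exact: mspan_mul.
  - elim: hb => [|c g z Ac gbs _ IH]; first by rewrite mulr0; apply: MSpan0.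
    rewrite mulrDr; apply: mspan_add => //; rewrite mulrCA.
    by apply: mspan_mul => //; apply: bM.
  - by rewrite mul1r.
  - rewrite mulrBl -mulN1r; apply: mspan_add; first exact: Hu.
    by apply: (mspan_mul hA); [apply: (isrN hA); apply: (isr1 hA)|exact: Hv].
  - by rewrite -mulrA; apply/Hu/Hv.
have /(mspanP hA)[c [Ac yE]] : mspan A [set` bs] y by rewrite -[y]mulr1; apply: stab.
have /choice[d dE] : forall i, exists d, f d = c i by move=> i; have [d _ dE] := Ac i; exists d.
by exists d; rewrite [LHS]yE; apply: eq_bigr => i _; rewrite dE.
Qed.

Lemma spans_basis n (b : 'I_n -> K) : spans b ->
  exists m (b' : 'I_m -> K), spans b' /\ indep b'.
Proof.
move=> sb; have ex : exists n, `[< exists b : 'I_n -> K, spans b >].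
  by exists n; apply/asboolP; exists b.
case: (ex_minnP ex) => m /asboolP[b' sb'] mmin; exists m, b'; split=> //.
move=> c c0 i; apply: contrapT => /eqP ci.
case: m b' sb' mmin c c0 i ci => [|m] b' sb' mmin c c0 i ci; first by case: i ci.
have : (m.+1 <= m)%N; last by rewrite ltnn.
apply: mmin; apply/asboolP; exists (fun j => b' (lift i j)) => y.
have [d dE] := sb' y.
exists (fun j => d (lift i j) - d i / c i * c (lift i j)).
have bi : b' i = - \sum_j f (c (lift i j) / c i) * b' (lift i j).
  move: c0; rewrite (bigD1_ord i) //= => /eqP; rewrite addr_eq0 => /eqP E.
  apply: (mulfI (_ : f (c i) != 0)); first by rewrite fmorph_eq0.
  rewrite E mulrN mulr_sumr; congr (- _); apply: eq_bigr => j _.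
  by rewrite mulrA -rmorphM mulrCA divff // mulr1.
rewrite dE (bigD1_ord i) //= bi mulrN mulr_sumr addrC -sumrN -big_split.
apply: eq_bigr => j _ /=; rewrite rmorphB mulrBl; congr (_ - _).
by rewrite mulrA -rmorphM; congr (f _ * _); rewrite mulrA mulrAC.
Qed.

Lemma indep_le e (b : 'I_e -> K) r (u : 'I_r -> K) : spans b -> indep u -> (r <= e)%N.
Proof.
move=> sb iu; have /choice[c cE] : forall i, exists c : 'I_e -> F, u i = \sum_j f (c j) * b j.
  by move=> i; apply: sb.
pose M := \matrix_(i, j) c i j : 'M[F]_(r, e).
have -> : r = \rank M; last exact: rank_leq_col.
apply/esym/eqP; rewrite -/(row_free M) -kermx_eq0; apply/eqP/matrixP => i j.
rewrite [RHS]mxE; apply: (iu (fun j => kermx M i j)).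
under eq_bigr => l _ do rewrite cE mulr_sumr.
rewrite exchange_big /= big1 // => l _.
have : (kermx M *m M) i l = 0 by rewrite mulmx_ker mxE.
rewrite mxE => /(congr1 f); rewrite rmorph0 rmorph_sum => E.
transitivity (\sum_i0 f (kermx M i i0 * M i0 l) * b l); last by rewrite -mulr_suml E mul0r.
by apply: eq_bigr => i0 _; rewrite mulrA -rmorphM [M i0 l]mxE.
Qed.

Lemma indep_widen n m (g : 'I_n -> K) (h : (m <= n)%N) :
  indep g -> indep (g \o widen_ord h).
Proof.
move=> ig c c0 i.
pose d (j : 'I_n) := if insub (val j) is Some j' then c j' else 0.
have dE (j : 'I_m) : d (widen_ord h j) = c j.
  by rewrite /d /= insubT //= => lt; congr c; apply: val_inj.
rewrite -dE; apply: ig; rewrite -[RHS]c0 (bigID (fun j : 'I_n => (j < m)%N)) /= addrC big1 ?add0r.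
  rewrite (big_ord_narrow h); apply: eq_bigr => j _.
  by rewrite -dE.
by move=> j jm; rewrite /d insubN // rmorph0 mul0r.
Qed.

Definition linear_set (Q : set K) := Q 0 /\ forall c x y, Q x -> Q y -> Q (f c * x + y).

(** V/V' is spanned by [p], so that one member of the family can be used to clear the others of
    their [p]-coefficients. [Q] is any subspace that the combinations should not leave. *)
Lemma indep_drop r (g : 'I_r.+1 -> K) (Q V V' : set K) p :
  linear_set Q -> linear_set V' ->
  (forall x, V x -> exists c, V' (x - f c * p)) ->
  indep g -> (forall i, V (g i)) -> (forall i, Q (g i)) ->
  exists g' : 'I_r -> K, [/\ indep g', forall i, V' (g' i) & forall i, Q (g' i)].
Proof.
move=> [Q0 QD] [V0 VD] lead ig Vg Qg.
have /choice[c cP] : forall i, exists c, V' (g i - f c * p) by move=> i; apply: lead.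
(* If all the coefficients vanish any index will do: division by 0 gives 0, and the remaining
   members stay unchanged. *)
have [i0 i0P] : exists i0 : 'I_r.+1, forall i, c i0 = 0 -> c i = 0.
  have [[i0 ci0]|nc] := pselect (exists i0, c i0 != 0).
    by exists i0 => i c0; rewrite c0 eqxx in ci0.
  by exists ord0 => i _; apply: contrapT => /eqP ci; apply: nc; exists i.
exists (fun j => g (lift i0 j) - f (c (lift i0 j) / c i0) * g i0); split.
- move=> d d0 j.
  pose C i := oapp d (- \sum_j d j * (c (lift i0 j) / c i0)) (unlift i0 i).
  have CE l : C (lift i0 l) = d l by rewrite /C liftK.
  rewrite -CE; apply: ig; rewrite -[RHS]d0 (bigD1_ord i0) //= /C unlift_none /=.
  under [X in _ + X]eq_bigr => l _ do rewrite liftK /=.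
  rewrite rmorphN rmorph_sum mulNr mulr_suml addrC -sumrN -big_split.
  by apply: eq_bigr => l _ /=; rewrite mulrBr [f (d l * _)]rmorphM mulrA.
- move=> j; have [c0|c0] := eqVneq (c i0) 0.
    rewrite c0 invr0 mulr0 rmorph0 mul0r subr0.
    by have := cP (lift i0 j); rewrite (i0P _ c0) rmorph0 mul0r subr0.
  set l := c (lift i0 j) / c i0.
  have -> : g (lift i0 j) - f l * g i0 =
      f (- l) * (g i0 - f (c i0) * p) + (g (lift i0 j) - f (c (lift i0 j)) * p).
    have -> : c (lift i0 j) = l * c i0 by rewrite divfK.
    by rewrite rmorphN rmorphM; ring.
  exact: VD.
- move=> j; rewrite addrC -mulNr -rmorphN; exact: QD.
Qed.

End FiniteBasis.

(** * Weak approximation and conditions on poles *)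

Section Places.
Variables (k : closedFieldType) (K : fieldType) (kK : {rmorphism k -> K}).
Variables (I : eqType) (O : I -> set K) (pi : I -> K).
Hypothesis hO : forall i, dvr kK (O i) (pi i).
Hypothesis sep : forall i j, i != j -> exists f, [/\ f != 0, O i f, ~ O i f^-1 & O j f^-1].

Notation v i := (vge (O i) (pi i)).

Lemma pole_one i j : i != j -> exists h, [/\ h != 0, v i 1 h^-1 & v j 1 h].
Proof.
have one a b : a != b -> exists f, [/\ f != 0, v a 1 f & v b 0 f^-1].
  move=> /sep[f [f0 af naf bf]]; exists f; split=> //; last exact/vge0.
  rewrite -[f]invrK -[1%R]subr0; apply: (vge_inv (hO a)); first by rewrite invr_eq0.
  by move=> /vge0.
move=> ij; have [f [f0 fi fj]] := one i j ij.
have [|g [g0 gj gi]] := one j i; first by rewrite eq_sym.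
exists (g / f); split; first by rewrite mulf_neq0 ?invr_eq0.
  by rewrite invf_div -[1%R]addr0; apply: (vgeM (hO i)).
by rewrite -[1%R]addr0; apply: (vgeM (hO j)).
Qed.

Lemma vge_bound (ys : seq I) (qs : seq K) :
  exists c : nat, forall i q, i \in ys -> q \in qs -> v i (- c%:Z) q.
Proof.
suff [c cP] : exists c : nat, forall p, p \in [seq (i, q) | i <- ys, q <- qs] -> v p.1 (- c%:Z) p.2.
  by exists c => i q iy qq; apply: (cP (i, q)); apply: allpairs_f.
elim: [seq _ | _ <- _, _ <- _] => [|p ps [c cP]]; first by exists 0%N.
have [d dP] := vge_ex (hO p.1) p.2.
have le (m n : nat) : (m <= n)%N -> (- n%:Z <= - m%:Z)%R by rewrite Num.Theory.lerN2 lez_nat.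
exists (maxn c d) => q; rewrite inE => /orP[/eqP->|/cP].
  by apply: (vge_le (hO _)) dP; apply/le/leq_maxr.
by apply: (vge_le (hO _)); apply/le/leq_maxl.
Qed.

Lemma vge_natX i (h : K) (N : nat) : v i 1 h -> v i N%:Z (h ^+ N).
Proof. by move=> h1; have := vgeX (hO i) N h1; rewrite natz. Qed.

(** As in the approximation theorem of Artin and Whaples: [g] has a pole at [i] and a zero at [y].
    If [h] is regular at [y], a power of it times [g] suffices. If not, h^N / (1 + h^N) is close to
    1 at [i] and at [y], small on [ys], and is multiplied by [g]. *)
Lemma pole_many i (ys : seq I) : i \notin ys ->
  exists h, [/\ h != 0, v i 1 h^-1 & forall j, j \in ys -> v j 1 h].
Proof.
elim: ys => [|y ys IH].
  exists (pi i)^-1; split=> //; first by rewrite invr_eq0 (dvr_pi_neq0 (hO i)).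
  by rewrite invrK -[X in v i _ X]expr1; apply: (vge_piz (hO i) 1).
rewrite inE negb_or => /andP[iy /IH[h [h0 hi hys]]].
have [g [g0 gi gy]] := pole_one iy.
have [c cP] := vge_bound ys [:: g].
pose N := c.+1.
have hN j : j \in ys -> v j 1 (h ^+ N * g).
  move=> jys; have -> : (1 = N%:Z + - c%:Z)%R by rewrite /N -addn1 PoszD addrAC subrr add0r.
  by apply: (vgeM (hO j)); [apply/vge_natX/hys | apply: cP; rewrite ?inE].
have hiN : v i 1 (h ^+ N)^-1.
  rewrite -exprVn; apply: (vge_le (hO i)) (vge_natX N hi).
  by rewrite lez_nat.
have [hy|nhy] := pselect (v y 0 h).
  exists (h ^+ N * g); split; first by rewrite mulf_neq0 ?expf_neq0.
    rewrite invfM; apply: (vge_le (hO i) (n := (1 + 1)%R)) => //.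
    exact: (vgeM (hO i)).
  move=> j; rewrite inE => /orP[/eqP->|/hN//].
  rewrite -[1%R]add0r; apply: (vgeM (hO y)) => //.
  by have := vgeX (hO y) N hy; rewrite mul0rn.
have hVy : v y 1 (h ^+ N)^-1.
  rewrite -exprVn; apply: (vge_le (hO y)) (vge_natX N _); first by rewrite lez_nat.
  by rewrite -[1%R]subr0; apply: (vge_inv (hO y)).
have hN0 : h ^+ N != 0 by rewrite expf_neq0.
have [n1 n1V] := vge_one_plus (hO i) hiN.
have [n2 n2V] := vge_one_plus (hO y) hVy.
have E : (h ^+ N) / (1 + h ^+ N) = (1 + (h ^+ N)^-1)^-1.
  have -> : 1 + h ^+ N = h ^+ N * (1 + (h ^+ N)^-1) by rewrite mulrDr mulr1 divff // addrC.
  by rewrite invfM mulrA divff // mul1r.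
exists (g / (1 + (h ^+ N)^-1)); split.
- by rewrite mulf_neq0 ?invr_eq0.
- rewrite invf_div mulrC -[1%R]addr0; apply: (vgeM (hO i)) => //.
  apply: (vgeD (hO i)); first exact: vge_1 (hO i).
  by apply: (vge_le (hO i)) hiN.
- move=> j; rewrite inE => /orP[/eqP->|jys].
    by rewrite -[1%R]addr0; apply: (vgeM (hO y)).
  rewrite -E mulrCA mulrA -[1%R]addr0; apply: (vgeM (hO j)); first exact: hN.
  have [|_ //] := vge_one_plus (hO j) (m := h ^+ N).
  by apply: (vge_le (hO j)) (vge_natX N (hys j jys)); rewrite lez_nat.
Qed.

(** The function h^M / (1 + h^M), with [h] having a pole at [i] and zeros on [ys], is 1 modulo the
    maximal ideal at [i] and as small as h^M on [ys]. *)
Lemma unit_small i (ys : seq I) (N : nat) : i \notin ys ->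
  exists e, [/\ e != 0, v i 0 e, v i 0 e^-1 & forall j, j \in ys -> v j N%:Z e].
Proof.
move=> /pole_many[h [h0 hi hys]]; pose M := N.+1.
have hM0 : h ^+ M != 0 by rewrite expf_neq0.
have hiM : v i 1 (h ^+ M)^-1.
  by rewrite -exprVn; apply: (vge_le (hO i)) (vge_natX M hi); rewrite lez_nat.
have [n1 n1V] := vge_one_plus (hO i) hiM.
exists (1 + (h ^+ M)^-1)^-1; split=> //; first by rewrite invr_eq0.
  rewrite invrK; apply: (vgeD (hO i)); first exact: vge_1 (hO i).
  exact: (vge_le (hO i)) hiM.
move=> j jys; have hj := vge_natX M (hys j jys).
have [|m1 m1V] := vge_one_plus (hO j) (m := h ^+ M).
  by apply: (vge_le (hO j)) hj; rewrite lez_nat.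
have -> : (1 + (h ^+ M)^-1)^-1 = h ^+ M * (1 + h ^+ M)^-1.
  have -> : 1 + h ^+ M = h ^+ M * (1 + (h ^+ M)^-1) by rewrite mulrDr mulr1 divff // addrC.
  by rewrite invfM mulrA divff // mul1r.
rewrite -[N%:Z]addr0; apply: (vgeM (hO j)) => //.
by apply: (vge_le (hO j)) hj; rewrite lez_nat.
Qed.

Lemma approximation (ys : seq I) i (j N : nat) : exists u,
  [/\ v i j%:Z u, ~ v i (j%:Z + 1) u & forall i', i' \in ys -> i' != i -> v i' N%:Z u].
Proof.
have [c cP] := vge_bound ys [:: pi i ^+ j].
have [|e [e0 ei eiV eys]] := @unit_small i [seq y <- ys | y != i] (N + c).
  by rewrite mem_filter eqxx.
exists (pi i ^+ j * e); split.
- rewrite -[j%:Z]addr0; apply: (vgeM (hO i)) => //.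
  exact: (vge_piz (hO i) j%:Z).
- move=> h; apply: (vge1_1 (hO i)).
  have -> : 1 = (pi i ^+ j * e) * (pi i ^ (- j%:Z) * e^-1).
    rewrite mulrACA divff // mulr1 [pi i ^+ j]exprnP -expfzDr ?subrr ?expr0z //.
    exact: dvr_pi_neq0 (hO i).
  have -> : (1 = (j%:Z + 1) + (- j%:Z + 0))%R by rewrite addr0 addrAC subrr add0r.
  apply: (vgeM (hO i)) => //; apply: (vgeM (hO i)) => //.
  exact: (vge_piz (hO i)).
- move=> i' iys ii; have -> : (N%:Z = - c%:Z + (N + c)%:Z)%R by rewrite PoszD addrCA addNr addr0.
  apply: (vgeM (hO i')); first by apply: cP; rewrite ?inE.
  by apply: eys; rewrite mem_filter ii.
Qed.

Lemma vge_linear i (n : int) : linear_set kK (v i n).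
Proof.
split; first exact: vge_zero (hO i) n.
by move=> c x y hx hy; apply: (vgeD (hO i)) => //; apply: (vgeZ (hO i)).
Qed.

(** A pole of order at most [P] has [P] polar coefficients, and the vanishing of each is one linear
    condition. *)
Lemma drop_place i P r n (g : 'I_n -> K) (Q : set K) : (P + r <= n)%N ->
  linear_set kK Q -> indep kK g -> (forall l, v i (- P%:Z) (g l)) -> (forall l, Q (g l)) ->
  exists g' : 'I_r -> K, [/\ indep kK g', forall l, v i 0 (g' l) & forall l, Q (g' l)].
Proof.
elim: P n g => [|P IH] n g Prn lQ ig vg Qg.
  exists (g \o widen_ord Prn); split; [exact: indep_widen|move=> l; exact: vg|move=> l; exact: Qg].
case: n g Prn ig vg Qg => [//|n] g Prn ig vg Qg.
have [|g' [ig' vg' Qg']] := @indep_drop _ _ kK n g Q (v i (- P.+1%:Z)) (v i (- P%:Z))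
    (pi i ^ (- P.+1%:Z)) lQ (vge_linear i _) _ ig vg Qg.
  move=> x /(vge_lead (hO i))[c hc]; exists c.
  by move: hc; have -> : (- P.+1%:Z + 1 = - P%:Z)%R by rewrite -addn1 PoszD opprD addrNK.
by apply: (IH n g').
Qed.

Lemma drop_places (ys : seq I) (P : I -> nat) r n (g : 'I_n -> K) (Q : set K) :
  (\sum_(y <- ys) P y + r <= n)%N ->
  linear_set kK Q -> indep kK g -> (forall y l, y \in ys -> v y (- (P y)%:Z) (g l)) ->
  (forall l, Q (g l)) ->
  exists g' : 'I_r -> K, [/\ indep kK g', forall y l, y \in ys -> v y 0 (g' l) & forall l, Q (g' l)].
Proof.
elim: ys n g Q => [|y ys IH] n g Q.
  rewrite big_nil add0n => rn lQ ig _ Qg.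
  by exists (g \o widen_ord rn); split=> //; [exact: indep_widen|move=> l; exact: Qg].
rewrite big_cons -addnA => Pn lQ ig vg Qg.
pose Q1 := [set x | (forall z, z \in ys -> v z (- (P z)%:Z) x) /\ Q x].
have lQ1 : linear_set kK Q1.
  split; first by split=> [z _|]; [exact: vge_zero (hO z) _ | exact: lQ.1].
  move=> c x x' [hx Qx] [hx' Qx']; split; last exact: lQ.2.
  by move=> z zys; apply: (vge_linear z _).2; [apply: hx|apply: hx'].
have [l|l|g1 [ig1 vg1 Qg1]] := @drop_place y (P y) _ n g Q1 Pn lQ1 ig.
- by apply: vg; rewrite inE eqxx.
- by split=> // z zys; apply: vg; rewrite inE zys orbT.
pose Q2 := [set x | v y 0 x /\ Q x].
have lQ2 : linear_set kK Q2.
  split; first by split; [exact: vge_zero (hO y) _ | exact: lQ.1].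
  by move=> c x x' [hx Qx] [hx' Qx']; split; [apply: (vge_linear y _).2|exact: lQ.2].
have [|l|g2 [ig2 vg2 Qg2]] := IH _ g1 Q2 (leqnn _) lQ2 ig1.
- by move=> z l zys; case: (Qg1 l) => h _; apply: h.
- by split; [apply: vg1|case: (Qg1 l)].
exists g2; split=> //; last by move=> l; case: (Qg2 l).
by move=> z l; rewrite inE => /orP[/eqP->|/vg2//]; case: (Qg2 l).
Qed.

End Places.

Import Order.TTheory.

Lemma indep_fraction (R : idomainType) (L : fieldType) (e : {rmorphism R -> L}) n (g : 'I_n -> L) :
  (forall a : 'I_n -> R, \sum_i e (a i) * g i = 0 -> forall i, a i = 0) ->
  indep (fraction_val e) g.
Proof.
move=> ig c c0; have /choice[ab abP] : forall i, exists p : R * R,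
    e p.2 != 0 /\ fraction_val e (c i) = e p.1 / e p.2.
  by move=> i; have [a [b [b0 E]]] := fraction_valP (c i); exists (a, b).
pose a i := (ab i).1 * \prod_(j | j != i) (ab j).2.
have aE i : e (a i) = fraction_val e (c i) * e (\prod_j (ab j).2).
  have [b0 ->] := abP i.
  by rewrite (bigD1 i) //= !rmorphM mulrA divfK.
have d0 : e (\prod_j (ab j).2) != 0.
  by rewrite rmorph_prod; apply/prodf_neq0 => j _; case: (abP j).
move=> i; apply/eqP; rewrite -(fmorph_eq0 (fraction_val e)).
suff : e (a i) == 0 by rewrite aE mulf_eq0 (negPf d0) orbF.
rewrite (ig a) ?rmorph0 //.
transitivity (e (\prod_j (ab j).2) * \sum_i fraction_val e (c i) * g i); last by rewrite c0 mulr0.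
by rewrite mulr_sumr; apply: eq_bigr => j _; rewrite aE; ring.
Qed.

Lemma fraction_indep (R : idomainType) (L : fieldType) (e : {rmorphism R -> L}) n (g : 'I_n -> L) :
  indep (fraction_val e) g ->
  forall a : 'I_n -> R, \sum_i e (a i) * g i = 0 -> forall i, e (a i) = 0.
Proof.
move=> ig a a0 i; have /choice[q qE] : forall j, exists q, fraction_val e q = e (a j).
  by move=> j; apply: fraction_in1.
rewrite -qE (ig q) ?rmorph0 //.
by rewrite -[RHS]a0; apply: eq_bigr => j _; rewrite qE.
Qed.

Lemma spans_scale (F K : fieldType) (f : {rmorphism F -> K}) n (b : 'I_n -> K) d :
  d != 0 -> spans f b -> spans f (fun i => d * b i).
Proof.
move=> d0 sb y; have [c E] := sb (y / d); exists c.
rewrite -[LHS](divfK d0) E mulr_suml; apply: eq_bigr => i _.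
by rewrite mulrAC -mulrA.
Qed.

Lemma indep_scale (F K : fieldType) (f : {rmorphism F -> K}) n (b : 'I_n -> K) d :
  d != 0 -> indep f b -> indep f (fun i => d * b i).
Proof.
move=> d0 ib c E; apply: ib; apply: (mulfI d0); rewrite mulr0 -[RHS]E mulr_sumr.
by apply: eq_bigr => i _; rewrite mulrCA.
Qed.

Lemma primitive_family (F : fieldType) n (a : 'I_n -> {poly F}) (i : 'I_n) : a i != 0 ->
  exists m (b : 'I_n -> {poly F}), (forall j, a j = b j * 'X^m) /\ exists j, (b j)`_0 != 0.
Proof.
have [s] := ubnP (size (a i)); elim: s a => // s IH a sa a0.
have [[j aj]|na] := pselect (exists j, (a j)`_0 != 0).
  by exists 0%N, a; split=> [l|]; [rewrite expr0 mulr1|exists j].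
have aX j : 'X %| a j.
  rewrite -['X]subr0 -polyC0 dvdp_XsubCl; apply/rootP; rewrite horner_coef0.
  by apply: contrapT => /eqP aj; apply: na; exists j.
have aE j : a j = (a j %/ 'X) * 'X by rewrite divpK.
have b0 : a i %/ 'X != 0 by apply: contra_neq a0 => b0; rewrite aE b0 mul0r.
have [|//|m [b [bE bn]]] := IH (fun j => a j %/ 'X).
  by move: sa; rewrite {1}aE size_mulX // ltnS.
by exists m.+1, b; split=> // j; rewrite aE bE exprS mulrA mulrAC.
Qed.

Section RegularFunction.
Variables (k : closedFieldType) (K : fieldType) (kK : {rmorphism k -> K}).
Variables (I : eqType) (O : I -> set K) (pi : I -> K).
Hypothesis hO : forall i, dvr kK (O i) (pi i).
Hypothesis sep : forall i j, i != j -> exists f, [/\ f != 0, O i f, ~ O i f^-1 & O j f^-1].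
Hypothesis fin : forall z, ~ algebraicOver kK z ->
  exists ys : seq K, forall y, subring_gen (range (fraction_val (evalp kK z)) `|` [set` ys]) y.

Notation v i := (vge (O i) (pi i)).

Lemma vge_transcendental i z : z != 0 -> v i 1 z -> ~ algebraicOver kK z.
Proof.
by move=> z0 vz /algebraicOver_closed[c zE]; rewrite zE in vz z0;
  move: z0; rewrite (vge1_const (hO i) vz) rmorph0 eqxx.
Qed.

Lemma vge_poly i z (P : {poly k}) : v i 0 z -> v i 0 (evalp kK z P).
Proof.
move=> hz; rewrite /evalp horner_coef; apply: (vge_sum (hO i)) => l _.
rewrite coef_map; apply: (vgeZ (hO i)).
by have := vgeX (hO i) l hz; rewrite mul0rn.
Qed.

Lemma vge_poly_at i z (P : {poly k}) (a : nat) : v i a%:Z z ->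
  v i a%:Z (evalp kK z P - kK P`_0).
Proof.
move=> hz; have hz0 : v i 0 z by apply: (vge_le (hO i)) hz.
have [Q [c ->]] : exists Q c, P = Q * 'X + c%:P.
  by elim/poly_ind: P => [|Q c _]; [exists 0, 0; rewrite mul0r addr0|exists Q, c].
rewrite rmorphD rmorphM /= evalpX evalpC coefD coefMX coefC /= add0r addrK.
rewrite -[a%:Z]add0r; apply: (vgeM (hO i)) => //; exact: vge_poly.
Qed.

(* The functions [U i j], [j < a i], of valuation [j] at [i] and of valuation at least [a] at the
   other zeros, are linearly independent over [k(z)]. *)
Lemma zeros_bound z e (b : 'I_e -> K) (L : seq I) (a : I -> nat) :
  ~ algebraicOver kK z -> spans (fraction_val (evalp kK z)) b -> uniq L ->
  (forall i, i \in L -> v i (a i)%:Z z) -> (\sum_(i <- L) a i <= e)%N.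
Proof.
move=> tz sb uL aL; pose N := \sum_(i <- L) a i.
have /choice[U UP] : forall p : I * nat, exists u,
    [/\ v p.1 p.2%:Z u, ~ v p.1 (p.2%:Z + 1) u & forall i', i' \in L -> i' != p.1 -> v i' N%:Z u].
  by move=> p; apply: approximation.
pose ps := [seq (i, j) | i <- L, j <- iota 0 (a i)].
have sps : size ps = N.
  rewrite size_allpairs_dep sumnE big_map; apply: eq_bigr => i _.
  by rewrite size_iota.
have ups : uniq ps.
  apply: allpairs_uniq_dep => //; first by move=> i _; apply: iota_uniq.
  by move=> [i j] [i' j'] _ _ /= [-> ->].
have psP p : p \in ps -> p.1 \in L /\ (p.2 < a p.1)%N.
  by move=> /allpairsPdep[i [j [iL]]]; rewrite mem_iota add0n leq0n => ja ->.
have aN i : i \in L -> (a i <= N)%N by move=> iL; rewrite /N (big_rem i) //= leq_addr.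
rewrite -/N -sps; have [ps0|ps0] := eqVneq (size ps) 0%N; first by rewrite ps0.
have psn (x : 'I_(size ps)) : tnth (in_tuple ps) x \in ps by apply: mem_tnth.
apply: (indep_le sb (u := fun x => U (tnth (in_tuple ps) x))).
apply: indep_fraction => c c0 x0; apply: contrapT => /eqP cx0.
have [m [d [dE [x1 dx1]]]] := primitive_family cx0.
have z0 : z != 0.
  by apply: contra_notN tz => /eqP ->; rewrite -(rmorph0 kK); apply: algebraic_id.
have {c0 dE} d0 : \sum_x evalp kK z (d x) * U (tnth (in_tuple ps) x) = 0.
  apply: (mulIf (expf_neq0 m z0)); rewrite mul0r -[RHS]c0 mulr_suml.
  apply: eq_bigr => x _; rewrite dE rmorphM rmorphXn /= evalpX.
  by rewrite mulrAC.
(* Among the terms at the place i of [x1] whose polynomial has a nonzero constant term, [x2] has the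
   least j: its valuation at i is exactly j. All other terms have valuation at least j + 1 there,
   those of the other places because N >= a i > j. *)
pose P x := ((tnth (in_tuple ps) x).1 == (tnth (in_tuple ps) x1).1) && ((d x)`_0 != 0).
have Px1 : P x1 by rewrite /P eqxx.
case: (@arg_minnP _ x1 P (fun x => (tnth (in_tuple ps) x).2) Px1) => x2 /andP[/eqP x21 dx2] mn.
set i := (tnth (in_tuple ps) x1).1 in x21 mn *; set j := (tnth (in_tuple ps) x2).2 in mn *.
have [iL ja] := psP _ (psn x2); rewrite -/j x21 in iL ja.
have [vj nvj _] := UP (tnth (in_tuple ps) x2); rewrite -/j x21 in vj nvj.
apply: nvj.
have js (l : nat) : (j < l)%N -> (j%:Z + 1 <= l%:Z)%R by rewrite -[1]/(1%:Z) -PoszD addn1 lez_nat.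
have zi := aL i iL.
have zi0 : v i 0 z by apply: (vge_le (hO i)) zi.
have big x : (tnth (in_tuple ps) x).1 = i -> (d x)`_0 = 0 -> v i (j%:Z + 1) (evalp kK z (d x) * U (tnth (in_tuple ps) x)).
  move=> xi dx; have [vx _ _] := UP (tnth (in_tuple ps) x).
  have := vge_poly_at (d x) zi; rewrite dx rmorph0 subr0 => h.
  rewrite -[(_ + 1)%R]addr0; apply: (vgeM (hO i)).
    exact: (vge_le (hO i)) (js _ ja) h.
  by rewrite -xi; apply: (vge_le (hO _)) vx.
have rest : v i (j%:Z + 1) (evalp kK z (d x2) * U (tnth (in_tuple ps) x2)).
  move: d0; rewrite (bigD1 x2) //= => /eqP; rewrite addr_eq0 => /eqP ->.
  apply: (vgeN (hO i)); apply: (vge_sum (hO i)) => x xx2.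
  have [xL xa] := psP _ (psn x); have [vx _ ox] := UP (tnth (in_tuple ps) x).
  have [xi|xi] := eqVneq (tnth (in_tuple ps) x).1 i; last first.
    rewrite -[(_ + 1)%R]add0r; apply: (vgeM (hO i)); first exact: vge_poly.
    apply: (vge_le (hO i)) (ox _ iL _); last by rewrite eq_sym.
    by apply: js; apply: leq_trans ja (aN _ iL).
  have [dx|dx] := eqVneq (d x)`_0 0; first exact: big.
  have jx : (j < (tnth (in_tuple ps) x).2)%N.
    rewrite ltn_neqAle mn ?andbT; last by rewrite /P xi dx eqxx.
    apply: contra_neqN xx2 => /eqP jx; apply/val_inj/eqP.
    rewrite -(nth_uniq (tnth (in_tuple ps) x1) _ _ ups) ?ltn_ord //.
    by rewrite -!(tnth_nth _ (in_tuple ps)) [X in X == _]surjective_pairing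
      [X in _ == X]surjective_pairing xi x21 -jx.
  rewrite -[(_ + 1)%R]add0r; apply: (vgeM (hO i)); first exact: vge_poly.
  by rewrite xi in vx; apply: (vge_le (hO i)) (js _ jx) vx.
have := vge_poly_at (d x2) zi.
set q := evalp kK z (d x2) in rest * => hq.
have h : v i (j%:Z + 1) (kK (d x2)`_0 * U (tnth (in_tuple ps) x2)).
  have -> : kK (d x2)`_0 * U (tnth (in_tuple ps) x2) =
    q * U (tnth (in_tuple ps) x2) - (q - kK (d x2)`_0) * U (tnth (in_tuple ps) x2) by ring.
  apply: (vgeB (hO i)) => //; rewrite -[(_ + 1)%R]addr0; apply: (vgeM (hO i)).
    exact: (vge_le (hO i)) (js _ ja) hq.
  by apply: (vge_le (hO i)) vj.
rewrite -[U _]mul1r -(rmorph1 kK) -(mulVf dx2) rmorphM -mulrA.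
exact: (vgeZ (hO i)).
Qed.

(** Being integral over k[1/z], the basis has no pole where 1/z is regular, hence no pole outside
    the zeros of z. *)
Lemma integral_basis z : ~ algebraicOver kK z^-1 -> ~ algebraicOver kK z ->
  exists e (b : 'I_e -> K), [/\ spans (fraction_val (evalp kK z)) b,
    indep (fraction_val (evalp kK z)) b & forall j, integralOver (evalp kK z^-1) (b j)].
Proof.
move=> tw tz; have [ys gen] := fin tz; have [ys' gen'] := fin tw.
have [n [b0 sb0]] := finite_spans (zariski gen) gen.
have [e [b [sb ib]]] := spans_basis sb0.
have alg j := zariski gen' (b j).
have /choice[D DP] : forall j, exists D, evalp kK z^-1 D != 0 /\ integralOver (evalp kK z^-1) (evalp kK z^-1 D * b j).
  by move=> j; apply: common_denominator; apply/integral_algebraic.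
pose D0 := \prod_j D j.
have D00 : evalp kK z^-1 D0 != 0.
  by rewrite rmorph_prod; apply/prodf_neq0 => j _; case: (DP j).
exists e, (fun j => evalp kK z^-1 D0 * b j); split.
- exact: spans_scale.
- exact: indep_scale.
- move=> j; rewrite /D0 (bigD1 j) //= rmorphM -mulrA mulrCA.
  by apply: integral_mul; [apply: integral_id | case: (DP j)].
Qed.

(** A form of Riemann's inequality. Let z be a uniformizer at [s], e the degree of K over k(z) and L
    the list of zeros of z, finite by [zeros_bound]. The e(N+1) products of a basis element by a
    power of 1/z up to N are independent over k and regular outside L. Cancelling the polar parts on
    L except at [s] takes fewer conditions, and of two independent functions that remain one is not
    constant. *)
Lemma regular_away (s : I) : exists t, ~ algebraicOver kK t /\ forall i, i != s -> O i t.
Proof.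
pose z := pi s; have z0 : z != 0 := dvr_pi_neq0 (hO s).
have vz : v s 1 z by rewrite -[X in v s _ X]expr1; apply: (vge_piz (hO s) 1).
have tz := vge_transcendental z0 vz.
have tw : ~ algebraicOver kK z^-1 by move=> /algebraic_inv; rewrite invrK.
have [e [b [sb ib bint]]] := integral_basis tw tz.
have zerosL L : uniq L -> (forall i, i \in L -> v i 1 z) -> (size L <= e)%N.
  move=> uL L1; rewrite -sum1_size; apply: (zeros_bound tz sb uL) => i iL; exact: L1.
pose isL n := `[< exists L : seq I, [/\ uniq L, s \in L, forall i, i \in L -> v i 1 z & size L = n] >].
have exL : exists n, isL n.
  exists 1%N; apply/asboolP; exists [:: s]; split; rewrite ?inE //.
  by move=> i; rewrite inE => /eqP ->.
have bdL n : isL n -> (n <= e)%N by move=> /asboolP[L [uL _ L1 <-]]; exact: zerosL.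
case: (ex_maxnP exL bdL) => _ /asboolP[L [uL sL L1 <-]] mx.
have outL i : i \notin L -> v i 0 z^-1.
  move=> iL; rewrite -(subrr 1); apply: (vge_inv (hO i)) => // vi.
  have : ((size L).+1 <= size L)%N; last by rewrite ltnn.
  apply: mx; apply/asboolP; exists (i :: L); split=> //=; first by rewrite iL.
  - by rewrite inE sL orbT.
  - by move=> l; rewrite inE => /orP[/eqP->|/L1].
have /choice[a aP] : forall i, exists a : nat, i \in L -> [/\ (0 < a)%N, v i a%:Z z & v i (- a%:Z) z^-1].
  move=> i; have [iL|iL] := boolP (i \in L); last by exists 0%N.
  have [n [h1 h2 h3]] := vge_val (hO i) z0.
  have n1 : (1 <= n)%R.
    rewrite leNgt; apply/negP => n1; apply: h3; apply: (vge_le (hO i)) (L1 i iL).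
    by rewrite lezD1.
  by case: n n1 h1 h2 {h3} => // n n1 h1 h2; exists n.
have suma : (\sum_(i <- L) a i <= e)%N.
  by apply: (zeros_bound tz sb uL) => i iL; have [] := aP i iL.
have [c cP] := vge_bound hO L [seq b j | j <- enum 'I_e].
(* [c] bounds the poles of the basis on L. Since the a_i add up to at most e, all polar parts amount
   to at most Ne + ce conditions, of which those at [s], at least N of them, are spared. With this N
   at most Ne - 2 are left. *)
pose N := (c * e + 2)%N.
pose G (x : 'I_e * 'I_N.+1) := b x.1 * z^-1 ^+ x.2.
pose g (x : 'I_(#|{: 'I_e * 'I_N.+1}|)) := G (enum_val x).
have ig : indep kK g.
  move=> d d0 x.
  pose d' (y : 'I_e * 'I_N.+1) := d (enum_rank y).
  have d'0 : \sum_y kK (d' y) * G y = 0.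
    rewrite -[RHS]d0 (reindex _ (onW_bij _ (enum_rank_bij _))) /=.
    by apply: eq_bigr => y _; rewrite /g enum_rankK.
  (* The relation becomes polynomial in z after multiplication by z^N, which reverses the order of
     the coefficients. *)
  pose Q j := \poly_(l < N.+1) d' (j, inord (N - l)).
  have Qj : forall j, evalp kK z (Q j) = 0.
    apply: fraction_indep ib _ _.
    transitivity (\sum_y kK (d' (y.1, y.2)) * G (y.1, y.2) * z ^+ N); last first.
      rewrite -mulr_suml [X in X * _](_ : _ = 0) ?mul0r //.
      by rewrite -[RHS]d'0; apply: eq_bigr => -[].
    rewrite -(pair_bigA _ (fun j l => kK (d' (j, l)) * G (j, l) * z ^+ N)) /=.
    apply: eq_bigr => j _; rewrite /evalp /Q.
    rewrite (@horner_coef_wide _ N.+1); last first.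
      by rewrite size_map_poly size_poly.
    rewrite mulr_suml (reindex_inj rev_ord_inj) /=; apply: eq_bigr => l _.
    rewrite coef_map coef_poly /= subSS ltnS leq_subr.
    have lN : (l <= N)%N by rewrite -ltnS.
    rewrite subKn // inord_val /G /= -!mulrA; congr (_ * _); rewrite mulrC; congr (_ * _).
    have -> : z ^+ N = z ^+ (N - l) * z ^+ l by rewrite -exprD subnK.
    by rewrite exprVn mulrCA mulVf ?mulr1 ?expf_neq0.
  have := Qj (enum_val x).1 => /(evalp_eq0 tz)/(congr1 (fun P : {poly k} => P`_(N - (enum_val x).2))).
  rewrite coef0 coef_poly ltnS leq_subr subKn; last by rewrite -ltnS.
  by rewrite inord_val -surjective_pairing /d' enum_valK.
have wX i (l : nat) : v i 0 z^-1 -> v i 0 (z^-1 ^+ l).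
  by move=> h; have := vgeX (hO i) l h; rewrite mul0rn.
pose ys := [seq y <- L | y != s].
pose P y := (N * a y + c)%N.
have outg i : i \notin L -> forall x, v i 0 (g x).
  move=> iL x; rewrite -[0]addr0 /g /G; apply: (vgeM (hO i)); last exact/wX/outL.
  apply/vge0; apply: (dvr_integrally_closed (hO i)) (bint _) => r.
  by apply/(@vge0 _ _ (pi i)); apply: vge_poly; apply: outL.
have ing i : i \in L -> forall x, v i (- (P i)%:Z) (g x).
  move=> iL x; have [a0 _ aw] := aP i iL.
  rewrite /P PoszD opprD addrC /g /G; apply: (vgeM (hO i)).
    by apply: cP => //; apply: map_f; rewrite mem_enum.
  have xN : ((enum_val x).2 <= N)%N by rewrite -ltnS.
  have := vgeX (hO i) (enum_val x).2 aw; apply: (vge_le (hO i)).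
  rewrite mulNrn Num.Theory.lerN2 -mulr_natr natz -PoszM lez_nat mulnC.
  by rewrite leq_mul2r xN orbT.
pose Q := [set y | forall i, i \notin L -> v i 0 y].
have lQ : linear_set kK Q.
  split; first by move=> i _; apply: vge_zero (hO i) 0.
  by move=> d x y hx hy i iL; apply: (vge_linear hO i 0).2; [apply: hx|apply: hy].
have count : (\sum_(y <- ys) P y + 2 <= #|{: 'I_e * 'I_N.+1}|)%N.
  rewrite card_prod !card_ord.
  have sumP : (\sum_(y <- L) P y = N * \sum_(y <- L) a y + c * size L)%N.
    by rewrite big_split /= -big_distrr /= [X in (_ + X)%N]big_const_seq count_predT iter_addn addn0.
  have sL' : (size L <= e)%N by apply: zerosL.
  have [a0 _ _] := aP s sL.
  have : (\sum_(y <- ys) P y + P s = \sum_(y <- L) P y)%N.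
    by rewrite addnC [RHS](big_rem s) //= rem_filter.
  rewrite sumP /P => E; have : (\sum_(y <- ys) (N * a y + c) + N <= N * e + c * e)%N.
    apply: leq_trans (_ : N * (\sum_(y <- L) a y) + c * size L <= _)%N.
      by rewrite -E leq_add2l; apply: leq_trans (leq_addr _ _); rewrite leq_pmulr.
    by apply: leq_add; rewrite leq_mul2l ?suma ?sL' orbT.
  move: (\sum_(y <- ys) _)%N => S; rewrite {2}/N addnA addnAC => h.
  have : (S + 2 <= N * e)%N by rewrite -(leq_add2r (c * e)).
  move=> /leq_trans; apply; rewrite mulnC leq_mul2l leqnSn orbT //.
have [||g' [ig' Lg' Qg']] := @drop_places _ _ _ _ _ _ hO ys P 2 _ g Q count lQ ig.
- by move=> y x; rewrite mem_filter => /andP[_ yL]; apply: ing.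
- by move=> x i iL; apply: outg.
have reg i x : i != s -> O i (g' x).
  move=> is_; apply/(@vge0 _ _ (pi i)); have [iL|iL] := boolP (i \in L); last exact: Qg'.
  by apply: Lg'; rewrite mem_filter is_ iL.
have [[x tx]|nt] := pselect (exists x, ~ algebraicOver kK (g' x)).
  by exists (g' x); split=> // i; apply: reg.
have cst x : exists c, g' x = kK c.
  by apply: algebraicOver_closed; apply: contrapT => tx; apply: nt; exists x.
have [c0 c0E] := cst ord0; have [c1 c1E] := cst ord_max.
have := ig' (fun x => if x == ord0 then c1 else - c0).
rewrite !big_ord_recl big_ord0 /= addr0 (_ : lift ord0 ord0 = ord_max); last exact: val_inj.
rewrite c0E c1E -!rmorphM -rmorphD /= mulNr mulrC subrr rmorph0 => /(_ erefl) h.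
have c10 := h ord0; have c00 := h ord_max; rewrite /= in c10 c00.
have := ig' (fun x => if x == ord0 then 1 else 0).
rewrite !big_ord_recl big_ord0 /= addr0 rmorph0 mul0r addr0 c0E.
have -> : c0 = 0 by rewrite -[c0]opprK c00 oppr0.
by rewrite rmorph0 mulr0 => /(_ erefl ord0)/eqP; rewrite /= oner_eq0.
Qed.

End RegularFunction.

(** * The trinomial and its inertia at the poles of t *)

Section RegularRepresentation.
Variables (A B : comPzRingType) (phi : {rmorphism A -> B}) (n : nat) (e : 'I_n -> B).
Hypothesis basis : forall b, exists! a : {ffun 'I_n -> A}, b = \sum_i phi (a i) * e i.

Lemma basis_inj (a a' : 'I_n -> A) :
  \sum_i phi (a i) * e i = \sum_i phi (a' i) * e i -> a =1 a'.
Proof.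
move=> E; have [c [_ cu]] := basis (\sum_i phi (a i) * e i).
have h1 : c = finfun a by apply: cu; apply: eq_bigr => i _; rewrite ffunE.
have h2 : c = finfun a' by apply: cu; rewrite E; apply: eq_bigr => i _; rewrite ffunE.
by move=> i; have := congr1 (fun f : {ffun _ -> _} => f i) (etrans (esym h1) h2); rewrite !ffunE.
Qed.

Lemma regular_representation : exists rho : B -> 'M[A]_n,
  [/\ (forall x i, x * e i = \sum_j phi (rho x i j) * e j),
      (forall x y, rho (x + y) = rho x + rho y),
      (forall x y, rho (x * y) = rho x *m rho y) &
      (forall a, rho (phi a) = a%:M)].
Proof.
have /choice[r rE] : forall x, exists M : 'M[A]_n, forall i, x * e i = \sum_j phi (M i j) * e j.
  move=> x; have /choice[a aE] : forall i, exists a : {ffun 'I_n -> A}, x * e i = \sum_j phi (a j) * e j.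
    by move=> i; have [a [aE _]] := basis (x * e i); exists a.
  exists (\matrix_(i, j) a i j) => i; rewrite aE; apply: eq_bigr => j _.
  by rewrite mxE.
(* Rows indexed by the multiplied basis element reverse the order of the factors; commutativity
   restores it. *)
have rM x y : r (y * x) = r x *m r y.
  apply/matrixP => i j; rewrite mxE.
  apply: (@basis_inj (fun j => r (y * x) i j) (fun j => \sum_l r x i l * r y l j)).
  rewrite -rE -mulrA rE mulr_sumr.
  under eq_bigr => l _ do rewrite mulrCA rE mulr_sumr.
  rewrite exchange_big; apply: eq_bigr => l _.
  rewrite rmorph_sum mulr_suml; apply: eq_bigr => m _.
  by rewrite rmorphM mulrA.
exists r; split=> //.
- move=> x y; apply/matrixP => i j; rewrite mxE.
  apply: (@basis_inj (fun j => r (x + y) i j) (fun j => r x i j + r y i j)).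
  rewrite -rE mulrDl !rE -big_split; apply: eq_bigr => l _.
  by rewrite rmorphD mulrDl.
- by move=> x y; rewrite mulrC rM.
- move=> a; apply/matrixP => i j; rewrite mxE.
  apply: (@basis_inj (fun j => r (phi a) i j) (fun j => a *+ (i == j))).
  rewrite -rE (bigD1 i) //= eqxx mulr1n big1 ?addr0 // => l li.
  by rewrite eq_sym (negPf li) mulr0n rmorph0 mul0r.
Qed.

End RegularRepresentation.

Lemma det_size (R : idomainType) d r (M : 'M[{poly R}]_d) :
  (forall i j, size (M i j) <= r.+1)%N -> (size (\det M) <= (d * r).+1)%N.
Proof.
move=> Mr; apply: leq_trans (size_sum _ _ _) _; apply/bigmax_leqP => s _.
rewrite (_ : (-1) ^+ s * _ = (-1) ^+ s *: \prod_i M i (s i)); last first.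
  by rewrite -mul_polyC rmorphXn rmorphN1.
apply: leq_trans (size_scale_leq _ _) _; apply: leq_trans (size_prod_leq _ _) _.
rewrite leq_subLR addnS ltnS.
apply: leq_trans (_ : \sum_(i < d) r.+1 <= _)%N; first by apply: leq_sum.
by rewrite sum_nat_const card_ord mulnS.
Qed.

Lemma irreducible_dvd_exp (F : fieldType) (p q : {poly F}) m : irreducible_poly p ->
  q %| p ^+ m -> exists j, q %= p ^+ j.
Proof.
move=> ip; have p0 : p != 0 by rewrite -size_poly_gt0; case: ip => /ltnW.
elim: m q => [|m IH] q qp; first by exists 0%N; rewrite expr0 -size_poly_eq1 -dvdp1 -(expr0 p).
have [pq|npq] := boolP (p %| q); last first.
  exists 0%N; rewrite expr0 -size_poly_eq1 -dvdp1.
  have cqp : coprimep q (p ^+ m.+1).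
    by rewrite coprimep_expr // coprimep_sym irreducible_poly_coprime.
  by rewrite -(Gauss_dvdpr _ cqp) mulr1.
have [|j qj] := IH (q %/ p); last first.
  by exists j.+1; rewrite -(divpK pq) exprSr eqp_mul2r.
by rewrite -(dvdp_mul2r _ _ p0) divpK // -exprSr.
Qed.

Lemma clear_poly (R : idomainType) (L : fieldType) (e : {rmorphism R -> L})
    (q : {poly fraction_field e}) :
  exists (D : R) (g : {poly R}), e D != 0 /\
    map_poly e g = e D *: map_poly (fraction_val e) q.
Proof.
have /choice[ab abP] : forall i : 'I_(size q), exists p : R * R,
    e p.2 != 0 /\ fraction_val e q`_i = e p.1 / e p.2.
  by move=> i; have [a [b [b0 E]]] := fraction_valP q`_i; exists (a, b).
pose D := \prod_j (ab j).2.
have /choice[a aE] : forall i : nat, exists a, e a = e D * fraction_val e q`_i.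
  move=> i; have [iq|qi] := ltnP i (size q); last first.
    by exists 0; rewrite nth_default // !rmorph0 mulr0.
  exists ((ab (Ordinal iq)).1 * \prod_(j | j != Ordinal iq) (ab j).2).
  have [b0 /= ->] := abP (Ordinal iq).
  have -> : D = (ab (Ordinal iq)).2 * \prod_(j | j != Ordinal iq) (ab j).2.
    by rewrite /D (bigD1 (Ordinal iq)).
  by rewrite [LHS]rmorphM [X in _ = X * _]rmorphM; field.
exists D, (\poly_(i < size q) a i); split.
  by rewrite rmorph_prod; apply/prodf_neq0 => j _; case: (abP j).
apply/polyP => i; rewrite coef_map coefZ coef_map coef_poly.
by have [iq|qi] := ltnP i (size q); [exact: aE | rewrite /= nth_default // !rmorph0 mulr0].
Qed.

Section Trinomial.
Variables (k : fieldType) (n s : nat).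
Hypotheses (s0 : (0 < s)%N) (sn : (s < n)%N).

Definition trinomial (R : comNzRingType) (t : R) : {poly R} := 'X^n - t *: 'X^s + 1.

Lemma map_trinomial (R R' : comNzRingType) (f : {rmorphism R -> R'}) t :
  map_poly f (trinomial t) = trinomial (f t).
Proof. by rewrite rmorphD rmorphB /= map_polyZ !map_polyXn rmorph1. Qed.

Lemma size_trinomial (R : comNzRingType) (t : R) : size (trinomial t) = n.+1.
Proof.
rewrite /trinomial -addrA size_polyDl ?size_polyXn // ltnS.
apply: leq_trans (size_polyD _ _) _; rewrite geq_max size_polyN size_poly1.
rewrite (leq_trans (size_scale_leq _ _)) ?size_polyXn //.
exact: leq_trans sn.
Qed.

Lemma trinomial_monic (R : comNzRingType) (t : R) : trinomial t \is monic.
Proof.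
rewrite monicE lead_coefE size_trinomial /= !coefE eqxx.
by rewrite gtn_eqF // mulr0 subr0 gtn_eqF ?addr0 // (leq_trans s0) // ltnW.
Qed.

Lemma size_trinomial_exp (R : idomainType) (t : R) d : size (trinomial t ^+ d) = (n * d).+1.
Proof.
rewrite -[X in (X * _).+1]/(n.+1.-1) -(size_trinomial t) -size_exp prednK //.
by rewrite size_poly_gt0 expf_neq0 // monic_neq0 // trinomial_monic.
Qed.

Section Base.
Variables (K : fieldType) (kK : {rmorphism k -> K}) (t : K).
Hypothesis tt : ~ algebraicOver kK t.
Let e : {rmorphism {poly k} -> K} := evalp kK t.
(** The value of the parameter for which [t] itself is a root of the trinomial. *)
Let T : K := (t ^+ n + 1) / t ^+ s.

Let t0 : t != 0.
Proof. by apply: contra_notN tt => /eqP ->; rewrite -(rmorph0 kK); apply: algebraic_id. Qed.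

(* After clearing denominators, reduce modulo [y^n + 1], which [t] divides at this point of
   the curve. *)
Let trinomial_indep (h : 'I_n -> {poly k}) :
  \sum_i evalp kK T (h i) * t ^+ i = 0 -> forall i, h i = 0.
Proof.
move=> h0 i0; apply: contrapT => /eqP hi0.
have T0 : T != 0.
  have -> : T = e ('X^n + 1) / t ^+ s by rewrite rmorphD rmorphXn rmorph1 /= evalpX.
  rewrite mulf_neq0 ?invr_eq0 ?expf_neq0 //; apply/eqP => /(evalp_eq0 tt)/eqP.
  by rewrite -size_poly_eq0 -(rmorph1 polyC) size_XnaddC // (leq_trans s0) // ltnW.
have [m [b [hE [i1 bi1]]]] := primitive_family hi0.
have {h0 hE} b0 : \sum_i evalp kK T (b i) * t ^+ i = 0.
  apply: (mulIf (expf_neq0 m T0)); rewrite mul0r -[RHS]h0 mulr_suml.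
  by apply: eq_bigr => i _; rewrite hE rmorphM rmorphXn /= evalpX mulrAC.
pose M := \max_i size (b i).
pose P := 'X^n + 1 : {poly k}.
pose hom i := \sum_(l < M) (b i)`_l *: (P ^+ l * 'X^(s * (M - l))).
have homE i : e (hom i) = t ^+ (s * M) * evalp kK T (b i).
  rewrite /evalp (@horner_coef_wide _ M); last by rewrite size_map_poly /M (leq_bigmax i).
  rewrite rmorph_sum mulr_sumr; apply: eq_bigr => l _.
  rewrite coef_map -mul_polyC !rmorphM !rmorphXn /= rmorphD rmorphXn rmorph1 /= evalpC evalpX [RHS]mulrCA; congr (_ * _).
  have -> : t ^+ (s * M) = t ^+ (s * (M - l)) * t ^+ s ^+ l.
    by rewrite -exprM -exprD -mulnDr subnK // ltnW.
  by rewrite /T expr_div_n mulrCA -!mulrA mulrCA divff ?mulr1 ?expf_neq0 // mulrC.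
have homP i : P %| hom i - (b i)`_0 *: 'X^(s * M).
  have aux (c : nat -> k) M' : (0 < M')%N ->
      P %| \sum_(l < M') c l *: (P ^+ l * 'X^(s * (M' - l))) - c 0%N *: 'X^(s * M').
    case: M' => // M' _; rewrite big_ord_recl /= expr0 mul1r subn0 addrC addKr.
    elim/big_ind: _ => [|x y|l _]; [exact: dvdp0|exact: dvdp_add|].
    by rewrite /bump /= add1n -mul_polyC exprS -mulrA mulrCA dvdp_mulIl.
  have [M0|M0] := posnP M.
    have -> : b i = 0.
      by apply/eqP; rewrite -size_poly_leq0 -M0 /M (leq_bigmax i).
    by rewrite coef0 scale0r subr0 /hom M0 big_ord0 dvdp0.
  exact: (aux (nth 0 (b i))).
have sum0 : \sum_i hom i * 'X^i = 0.
  apply: (evalp_eq0 tt); rewrite [LHS](rmorph_sum e).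
  transitivity (t ^+ (s * M) * \sum_i evalp kK T (b i) * t ^+ i); last by rewrite b0 mulr0.
  rewrite mulr_sumr; apply/eq_bigr => i _.
  by rewrite [LHS]rmorphM rmorphXn /= evalpX [evalp _ _ _]homE mulrA.
have : P %| \sum_i ((b i)`_0 *: 'X^(s * M)) * 'X^i.
  have -> : \sum_i ((b i)`_0 *: 'X^(s * M)) * 'X^i =
      - (\sum_i hom i * 'X^i - \sum_i ((b i)`_0 *: 'X^(s * M)) * 'X^i).
    by rewrite sum0 sub0r opprK.
  rewrite dvdpNr -sumrB.
  elim/big_ind: _ => [|x y|i _]; [exact: dvdp0|exact: dvdp_add|].
  by rewrite -mulrBl dvdp_mulr.
have -> : \sum_i ((b i)`_0 *: 'X^(s * M)) * 'X^i = (\poly_(i < n) oapp (fun i => (b i)`_0) 0 (insub i)) * 'X^(s * M).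
  rewrite poly_def mulr_suml; apply: eq_bigr => i _.
  by rewrite valK /= -!scalerAl mulrC.
have n0 : (0 < n)%N by apply: leq_trans sn.
have cop : coprimep P 'X^(s * M).
  apply: coprimep_expr; rewrite -['X]subr0 -polyC0 coprimep_XsubC.
  by rewrite /root !hornerE expr0n gtn_eqF // add0r oner_neq0.
rewrite Gauss_dvdpl // => /dvdp_leq.
rewrite /P -(rmorph1 polyC) size_XnaddC // leqNgt ltnS size_poly.
case: eqP => [/(congr1 (fun p : {poly k} => p`_i1))|_ /(_ isT)//].
by rewrite coef0 coef_poly ltn_ord valK /= => E; rewrite E eqxx in bi1.
Qed.

(** After denominators are cleared, a factorization becomes an identity between polynomials in the
    parameter and y, which may be evaluated at [T] and [t]. The trinomial vanishes there, hence so
    does a factor of degree less than n in y, contradicting the independence of the powers of [t]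
    over k[T]. *)
Lemma trinomial_irreducible_base tau : fraction_val e tau = t -> irreducible_poly (trinomial tau).
Proof.
move=> tauE; have n0 : (0 < n)%N by apply: leq_trans sn.
split; first by rewrite size_trinomial ltnS.
move=> q q1 /dvdpP[h FE].
have F0 : trinomial tau != 0 by rewrite monic_neq0 // trinomial_monic.
have : h * q != 0 by rewrite -FE.
rewrite mulf_eq0 negb_or => /andP[h0 q0].
have [h1|h1] := eqVneq (size h) 1%N.
  by rewrite FE -[X in X %= _]mul1r eqp_mul2r // eqp_sym -size_poly_eq1 h1.
have sE : (size h + size q = n.+2)%N.
  have := size_mul h0 q0; rewrite -FE size_trinomial.
  by have := q0; rewrite -size_poly_gt0; case: (size q) => // m _; rewrite addnS /= => ->.
have sz (p : {poly fraction_field e}) : p != 0 -> size p != 1%N -> (1 < size p)%N.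
  by rewrite -size_poly_gt0; case: (size p) => [|[|]].
have big := sz h h0 h1; have bigq := sz q q0 q1.
have hn : (size h <= n)%N by rewrite -2!ltnS -sE -addn2 leq_add2l.
have qn : (size q <= n)%N by rewrite -2!ltnS -sE -add2n leq_add2r.
pose ev (g : {poly {poly k}}) : K := (map_poly (evalp kK T) g).[t].
have key (p : {poly fraction_field e}) : p != 0 -> (size p <= n)%N -> exists D g,
    [/\ e D != 0, map_poly e g = e D *: map_poly (fraction_val e) p & ev g != 0].
  move=> p0 pn; have [D [g [D0 gE]]] := clear_poly p; exists D, g; split=> //.
  have sg : (size g <= n)%N.
    have <- : size (map_poly e g) = size g by apply: size_map_inj_poly; [exact: evalp_inj|exact: rmorph0].
    by rewrite gE size_scale // size_map_poly.
  apply: contra_neq p0 => g0; apply: (map_poly_inj (fraction_val e)).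
  rewrite rmorph0; apply: (scalerI D0); rewrite -gE scaler0.
  apply/polyP => i; rewrite coef_map coef0.
  have [ig|gi] := ltnP i n; last first.
    have -> : g`_i = 0 by rewrite nth_default ?(leq_trans sg gi).
    exact: rmorph0.
  have -> : g`_i = 0; last exact: rmorph0.
  apply: (trinomial_indep (h := fun i : 'I_n => g`_i) _ (Ordinal ig)).
  rewrite -[RHS]g0 /ev (@horner_coef_wide _ n) ?(leq_trans (size_poly _ _)) //.
  by apply: eq_bigr => j _; rewrite coef_map.
have [D [g [D0 gE gv]]] := key h h0 hn; have [D' [g' [D'0 g'E g'v]]] := key q q0 qn.
have gg : g * g' = (D * D') *: trinomial 'X.
  apply: (map_inj_poly (evalp_inj tt)); first exact: rmorph0.
  rewrite -!/e [LHS]rmorphM map_polyZ map_trinomial -/e [e 'X]evalpX /= gE g'E rmorphM.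
  rewrite -scalerAl -scalerAr scalerA; congr (_ *: _).
  transitivity (map_poly (fraction_val e) (h * q)); first by rewrite rmorphM.
  by rewrite -FE [LHS](map_trinomial (fraction_val e)) tauE.
have : ev (g * g') = 0.
  rewrite gg /ev map_polyZ map_trinomial [_ 'X]evalpX !hornerE /T divfK ?expf_neq0 //.
  by rewrite opprD addrA subrr add0r addNr mulr0.
move/eqP; rewrite /ev rmorphM hornerM mulf_eq0 => /orP[] /eqP E.
  by rewrite /ev E eqxx in gv.
by rewrite /ev E eqxx in g'v.
Qed.

End Base.
End Trinomial.

(** The norm from K[y] to k(t)[y] of a factor q has degree d deg(q) and divides the d-th power of
    the trinomial, which is irreducible over k(t). It is therefore associated to a power of the
    trinomial, so that n divides d deg(q), hence deg(q). *)
Lemma trinomial_irreducible (k K : fieldType) (kK : {rmorphism k -> K}) (t : K) n s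
    d (b : 'I_d -> K) : (0 < s)%N -> (s < n)%N -> coprime n d -> ~ algebraicOver kK t ->
  spans (fraction_val (evalp kK t)) b -> indep (fraction_val (evalp kK t)) b ->
  irreducible_poly (trinomial n s t).
Proof.
move=> s0 sn nd tt sb ib; set f := fraction_val _ in sb ib.
have n0 : (0 < n)%N by apply: leq_trans sn.
have [tau tauE] : exists tau, f tau = t.
  by have [tau E] := fraction_in1 (evalp kK t) 'X; exists tau; rewrite -[RHS](evalpX kK t); exact: E.
pose phi : {rmorphism _ -> _} := map_poly f.
(* A basis of K over k(t) is a basis of K[y] over k(t)[y]; the norm is the determinant of the
   regular representation. *)
have basis (q : {poly K}) : exists! a : {ffun 'I_d -> {poly fraction_field (evalp kK t)}},
    q = \sum_i phi (a i) * (b i)%:P.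
  have /choice[c cE] : forall l : nat, exists c : 'I_d -> _, q`_l = \sum_i f (c i) * b i.
    by move=> l; apply: sb.
  exists [ffun i => \poly_(l < size q) c l i]; split.
    apply/polyP => l; rewrite coef_sum; have [lq|ql] := ltnP l (size q).
      by rewrite cE; apply: eq_bigr => i _; rewrite ffunE coefMC coef_map coef_poly lq.
    rewrite nth_default // big1 // => i _.
    by rewrite ffunE coefMC coef_map coef_poly ltnNge ql /= rmorph0 mul0r.
  move=> a aE; apply/ffunP => i; apply/polyP => l; apply/eqP; rewrite -subr_eq0; apply/eqP.
  move: i; apply: ib.
  transitivity (q`_l - (\sum_i phi (a i) * (b i)%:P)`_l); last by rewrite -aE subrr.
  rewrite coef_sum; have [lq|ql] := ltnP l (size q).
    rewrite cE -sumrB; apply: eq_bigr => i _.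
    by rewrite ffunE coef_poly lq rmorphB mulrBl coefMC coef_map.
  rewrite nth_default // sub0r -sumrN; apply: eq_bigr => i _.
  by rewrite ffunE coef_poly ltnNge ql /= sub0r rmorphN mulNr coefMC coef_map.
have [rho [rhoE _ rhoM rhoC]] := regular_representation basis.
have rho_size g i j : (size (rho g i j) <= size g)%N.
  apply/leq_sizeP => l gl; move: j; apply: ib.
  have := congr1 (fun p : {poly K} => p`_l) (rhoE g i).
  rewrite coefMC nth_default // mul0r coef_sum => E.
  by rewrite [RHS]E; apply: eq_bigr => j _; rewrite coefMC coef_map.
have irr := trinomial_irreducible_base s0 sn tt tauE.
split; first by rewrite size_trinomial.
move=> q q1 /dvdpP[h FE].
have F0 : h * q != 0 by rewrite -FE monic_neq0 // trinomial_monic.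
move: (F0); rewrite mulf_eq0 negb_or => /andP[h0 q0].
have detE : \det (rho h) * \det (rho q) = trinomial n s tau ^+ d.
  have FE' : phi (trinomial n s tau) = h * q by rewrite -FE [LHS](map_trinomial n s f) tauE.
  by rewrite -det_mulmx -rhoM -FE' rhoC det_scalar.
have sh0 : (0 < size h)%N by rewrite size_poly_gt0.
have sq0 : (0 < size q)%N by rewrite size_poly_gt0.
pose r1 := (size h).-1; pose r2 := (size q).-1.
have r1E : size h = r1.+1 by rewrite prednK.
have r2E : size q = r2.+1 by rewrite prednK.
have rn : (r1 + r2 = n)%N.
  by have := size_mul h0 q0; rewrite -FE size_trinomial // r1E r2E addnS /= => -[].
have s1 : (size (\det (rho h)) <= (d * r1).+1)%N by apply: det_size => i j; rewrite -r1E.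
have s2 : (size (\det (rho q)) <= (d * r2).+1)%N by apply: det_size => i j; rewrite -r2E.
have tau0 : trinomial n s tau ^+ d != 0 by rewrite expf_neq0 // monic_neq0 // trinomial_monic.
have : (size (\det (rho q)) = (d * r2).+1)%N.
  move: (tau0); rewrite -detE mulf_eq0 negb_or => /andP[d1 d2].
  have := size_mul d1 d2; rewrite detE size_trinomial_exp //=.
  move: s1 s2; rewrite -size_poly_gt0 in d1; rewrite -size_poly_gt0 in d2.
  case: (size _) d1 => // x _; case: (size _) d2 => // y _.
  rewrite !ltnS addnS /= -rn mulnDl [(r1 * d)%N]mulnC [(r2 * d)%N]mulnC => xr yr [E]; congr _.+1; apply/eqP.
  by rewrite eqn_leq yr -(leq_add2l (d * r1)) E leq_add2r.
have [||j /eqp_size ->] := @irreducible_dvd_exp _ (trinomial n s tau) (\det (rho q)) d.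
- exact: irr.
- by rewrite -detE dvdp_mull.
rewrite size_trinomial_exp //= => -[jE].
have : (n %| r2)%N by rewrite -(Gauss_dvdr _ nd) -jE dvdn_mulr.
have r20 : (0 < r2)%N by move: q1; rewrite r2E eqSS -lt0n.
move=> /(dvdn_leq r20) nr2.
have r10 : r1 = 0%N by apply/eqP; rewrite -leqn0 -(leq_add2r r2) add0n rn.
by rewrite FE -[X in X %= _]mul1r eqp_mul2r // eqp_sym -size_poly_eq1 r1E r10.
Qed.

(** * Splitting fields, Galois extensions and extension of places *)

Definition splits (L : fieldType) (q : {poly L}) : Prop :=
  exists zs : seq L, q %= \prod_(z <- zs) ('X - z%:P).

Lemma irreducible_factor (F : fieldType) (p : {poly F}) : (1 < size p)%N ->
  exists r, r %| p /\ irreducible_poly r.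
Proof.
move: {2}(size p) (leqnn (size p)) => n; elim: n p => [|n IH] p pn p1.
  by rewrite leqn0 in pn; rewrite (eqP pn) in p1.
have [irr|nirr] := pselect (irreducible_poly p); first by exists p.
have [q [q1 qp nqp]] : exists q : {poly F}, [/\ size q != 1%N, q %| p & ~ q %= p].
  apply: contrapT => nq; apply: nirr; split=> // q q1 qp.
  by apply: contrapT => nqp; apply: nq; exists q.
have p0 : p != 0 by rewrite -size_poly_gt0 ltnW.
have q0 : q != 0 by apply: contraTneq qp => ->; rewrite dvd0p.
have sq : (1 < size q)%N by move: q1 q0; rewrite -size_poly_gt0; case: (size q) => [|[|]].
have qlt : (size q < size p)%N.
  rewrite ltn_neqAle dvdp_leq // andbT; apply/negP => sqp.
  by apply: nqp; rewrite -dvdp_size_eqp.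
have [r [rq irr]] := IH q (leq_trans qlt pn) sq.
by exists r; split=> //; apply: dvdp_trans qp.
Qed.

Lemma exists_splitting (F : fieldType) (p : {poly F}) : p != 0 ->
  exists L : fieldExtType F, splits (map_poly (in_alg L) p).
Proof.
move: {2}(size p) (leqnn (size p)) => n; elim: n F p => [|n IH] F p pn p0.
  by rewrite leqn0 size_poly_eq0 (negPf p0) in pn.
have [p1|p1] := leqP (size p) 1.
  exists F^o, [::]; rewrite big_nil -size_poly_eq1 size_map_poly.
  by rewrite eqn_leq p1 size_poly_gt0.
have [r [rp irr]] := irreducible_factor p1.
have [K _ [x rx _]] := irredp_FAdjoin irr.
have /factor_theorem[q qE] : root (map_poly (in_alg K) p) x.
  by move: rp => /dvdpP[p' ->]; rewrite rmorphM rootM rx orbT.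
have q0 : q != 0.
  apply: contraNneq p0 => q0; move: qE; rewrite q0 mul0r => /eqP.
  by rewrite map_poly_eq0.
have sq : (size q <= n)%N.
  have := size_map_poly (in_alg K) p.
  by rewrite qE size_mul ?polyXsubC_eq0 // size_XsubC addn2 /= => sp; rewrite -sp in pn.
have [L [zs zsE]] := IH K q sq q0.
exists (baseFieldType L), ((in_alg L x) :: zs).
have -> : map_poly (in_alg (baseFieldType L)) p = map_poly (in_alg L) (map_poly (in_alg K) p).
  rewrite -map_poly_comp; apply: eq_map_poly => a /=.
  exact: baseField_scaleE.
rewrite big_cons qE rmorphM rmorphB /= map_polyX map_polyC mulrC /=.
by rewrite eqp_mull.
Qed.

Lemma exists_splitting_field (F : fieldType) (p : {poly F}) : p != 0 ->
  exists L : splittingFieldType F, splittingFieldFor 1 (map_poly (in_alg L) p) {:L}%VS.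
Proof.
move=> /exists_splitting[L [ys pE]]; pose E := <<1 & ys>>%AS.
have /choice[v vE] : forall i : 'I_(size ys), exists v : subvs_of E, vsval v = ys`_i.
  move=> i; have iE : ys`_i \in E by apply: seqv_sub_adjoin; rewrite mem_nth.
  by exists (vsproj E ys`_i); rewrite vsprojK.
pose zs := [seq v i | i <- enum 'I_(size ys)].
have zsE : map vsval zs = ys.
  rewrite -map_comp -[RHS](mkseq_nth 0) /mkseq -val_enum_ord -map_comp.
  by apply: eq_map => i; rewrite /= vE.
have splitE : splittingFieldFor 1 (map_poly (in_alg (subvs_of E)) p) {:subvs_of E}%VS.
  exists zs.
    rewrite -(eqp_map (vsval : {rmorphism subvs_of E -> L})).
    rewrite -zsE big_map in pE; rewrite rmorph_prod -map_poly_comp.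
    apply: eqp_trans (eqp_trans pE _).
      by rewrite (eq_map_poly (g := in_alg L)) ?eqpxx // => a /=; rewrite algid1.
    rewrite (eq_bigr (fun z => map_poly vsval ('X - z%:P))) ?eqpxx // => z _.
    by rewrite rmorphB /= map_polyX map_polyC.
  apply/vspaceP => u; rewrite memvf.
  pose toL := linfun (vsval : subvs_of E -> L).
  have : vsval u \in (toL @: <<1 & zs>>)%VS.
    rewrite aimg_adjoin_seq aimg1.
    have -> : map toL zs = ys by rewrite -zsE; apply: eq_map => z; rewrite lfunE.
    exact: subvsP.
  by move=> /memv_imgP[z zin]; rewrite lfunE => /val_inj ->.
have ax : splitting_field_axiom (subvs_of E).
  exists (map_poly (in_alg (subvs_of E)) p) => //.
  by apply/polyOverP => i; rewrite coef_map; apply: rpredZ (mem1v _).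
pose S : splittingFieldType F := HB.pack (subvs_of E) (FieldExt_isSplittingField.Build F (subvs_of E) ax).
by exists S.
Qed.

(* The group acts on the right. *)
Record galois_extension (K : fieldType) := GaloisExtension {
  gfield :> fieldType;
  gbase : {rmorphism K -> gfield};
  ggroup : finGroupType;
  gact : ggroup -> {rmorphism gfield -> gfield};
  gactM : forall g h x, gact (g * h)%g x = gact h (gact g x);
  gact1 : forall x, gact 1%g x = x;
  gact_base : forall g a, gact g (gbase a) = gbase a;
  gact_fixed : forall x, (forall g, gact g x = x) -> exists a, x = gbase a }.

Arguments gbase {K} _.
Arguments ggroup {K} _.
Arguments gact {K} _ _.

Lemma exists_galois (K : fieldType) (ps : seq {poly K}) : all (@separable_poly K) ps ->
  exists S : galois_extension K, forall p, p \in ps -> splits (map_poly (gbase S) p).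
Proof.
move=> sep; pose P := \prod_(p <- ps) p.
have nz p : p \in ps -> p != 0.
  move=> /(allP sep); apply: contraTneq => ->.
  by rewrite unlock deriv0 /coprimep gcd0p size_poly0.
have P0 : P != 0 by rewrite prodf_seq_neq0; apply/allP => p /nz.
have [L [zs PE gen]] := exists_splitting_field P0.
have galL : galois 1%AS {:L}%AS.
  apply/and3P; split; first exact: sub1v.
    have -> : {:L}%AS = <<1%AS & zs>>%AS by apply: val_inj; rewrite /= gen.
    apply: separable_Fadjoin_seq; apply/allP => z zzs.
    have : root (map_poly (in_alg L) P) z by rewrite (eqp_root PE) root_prod_XsubC.
    rewrite rmorph_prod -(big_map (map_poly (in_alg L)) xpredT id) -[root _ _]negbK root_bigmul -has_predC.
    move=> /hasP[_ /mapP[p pps ->] /=]; rewrite negbK => rz.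
    apply/separable_elementP; exists (map_poly (in_alg L) p); split=> //.
      by apply/polyOverP => i; rewrite coef_map; apply: rpredZ (mem1v _).
    by rewrite separable_map; apply: (allP sep).
  apply/splitting_normalField; first exact: sub1v.
  exists (map_poly (in_alg L) P); last by exists zs.
  by apply/polyOverP => i; rewrite coef_map; apply: rpredZ (mem1v _).
have actP (g : subg_of 'Gal({:L}%AS / 1%AS)) : kHom 1%AS {:L}%AS (gal_repr (sgval g)).
  by rewrite -gal_kHom ?sub1v // subgP.
have actM (g : subg_of 'Gal({:L}%AS / 1%AS)) : monoid_morphism (gal_repr (sgval g) : L -> L).
  by apply/kHom_monoid_morphism; apply: actP.
pose act (g : subg_of 'Gal({:L}%AS / 1%AS)) : {rmorphism L -> L} :=
  mk_rmorphism (linearB (gal_repr (sgval g))) (actM g).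
have actb g a : act g (in_alg L a) = in_alg L a.
  by have /kHomP_tmp[h _] := actP g; apply: h; apply: rpredZ (mem1v _).
have actMg g h x : act (g * h)%g x = act h (act g x) by rewrite /= galM ?memvf.
have act1g x : act 1%g x = x by rewrite /= gal_id.
have fix1 x : (forall g, act g x = x) -> exists a, x = in_alg L a.
  move=> xfix; have : x \in fixedField 'Gal({:L}%AS / 1%AS)%g.
    apply/fixedFieldP; first exact: memvf.
    by move=> g gG; have := xfix (subg _ g); rewrite /= subgK.
  by have /galois_fixedField E := galL; rewrite E => /vlineP[a ->]; exists a.
exists (GaloisExtension actMg act1g actb fix1) => p pps.
have : map_poly (in_alg L) p %| \prod_(z <- zs) ('X - z%:P).
  by rewrite -(eqp_dvdr _ PE) dvdp_map /P (big_rem p) //= dvdp_mulr.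
by move=> /dvdp_prod_XsubC[m pE]; exists (mask m zs).
Qed.

Module Export Subring.
Section SubringType.
Variables (L : fieldType) (O : set L) (hO : is_subring O).

Definition subring_mem of is_subring O : {pred L} := [pred x | `[< O x >]].

Lemma subring_memP : subring_closed (subring_mem hO).
Proof.
split=> [|x y /asboolP Ox /asboolP Oy|x y /asboolP Ox /asboolP Oy]; apply/asboolP.
- exact: isr1.
- exact: isrB.
- exact: isrM.
Qed.
HB.instance Definition _ := GRing.isSubringClosed.Build L (subring_mem hO) subring_memP.

Definition subring_of : Type := {x : L | x \in subring_mem hO}.
HB.instance Definition _ := SubType.on subring_of.
HB.instance Definition _ := Choice.on subring_of.
HB.instance Definition _ := [SubChoice_isSubComNzRing of subring_of by <:].

Definition subring_val (x : subring_of) : L := val x.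
HB.instance Definition _ := GRing.RMorphism.copy subring_val (val : subring_of -> L).

Lemma subring_valP (x : subring_of) : O (subring_val x).
Proof. by case: x => x xO; apply/asboolP. Qed.

Lemma subring_ex x : O x -> exists y : subring_of, subring_val y = x.
Proof. by move=> /asboolP Ox; exists (exist _ x Ox). Qed.

Lemma subring_val_inj : injective subring_val.
Proof. exact: val_inj. Qed.

Lemma subring_lift (A : pzRingType) (g : {rmorphism A -> L}) :
  (forall a, O (g a)) -> exists h : {rmorphism A -> subring_of}, forall a, subring_val (h a) = g a.
Proof.
move=> gO; have /choice[h hE] : forall a, exists x, subring_val x = g a.
  by move=> a; apply: subring_ex.
have hB : zmod_morphism h.
  by move=> a b; apply: subring_val_inj; rewrite [RHS](rmorphB (subring_val : {rmorphism _ -> _})) /= !hE; apply: rmorphB.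
have hM : monoid_morphism h.
  split=> [|a b]; apply: subring_val_inj; first by rewrite [RHS]rmorph1 hE rmorph1.
  by rewrite [RHS](rmorphM (subring_val : {rmorphism _ -> _})) /= !hE; apply: rmorphM.
by exists (mk_rmorphism hB hM).
Qed.

End SubringType.
End Subring.

Section IntegralClosure.
Variables (R : comNzRingType) (S : fieldType) (f : {rmorphism R -> S}).

Definition integral_set : set S := [set x | integralOver f x].

Lemma integral_set_subring : is_subring integral_set.
Proof.
by split; [exact: integral1|exact: integral_sub|exact: integral_mul].
Qed.

Definition integrals := subring_of integral_set_subring.
HB.instance Definition _ := GRing.ComNzRing.on integrals.
Definition ival : {rmorphism integrals -> S} := @subring_val S integral_set integral_set_subring.

Lemma ival_inj : injective ival.
Proof. exact: subring_val_inj. Qed.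

Lemma ival_ex x : integralOver f x -> exists y, ival y = x.
Proof. exact: (@subring_ex _ _ integral_set_subring). Qed.

Lemma integral_base : exists fI : {rmorphism R -> integrals}, forall r, ival (fI r) = f r.
Proof.
apply: (@subring_lift _ _ integral_set_subring R f) => r; exact: integral_id.
Qed.

Lemma integral_automorphism (g : {rmorphism S -> S}) : (forall r, g (f r) = f r) ->
  exists gI : {rmorphism integrals -> integrals}, forall x, ival (gI x) = g (ival x).
Proof.
move=> gf; pose g' : {rmorphism integrals -> S} := g \o ival.
apply: (@subring_lift _ _ integral_set_subring integrals g') => x.
have [p mp px] := subring_valP (x : subring_of integral_set_subring); exists p => //.
have -> : map_poly f p = map_poly g (map_poly f p).
  by rewrite -map_poly_comp; apply: eq_map_poly => r /=; rewrite gf.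
exact: rmorph_root.
Qed.

Section Place.
Variables (k : closedFieldType) (ev : {rmorphism R -> k}) (kR : {rmorphism k -> R}) (w : R).
Hypotheses (evk : forall c, ev (kR c) = c) (evw : ev w = 0).
Hypotheses (kerw : forall r, ev r = 0 -> exists r', r = r' * w).
Hypothesis nw : ~ integralOver f (f w)^-1.

(** As 1/w is not integral, w is not a unit of the integral closure and lies in a maximal ideal,
    which contains the kernel of [ev]. Modulo it a monic relation of x has coefficients in k and
    splits, so that x is congruent to a constant. *)
Lemma exists_place : exists phi : {rmorphism integrals -> k},
  forall x r, ival x = f r -> phi x = ev r.
Proof.
have [fI fIE] := integral_base.
have fw0 : f w != 0.
  by apply: contra_notN nw => /eqP ->; rewrite invr0; apply: integral0.
have [||M [mM wM]] := @maximal_above _ (principal (fI w : integrals)).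
- exact: principal_ideal.
- move=> [x /(congr1 ival)]; rewrite rmorphM rmorph1 fIE => E; apply: nw.
  have -> : (f w)^-1 = ival x by apply: (mulIf fw0); rewrite mulVf // -E mulrC.
  exact: (subring_valP (x : subring_of integral_set_subring)).
have hM := mM.1; have iM := prime_ideal_ideal hM; case: (hM) => M0 MD MM M1 Mp.
have Mw r : ev r = 0 -> M (fI r).
  by move=> /kerw[r' ->]; rewrite rmorphM; apply: wM; exists (fI r'); rewrite mulrC.
pose kI : {rmorphism k -> integrals} := fI \o kR.
have rc (x : integrals) : exists c, M (x - kI c).
  have [p mp /rootP px] := subring_valP (x : subring_of integral_set_subring).
  have [cs QE] := closed_field_poly_normal (map_poly ev p).
  have {}QE : map_poly ev p = \prod_(c <- cs) ('X - c%:P).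
    by rewrite QE (monicP (monic_map ev mp)) scale1r.
  have px0 : (map_poly fI p).[x] = 0.
    apply: ival_inj; rewrite rmorph0 -horner_map -map_poly_comp /=.
    by rewrite -[RHS]px; congr _.[_]; apply: eq_map_poly => r /=; rewrite fIE.
  have : M (\prod_(c <- cs) (x - kI c)).
    have -> : \prod_(c <- cs) (x - kI c) = (map_poly fI (map_poly kR (map_poly ev p) - p)).[x].
      rewrite rmorphB hornerD hornerN px0 subr0 QE !rmorph_prod horner_prod.
      by apply: eq_bigr => c _; rewrite !rmorphB /= !map_polyX !map_polyC hornerXsubC.
    rewrite horner_coef; elim/big_ind: _ => // i _; rewrite mulrC; apply: MM.
    by rewrite coef_map; apply: Mw; rewrite coefB rmorphB !coef_map /= evk subrr.
  elim: cs {QE} => [|c cs IH]; first by rewrite big_nil => /M1.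
  by rewrite big_cons => /Mp[h|/IH//]; exists c.
have [phi [phiM phik]] := residue_morphism hM rc; exists phi => x r xr.
have -> : x = fI r by apply: ival_inj; rewrite fIE.
have /phiM : M (fI (r - kR (ev r))) by apply: Mw; rewrite rmorphB evk subrr.
by rewrite rmorphB rmorphB /= -[fI (kR _)]/(kI _) phik => /eqP; rewrite subr_eq0 => /eqP.
Qed.

End Place.
End IntegralClosure.

Lemma closed_nonroot (k : closedFieldType) (P : {poly k}) : P != 0 -> exists x, P.[x] != 0.
Proof.
(* A root x of PX + 1 satisfies P(x)x = -1, hence is not a root of P. *)
move=> P0; have sz : size (P * 'X + 1%:P) != 1%N.
  rewrite size_polyDl size_mulX ?eqSS ?size_poly_eq0 // size_polyC.
  by rewrite oner_neq0 ltnS size_poly_gt0.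
have /closed_rootP[x /rootP] := sz; rewrite !hornerE => E; exists x.
by apply: contra_eq_neq E => ->; rewrite mul0r add0r oner_neq0.
Qed.

Lemma unity_root_prime (R : idomainType) l (z : R) : prime l -> z ^+ l = 1 -> z != 1 ->
  l.-primitive_root z.
Proof.
move=> pl zl z1; have [m mz ml] := prim_order_exists (prime_gt0 pl) zl.
have /primeP[_ /(_ m ml)] := pl; case/orP => /eqP mE; rewrite mE in mz; last by [].
by move: z1; rewrite -[z]expr1 (prim_expr_order mz) eqxx.
Qed.

Lemma exists_unity_root (k : closedFieldType) l : prime l -> l%:R != 0 :> k ->
  exists z : k, z ^+ l = 1 /\ z != 1.
Proof.
move=> pl l0; have l1 := prime_gt1 pl; pose P : {poly k} := \poly_(i < l) 1.
have /closed_rootP[z /rootP] : size P != 1%N.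
  by rewrite size_poly_eq ?oner_neq0 // gtn_eqF.
rewrite horner_poly; under eq_bigr => i _ do rewrite mul1r.
move=> E; exists z; split; first by apply/eqP; rewrite -subr_eq0 subrX1 E mulr0.
apply: contra_neq l0 => z1; rewrite -E z1 (eq_bigr (fun=> 1)) => [|i _]; last exact: expr1n.
by rewrite sumr_const card_ord.
Qed.

Lemma primitive_neq0 (R : nzRingType) l (z : R) : l.-primitive_root z -> z != 0.
Proof.
move=> pz; apply/eqP => z0; have := prim_expr_order pz.
by rewrite z0 expr0n gtn_eqF ?(prim_order_gt0 pz) // => /esym/eqP; rewrite oner_eq0.
Qed.

Lemma mulmod_inj l i i' j : prime l -> (j < l)%N -> (0 < j)%N -> (i < l)%N -> (i' < l)%N ->
  i * j = i' * j %[mod l] -> i = i'.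
Proof.
move=> pl jl j0; wlog ii : i i' / (i <= i')%N.
  move=> H il i'l E; have [/H|/ltnW/H h] := leqP i i'; first exact.
  by apply/esym/h.
move=> il i'l /eqP; rewrite eq_sym eqn_mod_dvd ?leq_mul2r ?ii ?orbT // -mulnBl.
rewrite Gauss_dvdl; last by rewrite prime_coprime // gtnNdvd.
rewrite -subn_eq0 in ii *; have [E|E] := posnP (i' - i).
  by move=> _; apply/eqP; rewrite eqn_leq -!subn_eq0 ii E.
by move=> /(dvdn_leq E); rewrite leqNgt (leq_ltn_trans (leq_subr _ _)).
Qed.

Section Inertia.
Variables (k : closedFieldType) (K : fieldType) (kK : {rmorphism k -> K}) (w : K).
Hypothesis tw : ~ algebraicOver kK w.
Variables (d : nat) (b : 'I_d -> K).
Hypothesis sb : spans (fraction_val (evalp kK w)) b.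
Variables (l s : nat).
Hypotheses (pl : prime l) (l0 : l%:R != 0 :> k) (ld : (d < l)%N) (s0 : (0 < s)%N).
Variable G : galois_extension K.
Local Notation n := (l + s)%N.
Local Notation F := (map_poly (gbase G) (trinomial n s w^-1)).
Hypothesis spF : splits F.
Variable u : G.
Hypothesis ul : u ^+ l = gbase G w^-1.

Variable f : {rmorphism {poly k} -> G}.
Hypothesis fE : forall P, f P = gbase G (evalp kK w P).
Let f_X : f 'X = gbase G w. Proof. by rewrite fE evalpX. Qed.
Let f_C c : f c%:P = gbase G (kK c). Proof. by rewrite fE evalpC. Qed.

Let w0 : w != 0.
Proof. by apply: contra_notN tw => /eqP ->; rewrite -(rmorph0 kK); apply: algebraic_id. Qed.

Let lg0 : (0 < l)%N := prime_gt0 pl.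

Let nXV : ~ integralOver f (f 'X)^-1.
Proof.
have fi : injective f by move=> p q; rewrite !fE => /fmorph_inj/(evalp_inj tw).
rewrite -[_^-1]mul1r -(rmorph1 f).
move=> /(integral_fraction_dvdp_exp fi)[|m]; first by rewrite polyX_eq0.
by rewrite expr1n dvdp1 size_polyX.
Qed.

Lemma infinite_place : exists phi : {rmorphism integrals f -> k},
  forall x r, ival f x = f r -> phi x = r.[0].
Proof.
pose ev : {rmorphism {poly k} -> k} := horner_eval (0 : k).
have evE P : ev P = P.[0] by [].
have [c|r|phi phiP] := @exists_place _ _ f k ev polyC 'X _ _ nXV.
- by rewrite evE hornerC.
- rewrite evE; elim/poly_ind: r => [|r c _]; first by exists 0; rewrite mul0r.
  by rewrite hornerMXaddC mulr0 add0r => ->; exists r; rewrite addr0.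
- by exists phi.
Qed.

Section Phi.
Variable phi : {rmorphism integrals f -> k}.
Hypothesis phiE : forall x r, ival f x = f r -> phi x = r.[0].
Local Notation iv := (ival f).

Let u0 : u != 0.
Proof.
apply: contra_eq_neq ul => ->.
by rewrite expr0n gtn_eqF // eq_sym fmorph_eq0 invr_eq0.
Qed.
Let v : G := u^-1.
Let v0 : v != 0. Proof. by rewrite invr_eq0. Qed.
Let vl : v ^+ l = gbase G w. Proof. by rewrite exprVn ul fmorphV invrK. Qed.

Let exV : exists V, iv V = v.
Proof.
apply: ival_ex; exists ('X^l - 'X%:P); first by rewrite monicXnsubC.
rewrite rmorphB /= map_polyXn map_polyC /= f_X -vl.
by rewrite /root !hornerE subrr.
Qed.

Let phiV V : iv V = v -> phi V = 0.
Proof.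
move=> VE; apply/eqP; suff : phi (V ^+ l) == 0 by rewrite rmorphXn expf_eq0 lg0.
have -> : phi (V ^+ l) = ('X : {poly k}).[0] by apply: phiE; rewrite rmorphXn /= VE vl f_X.
by rewrite hornerX.
Qed.

(* Otherwise the powers [a ^ i], [i < l], whose valuations are distinct modulo those of [k(w)],
   would be independent over [k(w)]. *)
Lemma no_fractional_valuation (a : K) p j : (0 < j < l)%N ->
  gbase G a = iv p * v ^+ j -> phi p = 0.
Proof.
move=> /andP[j0 jl] aE; apply: contrapT => /eqP p0.
suff : (l <= d)%N by rewrite leqNgt ld.
apply: (indep_le sb (u := fun i : 'I_l => a ^+ i)).
apply: indep_fraction => h h0 i0; apply: contrapT => /eqP hi0.
have [V VE] := exV; have [fI fIE] := integral_base f.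
have /choice[mh mhP] : forall i : 'I_l, exists mh : nat * {poly k},
    h i = mh.2 * 'X^(mh.1) /\ (h i != 0 -> mh.2.[0] != 0).
  move=> i; have [hi|hi] := eqVneq (h i) 0.
    by exists (0%N, 0); split=> [|/eqP//]; rewrite mul0r.
  have [m [c [cE [i1 c0]]]] := @primitive_family _ 1 (fun=> h i) ord0 hi.
  exists (m, c ord0); split=> [|_]; first exact: cE ord0.
  by rewrite /= horner_coef0; move: c0; rewrite (ord1 i1).
(* The exponent of [v] in the i-th term, since w = v^l and a^i contributes v^(ij). For 0 < j < l
   these exponents are distinct modulo l, so that after division by the least power of [v] a single
   term survives under [phi]. *)
pose e (i : 'I_l) := (l * (mh i).1 + i * j)%N.
case: (@arg_minnP _ i0 (fun i => h i != 0) e hi0) => i1 hi1 mn.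
have mhi i : h i != 0 -> i != i1 -> (e i1 < e i)%N.
  move=> hi; rewrite ltn_neqAle mn // andbT; apply: contra_neq => E; apply: val_inj.
  apply: (mulmod_inj pl jl j0 (ltn_ord i) (ltn_ord i1)).
  move/(congr1 (modn^~ l)): E; rewrite /e ![(l * _)%N]mulnC !modnMDl.
  by move=> ->.
pose T (i : 'I_l) m := fI (mh i).2 * p ^+ i * V ^+ m.
have T0 i m : h i = 0 -> T i m = 0.
  have [-> _] := mhP i => /eqP; rewrite mulf_eq0 expf_eq0 polyX_eq0 andbF orbF => /eqP mi.
  by rewrite /T mi rmorph0 !mul0r.
have sumT : \sum_i T i (e i) = 0.
  apply: (@ival_inj _ _ f); rewrite rmorph0 rmorph_sum.
  transitivity (gbase G (\sum_i evalp kK w (h i) * a ^+ i)); last by rewrite h0 rmorph0.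
  rewrite rmorph_sum; apply: eq_bigr => i _; have [hE _] := mhP i.
  have -> : evalp kK w (h i) = evalp kK w (mh i).2 * w ^+ (mh i).1.
    by rewrite {1}hE rmorphM rmorphXn /= evalpX.
  rewrite [RHS]rmorphM [gbase G (a ^+ i)]rmorphXn aE [gbase G (_ * _)]rmorphM.
  rewrite [gbase G (w ^+ _)]rmorphXn /= -fE -vl.
  rewrite /T !rmorphM !rmorphXn /= fIE VE /e exprD !exprM exprMn -!exprM [(j * i)%N]mulnC.
  by ring.
have sumT' : \sum_i T i (e i - e i1)%N = 0.
  apply: (@ival_inj _ _ f); apply: (mulIf (expf_neq0 (e i1) v0)).
  rewrite rmorph0 mul0r -[RHS](rmorph0 iv) -[in RHS]sumT -VE -rmorphXn -rmorphM.
  congr (iv _); rewrite mulr_suml; apply: eq_bigr => i _.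
  have [hi|hi] := eqVneq (h i) 0; first by rewrite !T0 // mul0r.
  by rewrite /T -mulrA -exprD subnK // mn.
have := congr1 phi sumT'; rewrite rmorph_sum rmorph0 (bigD1 i1) //= big1 ?addr0 => [|i ii1].
  rewrite /T subnn expr0 mulr1 rmorphM rmorphXn => /eqP; rewrite mulf_eq0 expf_eq0 (negPf p0) andbF orbF.
  rewrite (phiE (r := (mh i1).2)) ?fIE //.
  by have [_ /(_ hi1)/negPf ->] := mhP i1.
have [hi|hi] := eqVneq (h i) 0; first by rewrite T0 // rmorph0.
by rewrite /T rmorphM [phi (V ^+ _)]rmorphXn (phiV VE) expr0n subn_eq0 leqNgt mhi // mulr0.
Qed.

Let cI : exists c : {rmorphism k -> integrals f}, forall x, iv (c x) = gbase G (kK x).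
Proof.
have [fI fIE] := integral_base f; exists (fI \o polyC) => x /=.
by rewrite fIE f_C.
Qed.

Let unity x : x ^+ l = 1 -> exists2 z, x = gbase G (kK z) & z ^+ l = 1.
Proof.
move=> xl; have [z1 [z1l z1n]] := exists_unity_root pl l0.
have pz := unity_root_prime pl z1l z1n.
have pg : l.-primitive_root (gbase G (kK z1)) by rewrite !fmorph_primitive_root.
have [i ->] := prim_rootP pg xl; exists (z1 ^+ i); first by rewrite !rmorphXn.
by rewrite exprAC z1l expr1n.
Qed.

Let ratio g : exists2 z, gact G g u = gbase G (kK z) * u & z ^+ l = 1.
Proof.
have [|z zE zl] := @unity (gact G g u / u).
  by rewrite expr_div_n -rmorphXn ul gact_base divff // fmorph_eq0 invr_eq0.
by exists z => //; rewrite -zE divfK.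
Qed.

Let generator : exists sg z, [/\ gact G sg u = gbase G (kK z) * u & l.-primitive_root z].
Proof.
have [[sg su]|nu] := pselect (exists sg, gact G sg u != u).
  have [z zE zl] := ratio sg; exists sg, z; split=> //.
  apply: unity_root_prime => //; apply: contra_neq su => z1.
  by rewrite zE z1 !rmorph1 mul1r.
(* If the group fixes [u], then [u] lies in K and 1/u = v contradicts [no_fractional_valuation] with
   p = 1 and j = 1. *)
have [g|a uE] := @gact_fixed _ G u.
  by apply: contrapT => /eqP gu; apply: nu; exists g.
have := @no_fractional_valuation a^-1 1 1; rewrite (prime_gt1 pl) rmorph1 => /(_ isT).
by rewrite fmorphV -uE rmorph1 mul1r => /(_ erefl)/eqP; rewrite oner_eq0.
Qed.

Section Generator.
Variables (sg : ggroup G) (z : k).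
Hypotheses (sgu : gact G sg u = gbase G (kK z) * u) (pz : l.-primitive_root z).
Variable c : {rmorphism k -> integrals f}.
Hypothesis cE : forall x, iv (c x) = gbase G (kK x).
Variable gI : ggroup G -> {rmorphism integrals f -> integrals f}.
Hypothesis gIE : forall g x, iv (gI g x) = gact G g (iv x).

Let phic x : phi (c x) = x.
Proof. by rewrite (phiE (r := x%:P)) ?hornerC // cE f_C. Qed.

Let gIc g x : gI g (c x) = c x.
Proof. by apply: (@ival_inj _ _ f); rewrite gIE cE gact_base. Qed.

Let gIM g h x : gI (g * h)%g x = gI h (gI g x).
Proof. by apply: (@ival_inj _ _ f); rewrite !gIE gactM. Qed.

Let sgXu i : gact G (sg ^+ i)%g u = gbase G (kK (z ^+ i)) * u.
Proof.
elim: i => [|i IH]; first by rewrite expg0 gact1 expr0 !rmorph1 mul1r.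
by rewrite expgSr gactM IH rmorphM gact_base sgu mulrA -!rmorphM -exprSr.
Qed.

Let power g : exists e, gact G g u = gact G (sg ^+ e)%g u.
Proof.
have [x xE xl] := ratio g; have [i iE] := prim_rootP pz xl.
by exists i; rewrite sgXu -iE.
Qed.

(** [A] is l^-1 times the sum of its Lagrange resolvents [q j], the eigenvectors of [sg] for z^j.
    The product of [q j] and v^j is invariant, hence in K, so that for 0 < j < l the residue of
    [q j] vanishes by [no_fractional_valuation]; only the fixed part [q 0] counts. *)
Lemma residue_inertia A : (forall h, gact G h u = u -> gI h A = A) ->
  phi (gI sg A) = phi A.
Proof.
move=> fixA.
have same g h : gact G g u = gact G h u -> gI g A = gI h A.
  move=> gh; rewrite -[g](mulgKV h) gIM fixA //.
  by rewrite gactM gh -gactM mulgV gact1.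
pose T (j i : nat) := c (z ^- (i * j)) * gI (sg ^+ i)%g A.
pose q j := \sum_(i < l) T j i.
have zz : z != 0 by apply: (primitive_neq0 pz).
have sq j : gI sg (q j) = c (z ^+ j) * q j.
  have Tl : T j l = T j 0%N.
    rewrite /T mul0n expr0 exprM (prim_expr_order pz) expr1n expg0; congr (_ * _).
    by apply: same; rewrite sgXu (prim_expr_order pz) gact1 !rmorph1 mul1r.
  have shift : \sum_(i < l) T j i.+1 = q j.
    apply: (addrI (T j 0%N)); rewrite -(big_ord_recl l (fun i : 'I_l.+1 => T j i)).
    by rewrite big_ord_recr /= Tl addrC.
  rewrite -[in RHS]shift rmorph_sum mulr_sumr; apply: eq_bigr => i _.
  rewrite rmorphM gIc -gIM -expgSr /T mulrA -rmorphM; congr (c _ * _).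
  by rewrite mulSn exprD invfM mulrA mulfV ?mul1r // expf_neq0.
have sqX j e : gI (sg ^+ e)%g (q j) = c (z ^+ (j * e)) * q j.
  elim: e => [|e IH].
    by rewrite muln0 expr0 rmorph1 mul1r; apply: (@ival_inj _ _ f); rewrite gIE expg0 gact1.
  by rewrite expgSr gIM IH rmorphM gIc sq mulrA -rmorphM -exprD mulnS addnC.
have gq j g e : gact G g u = gact G (sg ^+ e)%g u -> gI g (q j) = c (z ^+ (j * e)) * q j.
  move=> ge; rewrite -sqX !rmorph_sum; apply: eq_bigr => i _.
  rewrite !rmorphM !gIc; congr (_ * _); rewrite -!gIM; apply: same.
  by rewrite !gactM sgXu !rmorphM !gact_base ge.
have q0 j : (0 < j < l)%N -> phi (q j) = 0.
  move=> jl; have [g|a aE] := @gact_fixed _ G (iv (q j) * v ^+ j).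
    have [e gE] := power g.
    have gv : gact G g v = (gbase G (kK (z ^+ e)))^-1 * v by rewrite /v fmorphV gE sgXu invfM.
    have zE : gbase G (kK (z ^+ (j * e))) * (gbase G (kK (z ^+ e)))^-1 ^+ j = 1.
      by rewrite mulnC exprM !rmorphXn exprVn mulfV // !expf_neq0 // !fmorph_eq0.
    by rewrite rmorphM -gIE (gq _ _ _ gE) rmorphM cE [gact G g (v ^+ j)]rmorphXn gv exprMn mulrACA zE mul1r.
  exact: no_fractional_valuation jl (esym aE).
have sumq : \sum_(j < l) q j = A *+ l.
  rewrite /q exchange_big /= (bigD1 (Ordinal lg0)) //= [X in _ + X]big1 ?addr0.
    rewrite (eq_bigr (fun=> A)) ?sumr_const ?card_ord // => j _.
    by rewrite /T mul0n expr0 invr1 rmorph1 mul1r; apply: (@ival_inj _ _ f); rewrite gIE expg0 gact1.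
  move=> i i0; rewrite /T -mulr_suml -rmorph_sum.
  have -> : \sum_(j < l) z ^- (i * j) = 0; last by rewrite rmorph0 mul0r.
  have zi : z ^- i != 1.
    rewrite invr_eq1 -[1](expr0 z) (eq_prim_root_expr pz) mod0n modn_small //.
  apply: (mulfI (_ : z ^- i - 1 != 0)); first by rewrite subr_eq0.
  rewrite mulr0 (eq_bigr (fun j : 'I_l => (z ^- i) ^+ j)) => [|j _]; last by rewrite exprM exprVn.
  by rewrite -subrX1 exprVn -exprM mulnC exprM (prim_expr_order pz) expr1n invr1 subrr.
have : \sum_(j < l) phi (gI sg (q j)) = \sum_(j < l) phi (q j).
  apply: eq_bigr => j _; rewrite sq rmorphM phic.
  have [->|j0] := posnP j; first by rewrite expr0 mul1r.
  by rewrite q0 ?j0 ?ltn_ord // mulr0.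
have -> : \sum_(j < l) phi (q j) = phi A *+ l by rewrite -(rmorph_sum phi) sumq (rmorphMn phi).
have -> : \sum_(j < l) phi (gI sg (q j)) = phi (gI sg A) *+ l.
  by rewrite -(rmorph_sum phi) -(rmorph_sum (gI sg)) sumq (rmorphMn (gI sg)) (rmorphMn phi).
by rewrite -[LHS]mulr_natl -[RHS]mulr_natl => /(mulfI l0).
Qed.

(** Places above the same place of K(u) are conjugate under the stabilizer of [u]. For a combination
    zz of the [Y i] with coefficients x^i, the product of the X - g(zz) over the stabilizer has
    coefficients fixed by it, to which [residue_inertia] applies. Hence the residue of sg(zz) is
    that of some g(zz), and for a general x this forces equality on each [Y i]. *)
Lemma inertia_lift (m : nat) (Y : 'I_m -> integrals f) :
  exists g, gact G g u = u /\ forall i, phi (gI sg (Y i)) = phi (gI g (Y i)).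
Proof.
apply: contrapT => ng.
pose D g := \poly_(i < m) oapp (fun i => phi (gI sg (Y i)) - phi (gI g (Y i))) 0 (insub i).
have D0 g : gact G g u == u -> D g != 0.
  move=> /eqP gu; apply: contra_notN ng => /eqP D0; exists g; split=> // i.
  have := congr1 (fun P : {poly k} => P`_i) D0; rewrite coef0 coef_poly ltn_ord valK /= => /eqP.
  by rewrite subr_eq0 => /eqP.
have [x] : exists x, (\prod_(g | gact G g u == u) D g).[x] != 0.
  by apply: closed_nonroot; apply/prodf_neq0.
rewrite horner_prod => /prodf_neq0 Dx.
pose zz := \sum_(i < m) c (x ^+ i) * Y i.
have Dz g : (D g).[x] = phi (gI sg zz) - phi (gI g zz).
  rewrite horner_poly !rmorph_sum -sumrB; apply: eq_bigr => i _.
  by rewrite valK /= mulrC !rmorphM !gIc !phic mulrBr.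
pose N := \prod_(g | gact G g u == u) ('X - (gI g zz)%:P).
have Nfix h : gact G h u = u -> map_poly (gI h) N = N.
  move=> hu; rewrite [RHS](reindex_inj (mulIg h)) rmorph_prod.
  rewrite [RHS](eq_bigl (fun g => gact G g u == u)) => [|g]; last first.
    by rewrite gactM -{2}hu (inj_eq (fmorph_inj _)).
  by apply: eq_bigr => g _; rewrite rmorphB /= map_polyX map_polyC /= -gIM.
have NE : map_poly phi (map_poly (gI sg) N) = map_poly phi N.
  apply/polyP => i; rewrite !coef_map; apply: residue_inertia => h /Nfix E.
  by rewrite -[in RHS]E coef_map.
have : root (map_poly phi (map_poly (gI sg) N)) (phi (gI sg zz)).
  rewrite /N (bigD1 1%g) /= ?gact1 // !rmorphM rootM; apply/orP; left.
  rewrite !rmorphB /= !map_polyX !map_polyC /= root_XsubC; apply/eqP.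
  by congr (phi (gI sg _)); apply: (@ival_inj _ _ f); rewrite gIE gact1.
rewrite NE rmorph_prod /root horner_prod => /prodf_eq0[g gu].
rewrite rmorphB /= map_polyX map_polyC hornerXsubC /= => /eqP E.
by have := Dx g gu; rewrite Dz E eqxx.
Qed.

End Generator.

(* Conjugate in this way, an automorphism of [S] that multiplies [u] by a root of unity acts on the residues
   of the [y / u], [y] a root, as the multiplication by a root of unity. *)
Lemma inertia_cycle_phi : exists g y, root F y /\
  forall j, gact G (g ^+ j)%g y = y -> (l %| j)%N.
Proof.
have [sg [z [sgu pz]]] := generator; have [c cE] := cI.
have /choice[gI gIE] : forall g, exists h : {rmorphism integrals f -> integrals f},
    forall x, iv (h x) = gact G g (iv x).
  by move=> g; apply: integral_automorphism => r; rewrite fE gact_base.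
have [ys ysE] := spF; have [V VE] := exV.
have FE : F = \prod_(y <- ys) ('X - y%:P).
  apply/eqP; rewrite -eqp_monic ?monic_prod_XsubC //.
  by apply: monic_map; apply: trinomial_monic => //; rewrite addnC -[X in (X < _)%N]addn0 ltn_add2l.
have FxE (x : G) : F.[x] = x ^+ n - gbase G w^-1 * x ^+ s + 1.
  by rewrite map_trinomial /trinomial !hornerE.
have tv : gbase G w^-1 * v ^+ l = 1 by rewrite vl -rmorphM mulVf // rmorph1.
have exY y : root F y -> exists Y, iv Y = y * v.
  move=> /rootP; rewrite FxE => Fy; have [fI fIE] := integral_base f.
  apply: ival_ex.
  pose q : {poly G} := 'X^n - 'X^s + (v ^+ n)%:P.
  have qy : root q (y * v).
    rewrite /root /q !hornerE; apply/eqP.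
    transitivity (v ^+ n * (y ^+ n - gbase G w^-1 * y ^+ s + 1)); last by rewrite Fy mulr0.
    rewrite !exprMn [v ^+ n]exprD; transitivity (y ^+ n * (v ^+ l * v ^+ s) - (gbase G w^-1 * v ^+ l) * (y ^+ s * v ^+ s) + v ^+ l * v ^+ s); last by ring.
    by rewrite tv; ring.
  have intv i : integralOver f (v ^+ i).
    by rewrite -VE -rmorphXn; apply: (@subring_valP _ _ (integral_set_subring f)).
  apply: (integral_root_monic _ qy).
    rewrite /q -addrA monicE lead_coefDl ?lead_coefXn // size_polyXn ltnS.
    apply: leq_trans (size_polyD _ _) _; rewrite geq_max size_polyN size_polyXn size_polyC.
    by rewrite -[X in (X < _)%N]add0n ltn_add2r lg0 (leq_trans (leq_b1 _)) // addn_gt0 lg0.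
  apply/integral_poly => i; rewrite /q !coefE; apply: integral_add; last first.
    by case: eqP => _; [exact: intv|exact: integral0].
  by apply: integral_sub; exact: integral_nat.
have /choice[psi psiE] : forall y, exists x, root F y -> forall Y, iv Y = y * v -> phi Y = x.
  move=> y; have [[Y YE]|nY] := pselect (exists Y, iv Y = y * v).
    by exists (phi Y) => _ Y' Y'E; congr (phi _); apply: (@ival_inj _ _ f); rewrite YE.
  by exists 0 => _ Y YE; case: nY; exists Y.
have rootg g y : root F y -> root F (gact G g y).
  move=> Fy; have -> : F = map_poly (gact G g) F.
    by rewrite -map_poly_comp; apply: eq_map_poly => x /=; rewrite gact_base.
  exact: rmorph_root.
have rootys i : root F (tnth (in_tuple ys) i) by rewrite FE root_prod_XsubC mem_tnth.
have /choice[Y YE] : forall i, exists Y, iv Y = tnth (in_tuple ys) i * v.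
  by move=> i; apply: exY.
(* The product of the 1 - y v over all roots y is the value v^n at 1 of the equation of the y v. It
   vanishes at the place, so that some y v has residue 1. *)
have [y0 y0F y01] : exists2 y0, root F y0 & psi y0 = 1.
  have : \prod_i (1 - Y i) = V ^+ n.
    apply: (@ival_inj _ _ f); rewrite rmorph_prod rmorphXn /= VE.
    transitivity (v ^+ n * F.[u]).
      have sy : size ys = n.
        have := size_prod_XsubC ys id; rewrite -FE size_map_poly size_trinomial //; first by case.
        by rewrite -[X in (X < _)%N]add0n ltn_add2r.
      rewrite FE horner_prod (big_nth 0) big_mkord -{1}sy -[v ^+ _]/(v ^+ size ys).
      have -> : v ^+ size ys = \prod_(i < size ys) v by rewrite prodr_const card_ord.
      rewrite -big_split; apply: eq_bigr => i _ /=.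
      rewrite rmorphB rmorph1 YE hornerXsubC (tnth_nth 0) /= mulrBr mulVf //.
      by rewrite [ys`_i * v]mulrC.
    rewrite FxE mulrDr mulrBr mulr1 -!exprMn mulVf // expr1n.
    have -> : v ^+ n * (gbase G w^-1 * u ^+ s) = (gbase G w^-1 * v ^+ l) * (v * u) ^+ s.
      by rewrite exprD exprMn; ring.
    by rewrite tv mul1r mulVf // expr1n subrr add0r.
  move=> /(congr1 phi)/eqP; rewrite rmorph_prod rmorphXn (phiV VE) expr0n addn_eq0.
  rewrite (gtn_eqF lg0) /= => /prodf_eq0[i _].
  rewrite rmorphB rmorph1 subr_eq0 => /eqP E; exists (tnth (in_tuple ys) i) => //.
  by rewrite E; apply/esym/psiE.
have [g [gu gY]] := inertia_lift sgu pz cE gIE Y.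
(* [gY] is applied to the root g^-1 y: [g] fixes [v], whereas [sg] divides it by z. *)
have key y : root F y -> psi (gact G (g^-1 * sg)%g y) = z * psi y.
  move=> Fy; pose y' := gact G g^-1%g y.
  have y'F : root F y' by apply: rootg.
  have [i y'E] : exists i, y' = tnth (in_tuple ys) i.
    by apply/tnthP; rewrite -root_prod_XsubC -FE.
  have [Yy YyE] := exY _ Fy; have [Yr YrE] := exY _ (rootg (g^-1 * sg)%g _ Fy).
  rewrite -(psiE _ Fy _ YyE) -(psiE _ (rootg _ _ Fy) _ YrE).
  have zz : z != 0 by apply: (primitive_neq0 pz).
  have e1 : gI g (Y i) = Yy.
    apply: (@ival_inj _ _ f); rewrite gIE YE -y'E YyE rmorphM fmorphV gu.
    by rewrite /y' -gactM mulVg gact1.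
  have e2 : gI sg (Y i) = c z^-1 * Yr.
    apply: (@ival_inj _ _ f); rewrite gIE YE -y'E rmorphM fmorphV sgu rmorphM cE YrE.
    by rewrite invfM !fmorphV gactM mulrCA.
  have := gY i; rewrite e1 e2 rmorphM => <-.
  have -> : phi (c z^-1) = z^-1 by rewrite (phiE (r := (z^-1)%:P)) ?hornerC // cE f_C.
  by rewrite mulrA mulfV // mul1r.
exists (g^-1 * sg)%g, y0; split=> // j E.
have it i : psi (gact G ((g^-1 * sg) ^+ i)%g y0) = z ^+ i.
  elim: i => [|i IH]; first by rewrite expg0 gact1 expr0.
  by rewrite expgSr gactM key ?IH ?exprS //; apply: rootg.
have := it j; rewrite E y01 => /esym/eqP.
by rewrite -(prim_order_dvd pz).
Qed.

End Phi.

Lemma inertia_cycle : exists g y, root F y /\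
  forall j, gact G (g ^+ j)%g y = y -> (l %| j)%N.
Proof. by have [phi phiE] := infinite_place; apply: inertia_cycle_phi phiE. Qed.

End Inertia.

(** * Multiple transitivity from a cycle of prime length *)

Lemma prime_dvd_fact l m : prime l -> (l %| m`!)%N -> (l <= m)%N.
Proof.
move=> pl; elim: m => [|m IH]; first by rewrite fact0 dvdn1 => /eqP E; rewrite E in pl.
rewrite factS Euclid_dvdM // => /orP[/dvdn_leq|/IH/leqW //]; exact.
Qed.

Section PrimeCycle.
Import fintype finset.
Local Open Scope group_scope.
Local Open Scope set_scope.
Variables (T : finType) (l : nat).
Hypothesis pl : prime l.
Implicit Types (H : {group {perm T}}) (S : {set T}).

Let lg1 : (1 < l)%N := prime_gt1 pl.

Lemma orbit_prime (g : {perm T}) y : #[g] = l -> g y != y -> #|orbit 'P <[g]> y| = l.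
Proof.
move=> gl gy; have := dvdn_orbit 'P <[g]> y; rewrite -orderE gl.
have /primeP[_ h] := pl => /h /orP[/eqP|/eqP//].
move/eqP/cards1P => [x E]; case/eqP: gy.
have : y \in orbit 'P <[g]> y by apply: orbit_refl.
have : g y \in orbit 'P <[g]> y by apply/orbitP; exists g; rewrite ?cycle_id.
by rewrite E !inE => /eqP -> /eqP ->.
Qed.

Section TwoTransitive.
Variables (H : {group {perm T}}) (S : {set T}) (s : nat).
Hypotheses (trH : [transitive H, on S | 'P]) (cS : #|S| = (l + s)%N) (s0 : (0 < s)%N) (sl : (s < l)%N).
Hypothesis cyc : exists g, [/\ g \in H, #[g] = l & exists2 y, y \in S & g y != y].

Let actH : [acts H, on S | 'P] := atrans_acts trH.

Let imS g y : g \in H -> y \in S -> g y \in S.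
Proof. by move=> gH yS; have := acts_act actH gH y; rewrite /= apermE yS. Qed.

Let orbS (A : {group {perm T}}) y : A \subset H -> y \in S -> orbit 'P A y \subset S.
Proof.
move=> AH yS; apply/subsetP => _ /orbitP[g gA <-]; rewrite /= apermE.
by apply: imS => //; apply: (subsetP AH).
Qed.

Let moved g := [set y in S | g y != y].

Let movedE g y : g \in H -> #[g] = l -> y \in S -> g y != y -> moved g = orbit 'P <[g]> y.
Proof.
move=> gH gl yS gy; have gs : <[g]> \subset H by rewrite cycle_subG.
apply/eqP; rewrite eq_sym finset.eqEsubset; apply/andP; split; apply/subsetP => z.
  move=> zo; rewrite inE (subsetP (orbS gs yS)) //=.
  apply: contraNneq gy => gz; have /orbitP[h hg yE] : y \in orbit 'P <[g]> z by rewrite orbit_sym.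
  rewrite -yE /= apermE; have /cycleP[i ->] := hg.
  by rewrite -permM -expgSr expgS permM gz.
rewrite inE => /andP[zS gz]; apply: contraT => nz.
have dis : orbit 'P <[g]> y :&: orbit 'P <[g]> z = finset.set0.
  apply/finset.setP => x; rewrite finset.in_setI finset.in_set0; apply/negP => /andP[xy xz]; case/negP: nz.
  by move/orbit_eqP: xy => xy; move/orbit_eqP: xz => xz; apply/orbit_eqP; rewrite -xz.
have : (l + l <= l + s)%N; last by rewrite leq_add2l leqNgt sl.
rewrite -{1}(orbit_prime gl gy) -{1}(orbit_prime gl gz) -cS.
rewrite -cardsUI dis cards0 addn0; apply: subset_leq_card.
by rewrite finset.subUset !orbS.
Qed.

Let Fix a := [set g in H | (#[g] == l) && (g a == a)].

Let FixJ h a : h \in H -> Fix (h a) = Fix a :^ h.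
Proof.
move=> hH; apply/setP => g; rewrite mem_conjg !inE groupJr ?groupV // orderJ.
congr [&& _, _ & _]; rewrite -(inj_eq (@perm_inj _ h^-1)) permK.
by rewrite conjgE invgK !permM.
Qed.

Let trans a b : a \in S -> b \in S -> exists2 h, h \in H & b = h a.
Proof. by move=> aS bS; have [h hH ->] := atransP2 trH aS bS; exists h. Qed.

Let fixing a : a \in S -> exists2 g, g \in Fix a & exists2 y, y \in S & g y != y.
Proof.
move=> aS; have [g [gH gl [y yS gy]]] := cyc.
have [b bS gb] : exists2 b, b \in S & g b = b.
  apply: contrapT => nb; have : moved g = S.
    apply/setP => b; rewrite inE; case bS: (b \in S) => //=.
    by apply/negP => /eqP gb; apply: nb; exists b.
  move=> /(congr1 (fun A : {set T} => #|A|)); rewrite (movedE gH gl yS gy) (orbit_prime gl gy) cS.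
  by rewrite -[LHS]addn0 => /addnI E; move: s0; rewrite -E.
have [h hH aE] := trans bS aS; exists (g ^ h).
  by rewrite aE FixJ // memJ_conjg inE gH gl eqxx gb eqxx.
exists (h y); first exact: imS.
by rewrite conjgE !permM permK (inj_eq perm_inj).
Qed.

Let cl a := [set b in S | Fix b == Fix a].

Let cl_card h a : h \in H -> a \in S -> #|cl (h a)| = #|cl a|.
Proof.
move=> hH aS; rewrite -(card_imset (cl a) (@perm_inj _ h)); congr #|pred_of_set _|.
apply/setP => b; apply/idP/imsetP => [|[c + ->]].
  rewrite inE => /andP[bS /eqP E]; exists (h^-1 b); last by rewrite permKV.
  rewrite inE imS ?groupV //=; apply/eqP.
  by rewrite FixJ ?groupV // E FixJ // -conjsgM mulgV conjsg1.
by rewrite !inE => /andP[cS' /eqP E]; rewrite imS //= !FixJ // E.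
Qed.

(** The classes have equal cardinality by transitivity. The l points moved by an element of order l
    form a union of classes, so that this cardinality divides l; a class is also contained in the
    fixed points of such an element, which number s < l. *)
Let cl1 a : a \in S -> #|cl a| = 1%N.
Proof.
move=> aS; have [g ga [y yS gy]] := fixing aS.
move: (ga); rewrite inE => /and3P[gH /eqP gl /eqP gaa].
have cls : (#|cl a| <= s)%N.
  have : cl a \subset S :\: moved g.
    apply/subsetP => b; rewrite !inE => /andP[bS /eqP E]; rewrite bS /= andbT negbK.
    by move: ga; rewrite -E inE => /and3P[].
  move=> /subset_leq_card/leq_trans; apply; rewrite cardsD (finset.setIidPr _); last first.
    by apply/subsetP => b; rewrite inE => /andP[].
  by rewrite (movedE gH gl yS gy) (orbit_prime gl gy) cS addKn.
have : (#|cl a| %| l)%N.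
  rewrite -(orbit_prime gl gy) -(movedE gH gl yS gy).
  pose R b c := Fix c == Fix b.
  have eR : {in moved g & &, equivalence_rel R}.
    by move=> b c e _ _ _; rewrite /R eqxx; split=> // /eqP ->.
  rewrite (card_uniform_partition _ (equivalence_partitionP eR) (n := #|cl a|)) ?dvdn_mull //.
  move=> A /imsetP[b]; rewrite inE => /andP[bS gb] ->.
  have [h hH bE] := trans aS bS; rewrite -(cl_card hH aS) -bE; congr #|pred_of_set _|.
  apply/finset.setP => c; rewrite !inE /R; case cS': (c \in S) => //=.
  apply: andb_idl => /eqP E; apply: contraNneq gb => gc.
  have : g \in Fix c by rewrite inE gH gl eqxx gc eqxx.
  by rewrite E inE => /and3P[].
have /primeP[_ h] := pl => /h /orP[/eqP//|/eqP E].
by rewrite E leqNgt sl in cls.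
Qed.

Let moving a b : a \in S -> b \in S -> a != b ->
  exists g, [/\ g \in H, #[g] = l, g a = a & g b != b].
Proof.
move=> aS bS ab; have nsub : ~~ (Fix a \subset Fix b).
  apply: contraNN ab => sub; have [h hH bE] := trans aS bS.
  have E : Fix b = Fix a.
    by apply/esym/eqP; rewrite eqEcard sub bE FixJ // cardJg leqnn.
  have /eqP/cards1P[x xE] := cl1 aS.
  have : a \in cl a by rewrite inE aS eqxx.
  have : b \in cl a by rewrite inE bS E eqxx.
  by rewrite xE !inE => /eqP -> /eqP ->.
have [g] := subsetPn nsub; rewrite !inE => /and3P[gH /eqP gl /eqP ga].
by rewrite gH gl eqxx /= => gb; exists g.
Qed.

(** By [moving], for each other point some element of order l fixes [x] and moves that point. Every
    orbit of the stabilizer on the rest thus has at least l elements, and the rest has l + s - 1 <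
    2l. *)
Lemma stab_transitive x : x \in S ->
  [transitive 'C_H[x | 'P], on S :\ x | 'P] /\
  exists g, [/\ g \in 'C_H[x | 'P], #[g] = l & exists2 y, y \in S :\ x & g y != y].
Proof.
move=> xS; have stab g : g \in H -> g x = x -> g \in 'C_H[x | 'P].
  by move=> gH gx; rewrite inE gH /=; apply/astab1P; rewrite /= apermE.
have CH : 'C_H[x | 'P] \subset H by apply: subsetIl.
split; last first.
  have [g + [y yS gy]] := fixing xS; rewrite inE => /and3P[gH /eqP gl /eqP gx].
  exists g; split=> //; first exact: stab.
  by exists y; rewrite // !inE yS andbT; apply: contraNneq gy => ->; rewrite gx.
have orb b : b \in S :\ x -> orbit 'P 'C_H[x | 'P] b \subset S :\ x.
  rewrite !inE => /andP[bx bS]; apply/subsetP => c cb.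
  rewrite !inE (subsetP (orbS CH bS)) // andbT.
  move: cb => /orbitP[g]; rewrite inE => /andP[gH /astab1P gx] <- /=.
  by rewrite apermE -[X in _ != X]gx /= apermE (inj_eq perm_inj).
have big b : b \in S :\ x -> (l <= #|orbit 'P 'C_H[x | 'P] b|)%N.
  rewrite !inE => /andP[bx bS]; have [|g [gH gl gx gb]] := moving xS bS; first by rewrite eq_sym.
  rewrite -(orbit_prime gl gb); apply: subset_leq_card.
  apply/subsetP => c /orbitP[h /cycleP[i ->] <-]; apply/orbitP.
  by exists (g ^+ i) => //; rewrite groupX // stab.
have [y yS] : exists y, y \in S :\ x.
  apply/set0Pn; rewrite -card_gt0; have := cardsD1 x S; rewrite xS cS add1n.
  by move=> E; rewrite -ltnS -E (leq_trans lg1) ?leq_addr.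
apply/imsetP; exists y => //; apply/eqP; rewrite eq_sym finset.eqEsubset orb //=.
apply/subsetP => z zS; apply: contraT => nz.
have dis : orbit 'P 'C_H[x | 'P] y :&: orbit 'P 'C_H[x | 'P] z = finset.set0.
  apply/finset.setP => c; rewrite finset.in_setI finset.in_set0; apply/negP => /andP[cy cz]; case/negP: nz.
  by move/orbit_eqP: cy => cy; move/orbit_eqP: cz => cz; apply/orbit_eqP; rewrite -cz.
have : (l + l <= #|S :\ x|)%N.
  apply: leq_trans (leq_add (big _ yS) (big _ zS)) _.
  rewrite -cardsUI dis cards0 addn0; apply: subset_leq_card.
  by rewrite finset.subUset !orb.
have := cardsD1 x S; rewrite xS cS add1n => E.
by rewrite -ltnS -E ltn_add2l ltnNge ltnW.
Qed.

End TwoTransitive.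

Lemma prime_cycle_transitive s H S : [transitive H, on S | 'P] -> #|S| = (l + s)%N -> (s < l)%N ->
  (exists g, [/\ g \in H, #[g] = l & exists2 y, y \in S & g y != y]) ->
  [transitive^s.+1 H, on S | 'P].
Proof.
elim: s H S => [|s IH] H S trH cS sl cyc;
  (have [x xS] : exists x, x \in S by apply/set0Pn; rewrite -card_gt0 cS addn_gt0 (prime_gt0 pl)).
  exact: (stab_ntransitiveI xS trH (ntransitive0 _ _ _)).
have [trC cycC] := stab_transitive trH cS isT sl cyc xS.
apply: (stab_ntransitiveI xS trH); apply: IH trC _ (ltnW sl) cycC.
by have := cardsD1 x S; rewrite xS cS add1n addnS => -[].
Qed.

End PrimeCycle.

Section NormalSubgroup.
Import fintype finset.
Local Open Scope group_scope.
Local Open Scope set_scope.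

(** For the stabilizer C of a point, the index of CN in G divides both #|S| and the index of N,
    hence is 1, and G = CN means that N is transitive. *)
Lemma normal_transitive (T : finType) (G N : {group {perm T}}) (S : {set T}) :
  [transitive G, on S | 'P] -> N <| G -> coprime #|S| #|G : N| -> [transitive N, on S | 'P].
Proof.
move=> trG nNG co; have /imsetP[x xS SE] := trG.
have CG : 'C_G[x | 'P] \subset G by apply: subsetIl.
apply/(subgroup_transitiveP xS (normal_sub nNG) trG).
have nC : 'C_G[x | 'P] \subset 'N(N) := subset_trans CG (normal_norm nNG).
have JG : 'C_G[x | 'P] <*> N \subset G by rewrite join_subG CG normal_sub.
have i1 : (#|G : 'C_G[x | 'P] <*> N| %| #|G : N|)%N.
  by rewrite -(Lagrange_index JG (joing_subr _ _)) dvdn_mulr.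
have i2 : (#|G : 'C_G[x | 'P] <*> N| %| #|S|)%N.
  by rewrite SE card_orbit -(Lagrange_index JG (joing_subl _ _)) dvdn_mulr.
have : (#|G : 'C_G[x | 'P] <*> N| %| 1)%N.
  by have /eqP <- := co; rewrite dvdn_gcd i1 i2.
rewrite dvdn1 indexg_eq1 => GJ; rewrite -norm_joinEl //.
by apply/eqP; rewrite finset.eqEsubset JG.
Qed.

(** The image in the permutations of [T] of the kernel of [aW] is a normal subgroup of index
    dividing #|W|!. As this is prime to #|T| the subgroup stays transitive, and as it is prime to l
    its order is still divisible by l. Cauchy's theorem then gives the element of order l needed for
    multiple transitivity. *)
Lemma transitive_kernel (gT : finGroupType) (T W : finType) (aT : gT -> {perm T})
    (aW : gT -> {perm W}) l s :
  {morph aT : g h / g * h} -> {morph aW : g h / g * h} ->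
  prime l -> #|T| = (l + s)%N -> (s < l)%N -> (#|W| < l)%N -> coprime (l + s) (#|W|)`! ->
  (forall x y, exists g, aT g x = y) ->
  (exists g y, forall j, aT (g ^+ j) y = y -> (l %| j)%N) ->
  forall m (e e' : 'I_m -> T), (m <= s.+1)%N -> injective e -> injective e' ->
  exists g, aW g = 1 /\ forall i, aT g (e i) = e' i.
Proof.
move=> mT mW pl cT sl Wl co trT [g0 [y0 g0P]] m e e' ms ie ie'.
have mT' : {in [set: gT] &, {morph aT : g h / g * h}} by move=> g h _ _; apply: mT.
have mW' : {in [set: gT] &, {morph aW : g h / g * h}} by move=> g h _ _; apply: mW.
pose fT := Morphism mT'; pose fW := Morphism mW'.
pose G := [group of fT @* [set: gT]]; pose N := [group of fT @* ('ker fW)].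
have nNG : N <| G by apply: morphim_normal; apply: ker_normal.
have iGN : (#|G : N| %| (#|W|)`!)%N.
  apply: dvdn_trans (_ : #|[set: gT] : 'ker fW| %| _)%N.
    by apply: index_morphim; apply: finset.subsetT.
  have -> : #|[set: gT] : 'ker fW| = #|fW @* [set: gT]| by rewrite card_morphim finset.setIT.
  by rewrite -card_Sym cardSg // finset.subsetT.
have trG : [transitive G, on [set: T] | 'P].
  apply/imsetP; exists y0; first by rewrite inE.
  apply/setP => y; rewrite inE; apply/esym/orbitP.
  have [g gy] := trT y0 y; exists (aT g); last by rewrite /= apermE.
  by apply: (mem_morphim fT); rewrite inE.
have trN : [transitive N, on [set: T] | 'P].
  by apply: normal_transitive trG nNG _; rewrite cardsT cT (coprime_dvdr iGN).
have lG : (l %| #|G|)%N.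
  have g0G : aT g0 \in G by apply: (mem_morphim fT); rewrite inE.
  apply: dvdn_trans (order_dvdG g0G); apply: g0P.
  have -> : aT (g0 ^+ #[aT g0]) = aT g0 ^+ #[aT g0] by rewrite -[aT]/(fT : _ -> _) morphX ?inE.
  by rewrite expg_order perm1.
have lN : (l %| #|N|)%N.
  move: lG; rewrite -(Lagrange (normal_sub nNG)) Euclid_dvdM // => /orP[//|li].
  by have := prime_dvd_fact pl (dvdn_trans li iGN); rewrite leqNgt Wl.
have [g gN gl] := Cauchy pl lN.
have cyc : exists g, [/\ g \in N, #[g] = l & exists2 y, y \in [set: T] & g y != y].
  exists g; split=> //; apply: contrapT => ng.
  have g1 : g = 1.
    apply/permP => y; rewrite perm1; apply/eqP; apply: contraT => gy.
    by exfalso; apply: ng; exists y.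
  by move: gl; rewrite g1 order1 => l1; rewrite -l1 in pl.
have cT' : #|[set: T]| = (l + s)%N by rewrite cardsT.
have tr := prime_cycle_transitive pl trN cT' sl cyc.
have {}tr := ntransitive_weak ms tr.
have dt (f : 'I_m -> T) : injective f -> [tuple f i | i < m] \in dtuple_on m [set: T].
  move=> fi; rewrite inE /= map_inj_uniq ?enum_uniq //.
  by apply/subsetP => z _; rewrite inE.
have [h hN hE] := atransP2 tr (dt e ie) (dt e' ie').
have [g1 g1T g1K hE'] := morphimP hN.
exists g1; split; first by apply/(mker (f := fW)).
move=> i; have := congr1 (fun t : m.-tuple T => tnth t i) hE.
by rewrite /= /n_act tnth_map !tnth_mktuple hE' => ->.
Qed.

End NormalSubgroup.

(** * The trinomial cover *)

Section OpenImmersion.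
Variables (X C : scheme) (j : scheme_morphism C X).
Hypothesis hj : open_immersion j.
Variables (F : fun_field X) (g : C).
Hypothesis jg : j g = gpt F.

Let ji : injective j. Proof. by case: hj. Qed.

Definition image_open (V : opens C) : opens X := Opens (let: And3 _ o _ := hj in o V).
Local Notation im := image_open.
Implicit Types V W : opens C.

Let im_preim V : mpreim j (im V) `<=` V.
Proof. by move=> x [y Vy /ji <-]. Qed.
Let preim_im V : V `<=` mpreim j (im V).
Proof. by move=> x Vx; exists x. Qed.
Let imS V W : W `<=` V -> im W `<=` im V.
Proof. by move=> h _ [y Wy <-]; exists y => //; apply: h. Qed.
Let im_gpt V : V g -> im V (gpt F).
Proof. by move=> Vg; exists g. Qed.

Let pullI V : {rmorphism sec (im V) -> sec V} := res (@preim_im V) \o pull j (im V).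

Let bij V : bijective (pull j (im V)).
Proof. by case: hj => _ _ h; apply: h => _ [y _ <-]; exists y. Qed.

Let res_back V (a : sec (mpreim j (im V))) : res (@im_preim V) (res (@preim_im V) a) = a.
Proof. by rewrite (res_res _ _ (@subset_refl _ _)) res_id. Qed.
Let res_forth V (a : sec V) : res (@preim_im V) (res (@im_preim V) a) = a.
Proof. by rewrite (res_res _ _ (@subset_refl _ _)) res_id. Qed.

Let pullI_inj V : injective (pullI V).
Proof.
move=> a b /= /(congr1 (res (@im_preim V))); rewrite !res_back.
exact: bij_inj (bij V) _ _.
Qed.

Let lift_ex V (s : sec V) : exists s', pullI V s' = s.
Proof.
have [inv invK Kinv] := bij V; exists (inv (res (@im_preim V) s)).
by rewrite /= Kinv res_forth.
Qed.

Let pullI_res V W (h : W `<=` V) s : pullI W (res (imS h) s) = res h (pullI V s).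
Proof.
rewrite /= pull_res (res_res _ _ (subset_trans (@preim_im W) (opens_preimS (@mcont _ _ j) (imS h)))).
by rewrite (res_res _ _ (subset_trans h (@preim_im V))); apply: res_irr.
Qed.

Lemma open_germ : exists germC : forall V, V g -> {rmorphism sec V -> F},
  [/\ (forall V W (h : W `<=` V) (hV : V g) (hW : W g) s, germC W hW (res h s) = germC V hV s),
      (forall V (hV : V g) s, germC V hV s = 0 -> s = 0) &
      (forall x q, (exists V (hV : V g) (s : sec V), V x /\ q = germC V hV s) <->
         local_ring F (j x) q)].
Proof.
have liftP V : {lift : {rmorphism sec V -> sec (im V)} | forall s, pullI V (lift s) = s}.
  apply: cid; have /choice[lift liftE] := @lift_ex V.
  have lB : zmod_morphism lift by move=> a b; apply: pullI_inj; rewrite rmorphB !liftE.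
  have lM : monoid_morphism lift.
    by split=> [|a b]; apply: pullI_inj; rewrite ?rmorph1 ?rmorphM !liftE.
  by exists (mk_rmorphism lB lM).
pose lift V := sval (liftP V).
have liftE V : forall s, pullI V (lift V s) = s := svalP (liftP V).
exists (fun V (hV : V g) => germ F (im V) (im_gpt hV) \o lift V); split.
- move=> V W h hV hW s /=.
  rewrite -(germ_res (imS h) (im_gpt hV) (im_gpt hW)); congr (germ F _ _ _).
  by apply: pullI_inj; rewrite pullI_res !liftE.
- move=> V hV s /= /germ_inj E; rewrite -(liftE V s) E; exact: rmorph0.
- move=> x q; split=> [[V [hV [s [Vx ->]]]]|[V [hV [s [Vx ->]]]]].
    by exists (im V), (im_gpt hV), (lift V s); split=> //; exists x.
  have hVg : mpreim j V g by rewrite /mpreim /opens_preim /in_opens /= jg.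
  exists (mpreim j V), hVg, (pull j V s); split=> //=.
  have h : im (mpreim j V) `<=` V by move=> _ [y Vy <-].
  rewrite -(germ_res h hV (im_gpt hVg)); congr (germ F _ _ _).
  apply: pullI_inj; rewrite liftE /= pull_res.
  by rewrite (res_res _ _ (@subset_refl _ _)) res_id.
Qed.

End OpenImmersion.

(* A transcendental [ct] that is regular at every point exists because a point of the
   projective curve has been removed. *)
Record curve (k : closedFieldType) (C : scheme) := Curve {
  cfield :> fun_field C;
  cconst : {rmorphism k -> cfield};
  cpi : C -> cfield;
  curve_dvrP : forall x, x <> gpt cfield -> dvr cconst (local_ring cfield x) (cpi x);
  curve_finite : forall z, ~ algebraicOver cconst z -> exists ys : seq cfield,
    forall y, subring_gen (range (fraction_val (evalp cconst z)) `|` [set` ys]) y;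
  curve_generic : forall q, local_ring cfield (gpt cfield) q;
  ct : cfield;
  ct_transcendental : ~ algebraicOver cconst ct;
  ct_regular : forall x, local_ring cfield x ct }.

(** [C] keeps the function field of [X], the generic point not being removed since it is not closed.
    The poles of [t] are confined to one point [s] of [Sigma]. *)
Lemma open_curve (k : closedFieldType) (X : kscheme k) (hX : smooth_connected_projective_curve X)
    (Sigma : set X) (hne : Sigma !=set0) (hcl : forall x : X, Sigma x -> closed_point x)
    (C : scheme) (j : scheme_morphism C X) (hj : open_immersion j) (hC : range j = ~` Sigma) :
  exists D : curve k C, forall c, closed_point c -> c <> gpt D.
Proof.
have [smX connX prX dimX] := hX.
have [F hF] := exists_fun_field smX connX dimX.
have noiso := @no_isolated_point _ _ smX connX dimX.
have ji : injective j by case: hj.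
have openim (W : opens C) : open (j @` W) by case: hj.
have closed_gpt (x : X) : closed [set x] -> x <> gpt F.
  move=> cx xg; apply: (@curve_not_point _ _ dimX x); apply/seteqP; split=> // y _.
  apply: contrapT => yx; have oC : open (~` [set x]) by rewrite openC.
  have := gptP F (Opens oC) y; rewrite /in_opens /= -xg => /(_ yx); exact.
have [g jg] : exists g, j g = gpt F.
  have : (~` Sigma) (gpt F) by move=> /hcl/closed_gpt.
  by rewrite -hC => -[g _ jg]; exists g.
have [gC [gC_res gC_inj gC_loc]] := open_germ hj jg.
have gP (V : opens C) x : V x -> V g.
  move=> Vx; have := gptP F (image_open hj V) (j x); case=> [|y Vy]; first by exists x.
  by rewrite -jg => /ji <-.
pose FC : fun_field C := @FunField C F g gP gC gC_res gC_inj.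
have locE x q : local_ring FC x q <-> local_ring F (j x) q by apply: gC_loc.
have two : exists y, y <> g.
  apply: contrapT => no; apply: (noiso (gpt F)).
  suff -> : [set gpt F] = j @` (opens_full C) by apply: openim.
  apply/seteqP; split=> [_ ->|_ [y _ <-]]; first by exists g.
  by rewrite -jg; congr (j _); apply: contrapT => yg; apply: no; exists y.
have closed_g c : closed_point c -> c <> g.
  move=> cc cg; have [y yg] := two.
  have oC : open (~` [set c]) by rewrite openC.
  have := gP (Opens oC) y; rewrite /in_opens /= -cg => h.
  by apply: h => // yc; apply: yg; rewrite yc.
have [s Ss] := hne; have sg := closed_gpt _ (hcl _ Ss).
pose I := {x : X | x != gpt F}.
have Ig (i : I) : val i <> gpt F by apply/eqP; case: i.
have /choice[pi piP] : forall x : X, exists p, x <> gpt F -> dvr (ff_const F) (local_ring F x) p.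
  move=> x; have [xg|xg] := pselect (x = gpt F); first by exists 0.
  by have [p hp] := curve_dvr smX connX dimX hF xg; exists p.
have fin := function_field_finite smX dimX hF.
have sI : s != gpt F by apply/eqP.
have [||//|t [tt treg]] := @regular_away k F (ff_const F) I (fun i => local_ring F (val i)) (fun i => pi (val i)) _ _ _ (exist _ s sI).
- by move=> i; apply/piP/Ig.
- move=> x y xy; apply: curve_separated => //; try exact: Ig.
  by apply/eqP.
have treg' x : x <> g -> local_ring FC x t.
  move=> xg; apply/locE.
  have jxg : j x != gpt F by apply/eqP; rewrite -jg => /ji.
  apply: (treg (exist _ (j x) jxg)); apply/eqP => /(congr1 val) /= E.
  have : range j (j x) by exists x.
  by rewrite hC E.
have tregC x : local_ring FC x t.
  have [xg|] := pselect (x = g); last exact: treg'.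
  have [y yg] := two; have [V [hV [q [Vy qE]]]] := treg' y yg.
  by rewrite xg; exists V, hV, q.
have dvrC x : x <> gpt FC -> dvr (ff_const F) (local_ring FC x) (pi (j x)).
  move=> xg; have -> : local_ring FC x = local_ring F (j x).
    by apply/seteqP; split=> q /locE.
  by apply: piP; rewrite -jg => /ji.
have gen q : local_ring FC (gpt FC) q.
  apply/locE; rewrite /= jg.
  have [U [Ug saU]] := smooth_affine_nbhd smX (gpt F); have [aU _ _] := saU.
  have [zero frac] := hF U saU Ug; have [a [b [b0 ->]]] := frac q.
  apply/(local_ringP Ug _ aU Ug); exists a, b; split=> //.
  by apply: contrapT => /zero b00; rewrite b00 rmorph0 eqxx in b0.
by exists (@Curve k C FC (ff_const F) (fun x => pi (j x)) dvrC fin gen t tt tregC).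
Qed.

(** * Subsheaves of a constant sheaf on an irreducible space *)

Module Export ConstantSections.
Section ConstantSheaf.
Variables (T : topologicalType) (g : T) (L : fieldType) (O : T -> set L).
Hypothesis gP : forall (U : opens T) x, U x -> U g.
Implicit Types U V W : opens T.

(** A section is an element of [L] that belongs to [O e] at each point. It is encoded as a constant
    function on U, so that the sections over the empty set form the zero ring. *)
Definition csec_mem (_ : forall e, is_subring (O e)) (U : opens T) : {pred ({e : T | U e} -> L)} :=
  [pred s | `[< (forall e e', s e = s e') /\ forall e, O (sval e) (s e) >]].

Hypothesis subO : forall e, is_subring (O e).

Lemma csec_memP U : subring_closed (csec_mem subO (U := U)).
Proof.
split=> [|s t /asboolP[sc sO] /asboolP[tc tO]|s t /asboolP[sc sO] /asboolP[tc tO]]; apply/asboolP.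
- by split=> // e; apply: isr1 (subO _).
- split=> [e e'|e]; last by apply: isrB; [exact: subO|exact: sO|exact: tO].
  by change (s e - t e = s e' - t e'); rewrite (sc e e') (tc e e').
- split=> [e e'|e]; last by apply: isrM; [exact: subO|exact: sO|exact: tO].
  by change (s e * t e = s e' * t e'); rewrite (sc e e') (tc e e').
Qed.

HB.instance Definition _ U := GRing.isSubringClosed.Build _ (csec_mem subO (U := U)) (@csec_memP U).

Definition csec (U : opens T) : Type := {s : {e : T | U e} -> L | s \in csec_mem subO (U := U)}.
HB.instance Definition _ U := SubType.on (csec U).
HB.instance Definition _ U := Choice.on (csec U).
HB.instance Definition _ U := GRing.SubChoice_isSubComPzRing.Build _ _ (csec U) (GRing.subringClosedP _).

Definition cfun U (s : csec U) : {e : T | U e} -> L := val s.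

Lemma csec_inj U (s t : csec U) : (forall e, cfun s e = cfun t e) -> s = t.
Proof. by move=> st; apply: val_inj; apply: functional_extensionality_dep. Qed.

Lemma csecP U (s : csec U) : (forall e e', cfun s e = cfun s e') /\ forall e, O (sval e) (cfun s e).
Proof. by case: s => s sP; apply/asboolP. Qed.

Lemma csec_ex (U : opens T) (f : {e : T | U e} -> L) : (forall e e', f e = f e') -> (forall e, O (sval e) (f e)) ->
  exists s : csec U, forall e, cfun s e = f e.
Proof.
move=> fc fO; have fP : f \in csec_mem subO (U := U) by apply/asboolP.
by exists (exist _ f fP).
Qed.

Lemma cfun_irr U (s : csec U) e e' : cfun s e = cfun s e'.
Proof. by have [h _] := csecP s. Qed.

Section Res.
Variables (U V : opens T) (h : V `<=` U).

Let inc (e : {e : T | V e}) : {e : T | U e} := exist _ (sval e) (h (svalP e)).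

Let cres_mem (s : csec U) : (fun e => cfun s (inc e)) \in csec_mem subO (U := V).
Proof. by have [sc sO] := csecP s; apply/asboolP; split=> [e e'|e]; [apply: sc|exact: (sO (inc e))]. Qed.

Definition cres_fun (s : csec U) : csec V :=
  exist (fun s => s \in csec_mem subO (U := V)) _ (cres_mem s).

Let cresB : zmod_morphism cres_fun.
Proof. by move=> s t; apply: csec_inj. Qed.
Let cresM : monoid_morphism cres_fun.
Proof. by split=> [|s t]; apply: csec_inj. Qed.

Definition cres : {rmorphism csec U -> csec V} := mk_rmorphism cresB cresM.

Lemma cresE s e e' : cfun (cres s) e = cfun s e'.
Proof. exact: (cfun_irr s (inc e) e'). Qed.
End Res.

Lemma cglue (I : Type) (U : opens T) (V : I -> opens T) (hV : forall i, V i `<=` U)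
    (s : forall i, csec (V i)) :
  (forall x, U x -> exists i, V i x) ->
  (forall i j (W : opens T) (hi : W `<=` V i) (hj : W `<=` V j), cres hi (s i) = cres hj (s j)) ->
  exists! t : csec U, forall i, cres (hV i) t = s i.
Proof.
move=> cov compat.
have uniq (t t' : csec U) : (forall i, cres (hV i) t = s i) -> (forall i, cres (hV i) t' = s i) -> t = t'.
  move=> tE t'E; apply: csec_inj => -[e Ue]; have [i Ve] := cov e Ue.
  have := congr1 (fun r => cfun r (exist _ e Ve)) (etrans (tE i) (esym (t'E i))).
  move=> E; transitivity (cfun (cres (hV i) t) (exist _ e Ve)); first exact/esym/cresE.
  by rewrite E; apply: cresE.
suff [t tE] : exists t : csec U, forall i, cres (hV i) t = s i.
  by exists t; split=> // t' t'E; apply: uniq.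
have same i j (e : {e | V i e}) (e' : {e | V j e}) : cfun (s i) e = cfun (s j) e'.
  have Vi : V i g by apply: gP (svalP e).
  have Vj : V j g by apply: gP (svalP e').
  pose W := Opens (openI (osetP (V i)) (osetP (V j))).
  have hi : W `<=` V i by move=> x [].
  have hj : W `<=` V j by move=> x [].
  have Wg : W g by split.
  have := congr1 (fun r => cfun r (exist _ g Wg)) (compat i j W hi hj).
  by rewrite (cresE _ _ _ e) (cresE _ _ _ e').
have /choice[f fE] : forall e : {e | U e}, exists q, forall i (e' : {e | V i e}), cfun (s i) e' = q.
  move=> [e Ue]; have [i Ve] := cov e Ue.
  by exists (cfun (s i) (exist _ e Ve)) => j e'; apply: same.
have [e e'|e|t tE] := @csec_ex U f.
- have [i Ve] := cov _ (svalP e).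
  by rewrite -(fE e i (exist _ _ Ve)) -(fE e' i (exist _ _ Ve)).
- have [i Ve] := cov _ (svalP e); rewrite -(fE e i (exist _ _ Ve)).
  by have [_ /(_ (exist _ _ Ve))] := csecP (s i).
- by exists t => i; apply: csec_inj => e; rewrite (cresE _ _ _ (exist (fun x => U x) (sval e) (hV i _ (svalP e)))) tE -(fE _ i e).
Qed.

Lemma cres_id U (h : U `<=` U) s : cres h s = s.
Proof. by apply: csec_inj => e; apply: cresE. Qed.

Lemma cres_comp U V W (hV : V `<=` U) (hW : W `<=` V) (hWU : W `<=` U) s :
  cres hWU s = cres hW (cres hV s).
Proof.
apply: csec_inj => e; pose eU := exist (fun x => U x) (sval e) (hWU _ (svalP e)).
pose eV := exist (fun x => V x) (sval e) (hW _ (svalP e)).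
transitivity (cfun s eU); first exact: cresE.
by apply/esym; transitivity (cfun (cres hV s) eV); apply: cresE.
Qed.

Definition constant_sheaf : ringed_space := RingedSpace cres_id cres_comp cglue.

Definition cval (U : opens T) (Ug : U g) (s : csec U) : L := cfun s (exist _ g Ug).

Lemma cval_zmod U (Ug : U g) : zmod_morphism (cval Ug).
Proof. by []. Qed.
Lemma cval_monoid U (Ug : U g) : monoid_morphism (cval Ug).
Proof. by []. Qed.

Definition cgerm (U : opens T) (Ug : U g) : {rmorphism csec U -> L} :=
  mk_rmorphism (@cval_zmod U Ug) (@cval_monoid U Ug).

Lemma cgermE U (Ug : U g) s e : cgerm Ug s = cfun s e.
Proof. exact: cfun_irr. Qed.

Lemma cgerm_inj U (Ug : U g) : injective (cgerm Ug).
Proof. by move=> s t st; apply: csec_inj => e; rewrite -!(cgermE Ug). Qed.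

Lemma cgerm_res U V (h : V `<=` U) (Ug : U g) (Vg : V g) s : cgerm Vg (cres h s) = cgerm Ug s.
Proof. exact: cresE. Qed.

Lemma cgermP U (Ug : U g) s e : U e -> O e (cgerm Ug s).
Proof. by move=> Ue; rewrite (cgermE Ug s (exist _ e Ue)); have [_ /(_ (exist _ e Ue))] := csecP s. Qed.

Lemma cgerm_ex U (Ug : U g) q : (forall e, U e -> O e q) -> exists s, cgerm Ug s = q.
Proof.
move=> qO; have [//|e|s sE] := @csec_ex U (fun=> q); first exact: qO (svalP e).
by exists s; rewrite /= /cval sE.
Qed.

Hypothesis opO : forall q, open [set e | O e q].

Lemma cunit U (Ug : U g) (s : csec U) e :
  @unit_at constant_sheaf U s e <-> [/\ U e, cgerm Ug s != 0 & O e (cgerm Ug s)^-1].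
Proof.
split=> [[V [h [t [Ve E]]]]|[Ue s0 sV]].
  have Vg : V g := gP Ve.
  have E' : cgerm Ug s * cgerm Vg t = 1.
    have := congr1 (cgerm Vg) E; rewrite [RHS]rmorph1 => <-.
    by rewrite [RHS]rmorphM; congr (_ * _); apply/esym/cgerm_res.
  have s0 : cgerm Ug s != 0 by apply: contra_eq_neq E' => ->; rewrite mul0r eq_sym oner_neq0.
  split=> //; first exact: (h _ Ve).
  have -> : (cgerm Ug s)^-1 = cgerm Vg t by apply: (mulfI s0); rewrite E' divff.
  exact: cgermP.
pose V : opens T := Opens (openI (osetP U) (opO (cgerm Ug s)^-1)).
have Ve : V e by split.
have Vg : V g := gP Ve.
have h : V `<=` U by move=> x [].
have [|t tE] := @cgerm_ex V Vg (cgerm Ug s)^-1; first by move=> x [].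
exists V, h, t; split=> //; apply: (cgerm_inj (Ug := Vg)).
rewrite [RHS]rmorph1 [LHS]rmorphM tE; rewrite [X in X / _](_ : _ = cgerm Ug s) ?divff //.
exact: cgerm_res.
Qed.

End ConstantSheaf.
End ConstantSections.

Definition inv_in (K : fieldType) (O : set K) (r : K) : Prop := r != 0 /\ O r^-1.

Definition pol_in (K : fieldType) (O : set K) (p : {poly K}) : Prop := forall i, O p`_i.

Section InvIn.
Variables (K : fieldType) (O : set K).
Hypothesis sO : is_subring O.

Lemma inv_in1 : inv_in O 1.
Proof. by rewrite /inv_in oner_neq0 invr1; split=> //; apply: isr1. Qed.

Lemma inv_inM r r' : O r -> O r' -> inv_in O (r * r') <-> inv_in O r /\ inv_in O r'.
Proof.
move=> Or Or'; split=> [[]|[[r0 rV] [r'0 r'V]]].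
  rewrite mulf_eq0 negb_or => /andP[r0 r'0]; rewrite invfM => rV; split; split=> //.
    by rewrite -[r^-1](divfK r'0); apply: isrM.
  by rewrite -[r'^-1](mulfK r0) mulrAC mulrC [_ / _]mulrC; apply: isrM.
by split; [rewrite mulf_neq0|rewrite invfM; apply: isrM].
Qed.

Lemma pol_inB p q : pol_in O p -> pol_in O q -> pol_in O (p - q).
Proof. by move=> hp hq i; rewrite coefB; apply: isrB. Qed.

Lemma pol_inM p q : pol_in O p -> pol_in O q -> pol_in O (p * q).
Proof. by move=> hp hq i; rewrite coefM; apply: isr_sum => // j _; apply: isrM. Qed.

Lemma pol_inC c : O c -> pol_in O c%:P.
Proof. by move=> Oc i; rewrite coefC; case: eqP => // _; apply: isr0. Qed.

Lemma pol_in1 : pol_in O 1.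
Proof. by apply: pol_inC; apply: isr1. Qed.

Lemma pol_inX : pol_in O 'X.
Proof. by move=> i; rewrite coefX; case: eqP => _; [apply: isr1|apply: isr0]. Qed.

Lemma pol_inD p q : pol_in O p -> pol_in O q -> pol_in O (p + q).
Proof. by move=> hp hq i; rewrite coefD; apply: isrD. Qed.

Lemma pol_in_horner p r : pol_in O p -> O r -> O p.[r].
Proof.
move=> hp Or; rewrite horner_coef; apply: isr_sum => // i _.
by apply: isrM => //; apply: isrX.
Qed.

Lemma pol_in_divl F q : F \is monic -> pol_in O F -> pol_in O (F * q) -> pol_in O q.
Proof.
move=> mF hF hFq; pose n := (size F).-1.
have sF : size F = n.+1 by rewrite prednK // size_poly_gt0 monic_neq0.
have Fn : F`_n = 1 by have /monicP := mF; rewrite lead_coefE.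
suff h m i : (size q <= i + m)%N -> O q`_i by move=> i; apply: (h (size q)); rewrite leq_addl.
elim/ltn_ind: m i => m IH i im.
have [qi|iq] := leqP (size q) i; first by rewrite nth_default //; apply: isr0.
have : O (F * q)`_(i + n) := hFq _.
have nlt : (n < (i + n).+1)%N by rewrite ltnS leq_addl.
rewrite coefM (bigD1 (Ordinal nlt)) //= Fn mul1r addnK => h.
rewrite -[q`_i](addrK (\sum_(j < (i + n).+1 | j != Ordinal nlt) F`_j * q`_(i + n - j))).
apply: isrB => //; apply: isr_sum => // j; rewrite -val_eqE /= => jn.
have [jn'|nj] := ltnP j n; last first.
  by rewrite nth_default ?mul0r ?sF; [apply: isr0|rewrite ltn_neqAle eq_sym jn].
have m0 : (0 < m)%N by rewrite lt0n; apply/eqP => m0; move: im; rewrite m0 addn0 leqNgt iq.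
apply: isrM => //; apply: (IH m.-1); first by rewrite ltn_predL.
apply: leq_trans im _; rewrite -[X in (i + X <= _)%N](prednK m0) addnS -addSn leq_add2r.
by rewrite -addnBA ?(ltnW jn') // -addn1 leq_add2l subn_gt0.
Qed.

End InvIn.

Section DvrUnits.
Variables (k K : fieldType) (kK : {rmorphism k -> K}) (O : set K) (pi : K).
Hypothesis hO : dvr kK O pi.

Lemma non_inv r : O r -> ~ inv_in O r -> vge O pi 1 r.
Proof.
move=> Or nr; have [->|r0] := eqVneq r 0; first exact: vge_zero hO 1.
rewrite -[r]invrK -[1%R]subr0; apply: (vge_inv hO); first by rewrite invr_eq0.
by move=> /vge0 rV; apply: nr.
Qed.

Lemma inv_nvge r : inv_in O r -> ~ vge O pi 1 r.
Proof.
move=> [r0 rV] h; apply: (vge1_1 hO); rewrite -(divff r0) -[1%R]addr0.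
by apply: (vgeM hO) => //; apply/vge0.
Qed.

Lemma inv_inD r r' : O r -> O r' -> inv_in O (r + r') -> inv_in O r \/ inv_in O r'.
Proof.
move=> Or Or' h; apply: contrapT => /not_orP[nr nr'].
by apply: (inv_nvge h); apply: (vgeD hO); apply: non_inv.
Qed.

Lemma inv_residue r : O r -> exists c, ~ inv_in O (r - kK c).
Proof.
move=> /(dvr_res hO)[c hc]; exists c => /inv_nvge; apply.
by rewrite /vge exprN1.
Qed.

Lemma inv_const c : c != 0 -> inv_in O (kK c).
Proof. by move=> c0; split; [rewrite fmorph_eq0|rewrite -fmorphV; apply: dvr_const hO _]. Qed.

End DvrUnits.

(** * Points, local rings and topology of the cover *)

Module Export CoverPoints.
Section Points.
Variables (k : closedFieldType) (C : scheme) (D : curve k C).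
Variables (L : fieldType) (iK : {rmorphism cfield D -> L}) (y : L) (F : {poly cfield D}).
Hypotheses (mF : F \is monic) (minF : forall p, evalp iK y p = 0 -> F %| p).
Hypothesis regF : forall x, pol_in (local_ring D x) F.
Local Notation K := (cfield D).
Local Notation kK := (cconst D).
Local Notation Ox := (local_ring D).
Let sOx x : is_subring (Ox x) := local_ring_subring D x.

(* [None] is the generic point of the cover, and [Some (x, a)] the closed point over [x] where
   [y] takes the value [a]. *)
Definition epred (e : option (C * k)) : bool :=
  if e is Some p then `[< p.1 <> gpt D /\ ~ inv_in (Ox p.1) F.[kK p.2] >] else true.

Definition epoint : Type := {e : option (C * k) | epred e}.
HB.instance Definition _ := Choice.on epoint.

Definition eproj (e : epoint) : C := if sval e is Some p then p.1 else gpt D.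

Local Notation hy := (evalp iK y).

(* [b] does not vanish at [e]. *)
Definition env (e : epoint) (b : {poly K}) : Prop :=
  if sval e is Some p then inv_in (Ox p.1) b.[kK p.2] else hy b != 0.

Definition eO (e : epoint) : set L :=
  [set q | exists a b, [/\ pol_in (Ox (eproj e)) a, pol_in (Ox (eproj e)) b, env e b &
     q = hy a / hy b]].

Lemma gpt_inv r : inv_in (Ox (gpt D)) r <-> r != 0.
Proof. by split=> [[]//|r0]; split=> //; apply: curve_generic. Qed.

Section AtPoint.
Variable e : epoint.
Local Notation pol := (pol_in (Ox (eproj e))).
Let sO : is_subring (Ox (eproj e)) := sOx (eproj e).

Lemma env1 : env e 1.
Proof.
rewrite /env; case: (sval e) => [[x l]|]; last by rewrite rmorph1 oner_neq0.
by rewrite hornerC; apply: inv_in1.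
Qed.

Lemma envC c : Ox (eproj e) c -> env e c%:P <-> inv_in (Ox (eproj e)) c.
Proof.
rewrite /env /eproj; case: (sval e) => [[x l]|] /= Oc; first by rewrite hornerC.
by rewrite evalpC fmorph_eq0 gpt_inv.
Qed.

Lemma pol_horner a p : sval e = Some p -> pol a -> Ox p.1 a.[kK p.2].
Proof.
rewrite /eproj; case: e => -[[x l]|//] /= /asboolP[xg _] [<-] ha.
apply: pol_in_horner => //; exact: dvr_const (curve_dvrP xg) _.
Qed.

Lemma envM a b : pol a -> pol b -> env e (a * b) <-> env e a /\ env e b.
Proof.
move=> ha hb; rewrite /env; case E: (sval e) => [p|].
  by rewrite hornerM; apply: inv_inM; [|apply: pol_horner|apply: pol_horner].
by rewrite rmorphM mulf_eq0 negb_or; split=> [/andP[]//|[-> ->]].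
Qed.

(** Two polynomials with the same value at [y] differ by a multiple qF. As F is monic, q has regular
    coefficients, and F vanishes at the point. *)
Lemma env_hy a b : pol a -> pol b -> hy a = hy b -> env e a -> env e b.
Proof.
move=> ha hb ab; rewrite /env; case E: (sval e) => [p|]; last by rewrite ab.
have /minF/dvdpP[q qE] : hy (b - a) = 0 by rewrite rmorphB /= ab subrr.
have [xg nF] : p.1 <> gpt D /\ ~ inv_in (Ox p.1) F.[kK p.2].
  by have := svalP e; rewrite E => /asboolP.
have hO := curve_dvrP xg.
have projE : eproj e = p.1 by rewrite /eproj E.
have hq : pol_in (Ox p.1) q.
  apply: (pol_in_divl (sOx p.1) mF (regF p.1)).
  by rewrite mulrC -qE -projE; apply: pol_inB.
have Oa := pol_horner E ha; have Ob := pol_horner E hb.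
have OF : Ox p.1 F.[kK p.2] by apply: pol_in_horner => //; apply: dvr_const hO _.
have Oq : Ox p.1 q.[kK p.2] by apply: pol_in_horner => //; apply: dvr_const hO _.
have -> : a = b - q * F by rewrite -qE opprB addrCA subrr addr0.
rewrite hornerD hornerN hornerM => h.
case: (inv_inD hO _ _ h) => //; first by apply: isrN => //; apply: isrM.
move=> [n0 nV]; exfalso; apply: nF.
have : inv_in (Ox p.1) (q.[kK p.2] * F.[kK p.2]).
  by split; [rewrite -oppr_eq0|rewrite -[X in Ox _ X]opprK -invrN; apply: isrN].
by move=> /(inv_inM (sOx _) Oq OF)[].
Qed.

Lemma env_neq0 b : pol b -> env e b -> hy b != 0.
Proof.
move=> hb nb; apply/eqP => b0.
have h0 : pol 0 by apply: pol_inC; [exact: sO|apply: isr0].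
have : env e 0 by apply: env_hy nb; rewrite ?rmorph0.
rewrite /env; case: (sval e) => [p|]; last by rewrite rmorph0 eqxx.
by rewrite horner0 => -[]; rewrite eqxx.
Qed.

Lemma envD a b : pol a -> pol b -> env e (a + b) -> env e a \/ env e b.
Proof.
move=> ha hb; rewrite /env; case E: (sval e) => [p|].
  have [xg nF] : p.1 <> gpt D /\ ~ inv_in (Ox p.1) F.[kK p.2].
    by have := svalP e; rewrite E => /asboolP.
  by rewrite hornerD; apply: (inv_inD (curve_dvrP xg)); apply: pol_horner.
rewrite rmorphD /=; have [h|] := eqVneq (hy a) 0; last by left.
by rewrite h add0r; right.
Qed.

Lemma eO_sub : is_subring (eO e).
Proof.
have h1 : pol 1 by apply: pol_in1.
split.
- by exists 1, 1; split=> //; [exact: env1|rewrite rmorph1 divr1].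
- move=> _ _ [a [b [ha hb nb ->]]] [a' [b' [ha' hb' nb' ->]]].
  exists (a * b' - a' * b), (b * b'); split.
  + by apply: pol_inB => //; apply: pol_inM.
  + exact: pol_inM.
  + by apply/envM.
  + rewrite rmorphB !rmorphM; field.
    by rewrite (env_neq0 hb nb) (env_neq0 hb' nb').
- move=> _ _ [a [b [ha hb nb ->]]] [a' [b' [ha' hb' nb' ->]]].
  exists (a * a'), (b * b'); split; try exact: pol_inM; first by apply/envM.
  by rewrite !rmorphM invfM mulrACA.
Qed.

Lemma eO_unit a b : pol a -> pol b -> env e b -> inv_in (eO e) (hy a / hy b) <-> env e a.
Proof.
move=> ha hb nb; have b0 := env_neq0 hb nb; split=> [[n0 [a' [b' [ha' hb' nb' E]]]]|na].
  have b'0 := env_neq0 hb' nb'.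
  have : hy (b * b') = hy (a * a').
    rewrite !rmorphM /=; move: n0 E; rewrite mulf_eq0 invr_eq0 negb_or b0 andbT invf_div => a0 E.
    by rewrite -[hy b](divfK a0) E mulrAC divfK // mulrC.
  move=> /(env_hy (pol_inM sO hb hb') (pol_inM sO ha ha')) h.
  have : env e (b * b') by apply/envM.
  by move=> /h/(envM ha ha')[].
have a0 := env_neq0 ha na; split; first by rewrite mulf_neq0 // invr_eq0.
by rewrite invf_div; exists b, a.
Qed.

Lemma eO_hy a : pol a -> eO e (hy a).
Proof.
move=> ha; exists a, 1; split=> //; [exact: pol_in1|exact: env1|].
by rewrite rmorph1 divr1.
Qed.

Lemma eO_hy_unit a : pol a -> inv_in (eO e) (hy a) <-> env e a.
Proof.
move=> ha; rewrite -[X in inv_in _ X]divr1 -(rmorph1 hy).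
by apply: eO_unit => //; [exact: pol_in1|exact: env1].
Qed.

Lemma eO_local q : eO e q -> inv_in (eO e) q \/ inv_in (eO e) (1 - q).
Proof.
move=> [a [b [ha hb nb ->]]]; have b0 := env_neq0 hb nb.
have hba : pol (b - a) by apply: pol_inB.
have -> : 1 - hy a / hy b = hy (b - a) / hy b by rewrite rmorphB mulrBl divff.
have : env e (a + (b - a)) by rewrite addrCA subrr addr0.
by case/(envD ha hba) => h; [left|right]; apply/eO_unit.
Qed.

Lemma eO_base r : Ox (eproj e) r -> eO e (iK r).
Proof. by move=> Or; rewrite -(evalpC iK y); apply: eO_hy; apply: pol_inC. Qed.

Lemma eO_base_unit r : Ox (eproj e) r -> inv_in (eO e) (iK r) <-> inv_in (Ox (eproj e)) r.
Proof.
move=> Or; rewrite -(evalpC iK y) -envC //.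
by apply: eO_hy_unit; apply: pol_inC.
Qed.

End AtPoint.

(** The coarsest topology for which the projection is continuous and each element of [L] is regular
    on an open set; the latter makes [eO e] the stalk at [e] of the constant subsheaf. *)
Definition eopen (U : set epoint) : Prop := forall e, U e -> exists (V : opens C) (qs : seq L),
  [/\ V (eproj e), forall q, q \in qs -> eO e q &
    forall e', V (eproj e') -> (forall q, q \in qs -> eO e' q) -> U e'].

Let eopenT : eopen setT.
Proof. by move=> e _; exists (opens_full C), [::]. Qed.

Let eopenI : setI_closed eopen.
Proof.
move=> A B oA oB e [/oA[V [qs [Ve qe VA]]] /oB[V' [qs' [Ve' qe' VB]]]].
exists (opensI V V'), (qs ++ qs'); split=> // [q|e' [Ve1 Ve1'] h].
  by rewrite mem_cat => /orP[/qe|/qe'].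
by split; [apply: VA|apply: VB] => // q qq; apply: h; rewrite mem_cat qq ?orbT.
Qed.

Let eopenU (I : Type) (f : I -> set epoint) : (forall i, eopen (f i)) -> eopen (\bigcup_i f i).
Proof.
move=> of_ e [i _ /of_[V [qs [Ve qe VA]]]]; exists V, qs; split=> // e' Ve' h.
by exists i => //; apply: VA.
Qed.

Definition etop : topologicalType :=
  HB.pack epoint (isOpenTopological.Build epoint eopenT eopenI eopenU).

Lemma open_etop (U : set etop) : open U <-> eopen U.
Proof. by []. Qed.

Definition egen : etop := exist _ None isT.

Lemma egenP (U : opens etop) (x : etop) : U x -> U egen.
Proof.
move=> Ux; have /open_etop oU := osetP U; have [V [qs [Ve qe VU]]] := oU x Ux.
apply: VU; first exact: gptP Ve.
move=> q /qe[a [b [ha hb nb ->]]]; exists a, b; split=> //.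
- by move=> i; apply: curve_generic.
- by move=> i; apply: curve_generic.
- exact: (env_neq0 hb nb).
Qed.

Definition esub (e : etop) : is_subring (eO e) := eO_sub e.

Lemma eopen_O q : open [set e : etop | eO e q].
Proof.
apply/open_etop => e qe; exists (opens_full C), [:: q]; split=> // [q'|e' _ h].
  by rewrite inE => /eqP ->.
by apply: h; rewrite inE.
Qed.

Lemma eproj_cont : continuous (eproj : etop -> C).
Proof.
apply/continuousP => V oV; apply/open_etop => e Ve.
by exists (Opens oV), [::].
Qed.

Definition esheaf : ringed_space := constant_sheaf egenP esub.

End Points.
End CoverPoints.

(** * Affine charts of the cover *)

Section AffineCover.
Variables (k : closedFieldType) (C : scheme) (D : curve k C).
Variables (L : fieldType) (iK : {rmorphism cfield D -> L}) (y : L) (F : {poly cfield D}).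
Hypotheses (mF : F \is monic) (minF : forall p, evalp iK y p = 0 -> F %| p).
Hypothesis hyF : evalp iK y F = 0.
Hypothesis regF : forall x, pol_in (local_ring D x) F.
Variables (V : opens C) (aV : affine V) (gV : V (gpt D)).
Local Notation K := (cfield D).
Local Notation kK := (cconst D).
Local Notation Ox := (local_ring D).
Local Notation hy := (evalp iK y).
Local Notation E := (etop iK y F).
Local Notation eOx := (@eO k C D L iK y F).
Local Notation nv := (@env k C D L iK y F).
Let sOx x : is_subring (Ox x) := local_ring_subring D x.
Implicit Types e : E.

Definition regular_on : set K := [set r | forall x, V x -> Ox x r].
Local Notation AV := regular_on.

Definition regular_over : set L := [set q | exists a, pol_in AV a /\ q = hy a].
Local Notation BV := regular_over.

Lemma regular_on_sub : is_subring AV.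
Proof.
split=> [x Vx|a b ha hb x Vx|a b ha hb x Vx]; first exact: isr1.
  by apply: isrB; [exact: sOx|exact: ha|exact: hb].
by apply: isrM; [exact: sOx|exact: ha|exact: hb].
Qed.
Let sA := regular_on_sub.

Lemma regular_over_sub : is_subring BV.
Proof.
split.
- by exists 1; split; [exact: pol_in1|rewrite rmorph1].
- by move=> _ _ [a [ha ->]] [b [hb ->]]; exists (a - b); split; [exact: pol_inB|rewrite rmorphB].
- by move=> _ _ [a [ha ->]] [b [hb ->]]; exists (a * b); split; [exact: pol_inM|rewrite rmorphM].
Qed.

Lemma regular_on_germ (a : sec V) : AV (germ D V gV a).
Proof. by move=> x Vx; exists V, gV, a. Qed.

Lemma regular_onP r : AV r -> exists a : sec V, germ D V gV a = r.
Proof. exact: germ_glue. Qed.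

Lemma germ_inv (a : sec V) x : V x -> unit_at a x <-> inv_in (Ox x) (germ D V gV a).
Proof. by move=> Vx; rewrite (germ_unit gV a Vx) /inv_in; split=> -[]. Qed.

Lemma const_reg c : AV (kK c).
Proof.
move=> x _; have [->|xg] := EM (x = gpt D); first exact: curve_generic.
exact: dvr_const (curve_dvrP xg) _.
Qed.

Lemma clear_denominators (s : seq K) x : V x -> (forall r, r \in s -> Ox x r) ->
  exists u, [/\ AV u, inv_in (Ox x) u & forall r, r \in s -> AV (u * r)].
Proof.
move=> Vx; elim: s => [|r s IH] hs.
  by exists 1; split=> //; [apply: isr1|apply: inv_in1].
have [r' rs|u [Au uu us]] := IH; first by apply: hs; rewrite inE rs orbT.
have [|a [b [bx rE]]] := (local_ringP gV r aV Vx).1; first by apply: hs; rewrite inE eqxx.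
have bi := (germ_inv b Vx).1 bx; exists (germ D V gV b * u); split.
- by apply: (isrM sA) => //; apply: regular_on_germ.
- by apply/(inv_inM (sOx x)); [exact: regular_on_germ|exact: Au|].
- move=> r'; rewrite inE => /orP[/eqP ->|r's]; last first.
    by rewrite -mulrA; apply: (isrM sA); [exact: regular_on_germ|exact: us].
  rewrite rE mulrAC mulrCA divff ?bi.1 // mulr1 mulrC.
  by apply: (isrM sA) => //; apply: regular_on_germ.
Qed.

Lemma clear_polynomial a x : V x -> pol_in (Ox x) a ->
  exists u, [/\ AV u, inv_in (Ox x) u & pol_in AV (u%:P * a)].
Proof.
move=> Vx ha; have [r /(nthP 0)[i _ <-]|u [Au uu us]] := @clear_denominators a x Vx; first exact: ha.
exists u; split=> // i; rewrite coefCM.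
have [ai|ia] := ltnP i (size a); first by apply: us; apply: mem_nth.
by rewrite nth_default // mulr0; apply: isr0.
Qed.

Lemma pol_regular a x : V x -> pol_in AV a -> pol_in (Ox x) a.
Proof. by move=> Vx ha i; apply: ha. Qed.

Lemma eO_fraction e q : V (eproj e) -> eOx e q ->
  exists a b, [/\ pol_in AV a, pol_in AV b, nv e b & q = hy a / hy b].
Proof.
move=> Ve [a [b [ha hb nb ->]]].
have [u [Au uu ua]] := clear_polynomial Ve ha.
have [v [Av uv vb]] := clear_polynomial Ve hb.
have polu := pol_regular Ve (pol_inC sA Au); have polv := pol_regular Ve (pol_inC sA Av).
have nu : nv e u%:P by apply/envC => //; apply: Au.
have nvv : nv e v%:P by apply/envC => //; apply: Av.
have nuv : nv e (u%:P * v%:P) by apply/envM.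
exists (v%:P * (u%:P * a)), (u%:P * (v%:P * b)); split.
- by apply: pol_inM => //; apply: pol_inC.
- by apply: pol_inM => //; apply: pol_inC.
- by rewrite mulrA; apply/envM => //; apply: pol_inM.
- rewrite mulrCA !mulrA rmorphM [hy (_ * b)]rmorphM /= -mulf_div divff ?mul1r //.
  apply: (env_neq0 mF minF regF _ nuv); exact: pol_inM.
Qed.

Lemma hy_reg e a : V (eproj e) -> pol_in AV a -> eOx e (hy a).
Proof. by move=> Ve ha; apply: eO_hy; apply: pol_regular. Qed.

Lemma regular_over_eO e q : V (eproj e) -> BV q -> eOx e q.
Proof. by move=> Ve [a [ha ->]]; apply: hy_reg. Qed.

Lemma nv_inv e a : V (eproj e) -> pol_in AV a -> inv_in (eOx e) (hy a) <-> nv e a.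
Proof. by move=> Ve ha; apply: eO_hy_unit => //; apply: pol_regular. Qed.

(** F generates the ideal of relations of [y]. A nontrivial common divisor of F and [b] would not
    vanish at [y], so that its cofactor in F, of smaller degree, would. *)
Lemma field_inverse b : hy b != 0 -> exists b', hy (b * b') = 1.
Proof.
move=> b0; have cop : coprimep F b.
  rewrite coprimep_def; have /dvdpP[q Fq] := dvdp_gcdl F b; have /dvdpP[r br] := dvdp_gcdr F b.
  set d := gcdp F b in Fq br *.
  have /eqP : hy q * hy d = 0 by rewrite -rmorphM -Fq.
  have hd : hy d != 0 by apply: contra_neq b0 => h; rewrite br rmorphM /= h mulr0.
  rewrite mulf_eq0 (negPf hd) orbF => /eqP/minF Fdq.
  have q0 : q != 0 by apply: contra_eq_neq Fq => ->; rewrite mul0r monic_neq0.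
  have d0 : d != 0 by apply: contra_neq hd => ->; rewrite rmorph0.
  have := dvdp_leq q0 Fdq; rewrite {1}Fq size_mul //.
  have : (0 < size d)%N by rewrite size_poly_gt0.
  have : (0 < size q)%N by rewrite size_poly_gt0.
  case: (size d) => // -[//|m]; case: (size q) => // m' _ _.
  by rewrite !addnS /= ltnNge leq_addr.
have [[u v] /= uv] := Bezout_eq1_coprimepP _ _ cop.
by exists v; rewrite mulrC -[v * b](addKr (u * F)) uv rmorphD rmorphN rmorphM /= hyF mulr0 oppr0 add0r rmorph1.
Qed.

Section Ring.
Variables (R : comPzRingType) (iR : {rmorphism R -> L}).
Hypotheses (iRi : injective iR) (iRP : forall q, BV q <-> exists r, iR r = q).

Let eOi e r : V (eproj e) -> eOx e (iR r).
Proof. by move=> Ve; apply: regular_over_eO => //; apply/iRP; exists r. Qed.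

Let esub' e : is_subring (eOx e) := esub mF minF regF e.

Lemma point_prime e : V (eproj e) -> prime_ideal [set r | ~ inv_in (eOx e) (iR r)].
Proof.
move=> Ve; split=> /=.
- by rewrite rmorph0 /inv_in eqxx => -[].
- move=> a b ha hb [ab0 abV]; have := @eO_local _ _ _ _ _ _ _ mF minF regF e (iR a * (iR (a + b))^-1) _.
  case; first by apply: isrM => //; apply: eOi.
    have h : eOx e (iR a) by apply: eOi.
    by rewrite (inv_inM (esub' e)) // => -[].
  have -> : 1 - iR a / iR (a + b) = iR b / iR (a + b).
    by apply: (mulIf ab0); rewrite mulrBl !divfK // mul1r rmorphD addrAC subrr add0r.
  by rewrite (inv_inM (esub' e)) //; [case|apply: eOi].
- by move=> a b hb; rewrite rmorphM /= (inv_inM (esub' e)); [case|exact: eOi|exact: eOi].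
- by rewrite rmorph1; apply; apply: inv_in1.
- move=> a b; rewrite rmorphM /= (inv_inM (esub' e)); [|exact: eOi|exact: eOi].
  by move=> /not_andP.
Qed.

(** The prime contracts to a point x of [V]. Modulo [Q] the equation F(y) = 0 becomes one over k
    when x is closed, and k being algebraically closed, [Q] contains y - l for some root l: the
    point is (x, l). *)
Lemma prime_lift (Q : set R) : prime_ideal Q -> exists e, V (eproj e) /\
  Q = [set r | ~ inv_in (eOx e) (iR r)].
Proof.
move=> hQ; have iQ := prime_ideal_ideal hQ.
have /choice[r0 r0E] a : exists r, pol_in AV a -> iR r = hy a.
  have [ha|] := EM (pol_in AV a); last by exists 0.
  by have [r rE] := (iRP (hy a)).1 (ex_intro _ a (conj ha erefl)); exists r.
have polA a : pol_in AV (germ D V gV a)%:P by apply: pol_inC => //; apply: regular_on_germ.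
pose phi a := r0 (germ D V gV a)%:P.
have phiE a : iR (phi a) = iK (germ D V gV a) by rewrite r0E // evalpC.
have phiB : zmod_morphism phi by move=> a b; apply: iRi; rewrite rmorphB !phiE -!rmorphB.
have phiM : monoid_morphism phi.
  by split=> [|a b]; apply: iRi; rewrite ?rmorph1 ?phiE ?rmorph1 // !rmorphM !phiE.
pose p := mk_rmorphism phiB phiM.
have [x Vx PxE] : exists2 x, V x & phi @^-1` Q = point_ideal V x.
  apply: (prime_point aV); case: hQ => Q0 QD QM Q1 Qp.
  split=> /=.
  - by rewrite -[phi 0]/(p 0) rmorph0.
  - by move=> a b; rewrite -[phi (a + b)]/(p (a + b)) rmorphD; apply: QD.
  - by move=> a b; rewrite phiM.2; apply: QM.
  - by rewrite phiM.1.
  - by move=> a b; rewrite phiM.2; apply: Qp.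
have QA r a : iR r = iK a -> AV a -> Q r <-> ~ inv_in (Ox x) a.
  move=> ra Aa; have [b bE] := regular_onP Aa.
  have -> : r = phi b by apply: iRi; rewrite ra phiE bE.
  have := congr1 (fun S => S b) PxE; rewrite /= => ->.
  by rewrite /point_ideal /= germ_inv // bE.
suff [e [Ve eE]] : exists e, V (eproj e) /\ forall a r, pol_in AV a -> iR r = hy a -> (Q r <-> ~ nv e a).
  exists e; split=> //; apply/seteqP.
  have h r : Q r <-> ~ inv_in (eOx e) (iR r).
    have [a [ha ra]] := (iRP (iR r)).2 (ex_intro _ r erefl).
    by rewrite (eE a) // ra nv_inv.
  by split=> r /h.
(* Over the generic point [Q] is zero: a nonzero element of it has an inverse in [L], and clearing
   the denominators of the inverse would produce a nonzero element of the base in [Q]. *)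
have [xg|xg] := EM (x = gpt D).
  exists (egen iK y F); split=> // a r ha ra.
  rewrite /env /=; split=> [Qr a0|]; last first.
    move=> /negP; rewrite negbK => /eqP a0; have -> : r = 0 by apply: iRi; rewrite ra a0 rmorph0.
    by case: hQ.
  have [b hab] := field_inverse a0.
  have hb : pol_in (Ox (gpt D)) b by move=> i; apply: curve_generic.
  have [u [Au uu ub]] := clear_polynomial gV hb.
  have [s sE] := (iRP (hy (u%:P * b))).1 (ex_intro _ _ (conj ub erefl)).
  have /(QA _ u) : iR (r * s) = iK u.
    by rewrite rmorphM /= ra sE -rmorphM mulrCA rmorphM /= hab mulr1 evalpC.
  case=> // h _; apply: h; [apply: (idealMl _ iQ); exact: Qr|rewrite xg; exact: uu].
have hO := curve_dvrP xg.
have resF i : exists c, ~ inv_in (Ox x) (F`_i - kK c) by apply: (inv_residue hO); apply: regF.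
have [cf cfE] := choice resF.
pose n := (size F).-1.
have sF : size F = n.+1 by rewrite prednK // size_poly_gt0 monic_neq0.
(* The reduction of F at x. It is made monic by construction, since the residues [cf i] are only
   chosen for i < n. *)
pose f : {poly k} := 'X^n + \poly_(i < n) cf i.
have sizef : size f = n.+1 by rewrite size_polyDl size_polyXn // ltnS size_poly.
have mf : f \is monic.
  by apply/monicP; rewrite lead_coefE sizef /= coefD coefXn eqxx coef_poly ltnn addr0.
have [s sE] := closed_field_poly_normal f; rewrite (monicP mf) scale1r in sE.
have regx l : AV (kK l) := const_reg l.
have polXl l : pol_in AV ('X - (kK l)%:P).
  by apply: pol_inB => //; [exact: pol_inX|exact: pol_inC].
have Fi i : ~ inv_in (Ox x) (F`_i - (map_poly kK f)`_i).
  rewrite coef_map coefD coefXn coef_poly; case: (ltngtP i n) => [lt|gt|->] /=.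
  - by rewrite add0r; exact: cfE.
  - rewrite nth_default ?sF // addr0 rmorph0 subrr => -[]; rewrite ?eqxx //.
  - rewrite addr0 rmorph1; have := monicP mF; rewrite lead_coefE -/n => ->.
    by rewrite subrr => -[]; rewrite eqxx.
have AFi i : AV (F`_i - (map_poly kK f)`_i).
  apply: (isrB sA); first by move=> z _; apply: regF.
  by rewrite coef_map; apply: const_reg.
have [r rE] : exists r, iR r = hy (map_poly kK f).
  apply/iRP; exists (map_poly kK f); split=> // i; rewrite coef_map; exact: const_reg.
have [Y YE] : exists Y, iR Y = y.
  by apply/iRP; exists 'X; split; [exact: pol_inX|rewrite evalpX].
have Qr : Q r.
  have [g gE] := choice (fun i => (iRP (iK (F`_i - (map_poly kK f)`_i))).1
    (ex_intro _ _ (conj (pol_inC sA (AFi i)) (esym (evalpC iK y _))))).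
  have -> : r = - \sum_(i < n.+1) g i * Y ^+ i.
    apply: iRi; rewrite rE rmorphN rmorph_sum /=.
    transitivity (- hy (F - map_poly kK f)); first by rewrite rmorphB /= hyF sub0r opprK.
    congr (- _); rewrite {1}/evalp (@horner_coef_wide _ n.+1).
      by apply: eq_bigr => i _; rewrite rmorphM rmorphXn /= YE coef_map /= gE coefB.
    rewrite size_map_poly; apply: leq_trans (size_polyD _ _) _.
    by rewrite size_polyN geq_max sF leqnn size_map_poly sizef leqnn.
  apply: idealN => //; apply: ideal_sum => // i _; apply: idealMl => //.
  by apply/(QA _ _ (gE i)); [exact: AFi|exact: Fi].
have [l lf Ql] : exists2 l, root f l & forall q, iR q = y - iK (kK l) -> Q q.
  have : forall q, iR q = hy (map_poly kK f) -> Q q.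
    by move=> q qE; have -> : q = r by apply: iRi; rewrite qE rE.
  have sub : {subset s <= root f} by move=> z zs; rewrite -[_ \in _]/(root f z) sE root_prod_XsubC.
  rewrite {1}sE; elim: s sub {sE} => [|l s IH] sub.
    move=> /(_ 1); rewrite big_nil !rmorph1 => /(_ erefl) Q1.
    by case: hQ => _ _ _ /(_ Q1).
  rewrite big_cons => h.
  have [ql qlE] : exists q, iR q = y - iK (kK l).
    apply/iRP; exists ('X - (kK l)%:P); split=> //.
    by rewrite rmorphB /= evalpX evalpC.
  have [qs qsE] : exists q, iR q = hy (map_poly kK (\prod_(z <- s) ('X - z%:P))).
    apply/iRP; eexists; split; last by [].
    by move=> i; rewrite coef_map; apply: const_reg.
  have : Q (ql * qs).
    apply: h; rewrite rmorphM /= qlE qsE rmorphM /= rmorphM /=; congr (_ * _).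
    by rewrite map_polyXsubC rmorphB /= evalpX evalpC.
  have [_ _ _ _ Qp] := hQ; case/Qp => [Ql|Qs].
    exists l; first by apply: sub; rewrite inE eqxx.
    by move=> q qE; have -> : q = ql by apply: iRi; rewrite qE qlE.
  apply: IH => [z zs|q qE]; first by apply: sub; rewrite inE zs orbT.
  by have -> : q = qs by apply: iRi; rewrite qE qsE.
have nF : ~ inv_in (Ox x) F.[kK l].
  move=> /(inv_nvge hO); apply.
  have -> : F.[kK l] = (F - map_poly kK f).[kK l].
    by rewrite hornerD hornerN horner_map /= (rootP lf) rmorph0 subr0.
  rewrite horner_coef; apply: (vge_sum hO) => i _; rewrite coefB -[1%R]addr0.
  apply: (vgeM hO); first by apply: (non_inv hO); [exact: AFi|exact: Fi].
  by apply/vge0; apply: isrX => //; apply: dvr_const hO _.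
have pe : @epred _ _ D F (Some (x, l)) by apply/asboolP.
exists (exist (fun z => epred F z) _ pe : epoint F); split=> // a q ha qa.
rewrite /env /=.
have /dvdpP[b ab] : ('X - (kK l)%:P) %| (a - (a.[kK l])%:P).
  by rewrite dvdp_XsubCl /root !hornerE subrr.
have Al : AV a.[kK l] by apply: (pol_in_horner sA).
have hb : pol_in AV b.
  apply: (pol_in_divl sA (monicXsubC (kK l)) (polXl l)).
  by rewrite mulrC -ab; apply: pol_inB => //; apply: pol_inC.
have [rb rbE] := (iRP (hy b)).1 (ex_intro _ _ (conj hb erefl)).
have [rl rlE] := (iRP (iK a.[kK l])).1 (ex_intro _ _ (conj (pol_inC sA Al) (esym (evalpC iK y _)))).
have [ql qlE] : exists q, iR q = y - iK (kK l).
  apply/iRP; exists ('X - (kK l)%:P); split=> //.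
  by rewrite rmorphB /= evalpX evalpC.
have qE : q = rb * ql + rl.
  apply: iRi; rewrite rmorphD rmorphM /= qa rbE qlE rlE -[a](subrK (a.[kK l])%:P) ab.
  by rewrite rmorphD rmorphM rmorphB /= evalpX !evalpC hornerD hornerM hornerXsubC subrr mulr0 add0r hornerC.
have Qb : Q (rb * ql) by rewrite mulrC; apply: idealMl => //; apply: Ql.
rewrite -(QA rl) // qE; split=> [h|]; last by case: iQ => _ + _; apply.
by rewrite -[rl](addKr (rb * ql)) addrC; apply: idealB.
Qed.

End Ring.

Lemma point_over_unique e e' : V (eproj e) -> V (eproj e') ->
  (forall q, BV q -> inv_in (eOx e) q <-> inv_in (eOx e') q) -> e = e'.
Proof.
move=> Ve Ve' h.
have xx : eproj e = eproj e'.
  apply: (point_ideal_inj aV) => //; apply/seteqP.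
  have hh (a : sec V) : unit_at a (eproj e) <-> unit_at a (eproj e').
    have Aa := regular_on_germ a.
    rewrite !germ_inv // -(eO_base_unit mF minF regF (Aa _ Ve)).
    rewrite -(eO_base_unit mF minF regF (Aa _ Ve')); apply: h.
    by exists (germ D V gV a)%:P; split; [exact: pol_inC|rewrite evalpC].
  by split=> a /= na /hh.
have hX l : nv e ('X - (kK l)%:P) <-> nv e' ('X - (kK l)%:P).
  have hp : pol_in AV ('X - (kK l)%:P).
    by apply: pol_inB => //; [exact: pol_inX|apply: pol_inC => //; exact: const_reg].
  by rewrite -!nv_inv //; apply: h; exists ('X - (kK l)%:P).
have Pe := svalP e; have Pe' := svalP e'.
move: hX xx Pe Pe'; rewrite /env /eproj => hX xx Pe Pe'; apply: val_inj => /=.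
move: hX xx Pe Pe'; case: (sval e) => [[x l]|]; case: (sval e') => [[x' l']|] //= hX xx.
- rewrite -xx in hX *; move=> /asboolP[xg _] _; congr (Some (_, _)).
  move: (hX l'); rewrite !hornerXsubC subrr => -[h1 _]; apply/eqP/negPn/negP => ll.
  have /h1[] : inv_in (Ox x) (kK l - kK l').
    by rewrite -rmorphB; apply: (inv_const (curve_dvrP xg)); rewrite subr_eq0.
  by rewrite eqxx.
- by move=> /asboolP[].
- by move=> _ /asboolP[]; rewrite -xx.
Qed.

End AffineCover.

Section AffineOver.
Variables (k : closedFieldType) (C : scheme) (D : curve k C).
Variables (L : fieldType) (iK : {rmorphism cfield D -> L}) (y : L) (F : {poly cfield D}).
Hypotheses (mF : F \is monic) (minF : forall p, evalp iK y p = 0 -> F %| p).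
Hypothesis hyF : evalp iK y F = 0.
Hypothesis regF : forall x, pol_in (local_ring D x) F.
Local Notation K := (cfield D).
Local Notation kK := (cconst D).
Local Notation Ox := (local_ring D).
Local Notation hy := (evalp iK y).
Local Notation E := (etop iK y F).
Local Notation eOx := (@eO k C D L iK y F).
Local Notation nv := (@env k C D L iK y F).
Local Notation ES := (esheaf mF minF regF).
Implicit Types e : E.
Let esub' e : is_subring (eOx e) := esub mF minF regF e.

Definition over (V : opens C) : opens ES := opens_preim (@eproj_cont k C D L iK y F) V.

Lemma over_unit (U : opens ES) (gU : U (egen iK y F)) (s : sec U) e :
  unit_at s e <-> U e /\ inv_in (eOx e) (cgerm (esub mF minF regF) gU s).
Proof.
rewrite (cunit (fun q => @eopen_O _ _ _ _ _ _ _ q) gU s e).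
by split=> [[]|[? []]].
Qed.

Section OverV.
Variables (V : opens C) (aV : affine V) (gV : V (gpt D)).
Local Notation AV := (regular_on V).
Local Notation BV := (regular_over iK y V).
Let sA : is_subring AV := regular_on_sub D V.
Let sB : is_subring BV := regular_over_sub iK y V.

(** If the denominators of [q] formed a proper ideal, a maximal ideal containing it would be a point
    over [V]. There q = a/b with b not vanishing, but b is a denominator. *)
Lemma regular_overP q : BV q <-> forall e, V (eproj e) -> eOx e q.
Proof.
split=> [Bq e Ve|h]; first exact: (regular_over_eO Ve Bq).
pose R := subring_of sB; pose iR : {rmorphism R -> L} := @subring_val _ _ sB.
have iRP r : BV r <-> exists b, iR b = r.
  by split=> [/(subring_ex sB)//|[b <-]]; apply: subring_valP.
apply: contrapT => nq.
pose I := [set b : R | BV (iR b * q)].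
have iI : ideal I.
  split=> [|a b|a b]; rewrite /I /=.
  - by rewrite rmorph0 mul0r; apply: isr0.
  - by rewrite rmorphD mulrDl; apply: isrD.
  - by rewrite rmorphM -mulrA; apply: isrM => //; apply: subring_valP.
have [|Q [[pQ _] IQ]] := maximal_above iI; first by rewrite /I /= rmorph1 mul1r.
have [e [Ve QE]] := prime_lift mF minF hyF regF aV gV (@subring_val_inj _ _ sB) iRP pQ.
have [a [b [ha hb nb qE]]] := eO_fraction mF minF regF aV gV Ve (h e Ve).
have [r rE] := (iRP (hy b)).1 (ex_intro _ b (conj hb erefl)).
have : Q r.
  apply: IQ; rewrite /I /= rE qE mulrC divfK; first by exists a.
  exact: (env_neq0 mF minF regF (pol_regular Ve hb) nb).
by rewrite QE => h'; apply: h'; change (inv_in (eOx e) (iR r)); rewrite rE; apply: (nv_inv mF minF regF Ve hb).2 nb.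
Qed.

Let gE : over V (egen iK y F) := gV.
Local Notation gm := (cgerm (esub mF minF regF) gE).

Let gmP q : BV q <-> exists r, gm r = q.
Proof.
split=> [/regular_overP h|[r <-]]; first exact: cgerm_ex.
by apply/regular_overP => e Ve; apply: cgermP.
Qed.

Lemma sec_ex q : BV q -> exists s, gm s = q.
Proof. by move/gmP. Qed.

Lemma sec_regular s : BV (gm s).
Proof. by apply/gmP; exists s. Qed.

Let cgi : injective gm := @cgerm_inj _ _ _ _ _ _ gE.

Let pointE (e : E) : V (eproj e) ->
  [set s : sec (over V) | ~ unit_at s (e : ES)] = [set s | ~ inv_in (eOx e) (gm s)].
Proof.
by move=> Ve; apply/seteqP; split=> s /= h /= h'; apply: h; [apply/(over_unit gE)|apply (over_unit gE) in h'; case: h'].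
Qed.

Lemma empty_sec (U : opens ES) (s t : sec U) : ~ U (egen iK y F) -> s = t.
Proof.
by move=> nU; apply: csec_inj => -[e Ue]; case: nU; apply: (egenP mF minF regF Ue).
Qed.

Lemma over_affine : affine (over V).
Proof.
split=> [e Ve|Q pQ|W e WV We|s].
- by rewrite pointE //; apply: (point_prime mF minF regF gmP).
- have [e [Ve QE]] := prime_lift mF minF hyF regF aV gV cgi gmP pQ.
  exists e; split=> [|e' [Ve' E']]; first by rewrite pointE.
  apply: (point_over_unique mF minF regF aV gV) => // q /gmP[r <-].
  move: E'; rewrite QE pointE // => /(congr1 (fun S => S r)) /= E'.
  by split=> h; apply: contrapT; [rewrite -E'|rewrite E'] => /(_ h).
- have Ve := WV e We.
  have [U [qs [Ue hq UW]]] := (open_etop _).1 (osetP W) e We.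
  have [f [fe fU]] := basic_nbhd aV Ve Ue.
  (* A common denominator of the finitely many functions whose regularity defines the neighbourhood;
     they are all regular where it does not vanish. *)
  have [b [hb nb qb]] : exists b, [/\ pol_in AV b, nv e b &
      forall q, q \in qs -> exists a, pol_in AV a /\ q = hy a / hy b].
    elim: qs hq {UW} => [|q qs IH] hq.
      by exists 1; split=> //; [apply: pol_in1 sA|exact: env1].
    have [q' q's|b [hb nb qb]] := IH; first by apply: hq; rewrite inE q's orbT.
    have [|a [b' [ha hb' nb' qE]]] := @eO_fraction _ _ _ _ _ _ _ mF minF regF _ aV gV _ q Ve.
      by apply: hq; rewrite inE eqxx.
    have b0 := env_neq0 mF minF regF (pol_regular Ve hb) nb.
    have b'0 := env_neq0 mF minF regF (pol_regular Ve hb') nb'.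
    exists (b * b'); split; first exact: pol_inM.
      by apply/envM => //; exact: (pol_regular Ve).
    move=> q'; rewrite inE => /orP[/eqP ->|/qb[a' [ha' ->]]].
      by exists (b * a); split; [exact: pol_inM|rewrite qE !rmorphM /= -mulf_div divff // mul1r].
    by exists (a' * b'); split; [exact: pol_inM|rewrite !rmorphM /= -mulf_div divff // mulr1].
  have hf : pol_in AV (germ D V gV f)%:P by apply: pol_inC => //; apply: regular_on_germ.
  have [s sE] : exists s : sec (over V), gm s = hy ((germ D V gV f)%:P * b).
    by apply/gmP; eexists; split; last by []; exact: pol_inM.
  have sU e' : V (eproj e') -> unit_at s (e' : ES) <-> unit_at f (eproj e') /\ nv e' b.
    move=> Ve'; rewrite (over_unit gE) sE (nv_inv mF minF regF Ve' (pol_inM sA hf hb)).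
    rewrite (envM iK y (pol_regular Ve' hf) (pol_regular Ve' hb)).
    rewrite (envC iK y (regular_on_germ gV f Ve')).
    by rewrite (germ_inv gV) //; split=> [[_]|].
  exists s; split; first by apply/sU.
  move=> e' /= se'; have Ve' : V (eproj e') by apply: (unit_at_in se').
  have [fe' nb'] := (sU _ Ve').1 se'.
  apply: UW; first exact: fU.
  by move=> q /qb[a [ha ->]]; exists a, b; split=> //; exact: (pol_regular Ve').
- have DsP e : basic s e <-> V (eproj e) /\ inv_in (eOx e) (gm s) by apply: over_unit.
  have [gD|gD] := EM (basic s (egen iK y F)); last first.
    split.
    + by exists 1; apply: empty_sec.
    + by move=> t; exists 0, 0; apply: empty_sec.
    + move=> a _; exists 1%N; suff -> : s = 0 by rewrite mul0r.
      apply: cgi; rewrite rmorph0; apply/eqP/negP => /negP s0; apply: gD; apply/DsP; split=> //.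
      have [b [hb sb]] := sec_regular s; rewrite sb in s0 *.
      by apply: (@nv_inv _ _ _ _ _ _ _ mF minF regF _ (egen iK y F) b gV hb).2.
  pose gd := cgerm (esub mF minF regF) gD.
  have gdi : injective gd by apply: cgerm_inj.
  have gd_res a : gd (res (@basicS ES (over V) s) a) = gm a by apply: cgerm_res.
  have s0 : gm s != 0 by have [_ []] := (DsP _).1 gD.
  split.
  + have [|t tE] := @cgerm_ex _ _ _ _ (esub mF minF regF) _ gD (gm s)^-1.
      by move=> e /DsP[_ []].
    by exists t; apply: gdi; rewrite [LHS]rmorphM [RHS]rmorph1 gd_res /gd tE divff.
  (* The ideal of denominators of [t]. If no power of [s] were among them, a prime containing them
     and avoiding the powers of [s] would be a point of [basic s], where [t] is regular and has a
     denominator that does not vanish. *)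
  + move=> t; pose I := [set r | BV (gm r * gd t)].
    have iI : ideal I.
      split=> [|a b ha hb|a b hb].
      * by change (BV (gm 0 * gd t)); rewrite [gm 0]rmorph0 mul0r; apply: isr0.
      * by change (BV (gm (a + b) * gd t)); rewrite [gm _]rmorphD mulrDl; apply: isrD.
      * change (BV (gm (a * b) * gd t)); rewrite [gm _]rmorphM -mulrA.
        by apply: isrM => //; apply: sec_regular.
    have [n In] : exists n, I (s ^+ n).
      apply: contrapT => nI.
      have [||r [n ->] In|Q [pQ IQ sQ]] := @prime_avoiding _ I [set r | exists n, r = s ^+ n] iI.
      * by exists 0%N.
      * by move=> _ _ [n ->] [m ->]; exists (n + m)%N; rewrite exprD.
      * by apply: nI; exists n.
      have [e [Ve QE]] := prime_lift mF minF hyF regF aV gV cgi gmP pQ.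
      have us : inv_in (eOx e) (gm s).
        by apply: contrapT => h; apply: (sQ s); [exists 1%N|rewrite QE].
      have te : eOx e (gd t) by apply: cgermP; apply/DsP.
      have [a [b [ha hb nb tE]]] := eO_fraction mF minF regF aV gV Ve te.
      have [r rE] := (gmP (hy b)).1 (ex_intro _ b (conj hb erefl)).
      have : Q r.
        apply: IQ; change (BV (gm r * gd t)); rewrite rE tE mulrC divfK; first by exists a.
        exact: (env_neq0 mF minF regF (pol_regular Ve hb) nb).
      rewrite QE => h'; apply: h'; rewrite rE; exact: (nv_inv mF minF regF Ve hb).2 nb.
    have [a aE] := (gmP (gm (s ^+ n) * gd t)).1 In; exists n, a; apply: gdi.
    by rewrite [LHS]rmorphM [X in X * _]rmorphXn gd_res [RHS]gd_res aE [X in _ = X * _]rmorphXn.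
  + move=> a /(congr1 gd); rewrite gd_res [RHS]rmorph0 => a0.
    by exists 0%N; rewrite mul1r; apply: cgi; rewrite [RHS]rmorph0.
Qed.
End OverV.

Lemma over_local e : @local_stalk ES e.
Proof.
move=> U Ue; have gU := egenP mF minF regF Ue; split=> [|s].
  by rewrite (over_unit gU) => -[_ []]; rewrite [X in X != 0]rmorph0 eqxx.
rewrite !(over_unit gU).
have -> : cgerm (esub mF minF regF) gU (1 - s) = 1 - cgerm (esub mF minF regF) gU s.
  by rewrite [LHS]rmorphB [X in X - _]rmorph1.
have /(eO_local mF minF regF) : eOx e (cgerm (esub mF minF regF) gU s) by apply: cgermP.
by case; [left|right].
Qed.

Lemma over_covered e : exists U : opens ES, U e /\ affine U.
Proof.
have [V [Ve aV]] := sch_affine (eproj e).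
by exists (over V); split=> //; apply: over_affine aV _; apply: gptP Ve.
Qed.

Definition cover_scheme : scheme := @Scheme ES over_local over_covered.

Lemma cover_pull_ex (V : opens C) (s : sec V) : exists t : csec (esub mF minF regF) (over V),
  forall e : {e : E | over V e}, cfun t e = iK (germ D V (gptP D V _ (svalP e)) s).
Proof.
apply: csec_ex => [e e'|e].
- by rewrite (Prop_irrelevance (gptP D V _ (svalP e)) (gptP D V _ (svalP e'))).
- by apply: eO_base => //; exists V, (gptP D V _ (svalP e)), s; split=> //; exact: (svalP e).
Qed.

Definition cover_pull (V : opens C) (s : sec V) : csec (esub mF minF regF) (over V) :=
  sval (cid (cover_pull_ex s)).

Lemma cover_pullE V (s : sec V) (e : {e : E | over V e}) :
  cfun (cover_pull s) e = iK (germ D V (gptP D V _ (svalP e)) s).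
Proof. by rewrite /cover_pull; case: cid => t /= ->. Qed.

Let pB V : zmod_morphism (@cover_pull V).
Proof.
move=> s t; apply: csec_inj => e; rewrite [RHS](_ : _ = cfun (cover_pull s) e - cfun (cover_pull t) e) //.
by rewrite !cover_pullE !rmorphB.
Qed.

Let pM V : monoid_morphism (@cover_pull V).
Proof.
split=> [|s t]; apply: csec_inj => e.
  by rewrite cover_pullE !rmorph1.
rewrite [RHS](_ : _ = cfun (cover_pull s) e * cfun (cover_pull t) e) //.
by rewrite !cover_pullE !rmorphM.
Qed.

Definition cover_pullback V : {rmorphism sec V -> sec (over V)} := mk_rmorphism (@pB V) (@pM V).

Let pres (V W : opens C) (h : W `<=` V) (s : sec V) :
  cover_pullback W (res h s) = @res ES (over V) (over W) (opens_preimS (@eproj_cont k C D L iK y F) h) (cover_pullback V s).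
Proof.
apply: csec_inj => -[e We]; pose e' : {e | over V e} := exist _ e (h _ We).
rewrite (cresE _ _ _ e') /= !cover_pullE; congr (iK _); exact: germ_res.
Qed.

Let plocal (V : opens C) (s : sec V) (e : cover_scheme) :
  V (eproj e) -> unit_at (cover_pullback V s) e -> unit_at s (eproj e).
Proof.
move=> Ve; have gV := gptP D V _ Ve.
rewrite (over_unit (U := over V) gV) => -[_].
rewrite (cgermE (gV : over V (egen iK y F)) _ (exist (over V) e Ve)) cover_pullE /=.
rewrite (eO_base_unit mF minF regF); last by eexists V, _, s.
by move: (svalP _) => /= Ve' [h0 hV]; apply/(germ_unit (gptP D V _ Ve') s Ve).
Qed.

Definition cover_proj : scheme_morphism cover_scheme C :=
  @SchemeMorphism cover_scheme C _ (@eproj_cont k C D L iK y F) cover_pullback pres plocal.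

Lemma cover_proj_germ (V : opens C) (gV : V (gpt D)) s :
  cgerm (esub mF minF regF) (gV : over V (egen iK y F)) (pull cover_proj V s) = iK (germ D V gV s).
Proof.
rewrite (cgermE (gV : over V (egen iK y F)) _ (exist (over V) (egen iK y F) gV)) cover_pullE; congr (iK (germ D V _ s)).
exact: Prop_irrelevance.
Qed.

End AffineOver.

Definition separable_basis (A B : comPzRingType) (phi : A -> B) n (e : 'I_n -> B) : Prop :=
  exists c : 'I_n -> 'M[A]_n,
    [/\ (forall b, exists! a : {ffun 'I_n -> A}, b = \sum_i phi (a i) * e i),
        (forall i j, e i * e j = \sum_l phi (c i j l) * e l) &
        exists d, \det (\matrix_(i, j) \sum_l c i j l * \tr (c l)) * d = 1].

Lemma pol_lift (K : fieldType) (O : set K) (sO : is_subring O) (p : {poly K}) : pol_in O p ->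
  exists q : {poly subring_of sO}, map_poly (@subring_val _ _ sO) q = p.
Proof.
move=> hp; have [f fE] := choice (fun i => subring_ex sO (hp i)).
exists (\poly_(i < size p) f i); apply/polyP => i; rewrite coef_map coef_poly.
have [ip|pi] := ltnP i (size p); first exact: fE.
by rewrite nth_default // rmorph0.
Qed.

Section Residue.
Variables (k K : fieldType) (kK : {rmorphism k -> K}) (O O' : set K) (pi : K).
Hypotheses (hO : dvr kK O pi) (sO' : is_subring O') (O'O : O' `<=` O) (constO' : forall c, O' (kK c)).
Local Notation vl := (@subring_val _ _ sO').

Lemma residue_on : exists rho : {rmorphism subring_of sO' -> k},
  (forall a, rho a = 0 <-> ~ inv_in O (vl a)) /\ (forall a c, vl a = kK c -> rho a = c).
Proof.
have sO := dvr_sub hO.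
have [h hE] := @subring_lift _ _ sO' k kK constO'.
pose P := [set a : subring_of sO' | ~ inv_in O (vl a)].
have Oa a : O (vl a) by apply: O'O; exact: (subring_valP a).
have pP : prime_ideal P.
  split; rewrite /P /=.
  - by rewrite rmorph0 /inv_in eqxx => -[].
  - by move=> a b ha hb; rewrite rmorphD => /(inv_inD hO (Oa a) (Oa b))[].
  - by move=> a b hb; rewrite rmorphM => /(inv_inM sO (Oa a) (Oa b))[].
  - by rewrite rmorph1; apply; apply: inv_in1.
  - by move=> a b; rewrite rmorphM => nab; apply/not_andP => ab; apply: nab; apply/(inv_inM sO (Oa a) (Oa b)).
have [|rho [rho0 rhoh]] := residue_morphism (phi := h) pP.
  by move=> a; have [c hc] := inv_residue hO (Oa a); exists c; rewrite /P /= [X in inv_in _ X]rmorphB /= hE.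
exists rho; split=> [a|a c ac]; first by rewrite -rho0.
by rewrite -(rhoh c); congr (rho _); apply: subring_val_inj; rewrite ac hE.
Qed.

End Residue.

(** * The cover is finite étale *)

Section FiniteEtale.
Variables (k : closedFieldType) (C : scheme) (D : curve k C).
Variables (L : fieldType) (iK : {rmorphism cfield D -> L}) (y : L) (F : {poly cfield D}).
Hypotheses (mF : F \is monic) (minF : forall p, evalp iK y p = 0 -> F %| p).
Hypothesis hyF : evalp iK y F = 0.
Hypothesis regF : forall x, pol_in (local_ring D x) F.
Hypothesis sepF : forall x l, x <> gpt D -> ~ inv_in (local_ring D x) F.[cconst D l] ->
  inv_in (local_ring D x) F^`().[cconst D l].
Variables (V : opens C) (aV : affine V) (gV : V (gpt D)) (x0 : C) (Vx0 : V x0) (x0g : x0 <> gpt D).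
Local Notation K := (cfield D).
Local Notation kK := (cconst D).
Local Notation Ox := (local_ring D).
Local Notation hy := (evalp iK y).
Local Notation AV := (regular_on V).
Local Notation n := (size F).-1.
Local Notation A := (sec V).
Local Notation gA := (germ D V gV).
Let sA : is_subring AV := regular_on_sub D V.
Let A' := subring_of sA.
Local Notation vl := (@subring_val _ _ sA).

Let sF : size F = n.+1.
Proof. by rewrite prednK // size_poly_gt0 monic_neq0. Qed.

Let gAi : injective gA. Proof.
move=> a b /eqP; rewrite -subr_eq0 -rmorphB => /eqP/germ_inj/eqP.
by rewrite subr_eq0 => /eqP.
Qed.

Lemma regular_mod a : pol_in AV a -> exists r, [/\ pol_in AV r, (size r <= n)%N & hy r = hy a].
Proof.
have [m] := ubnP (size a); elim: m a => // m IH a; rewrite ltnS => am ha.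
have [an|na] := leqP (size a) n; first by exists a.
have a0 : a != 0 by rewrite -size_poly_gt0; apply: leq_ltn_trans na.
pose b := a - (lead_coef a)%:P * 'X^(size a - size F) * F.
have polF : pol_in AV F by move=> i x _; apply: regF.
have polX i : pol_in AV ('X^i : {poly K}).
  by elim: i => [|i IHi]; [exact: (pol_in1 sA)|rewrite exprS; exact: (pol_inM sA (pol_inX sA) IHi)].
have hb : pol_in AV b.
  apply: pol_inB => //; apply: pol_inM => //; apply: pol_inM => //; apply: pol_inC => //.
  by rewrite lead_coefE; apply: ha.
have hyb : hy b = hy a by rewrite rmorphB /= rmorphM /= hyF mulr0 subr0.
have sb : (size b < m)%N.
  apply: leq_trans _ am; rewrite -(prednK (n := size a)) ?size_poly_gt0 // ltnS.
  apply/leq_sizeP => i ai; rewrite coefB.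
  have la : lead_coef a != 0 by rewrite lead_coef_eq0.
  have sM : size ((lead_coef a)%:P * 'X^(size a - size F) * F) = size a.
    rewrite -mulrA size_Cmul // mulrC size_Mmonic ?monicXn ?monic_neq0 // size_polyXn addnS /=.
    by rewrite subnKC // sF.
  move: ai; rewrite leq_eqVlt => /orP[/eqP <-|ia].
    rewrite -lead_coefE -[X in _`_(X.-1)]sM -lead_coefE lead_coef_Mmonic //.
    by rewrite lead_coef_Mmonic ?monicXn // lead_coefC subrr.
  by rewrite !nth_default ?subr0 // ?sM; move: ia; case: (size a).
by have [r [hr rn rE]] := IH b sb hb; exists r; rewrite rE.
Qed.

Variables (B : comPzRingType) (phi : {rmorphism A -> B}) (gm : {rmorphism B -> L}).
Hypotheses (gmi : injective gm) (phiE : forall a, gm (phi a) = iK (gA a)).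
Hypothesis gmP : forall b, regular_over iK y V (gm b).
Variables (Y : B) (YE : gm Y = y).

Let sumE (a : 'I_n -> A) : gm (\sum_i phi (a i) * Y ^+ i) = hy (\poly_(i < n) nth 0 [seq gA (a i) | i : 'I_n] i).
Proof.
rewrite rmorph_sum /evalp (@horner_coef_wide _ n); last first.
  by rewrite size_map_poly size_poly.
apply: eq_bigr => i _; rewrite rmorphM rmorphXn /= phiE YE coef_map coef_poly ltn_ord /=.
by rewrite (nth_map i) ?size_enum_ord // nth_ord_enum.
Qed.

Lemma cover_decomposition b : exists! a : {ffun 'I_n -> A}, b = \sum_i phi (a i) * Y ^+ i.
Proof.
have [a [ha ab]] := gmP b.
have [r [hr rn rE]] := regular_mod ha.
have [f fE] := choice (fun i => regular_onP gV (hr i)).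
exists [ffun i : 'I_n => f i]; split.
  apply: gmi; rewrite ab -rE sumE; congr (hy _); apply/polyP => i; rewrite coef_poly.
  case: ltnP => [ni|ni]; last by rewrite nth_default //; apply: leq_trans ni.
  by rewrite (nth_map (Ordinal ni)) ?size_enum_ord // (nth_ord_enum _ (Ordinal ni)) ffunE fE.
move=> g gE'; apply/ffunP => i; rewrite ffunE; apply: gAi; rewrite fE.
have := congr1 gm gE'; rewrite ab -rE sumE => /eqP; rewrite -subr_eq0 -rmorphB => /eqP/minF Fd.
have : r - \poly_(i < n) nth 0 [seq gA (g i) | i : 'I_n] i = 0.
  apply/eqP/negPn/negP => /dvdp_leq/(_ Fd); apply/negP; rewrite -ltnNge.
  rewrite [X in (_ < X)%N]sF ltnS.
  by apply: leq_trans (size_polyD _ _) _; rewrite size_polyN geq_max rn size_poly.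
move=> /eqP; rewrite subr_eq0 => /eqP ->; rewrite coef_poly ltn_ord.
by rewrite (nth_map i) ?size_enum_ord // nth_ord_enum.
Qed.

(** At x the algebra reduces to k[y]/(f), where f is the reduction of F and is separable. The
    Vandermonde matrix [W] of its roots diagonalizes the multiplications, so that the trace form is
    W times its transpose. *)
Lemma discriminant_unit (c : 'I_n -> 'M[A]_n) x : V x -> x <> gpt D ->
  (forall i j : 'I_n, Y ^+ i * Y ^+ j = \sum_l phi (c i j l) * Y ^+ l) ->
  unit_at (\det (\matrix_(i, j) \sum_l c i j l * \tr (c l))) x.
Proof.
move=> Vx xg cE; have [rho [rho0 rhoc]] := residue_on (curve_dvrP xg) sA (fun r (h : AV r) => h x Vx) (@const_reg _ _ D V).
have tauP a : exists a', vl a' = gA a by apply: subring_ex; apply: regular_on_germ.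
have [tau tauE] := choice tauP.
have tB : zmod_morphism tau by move=> a b; apply: subring_val_inj; rewrite [RHS](rmorphB (vl : {rmorphism _ -> _})) /= !tauE; apply: rmorphB.
have tM : monoid_morphism tau.
  split=> [|a b]; apply: subring_val_inj; first by rewrite [RHS]rmorph1 tauE rmorph1.
  by rewrite [RHS](rmorphM (vl : {rmorphism _ -> _})) /= !tauE; apply: rmorphM.
pose ev : {rmorphism A -> k} := rho \o mk_rmorphism tB tM.
suff : ev (\det (\matrix_(i, j) \sum_l c i j l * \tr (c l))) <> 0.
  move=> h; apply/(germ_inv gV) => //; apply: contrapT => h'; apply: h.
  by rewrite /ev /= rho0 tauE.
have polF : pol_in AV F by move=> i z _; apply: regF.
have [F0 F0E] := pol_lift sA polF.
pose f := map_poly rho F0.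
have lF0 : lead_coef F0 = 1.
  by apply: subring_val_inj; rewrite -lead_coef_map_inj ?rmorph0 // ?F0E ?(monicP mF) ?rmorph1 //; exact: subring_val_inj.
have sF0 : size F0 = n.+1.
  by rewrite -sF -F0E size_map_inj_poly ?rmorph0 //; exact: subring_val_inj.
have mf : f \is monic by rewrite monic_map // monicE lF0.
have sf : size f = n.+1 by rewrite size_map_poly_id0 // lF0 rmorph1 oner_neq0.
have cA l : exists a, vl a = kK l by apply: subring_ex; apply: const_reg.
have [ct ctE] := choice cA.
have rct l : rho (ct l) = l by apply: rhoc; apply: ctE.
have fl l : f.[l] = 0 <-> ~ inv_in (Ox x) F.[kK l].
  by rewrite -{1}(rct l) horner_map rho0 -(horner_map vl) /= ctE F0E.
have f'l l : f^`().[l] = 0 <-> ~ inv_in (Ox x) F^`().[kK l].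
  by rewrite -{1}(rct l) deriv_map horner_map rho0 -(horner_map vl) /= ctE -deriv_map F0E.
have sepf : separable_poly f.
  rewrite unlock; apply: Pdiv.ClosedField.root_coprimep => l /rootP/fl nl; apply/eqP => /f'l; apply.
  exact: sepF.
have [s sE] := closed_field_poly_normal f; rewrite (monicP mf) scale1r in sE.
have us : uniq s by rewrite -separable_prod_XsubC -sE.
have ss : size s = n by have := sf; rewrite sE size_prod_XsubC => -[].
pose r : 'rV[k]_n := \row_m s`_m.
pose W := Vandermonde n r.
have W0 : \det W != 0.
  rewrite det_Vandermonde; apply/prodf_neq0 => i _; apply/prodf_neq0 => j ij.
  by rewrite !mxE subr_eq0 nth_uniq ?ss // gtn_eqF.
have rel i j (m : 'I_n) : \sum_l ev (c i j l) * s`_m ^+ l = s`_m ^+ i * s`_m ^+ j :> k.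
  pose G := 'X^i * 'X^j - \poly_(l < n) nth 0 [seq tau (c i j l) | l : 'I_n] l.
  have Gl (l : 'I_n) : (\poly_(l < n) nth 0 [seq tau (c i j l) | l : 'I_n] l)`_l = tau (c i j l).
    by rewrite coef_poly ltn_ord (nth_map i) ?size_enum_ord // nth_ord_enum.
  have : hy (map_poly vl G) = 0.
    rewrite rmorphB rmorphM /= !map_polyXn rmorphB rmorphM !rmorphXn /= evalpX -YE.
    rewrite -!rmorphXn -rmorphM cE rmorph_sum /evalp (@horner_coef_wide _ n); last first.
      rewrite size_map_poly; apply: leq_trans (size_poly n (fun l => nth 0 [seq tau (c i j l) | l : 'I_n] l)).
      by apply: leq_trans (size_poly _ _) _.
    apply/eqP; rewrite subr_eq0; apply/eqP/eq_bigr => l _.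
    by rewrite rmorphM phiE rmorphXn /= !coef_map /= Gl tauE.
  move=> /minF/dvdpP[q qE].
  have hq : pol_in AV q.
    apply: (pol_in_divl sA mF polF); rewrite mulrC -qE => l; rewrite coef_map.
    exact: subring_valP.
  have [q0 q0E] := pol_lift sA hq.
  have GE : G = q0 * F0.
    apply: (map_inj_poly (@subring_val_inj _ _ sA) (rmorph0 vl)).
    by rewrite qE rmorphM /= q0E F0E.
  have fm : f.[s`_m] = 0 by apply/rootP; rewrite sE root_prod_XsubC mem_nth // ss.
  have : (map_poly rho G).[s`_m] = 0 by rewrite GE rmorphM /= hornerM fm mulr0.
  rewrite rmorphB rmorphM /= !map_polyXn !hornerE => /eqP; rewrite subr_eq0 => /eqP ->.
  rewrite (@horner_coef_wide _ n); last by rewrite (leq_trans (size_poly _ _)) ?size_poly.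
  by apply: eq_bigr => l _; rewrite coef_map Gl.
pose C' i := map_mx ev (c i).
have CW i : C' i *m W = W *m diag_mx (\row_m s`_m ^+ i).
  apply/matrixP => j m; rewrite mul_mx_diag !mxE.
  by under eq_bigr do rewrite !mxE; rewrite rel mulrC.
have uW : W \in unitmx by rewrite unitmxE unitfE.
have trC i : \tr (C' i) = \sum_(m < n) s`_m ^+ i.
  rewrite -[C' i](mulmxK uW) CW -mulmxA mxtrace_mulC -mulmxA mulVmx // mulmx1 mxtrace_diag.
  by apply: eq_bigr => m _; rewrite mxE.
rewrite -det_map_mx.
have -> : map_mx ev (\matrix_(i, j) \sum_l c i j l * \tr (c l)) = W *m W^T.
  apply/matrixP => i j; rewrite !mxE rmorph_sum.
  transitivity (\sum_l ev (c i j l) * \sum_(m < n) s`_m ^+ l).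
    by apply: eq_bigr => l _; rewrite -trC trace_map_mx -rmorphM.
  under eq_bigr do rewrite mulr_sumr; rewrite exchange_big /=; apply: eq_bigr => m _.
  by rewrite rel !mxE.
by rewrite det_mulmx det_tr => /eqP; rewrite mulf_eq0 orbb (negPf W0).
Qed.

Lemma cover_separable_basis : separable_basis (phi) (fun i : 'I_n => Y ^+ i).
Proof.
have cP (i j : 'I_n) : exists a : {ffun 'I_n -> A}, Y ^+ i * Y ^+ j = \sum_l phi (a l) * Y ^+ l.
  by have [a [aE _]] := cover_decomposition (Y ^+ i * Y ^+ j); exists a.
have [c cE] := choice (fun ij : 'I_n * 'I_n => cP ij.1 ij.2).
exists (fun i => \matrix_(j, l) c (i, j) l); split; first exact: cover_decomposition.
  by move=> i j; rewrite (cE (i, j)); under [RHS]eq_bigr do rewrite mxE.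
set d := \det _.
have ud x : V x -> unit_at d x.
  move=> Vx; have h z : V z -> z <> gpt D -> unit_at d z.
    move=> Vz zg; apply: discriminant_unit => // i j; rewrite (cE (i, j)) /=.
    by under [RHS]eq_bigr do rewrite mxE.
  (* The discriminant is only computed at closed points; being a unit at [x0], it is one near [x0],
     hence at the generic point. *)
  have [->|xg] := EM (x = gpt D); last exact: h.
  exact: (gptP D (basic d) _ (h x0 Vx0 x0g)).
have [x Vx|b bE] := germ_glue gV (q := (gA d)^-1).
  by have [_ h] := (germ_inv gV d Vx).1 (ud x Vx).
have d0 : gA d != 0 by have [h _] := (germ_inv gV d Vx0).1 (ud _ Vx0).
by exists b; apply: gAi; rewrite rmorphM rmorph1 bE divff.
Qed.

End FiniteEtale.

Lemma irreducible_minimal (K L : fieldType) (iK : {rmorphism K -> L}) (y : L) (F p : {poly K}) :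
  irreducible_poly F -> evalp iK y F = 0 -> evalp iK y p = 0 -> F %| p.
Proof.
move=> [_ irrF] Fy py; have [cop|ncop] := boolP (coprimep F p).
  have [[u v] /= uv] := Bezout_eq1_coprimepP _ _ cop.
  have := congr1 (evalp iK y) uv; rewrite rmorphD !rmorphM /= Fy py !mulr0 addr0 rmorph1.
  by move/eqP; rewrite eq_sym oner_eq0.
by rewrite -(eqp_dvdl _ (irrF _ ncop (dvdp_gcdl F p))) dvdp_gcdr.
Qed.

Lemma trinomial_relation (B : comPzRingType) (L : fieldType) (g : {rmorphism B -> L}) n s (Y b : B) :
  injective g -> g Y ^+ n - g b * g Y ^+ s + 1 = 0 -> Y ^+ n - b * Y ^+ s + 1 = 0.
Proof.
by move=> gi h; apply: gi; rewrite rmorph0 rmorphD rmorphB rmorphM !rmorphXn rmorph1.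
Qed.

Section TrinomialCover.
Variables (k : closedFieldType) (p : nat) (hp : p \in [pchar k]).
Variables (C : scheme) (D : curve k C) (t : cfield D) (n s : nat) (c0 : C).
Hypotheses (tO : forall x, local_ring D x t) (s0 : (0 < s)%N) (sn : (s < n)%N).
Hypotheses (ps : (p %| s)%N) (pn : ~~ (p %| n)%N) (c0g : c0 <> gpt D).
Hypothesis irr : irreducible_poly (trinomial n s t).
Local Notation F := (trinomial n s t).
Local Notation K := (cfield D).

Lemma trinomial_regular x : pol_in (local_ring D x) F.
Proof.
have sO := local_ring_subring D x; rewrite /trinomial -mul_polyC.
have polX i : pol_in (local_ring D x) ('X^i : {poly K}).
  by elim: i => [|i IH]; [exact: (pol_in1 sO)|rewrite exprS; exact: (pol_inM sO (pol_inX sO) IH)].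
apply: pol_inD => //; last exact: pol_in1.
by apply: pol_inB => //; apply: pol_inM => //; apply: pol_inC.
Qed.

Lemma trinomial_separable x l : x <> gpt D -> ~ inv_in (local_ring D x) F.[cconst D l] ->
  inv_in (local_ring D x) F^`().[cconst D l].
Proof.
move=> xg; have hO := curve_dvrP xg.
have sK : s%:R = 0 :> K.
  by rewrite -(rmorph_nat (cconst D)); have/eqP -> : s%:R == 0 :> k; rewrite -?(dvdn_pcharf hp) // rmorph0.
have nk : n%:R != 0 :> k by rewrite -(dvdn_pcharf hp).
have -> : F^`().[cconst D l] = cconst D (n%:R * l ^+ n.-1).
  have sP : s%:R = 0 :> {poly K} by rewrite -(rmorph_nat (@polyC K)) sK; exact: polyC0.
  rewrite /trinomial derivD derivB derivZ !derivXn derivC addr0 -[_ *+ s]mulr_natl sP mul0r scaler0 subr0.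
  by rewrite hornerMn hornerXn rmorphM rmorph_nat rmorphXn /= mulr_natl.
move=> h; apply: (inv_const hO); rewrite mulf_neq0 // expf_eq0 negb_and; apply/orP; right.
apply/eqP => l0; apply: h; have -> : F.[cconst D l] = 1; last by apply: inv_in1; apply: local_ring_subring.
rewrite l0 rmorph0 /trinomial !hornerE !expr0n !gtn_eqF ?(leq_trans s0 (ltnW sn)) //.
by rewrite mulr0 subr0 add0r.
Qed.

Lemma trinomial_cover : exists E : etale_cover C, forall V : opens C, affine V -> V c0 ->
  affine (mpreim (cov_map E) V) /\ exists Y : sec (mpreim (cov_map E) V),
    separable_basis (pull (cov_map E) V) (fun i : 'I_n => Y ^+ i) /\
    forall (gV : V (gpt D)) tV, germ D V gV tV = t ->
      Y ^+ n - pull (cov_map E) V tV * Y ^+ s + 1 = 0.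
Proof.
have mF : F \is monic by apply: trinomial_monic.
have [L [iK [y hyF]]] : exists (L : fieldType) (iK : {rmorphism K -> L}) y, evalp iK y F = 0.
  have F0 : F != 0 by apply: monic_neq0.
  have [L [zs pE]] := exists_splitting F0; exists L, (in_alg L : {rmorphism K -> L}).
  case: zs pE => [|z zs] pE.
    have := eqp_size pE; rewrite size_map_poly size_trinomial // big_nil size_poly1 => -[n0].
    by move: sn; rewrite n0.
  by exists z; apply/rootP; rewrite (eqp_root pE) root_prod_XsubC inE eqxx.
have minF q : evalp iK y q = 0 -> F %| q by apply: irreducible_minimal.
have regF := trinomial_regular; have sepF := trinomial_separable.
pose E := cover_scheme mF minF hyF regF; pose pi := cover_proj mF minF hyF regF : scheme_morphism E C.
have sF : (size F).-1 = n by rewrite size_trinomial.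
have main (V : opens C) x0 (aV : affine V) (Vx0 : V x0) : x0 <> gpt D ->
    affine (mpreim pi V) /\ exists Y : sec (mpreim pi V),
    separable_basis (pull pi V) (fun i : 'I_n => Y ^+ i) /\
    forall (gV : V (gpt D)) tV, germ D V gV tV = t -> Y ^+ n - pull pi V tV * Y ^+ s + 1 = 0.
  move=> x0g; have gV : V (gpt D) := gptP D V _ Vx0.
  split; first exact: over_affine mF minF hyF regF _ aV gV.
  have [|Y YE] := @sec_ex _ _ _ _ _ _ _ mF minF hyF regF V aV gV y.
    by exists 'X; split; [apply: pol_inX; apply: regular_on_sub|rewrite evalpX].
  pose gm := cgerm (esub mF minF regF) (gV : over mF minF regF V (egen iK y F)).
  have gmi : injective gm by apply: cgerm_inj.
  have phiE a : gm (pull pi V a) = iK (germ D V gV a) by apply: cover_proj_germ.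
  have gmP b : regular_over iK y V (gm b) by apply: sec_regular.
  exists Y; split.
    have := @cover_separable_basis _ _ _ _ _ _ _ mF minF hyF regF sepF V gV _ Vx0 x0g
      (sec (mpreim pi V)) (pull pi V) gm gmi phiE gmP Y YE.
    by rewrite sF.
  move=> gV' tV tE; apply: (@trinomial_relation (sec (mpreim pi V)) L gm _ _ _ _ gmi).
  rewrite phiE YE (_ : germ D V gV tV = t); last by rewrite -tE (Prop_irrelevance gV gV').
  have := hyF; rewrite /trinomial rmorphD rmorphB /= rmorph1 rmorphXn /= evalpX => <-.
  by rewrite -mul_polyC rmorphM rmorphXn /= evalpC evalpX.
have fe : finite_etale pi.
  move=> x; have [V [Vx aV Vx0]] : exists V : opens C, [/\ V x, affine V & exists2 x0, V x0 & x0 <> gpt D].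
    have [xg|xg] := EM (x = gpt D).
      (* The neighbourhood of the generic point has to contain another point as well, and [c0]
         provides one. *)
      have [V [Vc aV]] := sch_affine c0; exists V; split=> //; last by exists c0.
      by rewrite xg; apply: gptP Vc.
    by have [V [Vx aV]] := sch_affine x; exists V; split=> //; exists x.
  case: Vx0 => x0 Vx0 x0g; have [aE [Y [[c [h1 h2 h3]] _]]] := main V x0 aV Vx0 x0g.
  by exists V; split=> //; exists n, (fun i => Y ^+ i), c.
exists (EtaleCover fe) => V aV Vc; exact: (main V c0 aV Vc c0g).
Qed.

End TrinomialCover.

(** * Galois action on the fibres *)

(** Write N as the product of a matrix of full column rank by one of full row rank. If N N = 0 then
    their product in the reverse order, which has the same trace, is zero. *)
Lemma square_zero_trace (F : fieldType) n (N : 'M[F]_n) : N *m N = 0 -> \tr N = 0.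
Proof.
rewrite -{1 2 3}(mulmx_base N) => h; rewrite mxtrace_mulC.
suff -> : row_base N *m col_base N = 0 by rewrite mxtrace0.
apply: (row_full_inj (col_base_full N)); apply: (row_free_inj (row_base_free N)).
by rewrite mulmx0 mul0mx mulmxA -mulmxA.
Qed.

Section TraceForm.
Variables (F : fieldType) (n : nat) (C : 'I_n -> 'M[F]_n).
Hypotheses (C1 : exists x : 'I_n -> F, 1%:M = \sum_i x i *: C i).
Hypothesis CM : forall i j, exists x : 'I_n -> F, C i *m C j = \sum_l x l *: C l.
Hypothesis Ccomm : forall i j, C i *m C j = C j *m C i.
Hypothesis Cdet : \det (\matrix_(i, j) \tr (C i *m C j)) != 0.

Definition mx_span (N : 'M[F]_n) : Prop := exists x : 'I_n -> F, N = \sum_i x i *: C i.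

Lemma mx_spanD N N' : mx_span N -> mx_span N' -> mx_span (N + N').
Proof.
move=> [x ->] [x' ->]; exists (fun i => x i + x' i); rewrite -big_split.
by apply: eq_bigr => i _; rewrite scalerDl.
Qed.

Lemma mx_spanZ a N : mx_span N -> mx_span (a *: N).
Proof.
move=> [x ->]; exists (fun i => a * x i); rewrite scaler_sumr.
by apply: eq_bigr => i _; rewrite scalerA.
Qed.

Lemma mx_span_sum (I : Type) (r : seq I) (G : I -> 'M[F]_n) :
  (forall i, mx_span (G i)) -> mx_span (\sum_(i <- r) G i).
Proof.
move=> hG; elim/big_ind: _ => // [|N N']; last exact: mx_spanD.
by exists (fun=> 0); rewrite big1 // => i _; rewrite scale0r.
Qed.

Lemma mx_spanM N N' : mx_span N -> mx_span N' -> mx_span (N *m N').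
Proof.
move=> [x ->] [x' ->]; rewrite mulmx_suml; apply: mx_span_sum => i.
rewrite mulmx_sumr; apply: mx_span_sum => j.
rewrite -scalemxAl -scalemxAr; do 2 apply: mx_spanZ; exact: CM.
Qed.

Lemma mx_span_comm N i : mx_span N -> N *m C i = C i *m N.
Proof.
move=> [x ->]; rewrite mulmx_suml mulmx_sumr; apply: eq_bigr => j _.
by rewrite -scalemxAl -scalemxAr Ccomm.
Qed.

(** N commutes with the algebra, so that each N C_j has square zero and trace zero; N is then in the
    kernel of the trace form, which is nondegenerate. *)
Lemma mx_span_reduced N : mx_span N -> N *m N = 0 -> N = 0.
Proof.
move=> sN NN; case: (sN) => x NE; pose X := \row_i x i.
have XT : X *m (\matrix_(i, j) \tr (C i *m C j)) = 0.
  apply/rowP => j; rewrite !mxE.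
  transitivity (\tr (N *m C j)).
    rewrite NE mulmx_suml linear_sum; apply: eq_bigr => i _.
    by rewrite -scalemxAl linearZ !mxE.
  by apply: square_zero_trace; rewrite mulmxA -[N *m C j *m N]mulmxA -(mx_span_comm j sN) !mulmxA NN !mul0mx.
have uT : (\matrix_(i, j) \tr (C i *m C j)) \in unitmx by rewrite unitmxE unitfE.
have X0 : X = 0 by rewrite -[X](mulmxK uT) XT mul0mx.
by rewrite NE big1 // => i _; have /rowP/(_ i) := X0; rewrite !mxE => ->; rewrite scale0r.
Qed.

End TraceForm.

(** If (X - a)^2 q were the minimal polynomial, (X - a) q would take at [M] a value of square zero,
    hence zero, against minimality. *)
Lemma minpoly_squarefree (F : fieldType) n (C : 'I_n.+1 -> 'M[F]_n.+1) M a :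
  mx_span C 1%:M -> (forall i j, mx_span C (C i *m C j)) -> (forall i j, C i *m C j = C j *m C i) ->
  \det (\matrix_(i, j) \tr (C i *m C j)) != 0 -> mx_span C M ->
  ~ (('X - a%:P) ^+ 2 %| mxminpoly M).
Proof.
move=> C1 CM Cc Cd sM /dvdpP[q qE].
have sH p : mx_span C (horner_mx M p).
  elim/poly_ind: p => [|p c IH]; first by rewrite rmorph0; have := mx_spanZ 0 C1; rewrite scale0r.
  rewrite rmorphD rmorphM /= horner_mx_X horner_mx_C -scalemx1.
  by apply: mx_spanD; [apply: mx_spanM|apply: mx_spanZ].
pose N := horner_mx M (('X - a%:P) * q).
have NN : N *m N = 0.
  rewrite -[LHS](rmorphM (horner_mx M)) /= (_ : _ * _ = mxminpoly M * q).
    by rewrite rmorphM /= mx_root_minpoly mul0r.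
  by rewrite qE; ring.
have N0 : N = 0 := mx_span_reduced Cc Cd (sH _) NN.
have m0 : mxminpoly M != 0 by apply: monic_neq0; apply: mxminpoly_monic.
have q0 : q != 0 by apply: contra_neq m0 => q0; rewrite qE q0 mul0r.
have := dvdp_leq _ (mxminpoly_min N0).
rewrite mulf_neq0 ?polyXsubC_eq0 // qE => /(_ isT).
rewrite expr2 mulrA [q * _]mulrC size_Mmonic ?mulf_neq0 ?polyXsubC_eq0 ?monicXsubC //.
rewrite size_XsubC addn2 /= ltnn; by [].
Qed.

Lemma double_root (F : fieldType) (zs : seq F) : ~~ uniq zs ->
  exists a, ('X - a%:P) ^+ 2 %| \prod_(z <- zs) ('X - z%:P).
Proof.
elim: zs => //= z zs IH; rewrite negb_and negbK => /orP[zz|/IH[a ha]].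
  exists z; rewrite big_cons expr2 dvdp_mul // dvdp_XsubCl root_prod_XsubC //.
by exists a; rewrite big_cons dvdp_mull.
Qed.

Section SeparableAlgebra.
Variables (A B : comPzRingType) (phi : {rmorphism A -> B}) (n : nat) (e : 'I_n -> B).
Hypothesis sb : separable_basis phi e.

Lemma trace_form : exists (rho : B -> 'M[A]_n) (delta : A),
  [/\ (forall x i, x * e i = \sum_j phi (rho x i j) * e j),
      (forall x y, rho (x + y) = rho x + rho y),
      (forall x y, rho (x * y) = rho x *m rho y),
      (forall a, rho (phi a) = a%:M) &
      \det (\matrix_(i, j) \tr (rho (e i) *m rho (e j))) * delta = 1].
Proof.
have [c [basis cE [delta dE]]] := sb.
have [rho [r1 r2 r3 r4]] := regular_representation basis.
exists rho, delta; split=> //.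
have cr i j l : c i j l = rho (e i) j l.
  by apply: (basis_inj basis (a := c i j) (a' := rho (e i) j)); rewrite -cE r1.
have r0 : rho 0 = 0 by rewrite -(rmorph0 phi) r4; apply/matrixP => i j; rewrite !mxE mul0rn.
rewrite -[RHS]dE; congr (\det _ * _); apply/matrixP => i j; rewrite !mxE.
rewrite -r3 cE (big_morph _ r2 r0) raddf_sum; apply: eq_bigr => l _.
rewrite r3 r4 mul_scalar_mx [LHS]mxtraceZ.
by congr (_ * \tr _); apply/matrixP => ? ?; rewrite cr.
Qed.

(** Dedekind's argument: the [h l] form a basis of the linear forms on the free algebra, so that g
    is a combination of them with coefficients w_l. Multiplicativity yields w_l (g b - h_l b) = 0
    for all b, and some w_l is nonzero. *)
Lemma hom_unique (S : fieldType) (j : {rmorphism A -> S}) (h : 'I_n -> {rmorphism B -> S})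
    (g : {rmorphism B -> S}) :
  (forall l a, h l (phi a) = j a) -> (\matrix_(l, i) h l (e i)) \in unitmx ->
  (forall a, g (phi a) = j a) -> exists l, forall b, g b = h l b.
Proof.
move=> hj hu gj; set W := \matrix_(l, i) _ in hu.
pose v : 'rV[S]_n := \row_i g (e i); pose w := v *m invmx W.
have vE : v = w *m W by rewrite mulmxKV.
clearbody w; have [rho [_ [r1 _ _ _ _]]] := trace_form.
have act (f : {rmorphism B -> S}) b i : (forall a, f (phi a) = j a) ->
    f b * f (e i) = \sum_l j (rho b i l) * f (e l).
  move=> fj; rewrite -rmorphM r1 rmorph_sum; apply: eq_bigr => l _.
  by rewrite rmorphM /= fj.
have key b : w *m diag_mx (\row_l (g b - h l b)) = 0.
  have E : w *m diag_mx (\row_l (g b - h l b)) *m W = 0.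
    apply/rowP => i; rewrite !mxE.
    transitivity (g b * v 0 i - \sum_l j (rho b i l) * v 0 l).
      rewrite [in RHS]vE mxE mulr_sumr.
      under [X in _ - X]eq_bigr do rewrite mxE mulr_sumr.
      rewrite exchange_big -sumrB; apply: eq_bigr => l _.
      under [X in _ - X]eq_bigr do rewrite mulrCA.
      rewrite -mulr_sumr mul_mx_diag !mxE.
      under [X in _ - _ * X]eq_bigr do rewrite mxE.
      by rewrite -(act (h l)) //; ring.
    rewrite mxE (act g) // -sumrB big1 // => l _; rewrite mxE subrr //.
  by rewrite -[LHS](mulmxK hu) E mul0mx.
have [l wl] : exists l, w 0 l != 0.
  apply: contrapT => nw; have w0 : w = 0.
    apply/rowP => l; rewrite [RHS]mxE; apply/eqP; apply: contrapT => /negP wl.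
    by apply: nw; exists l.
  have v0 i : g (e i) = 0 by have := congr1 (fun u : 'rV_n => u 0 i) vE; rewrite w0 mul0mx !mxE.
  have [c [basis _ _]] := sb; have [a [aE _]] := basis 1.
  have := rmorph1 g; rewrite aE rmorph_sum big1 => [/eqP|i _]; last by rewrite rmorphM /= v0 mulr0.
  by rewrite eq_sym oner_eq0.
exists l => b; apply/eqP; rewrite -subr_eq0; have /rowP/(_ l) := key b.
by rewrite mul_mx_diag !mxE => /eqP; rewrite mulf_eq0 (negPf wl).
Qed.

(** The vector of the g(e_i) is a nonzero eigenvector, with eigenvalue g(b), of the matrix of the
    multiplication by b, whose entries come from R. *)
Lemma hom_integral (S : fieldType) (R : comNzRingType) (f : {rmorphism R -> S}) (r : {rmorphism A -> R})
    (g : {rmorphism B -> S}) : (forall a, g (phi a) = f (r a)) -> forall b, integralOver f (g b).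
Proof.
move=> gf b; have [rho [_ [r1 _ _ _ _]]] := trace_form.
exists (char_poly (map_mx r (rho b))^T); first exact: char_poly_monic.
rewrite -[map_poly _ _]/(map_poly f _) map_char_poly -eigenvalue_root_char.
apply/eigenvalueP; exists (\row_i g (e i)).
  apply/rowP => i; rewrite !mxE -rmorphM r1 rmorph_sum; apply: eq_bigr => l _.
  by rewrite !mxE rmorphM /= gf mulrC.
apply/eqP => /rowP v0; have [c [basis _ _]] := sb; have [a [aE _]] := basis 1.
have := rmorph1 g; rewrite aE rmorph_sum big1 => [/eqP|i _].
  by rewrite eq_sym oner_eq0.
by have := v0 i; rewrite !mxE rmorphM /= => ->; rewrite mulr0.
Qed.

End SeparableAlgebra.

Section SeparableHoms.
Variables (A B : comPzRingType) (phi : {rmorphism A -> B}).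

Section Positive.
Variables (n : nat) (e : 'I_n.+1 -> B).
Hypothesis sb : separable_basis phi e.
Variables (rho : B -> 'M[A]_n.+1) (delta : A).
Hypotheses (r1 : forall x i, x * e i = \sum_j phi (rho x i j) * e j)
  (r2 : forall x y, rho (x + y) = rho x + rho y) (r3 : forall x y, rho (x * y) = rho x *m rho y)
  (r4 : forall a, rho (phi a) = a%:M)
  (dE : \det (\matrix_(i, j) \tr (rho (e i) *m rho (e j))) * delta = 1).

Section Field.
Variables (F : fieldType) (j : {rmorphism A -> F}).
Let C i := map_mx j (rho (e i)).

Lemma rho_decomposition x : exists a : 'I_n.+1 -> A, map_mx j (rho x) = \sum_i j (a i) *: C i.
Proof.
have [c [basis _ _]] := sb; have [a [-> _]] := basis x; exists a.
have r0 : rho 0 = 0 by rewrite -(rmorph0 phi) r4; apply/matrixP => ? ?; rewrite !mxE mul0rn.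
rewrite (big_morph _ r2 r0) (big_morph _ (@map_mxD _ _ j _ _) (@map_mx0 _ _ j _ _)); apply: eq_bigr => i _.
by rewrite r3 r4 mul_scalar_mx map_mxZ.
Qed.

Lemma rho_span x : mx_span C (map_mx j (rho x)).
Proof. by have [a ->] := rho_decomposition x; exists (fun i => j (a i)). Qed.

Lemma rho_minpoly x a : ~ (('X - a%:P) ^+ 2 %| mxminpoly (map_mx j (rho x))).
Proof.
have CC i l : C i *m C l = map_mx j (rho (e i * e l)) by rewrite r3 map_mxM.
apply: (@minpoly_squarefree _ _ C); last exact: rho_span.
- rewrite (_ : 1%:M = map_mx j (rho 1)); first exact: rho_span.
  by rewrite -(rmorph1 phi) r4 map_scalar_mx rmorph1.
- by move=> i l; rewrite CC; apply: rho_span.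
- by move=> i l; rewrite !CC mulrC.
- have := congr1 j dE; rewrite rmorphM rmorph1 /= => h; apply/eqP => d0.
  have := oner_neq0 F; rewrite -h (_ : j (\det _) = 0) ?mul0r ?eqxx // -det_map_mx -[RHS]d0.
  by congr (\det _); apply/matrixP => i l; rewrite !mxE -trace_map_mx map_mxM.
Qed.

End Field.

Lemma minpoly_separable (K : fieldType) (gA : {rmorphism A -> K}) x :
  separable_poly (mxminpoly (map_mx gA (rho x))).
Proof.
set m := mxminpoly _; have m0 : m != 0 by apply: monic_neq0; apply: mxminpoly_monic.
have [T [zs zsE]] := exists_splitting m0.
rewrite -(separable_map (in_alg T)) (eqp_separable zsE) separable_prod_XsubC.
apply: contrapT => /negP/double_root[a]; rewrite -(eqp_dvdr _ zsE) -mxminpoly_map -map_mx_comp.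
exact: (@rho_minpoly _ (in_alg T \o gA)).
Qed.

(** The matrices of the multiplications commute and, their minimal polynomials being separable and
    split in [S], are simultaneously diagonalizable. The diagonal entries are the morphisms, and the
    square of det h_l(e_i) is the discriminant, of inverse [delta]. *)
Lemma separable_homs_pos (K S : fieldType) (gA : {rmorphism A -> K}) (iS : {rmorphism K -> S}) :
  (forall i, splits (map_poly iS (mxminpoly (map_mx gA (rho (e i)))))) ->
  exists h : 'I_n.+1 -> {rmorphism B -> S}, (forall l a, h l (phi a) = iS (gA a)) /\
    \det (\matrix_(l, i) h l (e i)) ^+ 2 * iS (gA delta) = 1.
Proof.
move=> spl; pose j : {rmorphism A -> S} := iS \o gA.
pose M x := map_mx j (rho x).
pose As := [seq M (e i) | i : 'I_n.+1].
have /codiagonalizableP[P uP /allP PD] : {in As &, forall A B, comm_mx A B} /\ {in As, forall A, diagonalizable A}.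
  split=> [_ _ /mapP[i _ ->] /mapP[i' _ ->]|_ /mapP[i _ ->]].
    by rewrite /comm_mx /M -!map_mxM -!r3 mulrC.
  apply/diagonalizableP; have [zs zsE] := spl i; exists zs.
    have := minpoly_separable gA (e i); rewrite -(separable_map iS) (eqp_separable zsE).
    by rewrite separable_prod_XsubC.
  by rewrite -(eqp_dvdr _ zsE) -mxminpoly_map -map_mx_comp.
pose N x := P *m M x *m invmx P.
have ND x : is_diag_mx (N x).
  have [a aE] := rho_decomposition j x; rewrite /N /M aE mulmx_sumr mulmx_suml.
  apply/is_diag_mxP => i l il; rewrite summxE big1 // => m _.
  rewrite -scalemxAr -scalemxAl mxE.
  have /PD : M (e m) \in As by apply: (map_f (fun i => M (e i))); rewrite mem_enum.
  move=> /= /(diagonalizable_forP (M (e m)) uP)h.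
  by rewrite [X in _ * X](h i l il) mulr0.
have N0 x i l : i != l -> N x i l = 0 by have /is_diag_mxP := ND x; apply.
have NB x y : N (x - y) = N x - N y.
  rewrite /N /M.
  have -> : rho (x - y) = rho x - rho y.
    by apply/eqP; rewrite eq_sym subr_eq -r2 subrK.
  by rewrite map_mxB mulmxBr mulmxBl.
have NM x y : N (x * y) = N x *m N y.
  by rewrite /N /M r3 map_mxM !mulmxA mulmxKV.
have N1 a : N (phi a) = (j a)%:M.
  by rewrite /N /M r4 map_scalar_mx scalar_mxC -mulmxA mulmxV // mulmx1.
have hB l : zmod_morphism (fun x => N x l l) by move=> x y; rewrite NB !mxE.
have hM l : monoid_morphism (fun x => N x l l).
  split=> [|x y]; first by rewrite -(rmorph1 phi) N1 rmorph1 mxE eqxx.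
  rewrite NM mxE (bigD1 l) //= big1 ?addr0 // => i il.
  by rewrite N0 ?mul0r // eq_sym.
exists (fun l => mk_rmorphism (hB l) (hM l)); split=> [l a|]; first by rewrite /= N1 mxE eqxx.
set W := \matrix_(l, i) _.
have -> : \det W ^+ 2 = j (\det (\matrix_(i, j) \tr (rho (e i) *m rho (e j)))).
  rewrite expr2 -{1}(det_tr W) -det_mulmx -det_map_mx; congr (\det _); apply/matrixP => i i'.
  rewrite [RHS]mxE [X in j X]mxE [LHS]mxE -r3 -trace_map_mx.
  transitivity (\tr (N (e i * e i'))); last first.
    by rewrite /N mxtrace_mulC mulmxA mulVmx // mul1mx.
  have WE a b : W a b = N (e b) a a by rewrite mxE.
  by apply: eq_bigr => l _; rewrite [W^T i l]mxE !WE; apply/esym/(hM l).2.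
by rewrite -rmorphM dE rmorph1.
Qed.

End Positive.

Lemma separable_homs n (e : 'I_n -> B) (K : fieldType) (gA : {rmorphism A -> K}) : separable_basis phi e ->
  exists (ps : seq {poly K}) (delta : A), all (@separable_poly K) ps /\
  forall (S : fieldType) (iS : {rmorphism K -> S}), (forall p, p \in ps -> splits (map_poly iS p)) ->
    exists h : 'I_n -> {rmorphism B -> S}, (forall l a, h l (phi a) = iS (gA a)) /\
      \det (\matrix_(l, i) h l (e i)) ^+ 2 * iS (gA delta) = 1.
Proof.
(* Minimal polynomials are taken of nonempty matrices, so that the algebra of rank 0 is treated
   apart. *)
case: n e => [|n] e sb.
  exists [::], 1; split=> // S iS _.
  have h0 : 'I_0 -> {rmorphism B -> S} by case.
  by exists h0; split=> [[]//|]; rewrite det_mx00 !rmorph1 expr1n mulr1.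
have [rho [delta [r1 r2 r3 r4 dE]]] := trace_form sb.
exists [seq mxminpoly (map_mx gA (rho (e i))) | i : 'I_n.+1], delta; split.
  by apply/allP => _ /mapP[i _ ->]; apply: (minpoly_separable sb r2 r3 r4 dE).
move=> S iS spl; have [|h hP] := @separable_homs_pos _ _ sb rho delta r2 r3 r4 dE K S gA iS; last by exists h.
move=> i.
by apply: spl; apply: (map_f (fun i => mxminpoly (map_mx gA (rho (e i))))); rewrite mem_enum.
Qed.

End SeparableHoms.

Lemma localization_extend (B B' : comPzRingType) (S : fieldType) (r : {rmorphism B -> B'}) (s : B)
    (h : {rmorphism B -> S}) :
  (exists t, r s * t = 1) -> (forall t, exists n a, r s ^+ n * t = r a) ->
  (forall a, r a = 0 -> exists n, s ^+ n * a = 0) -> h s != 0 ->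
  exists h' : {rmorphism B' -> S}, forall t n a, r s ^+ n * t = r a -> h' t * h s ^+ n = h a.
Proof.
move=> _ frac zero hs.
have uniq t n a n' a' : r s ^+ n * t = r a -> r s ^+ n' * t = r a' -> h a / h s ^+ n = h a' / h s ^+ n'.
  move=> E E'; apply/eqP; rewrite eqr_div ?expf_neq0 // -!rmorphXn -!rmorphM /=.
  have [|m] := zero (a * s ^+ n' - a' * s ^+ n).
    by rewrite rmorphB !rmorphM !rmorphXn -E -E' /=; ring.
  move=> /(congr1 h); rewrite rmorphM rmorph0 rmorphB => /eqP.
  by rewrite mulf_eq0 rmorphXn expf_eq0 (negPf hs) andbF /= subr_eq0.
have [N NE] := choice frac; have [a aE] := choice NE.
pose h' t := h (a t) / h s ^+ N t.
have h'E t n b : r s ^+ n * t = r b -> h' t = h b / h s ^+ n by move=> E; apply: uniq (aE t) E.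
have hB : zmod_morphism h'.
  move=> t t'; rewrite (h'E _ (N t + N t')%N (a t * s ^+ N t' - a t' * s ^+ N t)).
    by rewrite rmorphB !rmorphM !rmorphXn /h' exprD; field; rewrite !expf_neq0.
  by rewrite rmorphB !rmorphM !rmorphXn -!aE exprD; ring.
have hM : monoid_morphism h'.
  split=> [|t t']; first by rewrite (h'E _ 0%N 1) ?rmorph1 ?divr1 // mulr1.
  rewrite (h'E _ (N t + N t')%N (a t * a t')) ?rmorphM ?exprD -?aE; last by ring.
  by rewrite /h' mulf_div.
exists (mk_rmorphism hB hM) => t n b E; rewrite /= (h'E _ _ _ E) divfK // expf_neq0 //.
Qed.

Record cover_chart (C : scheme) (c : C) (Y : etale_cover C) := CoverChart {
  ch_open : opens C;
  ch_mem : ch_open c;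
  ch_affine : affine ch_open;
  ch_affine_pre : affine (mpreim (cov_map Y) ch_open);
  ch_rank : nat;
  ch_basis : 'I_ch_rank -> sec (mpreim (cov_map Y) ch_open);
  ch_separable : separable_basis (pull (cov_map Y) ch_open) ch_basis }.

Lemma exists_chart (C : scheme) (c : C) (Y : etale_cover C) : exists _ : cover_chart c Y, True.
Proof.
have [V [Vc aV aE [n [e [cc [h1 h2 h3]]]]]] := @cov_fe C Y c.
have sb : separable_basis (pull (cov_map Y) V) e by exists cc.
by exists (CoverChart Vc aV aE sb).
Qed.

Section Fibres.
Variables (k : closedFieldType) (C : scheme) (D : curve k C) (c : C) (cg : c <> gpt D).
Local Notation K := (cfield D).
Local Notation kK := (cconst D).
Local Notation Oc := (local_ring D c).
Let hO := curve_dvrP cg.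
Let sO : is_subring Oc := local_ring_subring D c.
Local Notation Rc := (subring_of sO).
Local Notation vc := (@subring_val _ _ sO : {rmorphism Rc -> K}).

Section Chart.
Variables (Y : etale_cover C) (d : cover_chart c Y).
Local Notation V := (ch_open d).
Local Notation A := (sec V).
Local Notation B := (sec (mpreim (cov_map Y) V)).
Local Notation plY := (pull (cov_map Y) V).
Let gV : V (gpt D) := gptP D V _ (ch_mem d).

Definition chart_germ : {rmorphism A -> K} := germ D V gV.

Lemma chart_germ_inj : injective chart_germ.
Proof.
move=> a b /eqP; rewrite -subr_eq0 -rmorphB => /eqP/germ_inj/eqP.
by rewrite subr_eq0 => /eqP.
Qed.

Lemma chart_local : exists r : {rmorphism A -> Rc}, forall a, vc (r a) = chart_germ a.
Proof. by apply: subring_lift => a; exists V, gV, a; split=> //; exact: (ch_mem d). Qed.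

Lemma chart_const : exists kA : {rmorphism k -> A}, forall x, chart_germ (kA x) = kK x.
Proof.
have h x : exists a, chart_germ a = kK x by apply: (regular_onP gV); apply: const_reg.
have [kA kAE] := choice h.
have kB : zmod_morphism kA by move=> a b; apply: chart_germ_inj; rewrite rmorphB !kAE rmorphB.
have kM : monoid_morphism kA.
  by split=> [|a b]; apply: chart_germ_inj; rewrite ?rmorph1 ?rmorphM !kAE ?rmorph1 ?rmorphM.
by exists (mk_rmorphism kB kM).
Qed.

Definition chart_polys : seq {poly K} :=
  sval (cid (separable_homs chart_germ (ch_separable d))).

End Chart.

Section Place.
Variables (S : galois_extension K).
Definition local_base : {rmorphism Rc -> S} := gbase S \o vc.
Variables (ev : {rmorphism Rc -> k}).
Hypotheses (ev0 : forall a, ev a = 0 <-> ~ inv_in Oc (vc a)) (evc : forall a x, vc a = kK x -> ev a = x).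
Variables (phi : {rmorphism integrals local_base -> k}).
Hypothesis phiE : forall x r, ival _ x = local_base r -> phi x = ev r.

Section OneChart.
Variables (Y : etale_cover C) (d : cover_chart c Y).
Local Notation V := (ch_open d).
Local Notation A := (sec V).
Local Notation B := (sec (mpreim (cov_map Y) V)).
Local Notation plY := (pull (cov_map Y) V).
Local Notation gA := (chart_germ d).
Local Notation n := (ch_rank d).
Local Notation ee := (@ch_basis _ _ _ d).

Definition over_hom (h : {rmorphism B -> S}) : Prop := forall a, h (plY a) = gbase S (gA a).

(* The place [phi \o h] of the function field of [Y] is centered at [y]. *)
Definition center (h : {rmorphism B -> S}) (y : Y) : Prop :=
  forall b x, ival _ x = h b -> unit_at b y <-> phi x != 0.

Lemma over_integral h : over_hom h -> exists h' : {rmorphism B -> integrals local_base}, forall b, ival _ (h' b) = h b.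
Proof.
move=> hh; apply: subring_lift => b; have [r rE] := chart_local d.
by apply: (hom_integral (ch_separable d) (r := r)) => a; rewrite hh /local_base /= rE.
Qed.

Lemma unit_c (r : {rmorphism A -> Rc}) (a : A) : (forall a, vc (r a) = gA a) -> unit_at a c <-> ev (r a) <> 0.
Proof.
move=> rE; rewrite (germ_inv (gptP D V _ (ch_mem d)) a (ch_mem d)) ev0 rE.
by split=> [h []//|h]; apply: contrapT.
Qed.

Lemma center_exists h : over_hom h -> exists2 y : Y, cov_map Y y = c & center h y.
Proof.
move=> hh; have [h' h'E] := over_integral hh; have [r rE] := chart_local d.
pose P := [set b : B | phi (h' b) = 0].
have pP : prime_ideal P.
  split; rewrite /P /=.
  - by rewrite !rmorph0.
  - by move=> a b ha hb; rewrite !rmorphD /= ha hb addr0.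
  - by move=> a b hb; rewrite !rmorphM /= hb mulr0.
  - by rewrite !rmorph1 => /eqP; rewrite oner_eq0.
  - by move=> a b; rewrite !rmorphM /= => /eqP; rewrite mulf_eq0 => /orP[]/eqP; [left|right].
have [y Vy Py] := prime_point (ch_affine_pre d) pP.
have uy b : unit_at b y <-> phi (h' b) <> 0.
  have := congr1 (fun Q => Q b) Py; rewrite /P /point_ideal /= => ->.
  by split=> [h1 h2|/contrapT//]; apply: h2.
exists y; last first.
  move=> b x xE; have -> : x = h' b by apply: ival_inj; rewrite h'E.
  by rewrite uy; split=> /eqP.
apply: (point_ideal_inj (ch_affine d)) => //; first exact: (ch_mem d).
have hu (a : A) : unit_at a (cov_map Y y) <-> unit_at a c.
  rewrite -(pull_unitP (f := cov_map Y) a Vy) uy (unit_c a rE) (phiE (r := r a)) //.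
  by rewrite h'E hh /local_base /= rE.
by apply/seteqP; split=> a; rewrite /point_ideal /= hu.
Qed.

Lemma center_unique h y y' : over_hom h -> cov_map Y y = c -> cov_map Y y' = c ->
  center h y -> center h y' -> y = y'.
Proof.
move=> hh yc y'c hy hy'; have [h' h'E] := over_integral hh.
have Vy z : cov_map Y z = c -> mpreim (cov_map Y) V z by move=> zc; rewrite /mpreim /= /preimage /= zc; exact: (ch_mem d).
apply: (point_ideal_inj (ch_affine_pre d)); [exact: Vy|exact: Vy|].
have hu (b : B) : unit_at b y <-> unit_at b y' by rewrite (hy b (h' b)) // (hy' b (h' b)).
by apply/seteqP; split=> a; rewrite /point_ideal /= hu.
Qed.

Hypothesis spl : forall p, p \in chart_polys d -> splits (map_poly (gbase S) p).

(** The n morphisms to [S] are reduced to morphisms [psi l] to k by the place. Their matrix stays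
    invertible because the discriminant is a unit at [c], so that every morphism to k over [c] is
    one of them, in particular the evaluation at each point of the fibre. *)
Lemma chart_homs : exists (h : 'I_n -> {rmorphism B -> S}) (psi : 'I_n -> {rmorphism B -> k})
    (kB : {rmorphism k -> B}),
  [/\ (forall l, over_hom (h l)), (\matrix_(l, i) h l (ee i)) \in unitmx,
      (forall l b x, ival _ x = h l b -> psi l b = phi x),
      (\matrix_(l, i) psi l (ee i)) \in unitmx &
      [/\ (forall l x, psi l (kB x) = x) &
          forall (y : Y), cov_map Y y = c -> exists l, forall b, unit_at b y <-> psi l b != 0]].
Proof.
have [r rE] := chart_local d; have [kA kAE] := chart_const d.
move: spl; rewrite /chart_polys; case: cid => ps /= [delta [_ hP]] spl'.
have [h [hh hdet]] := hP S (gbase S) spl'.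
have [h' h'E] : exists h' : 'I_n -> {rmorphism B -> integrals local_base}, forall l b, ival _ (h' l b) = h l b.
  have /choice[h' h'E] l := over_integral (hh l).
  by exists h'.
pose psi l : {rmorphism B -> k} := phi \o h' l.
have psiE l b x : ival _ x = h l b -> psi l b = phi x.
  by move=> xE; rewrite /psi /= (_ : h' l b = x) //; apply: ival_inj; rewrite h'E.
have psiA l a : psi l (plY a) = ev (r a).
  by rewrite /psi /=; apply: phiE; rewrite h'E hh /local_base /= rE.
have evA a x : gA a = kK x -> ev (r a) = x by move=> ax; apply: evc; rewrite rE.
have hdet' : \det (\matrix_(l, i) psi l (ee i)) ^+ 2 * ev (r delta) = 1.
  have [fI fIE] := integral_base local_base.
  have E : \det (\matrix_(l, i) h' l (ee i)) ^+ 2 * fI (r delta) = 1.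
    apply: ival_inj; rewrite rmorphM rmorph1 rmorphXn -det_map_mx fIE /local_base /= rE -[RHS]hdet.
    by congr (\det _ ^+ 2 * _); apply/matrixP => l i; rewrite !mxE h'E.
  have := congr1 phi E; rewrite rmorphM rmorph1 rmorphXn -det_map_mx (phiE (fIE _)) => <-.
  by congr (\det _ ^+ 2 * _); apply/matrixP => l i; rewrite !mxE.
clearbody psi.
have unit_of (F : fieldType) (M : 'M[F]_n) x : \det M ^+ 2 * x = 1 -> M \in unitmx.
  move=> E; rewrite unitmxE unitfE; apply/eqP => M0.
  by move: E; rewrite M0 expr0n mul0r => /eqP; rewrite eq_sym oner_eq0.
pose kB : {rmorphism k -> B} := plY \o kA.
have psik l x : psi l (kB x) = x by rewrite [LHS](psiA l (kA x)); apply: evA.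
have uW := unit_of _ _ _ hdet; have uU := unit_of _ _ _ hdet'.
exists h, psi, kB; split=> //; split=> // y yc.
have Vy : mpreim (cov_map Y) V y by rewrite /mpreim /= /preimage /= yc; exact: (ch_mem d).
pose Q := point_ideal (mpreim (cov_map Y) V) y.
have pQ : prime_ideal Q := point_ideal_prime (ch_affine_pre d) Vy.
have iQ := prime_ideal_ideal pQ.
have QA a : ev (r a) = 0 -> Q (plY a).
  move=> a0; rewrite /Q /point_ideal /= (pull_unitP (f := cov_map Y) a) ?yc; last exact: (ch_mem d).
  by rewrite (unit_c a rE).
(* The residue field at y is k: the product of the b - psi_l(b) is killed by all [psi m], hence its
   coordinates vanish at [c] and it lies in the ideal of y; so does one of its factors. *)
have resid b : exists x, Q (b - kB x).
  pose z := \prod_(l < n) (b - kB (psi l b)).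
  have Qz : Q z.
    have [cc [basis _ _]] := ch_separable d; have [a [aE _]] := basis z.
    pose al : 'rV[k]_n := \row_i ev (r (a i)).
    have al0 : al *m (\matrix_(l, i) psi l (ee i))^T = 0.
      apply/rowP => m; rewrite !mxE.
      transitivity (psi m z).
        by rewrite aE rmorph_sum; apply: eq_bigr => i _; rewrite !mxE rmorphM /= psiA.
      rewrite /z rmorph_prod (bigD1 m) //= rmorphB psik subrr mul0r //.
    have uT : (\matrix_(l, i) psi l (ee i))^T \in unitmx by rewrite unitmx_tr.
    have {}al0 : al = 0 by rewrite -[al](mulmxK uT) al0 mul0mx.
    rewrite aE; apply: ideal_sum => // i _; apply: (idealMl _ iQ); apply: QA.
    by have /rowP/(_ i) := al0; rewrite !mxE.
  move: Qz; rewrite /z; elim: (index_enum _) => [|l s IH].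
    by rewrite big_nil => Q1; case: pQ => _ _ _ /(_ Q1).
  rewrite big_cons; case: (pQ) => _ _ _ _ Qp => /Qp[Ql|/IH//].
  by exists (psi l b).
have [chi [chi0 chik]] := residue_morphism (phi := kB) pQ resid.
have chiA a : chi (plY a) = (ev \o r) a.
  have : chi (plY (a - kA (ev (r a)))) = 0.
    by apply/chi0/QA; rewrite !rmorphB /= (evA (kA _) (ev (r a))) // subrr.
  by rewrite rmorphB rmorphB /= -[plY (kA _)]/(kB _) chik => /eqP; rewrite subr_eq0 => /eqP.
have [l lE] := hom_unique (ch_separable d) (j := ev \o r) (h := psi) psiA uU chiA.
exists l => b; rewrite -lE; split=> [ub|/eqP nb].
  by apply/eqP => /chi0; apply.
by apply: contrapT => /chi0.
Qed.

Lemma fibre_hom y : cov_map Y y = c -> exists2 h, over_hom h & center h y.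
Proof.
have [h [psi [kB [hh _ psiE _ [_ hy]]]]] := chart_homs => /hy[l lP].
by exists (h l) => // b x xE; rewrite lP (psiE l b x xE).
Qed.

(** Morphisms with the same centre have reductions with the same kernel, hence equal reductions; but
    distinct [psi l] are linearly independent. *)
Lemma hom_index h h' : over_hom h -> over_hom h' -> forall y, center h y -> center h' y -> forall b, h b = h' b.
Proof.
have [g [psi [kB [gg uW psiE uU [psik _]]]]] := chart_homs => hh hh' y hy hy'.
have [l lE] := hom_unique (ch_separable d) (j := gbase S \o gA) gg uW hh.
have [m mE] := hom_unique (ch_separable d) (j := gbase S \o gA) gg uW hh'.
suff lm : l = m by move=> b; rewrite lE mE lm.
have [g' g'E] := over_integral (gg l); have [g2 g2E] := over_integral (gg m).
have ker b : psi l b = 0 -> psi m b = 0.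
  move=> /eqP b0; apply/eqP; move: b0; apply: contraLR => b1.
  rewrite (psiE l b (g' b) (g'E b)).
  have hb : ival local_base (g' b) = h b by rewrite lE; apply: g'E.
  have hb' : ival local_base (g2 b) = h' b by rewrite mE; apply: g2E.
  by apply/(hy b _ hb)/(hy' b _ hb'); rewrite -(psiE m b (g2 b) (g2E b)).
have eq b : psi m b = psi l b.
  have : psi m (b - kB (psi l b)) = 0 by apply: ker; rewrite rmorphB /= psik subrr.
  by rewrite rmorphB /= psik => /eqP; rewrite subr_eq0 => /eqP.
apply/eqP/negPn/negP => nlm; pose v : 'rV[k]_n := delta_mx 0 l - delta_mx 0 m.
have v0 : v *m (\matrix_(l, i) psi l (ee i)) = 0.
  by rewrite mulmxBl -!rowE; apply/rowP => i; rewrite !mxE eq subrr.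
have : v = 0 by rewrite -[v](mulmxK uU) v0 mul0mx.
move=> /rowP/(_ l); rewrite !mxE !eqxx (negPf nlm) subr0 => /eqP.
by rewrite oner_eq0.
Qed.

End OneChart.
End Place.
End Fibres.

Section Naturality.
Variables (k : closedFieldType) (C : scheme) (D : curve k C) (c : C) (cg : c <> gpt D).
Local Notation K := (cfield D).
Local Notation sO := (local_ring_subring D c).
Local Notation Rc := (subring_of sO).
Local Notation vc := (@subring_val _ _ sO : {rmorphism Rc -> K}).

Section Transport.
Variables (Y Z : etale_cover C) (m : cover_morphism Y Z) (dY : cover_chart c Y) (dZ : cover_chart c Z).
Local Notation VY := (ch_open dY).
Local Notation VZ := (ch_open dZ).
Local Notation BY := (sec (mpreim (cov_map Y) VY)).
Local Notation BZ := (sec (mpreim (cov_map Z) VZ)).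

(** A morphism of covers need not respect the charts. Both are compared over [basic u], a smaller
    neighbourhood of [c]: [tr b] is the numerator of the pulled back section and [N b] the exponent
    of [u] in its denominator. *)
Lemma pulled_hom : exists (u : sec VY) (tr : BZ -> BY) (N : BZ -> nat),
  [/\ unit_at u c, (forall b y, cov_map Y y = c -> unit_at b (m y) <-> unit_at (tr b) y) &
    forall (S : galois_extension K) (h : {rmorphism BY -> S}), over_hom (D := D) h ->
      exists2 g : {rmorphism BZ -> S}, over_hom (D := D) g &
        forall b, g b * gbase S (chart_germ D dY u) ^+ N b = h (tr b)].
Proof.
have [u [uc uVZ]] := basic_nbhd (ch_affine dY) (ch_mem dY) (ch_mem dZ).
pose s : BY := pull (cov_map Y) VY u; pose W := basic s.
have sW (y : Y) : W y <-> VY (cov_map Y y) /\ unit_at u (cov_map Y y).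
  split=> [sy|[Vy uy]]; last exact: pull_unit.
  have Vy : VY (cov_map Y y) := unit_at_in sy.
  by split=> //; apply/(pull_unitP (f := cov_map Y) u Vy).
have hh : W `<=` mpreim (cov_map Y) VZ by move=> y /sW[_ /uVZ].
have mW (y : Y) : cov_map Z (m y) = cov_map Y y by apply: (cm_over m).1.
have hZ : W `<=` mpreim m (mpreim (cov_map Z) VZ).
  by move=> y /hh; rewrite /mpreim /= /preimage /= mW.
have aY := ch_affine_pre dY.
pose t b := res hZ (pull m (mpreim (cov_map Z) VZ) b).
have [N NE] := choice (fun b => basic_frac aY (t b)).
have [tr trE] := choice NE.
exists u, tr, N; split=> // [b y yc|S h hh'].
  have Wy : W y by apply/sW; rewrite yc; split=> //; exact: (ch_mem dY).
  have Zy : mpreim (cov_map Z) VZ (m y) by apply: (hZ _ Wy).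
  rewrite -(pull_unitP b Zy) -(unit_at_res hZ _ Wy) -(unit_at_res (@basicS _ _ s) (tr b) Wy) -trE unit_atM.
  split=> [h|[_ //]]; split=> //; apply: unit_atX.
  exact/(unit_at_res (@basicS _ _ s) s Wy).
have gu : h s != 0.
  rewrite hh' fmorph_eq0; apply: germ_unit_neq0 uc.
have [h' h'E] := localization_extend (basic_inv aY s) (@basic_frac _ _ aY s) (@basic_zero _ _ aY s) gu.
exists (h' \o (res hZ \o pull m (mpreim (cov_map Z) VZ)) : {rmorphism BZ -> S}); last first.
  by move=> b; rewrite -hh' -(h'E _ _ _ (trE b)).
move=> a; have [n [b1 b1E]] := basic_frac (ch_affine dY) (res uVZ a).
have E : res (@basicS _ _ s) s ^+ n * res hh (pull (cov_map Y) VZ a) =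
    res (@basicS _ _ s) (pull (cov_map Y) VY b1).
  have hu : W `<=` mpreim (cov_map Y) (basic u) by move=> y /sW[].
  have := congr1 (fun q => res hu (pull (cov_map Y) (basic u) q)) b1E.
  rewrite /= !rmorphM !rmorphXn /= !pull_res => E.
  rewrite -(res_res (opens_preimS (@mcont _ _ (cov_map Y)) (@basicS _ _ u)) hu).
  rewrite -[RHS](res_res (opens_preimS (@mcont _ _ (cov_map Y)) (@basicS _ _ u)) hu).
  by rewrite -(res_res (opens_preimS (@mcont _ _ (cov_map Y)) uVZ) hu).
have E' : (res hZ \o pull m (mpreim (cov_map Z) VZ)) (pull (cov_map Z) VZ a) = res hh (pull (cov_map Y) VZ a).
  exact: (cm_over m).2.
have uY : VY `&` VZ `<=` VY by move=> ? [].
apply: (mulIf (expf_neq0 n gu)); rewrite /= in E' *; rewrite E' (h'E _ _ _ E) !hh' -rmorphXn -rmorphM; congr (gbase S _).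
have bg : basic u (gpt D) by apply: gptP uc.
have := congr1 (germ D (basic u) bg) b1E; rewrite rmorphM rmorphXn /=.
rewrite !(germ_res _ (gptP D VY _ (ch_mem dY))) (germ_res _ (gptP D VZ _ (ch_mem dZ))) => E1.
rewrite -[LHS]E1.
by rewrite mulrC.
Qed.

End Transport.

Section Place.
Variables (S : galois_extension K) (ev : {rmorphism Rc -> k}).
Hypotheses (ev0 : forall a, ev a = 0 <-> ~ inv_in (local_ring D c) (vc a))
  (evc : forall a x, vc a = cconst D x -> ev a = x).
Variables (phi : {rmorphism integrals (local_base c S) -> k}).
Hypothesis phiE : forall x r, ival _ x = local_base c S r -> phi x = ev r.

(** A relation rather than a function: it is total and functional only when [S] splits the
    polynomials of the chart, while naturality holds in general. *)
Definition moves (Y : etale_cover C) (d : cover_chart c Y) (g : ggroup S) (y y' : Y) : Prop :=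
  exists h : {rmorphism sec (mpreim (cov_map Y) (ch_open d)) -> S},
    [/\ over_hom (D := D) h, center phi h y & center phi (gact S g \o h) y'].

Lemma over_gact (Y : etale_cover C) (d : cover_chart c Y) g
    (h : {rmorphism sec (mpreim (cov_map Y) (ch_open d)) -> S}) :
  over_hom (D := D) h -> over_hom (D := D) (gact S g \o h).
Proof. by move=> hh a; rewrite /= hh gact_base. Qed.

Lemma moves_natural (Y Z : etale_cover C) (m : cover_morphism Y Z) (dY : cover_chart c Y)
    (dZ : cover_chart c Z) g y y' : cov_map Y y = c -> cov_map Y y' = c ->
  moves dY g y y' -> moves dZ g (m y) (m y').
Proof.
move=> yc y'c [h [hh hy hy']].
have [u [tr [N [uc trU ext]]]] := pulled_hom m dY dZ.
have [q qq qE] := ext S h hh.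
have key (h1 : {rmorphism sec (mpreim (cov_map Y) (ch_open dY)) -> S})
    (q1 : {rmorphism sec (mpreim (cov_map Z) (ch_open dZ)) -> S}) z : over_hom (D := D) h1 ->
    over_hom (D := D) q1 -> (forall b, q1 b * gbase S (chart_germ D dY u) ^+ N b = h1 (tr b)) ->
    cov_map Y z = c -> center phi h1 z -> center phi q1 (m z).
  move=> hh1 qq1 E zc hz b x xE; rewrite (trU b z zc).
  have [h1' h1'E] := over_integral hh1; have [r rE] := chart_local D dY.
  rewrite (hz _ (h1' (tr b))) //; have [fI fIE] := integral_base (local_base c S).
  have -> : h1' (tr b) = x * fI (r u) ^+ N b.
    by apply: ival_inj; rewrite h1'E -E rmorphM rmorphXn fIE xE /local_base /= rE.
  rewrite rmorphM rmorphXn (phiE (fIE _)) mulf_eq0 negb_or expf_neq0 ?andbT //.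
  by apply/eqP; apply/(unit_c ev0 u rE).
exists q; split=> //; first exact: key hy.
apply: key hy' => //; [exact: over_gact|exact: over_gact|].
by move=> b; rewrite /= -qE rmorphM rmorphXn /= gact_base.
Qed.

Section Split.
Variables (Y : etale_cover C) (d : cover_chart c Y).
Hypothesis spl : forall p, p \in chart_polys D d -> splits (map_poly (gbase S) p).

Lemma moves_ex g y : cov_map Y y = c -> exists2 y', cov_map Y y' = c & moves d g y y'.
Proof.
move=> yc; have [h hh hy] := fibre_hom ev0 evc phiE spl yc.
have [y' y'c hy'] := center_exists ev0 phiE (over_gact g hh).
by exists y' => //; exists h.
Qed.

Lemma center_ext (h h' : {rmorphism sec (mpreim (cov_map Y) (ch_open d)) -> S}) y :
  (forall b, h b = h' b) -> center phi h y -> center phi h' y.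
Proof. by move=> E hy b x xE; apply: hy; rewrite xE E. Qed.

Lemma moves_unique g y y1 y2 : cov_map Y y1 = c -> cov_map Y y2 = c ->
  moves d g y y1 -> moves d g y y2 -> y1 = y2.
Proof.
move=> y1c y2c [h [hh hy hy1]] [h' [hh' hy' hy2]].
have E := hom_index ev0 evc phiE spl hh hh' hy hy'.
apply: (center_unique (over_gact g hh) y1c y2c hy1).
by apply: center_ext hy2 => b; rewrite /= E.
Qed.

Lemma moves_inv g y y' : moves d g y y' -> moves d g^-1%g y' y.
Proof.
move=> [h [hh hy hy']]; exists (gact S g \o h : {rmorphism _ -> _}); split=> //; first exact: over_gact.
by apply: center_ext hy => b; rewrite /= -gactM mulgV gact1.
Qed.

End Split.
End Place.
End Naturality.

Lemma ultra_finite (T : Type) (F : set_system T) n (B : 'I_n -> set T) : UltraFilter F ->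
  F (fun t => exists i, B i t) -> exists i, F (B i).
Proof.
move=> uF; elim: n B => [|n IH] B h.
  by case: (@filter_not_empty _ F _); apply: filterS h => t [[]].
have [|nB] := in_ultra_setVsetC (B ord0) uF; first by exists ord0.
have [|i iB] := IH (fun i => B (lift ord0 i)); last by exists (lift ord0 i).
apply: filterS (filterI h nB) => t [[i Bi] nBt].
by case: (unliftP ord0 i) Bi => [j ->|-> //]; exists j.
Qed.

(** * Automorphisms of the fibre functor from Galois groups *)

Section Lift.
Variables (k : closedFieldType) (C : scheme) (D : curve k C) (c : C) (cg : c <> gpt D).
Local Notation K := (cfield D).
Local Notation sO := (local_ring_subring D c).
Local Notation Rc := (subring_of sO).
Local Notation vc := (@subring_val _ _ sO : {rmorphism Rc -> K}).

Lemma exists_residue : exists ev : {rmorphism Rc -> k},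
  (forall a, ev a = 0 <-> ~ inv_in (local_ring D c) (vc a)) /\ (forall a x, vc a = cconst D x -> ev a = x).
Proof.
by apply: (residue_on (curve_dvrP cg) sO) => // x; apply: dvr_const (curve_dvrP cg) _.
Qed.

Variable ev : {rmorphism Rc -> k}.
Hypotheses (ev0 : forall a, ev a = 0 <-> ~ inv_in (local_ring D c) (vc a))
  (evc : forall a x, vc a = cconst D x -> ev a = x).

Lemma exists_local_place (S : galois_extension K) : exists phi : {rmorphism integrals (local_base c S) -> k},
  forall x r, ival _ x = local_base c S r -> phi x = ev r.
Proof.
have hO := curve_dvrP cg.
have [kR kRE] : exists kR : {rmorphism k -> Rc}, forall x, vc (kR x) = cconst D x.
  by apply: subring_lift => x; apply: dvr_const hO _.
have [w wE] := subring_ex sO (dvr_pi hO).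
apply: (exists_place (kR := kR) (w := w)).
- by move=> x; apply: evc; apply: kRE.
- move=> r /ev0 nr; have := non_inv hO (subring_valP r) nr.
  rewrite /vge exprN1 => /(subring_ex sO)[r' rE]; exists r'; apply: subring_val_inj.
  by rewrite [RHS](rmorphM vc) /= wE rE divfK // (dvr_pi_neq0 hO).
- have -> : (local_base c S w)^-1 = gbase S (cpi D c)^-1 by rewrite /local_base /= wE fmorphV.
  move=> [q mq rq]; apply: (dvr_piV hO); apply: (dvr_integrally_closed hO (f := vc)).
    exact: subring_valP.
  exists q => //; move: rq; rewrite (_ : map_poly (local_base c S) q = map_poly (gbase S) (map_poly vc q)).
    by rewrite fmorph_root.
  by rewrite -map_poly_comp.
Qed.

(* A level determines the action of an automorphism of the fibre functor on those covers that
   [lv_field] splits; an ultrafilter glues compatible choices. *)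
Record level := Level {
  lv_field : galois_extension K;
  lv_place : {rmorphism integrals (local_base c lv_field) -> k};
  lv_placeE : forall x r, ival _ x = local_base c lv_field r -> lv_place x = ev r;
  lv_elt : ggroup lv_field }.

Lemma chart_polys_separable (Y : etale_cover C) (d : cover_chart c Y) :
  all (@separable_poly K) (chart_polys D d).
Proof. by rewrite /chart_polys; case: cid => ps /= [? []]. Qed.

Variable d : forall Y : etale_cover C, cover_chart c Y.

Definition lmoves (lv : level) (Y : etale_cover C) (y y' : fibre c Y) : Prop :=
  moves (@lv_place lv) (d Y) (lv_elt lv) (sval y) (sval y').

Definition lsplits (lv : level) (ps : seq {poly K}) : Prop :=
  forall p, p \in ps -> separable_poly p -> splits (map_poly (gbase (lv_field lv)) p).

Local Notation polys Y := (chart_polys D (d Y)).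

Let spl lv Y (h : lsplits lv (polys Y)) : forall p, p \in polys Y -> splits (map_poly (gbase (lv_field lv)) p).
Proof. by move=> p pY; apply: h => //; have /allP/(_ p pY) := chart_polys_separable (d Y). Qed.

Lemma lmoves_ex lv Y (y : fibre c Y) : lsplits lv (polys Y) -> exists y', lmoves lv y y'.
Proof.
move=> /spl h; have [y' y'c hy] := moves_ex ev0 evc (@lv_placeE lv) h (lv_elt lv) (svalP y).
by exists (exist _ y' y'c).
Qed.

Lemma lmoves_unique lv Y (y y1 y2 : fibre c Y) : lsplits lv (polys Y) ->
  lmoves lv y y1 -> lmoves lv y y2 -> y1 = y2.
Proof.
move=> /spl h h1 h2; apply: fibre_inj.
exact: (moves_unique ev0 evc (@lv_placeE lv) h (svalP y1) (svalP y2) h1 h2).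
Qed.

Lemma lmoves_inj lv Y (y y1 y2 : fibre c Y) : lsplits lv (polys Y) ->
  lmoves lv y1 y -> lmoves lv y2 y -> y1 = y2.
Proof.
move=> /spl h /moves_inv h1 /moves_inv h2; apply: fibre_inj.
exact: (moves_unique ev0 evc (@lv_placeE lv) h (svalP y1) (svalP y2) h1 h2).
Qed.

Lemma lmoves_surj lv Y (y' : fibre c Y) : lsplits lv (polys Y) -> exists y, lmoves lv y y'.
Proof.
move=> /spl h; have [y yc hy] := moves_ex ev0 evc (@lv_placeE lv) h (lv_elt lv)^-1%g (svalP y').
by exists (exist _ y yc); have := moves_inv hy; rewrite invgK.
Qed.

Lemma fibre_finite lv Y : lsplits lv (polys Y) ->
  exists n (s : 'I_n -> fibre c Y), forall y, exists i, s i = y.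
Proof.
move=> /spl h; have [g [psi [kB [gg _ psiE _ [_ hy]]]]] := chart_homs ev0 evc (@lv_placeE lv) h.
have ex l : exists y : fibre c Y, center (@lv_place lv) (g l) (sval y).
  by have [y yc hc] := center_exists ev0 (@lv_placeE lv) (gg l); exists (exist _ y yc).
have [s sE] := choice ex; exists _, s => y.
have [l lP] := hy _ (svalP y); exists l; apply: fibre_inj.
apply: (center_unique (gg l) (svalP (s l)) (svalP y) (sE l)) => b x xE.
by rewrite lP (psiE l b x xE).
Qed.

Variables (lv : seq {poly K} -> level).
Hypothesis lvS : forall ps, lsplits (lv ps) ps.

(** For a point y the levels that move it to a given y' form a set of lists; as the fibre is finite,
    exactly one of these sets belongs to the ultrafilter. Bijectivity and naturality hold since they
    hold at each level that splits the covers involved. *)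
Lemma lift_automorphism : exists a : fibre_aut c, forall Y (y y' : fibre c Y),
  (forall ps, lmoves (lv ps) y y') -> fa a y = y'.
Proof.
pose T := seq {poly K}.
(* The filter of the tails: every cover is split at almost all lists, namely those containing the
   polynomials of its chart. *)
pose F0 : set_system T := [set A | exists ps : T, forall qs : T, {subset ps <= qs} -> A qs].
have FF0 : ProperFilter F0.
  split.
    by move=> [ps /(_ ps)]; apply.
  split.
  - by exists [::].
  - move=> A B [ps hA] [qs hB]; exists (ps ++ qs) => rs h; split; [apply: hA|apply: hB] => p pp.
      by apply: h; rewrite mem_cat pp.
    by apply: h; rewrite mem_cat pp orbT.
  - by move=> A B AB [ps hA]; exists ps => qs /hA/AB.
have [F [uF F0F]] := ultraFilterLemma FF0.
have big Y : F [set qs | lsplits (lv qs) (polys Y)].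
  by apply: F0F; exists (polys Y) => qs sub p /sub pq; apply: lvS.
have pick Y (Q : fibre c Y -> set T) : F (fun qs => exists y, Q y qs) -> exists y, F (Q y).
  move=> h; have [n [s sP]] := fibre_finite (lv := lv (polys Y)) (@lvS _).
  have [|i iF] := @ultra_finite T F n (fun i => Q (s i)) uF; last by exists (s i).
  by apply: filterS h => qs [y Qy]; have [i iy] := sP y; exists i; rewrite iy.
have exf Y (y : fibre c Y) : {y' | F [set qs | lmoves (lv qs) y y']}.
  by apply/cid/pick; apply: filterS (big Y) => qs h; apply: lmoves_ex.
have exb Y (y : fibre c Y) : {y' | F [set qs | lmoves (lv qs) y' y]}.
  by apply/cid/(pick _ (fun y' => [set qs | lmoves (lv qs) y' y])); apply: filterS (big Y) => qs h; apply: lmoves_surj.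
pose a Y (y : fibre c Y) := sval (exf Y y); pose b Y (y : fibre c Y) := sval (exb Y y).
have aP Y y : F [set qs | lmoves (lv qs) y (a Y y)] := svalP (exf Y y).
have bP Y y : F [set qs | lmoves (lv qs) (b Y y) y] := svalP (exb Y y).
have ne A : F A -> exists t, A t by move=> /filter_ex[t At]; exists t.
have abK Y y : b Y (a Y y) = y.
  have [qs [[h1 h2] h]] := ne _ (filterI (filterI (aP Y y) (bP Y (a Y y))) (big Y)).
  exact: lmoves_inj h h2 h1.
have baK Y y : a Y (b Y y) = y.
  have [qs [[h1 h2] h]] := ne _ (filterI (filterI (bP Y y) (aP Y (b Y y))) (big Y)).
  exact: lmoves_unique h h2 h1.
have nat (Y Z : etale_cover C) (g : cover_morphism Y Z) (y : fibre c Y) (z : fibre c Z) :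
    proj1_sig z = g (proj1_sig y) -> proj1_sig (a Z z) = g (proj1_sig (a Y y)).
  move=> zy; have [qs [[h1 h2] h]] := ne _ (filterI (filterI (aP Y y) (aP Z z)) (big Z)).
  have gc : cov_map Z (g (sval (a Y y))) = c by rewrite (cm_over g).1 (svalP (a Y y)).
  pose w : fibre c Z := exist _ _ gc.
  have h3 : lmoves (lv qs) z w.
    by rewrite /lmoves zy; apply: (moves_natural ev0 (@lv_placeE (lv qs)) g (d Z) (svalP y) (svalP (a Y y)) h1).
  by rewrite (lmoves_unique h h2 h3).
exists (FibreAut abK baK nat) => Y y y' h /=.
have [qs [h1 h2]] := ne _ (filterI (aP Y y) (big Y)).
exact: lmoves_unique h2 h1 (h qs).
Qed.

End Lift.

Section Identity.
Variables (C : scheme) (Y : etale_cover C).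

Let id_cont : continuous (id : Y -> Y). Proof. by move=> x; exact: cvg_id. Qed.
Let id_sub (V : opens Y) : opens_preim id_cont V `<=` V. Proof. by []. Qed.

Let id_res (V W : opens Y) (h : W `<=` V) (s : sec V) :
  res (@id_sub W) (res h s) = res (opens_preimS id_cont h) (res (@id_sub V) s).
Proof.
have hh : opens_preim id_cont W `<=` V := subset_trans (@id_sub W) h.
by rewrite (res_res _ _ hh) (res_res _ _ hh).
Qed.

Let id_local (V : opens Y) (s : sec V) (x : Y) : V x -> unit_at (res (@id_sub V) s) x -> unit_at s x.
Proof. by move=> Vx /unit_at_res; apply. Qed.

Let id_morphism : scheme_morphism Y Y := SchemeMorphism id_res id_local.

Let id_over : factors id_morphism (cov_map Y) (cov_map Y).
Proof.
split=> // V W hgf hh s; change (res hgf (res (@id_sub (mpreim (cov_map Y) V)) (pull (cov_map Y) V s)) = res hh (pull (cov_map Y) V s)).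
by rewrite (res_res _ _ hh).
Qed.

(** Naturality along the identity makes the action independent of the chart. *)
Definition id_cover : cover_morphism Y Y := CoverMorphism id_over.

End Identity.

Lemma separable_binomial_deriv (F : fieldType) (P : {poly F}) n : n%:R != 0 :> F -> P.[0] != 0 ->
  P^`() = 'X^(n.-1) *+ n -> separable_poly P.
Proof.
move=> n0 P0 P'; rewrite unlock P' -scaler_nat coprimepZr //; apply: coprimep_expr.
by rewrite -['X]subr0 -polyC0 coprimep_XsubC.
Qed.

Lemma trinomial_deriv (F : fieldType) (t : F) n s : s%:R = 0 :> F ->
  (trinomial n s t)^`() = 'X^(n.-1) *+ n.
Proof.
move=> sF; have sP : s%:R = 0 :> {poly F}.
  by rewrite -(rmorph_nat (@polyC F)) sF; exact: polyC0.
rewrite /trinomial derivD derivB derivZ !derivXn derivC addr0.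
by rewrite -[_ *+ s]mulr_natl sP mul0r scaler0 subr0.
Qed.

Section Level.
Variables (k : closedFieldType) (C : scheme) (D : curve k C) (c : C).
Local Notation K := (cfield D).
Local Notation sO := (local_ring_subring D c).
Local Notation Rc := (subring_of sO).
Local Notation vc := (@subring_val _ _ sO : {rmorphism Rc -> K}).
Variable ev : {rmorphism Rc -> k}.
Hypotheses (ev0 : forall a, ev a = 0 <-> ~ inv_in (local_ring D c) (vc a))
  (evc : forall a x, vc a = cconst D x -> ev a = x).

Section Action.
Variables (S : galois_extension K) (phi : {rmorphism integrals (local_base c S) -> k}).
Hypothesis phiE : forall x r, ival _ x = local_base c S r -> phi x = ev r.
Variables (Y : etale_cover C) (d : cover_chart c Y).
Hypothesis spl : forall p, p \in chart_polys D d -> splits (map_poly (gbase S) p).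
Local Notation B := (sec (mpreim (cov_map Y) (ch_open d))).
Local Notation n := (ch_rank d).
Local Notation ee := (@ch_basis _ _ _ d).

Lemma chart_action : exists (h : 'I_n -> {rmorphism B -> S}) (a : ggroup S -> {perm 'I_n}),
  [/\ (forall l, over_hom (D := D) (h l)),
      (forall l m, (forall i, h l (ee i) = h m (ee i)) -> l = m),
      (forall g : {rmorphism B -> S}, over_hom (D := D) g -> exists l, forall b, g b = h l b),
      {morph a : g g' / (g * g')%g} &
      forall g l b, gact S g (h l b) = h (a g l) b].
Proof.
have [h [psi [kB [hh uW _ _ _]]]] := chart_homs ev0 evc phiE spl.
have inj l m : (forall i, h l (ee i) = h m (ee i)) -> l = m.
  move=> E; apply/eqP/negPn/negP => nlm; pose v : 'rV[S]_n := delta_mx 0 l - delta_mx 0 m.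
  have v0 : v *m (\matrix_(l, i) h l (ee i)) = 0.
    by rewrite mulmxBl -!rowE; apply/rowP => i; rewrite !mxE E subrr.
  have : v = 0 by rewrite -[v](mulmxK uW) v0 mul0mx.
  by move=> /rowP/(_ l); rewrite !mxE !eqxx (negPf nlm) subr0 => /eqP; rewrite oner_eq0.
have all_hom (g : {rmorphism B -> S}) : over_hom (D := D) g -> exists l, forall b, g b = h l b.
  exact: (hom_unique (ch_separable d) (j := gbase S \o chart_germ D d) hh uW).
have /choice[f fE] (gl : ggroup S * 'I_n) : exists m, forall b, gact S gl.1 (h gl.2 b) = h m b.
  exact: all_hom (over_gact gl.1 (hh gl.2)).
have f_inj g : injective (fun l => f (g, l)).
  move=> l m E; apply: inj => i; have := fE (g, l) (ee i); rewrite /= E -(fE (g, m) (ee i)).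
  exact: fmorph_inj.
exists h, (fun g => perm (f_inj g)); split=> //.
  move=> g g'; apply/permP => l; rewrite permM !permE; apply: inj => i.
  by rewrite -(fE (_, l)) /= gactM -(fE (g', _)) /= -(fE (g, l)).
by move=> g l b; rewrite permE -(fE (g, l)).
Qed.

End Action.

Variable d : forall Y : etale_cover C, cover_chart c Y.
Variables (r : nat) (Ys : 'I_r -> etale_cover C) (E : etale_cover C).
Variable dY : forall i, cover_chart c (Ys i).
Variables (t : K) (p l s : nat) (Y0 : sec (mpreim (cov_map E) (ch_open (d E)))) (tV : sec (ch_open (d E))).
Hypotheses (hrank : ch_rank (d E) = (l + s)%N) (hbasis : forall i, @ch_basis _ _ _ (d E) i = Y0 ^+ i).
Hypotheses (tE : chart_germ D (d E) tV = t)
  (Yrel : Y0 ^+ (l + s) - pull (cov_map E) (ch_open (d E)) tV * Y0 ^+ s + 1 = 0).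
Hypotheses (tt : ~ algebraicOver (cconst D) t^-1).
Variables (dw : nat) (bw : 'I_dw -> K).
Hypotheses (sb : spans (fraction_val (evalp (cconst D) t^-1)) bw).
Hypotheses (pl : prime l) (s0 : (0 < s)%N) (sl : (s < l)%N) (dwl : (dw < l)%N).
Hypotheses (hp : p \in [pchar k]) (ps : (p %| s)%N) (lp : l != p).
Local Notation W := {i : 'I_r & 'I_(ch_rank (dY i))}.
Hypotheses (Wl : (#|{: W}| < l)%N) (Wc : coprime (l + s) (#|{: W}|)`!).
Hypothesis irr : irreducible_poly (trinomial (l + s) s t).
Local Notation n := (l + s)%N.
Local Notation F := (trinomial n s t).

Let lk : l%:R != 0 :> k.
Proof. by rewrite -(dvdn_pcharf hp) dvdn_prime2 // ?(eq_sym p) //; case/andP: hp. Qed.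
Let nK m : m%:R = cconst D m%:R :> K. Proof. by rewrite rmorph_nat. Qed.
Let sk : s%:R = 0 :> k. Proof. by apply/eqP; rewrite -(dvdn_pcharf hp). Qed.
Let t0 : t != 0.
Proof. by apply/eqP => t0; apply: tt; rewrite t0 invr0; apply: algebraic0. Qed.

Lemma separable_trinomial : separable_poly F.
Proof.
apply: (@separable_binomial_deriv _ _ n).
- by rewrite nK natrD sk addr0 fmorph_eq0.
- rewrite /trinomial !hornerE !expr0n !gtn_eqF ?addn_gt0 ?s0 ?orbT //.
  by rewrite mulr0 subr0 add0r oner_neq0.
- by apply: trinomial_deriv; rewrite nK sk rmorph0.
Qed.

Lemma separable_radical : separable_poly ('X^l - t%:P).
Proof.
apply: (@separable_binomial_deriv _ _ l).
- by rewrite nK fmorph_eq0.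
- by rewrite !hornerE expr0n gtn_eqF ?prime_gt0 //= sub0r oppr_eq0.
- by rewrite derivB derivXn derivC subr0.
Qed.

(** [transitive_kernel] is applied to the Galois group acting on the morphisms of the chart of [E],
    which correspond to the roots of the trinomial, and on the morphisms of the charts of the [Ys].
    The list [qs] is arbitrary, so that the prescribed action is realized at every level. *)
Lemma exists_level (qs : seq {poly K}) m (e e' : 'I_m -> fibre c E) (cg : c <> gpt D) : (m <= s.+1)%N ->
  injective e -> injective e' -> exists lv : level ev,
    [/\ lsplits lv qs, (forall i (y : fibre c (Ys i)), lmoves d lv y y) &
        forall i, lmoves d lv (e i) (e' i)].
Proof.
move=> ms ei ei'.
(* X^l - t is included so that the extension contains the l-th root [u] of t on which the inertia
   argument relies. *)
pose ps0 := F :: ('X^l - t%:P) :: chart_polys D (d E) ++ flatten [seq chart_polys D (dY i) | i : 'I_r].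
have sep : all (@separable_poly K) (seq.filter (@separable_poly K) qs ++ ps0).
  rewrite all_cat filter_all /= separable_trinomial separable_radical all_cat chart_polys_separable /=.
  by apply/allP => q /flattenP[_ /mapP[i _ ->]]; apply/allP/chart_polys_separable.
have [S Sspl] := exists_galois sep.
have Sspl0 q : q \in ps0 -> splits (map_poly (gbase S) q).
  by move=> qq; apply: Sspl; rewrite mem_cat qq orbT.
have [phi phiE] := exists_local_place cg ev0 evc S.
have splE q : q \in chart_polys D (d E) -> splits (map_poly (gbase S) q).
  by move=> qq; apply: Sspl0; rewrite /ps0 !inE mem_cat qq !orbT.
have splY i q : q \in chart_polys D (dY i) -> splits (map_poly (gbase S) q).
  move=> qq; apply: Sspl0; rewrite /ps0 !inE mem_cat; apply/orP; right; apply/orP; right; apply/orP; right.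
  by apply/flattenP; exists (chart_polys D (dY i)) => //; apply: (map_f (fun i => chart_polys D (dY i))); rewrite mem_enum.
have [h [a [hh hi hall aM aE]]] := chart_action phiE splE.
have actY i := chart_action phiE (@splY i).
have exY i : {a : ggroup S -> {perm 'I_(ch_rank (dY i))} |
    {morph a : g g' / (g * g')%g} /\ forall (g : ggroup S), a g = 1%g ->
      forall q : {rmorphism _ -> S}, over_hom (D := D) (d := dY i) q -> forall b, gact S g (q b) = q b}.
  apply: cid.
  have [h1 [a1 [_ _ hall1 a1M a1E]]] := actY i; exists a1; split=> // g g1 q qq b.
  by have [m1 m1E] := hall1 q qq; rewrite m1E a1E g1 perm1.
pose aY i := sval (exY i); have aYM i : {morph aY i : g g' / (g * g')%g} := (svalP (exY i)).1.
have aYfix i := (svalP (exY i)).2.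
pose rt i := h i Y0.
have rtP i : root (map_poly (gbase S) F) (rt i).
  apply/rootP; rewrite map_trinomial /trinomial !hornerE.
  have := congr1 (h i) Yrel; rewrite rmorphD rmorphB rmorphM !rmorphXn rmorph1 rmorph0 hh tE.
  by move=> <-.
have rt_inj : injective rt.
  by move=> i j ij; apply: hi => z; rewrite hbasis !rmorphXn /= -/(rt i) ij.
have mF : F \is monic by apply: trinomial_monic => //; rewrite -[X in (X < _)%N]add0n ltn_add2r prime_gt0.
have sF : size F = n.+1 by apply: size_trinomial => //; rewrite -[X in (X < _)%N]add0n ltn_add2r prime_gt0.
have rt_all y : root (map_poly (gbase S) F) y -> exists i, y = rt i.
  move=> ry; apply: contrapT => ny.
  have := @max_poly_roots _ (map_poly (gbase S) F) (y :: [seq rt i | i : 'I_(ch_rank (d E))]).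
  rewrite map_poly_eq0 monic_neq0 // /= ry map_inj_uniq // enum_uniq andbT size_map_poly sF.
  have ss : size [seq rt i | i : 'I_(ch_rank (d E))] = n by rewrite size_map size_enum_ord.
  rewrite ss ltnn => h1; suff : false by [].
  apply: h1 => //; first by apply/allP => _ /mapP[i _ ->].
  by apply/mapP => -[i _ yi]; apply: ny; exists i.
have [u ul] : exists u : S, u ^+ l = gbase S (t^-1)^-1.
  have [|zs zsE] := Sspl0 ('X^l - t%:P); first by rewrite /ps0 !inE eqxx orbT.
  case: zs zsE => [|z zs] zsE.
    have := eqp_size zsE; rewrite size_map_poly big_nil size_poly1 size_XnsubC ?prime_gt0 // => -[l0].
    by have := prime_gt0 pl; rewrite l0.
  have : root (map_poly (gbase S) ('X^l - t%:P)) z by rewrite (eqp_root zsE) root_prod_XsubC inE eqxx.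
  rewrite rmorphB /= map_polyXn map_polyC /= => /rootP; rewrite !hornerE => /eqP.
  by rewrite subr_eq0 => /eqP uE; exists z; rewrite invrK.
have cyc : exists g i, forall j, a (g ^+ j)%g i = i -> (l %| j)%N.
  have spF : splits (map_poly (gbase S) (trinomial n s (t^-1)^-1)).
    by rewrite invrK; apply: Sspl0; rewrite /ps0 inE eqxx.
  have [g [y [ry yP]]] := inertia_cycle tt sb pl lk dwl s0 spF ul
    (f := gbase S \o evalp (cconst D) t^-1) (fun P => erefl).
  rewrite invrK in ry; have [i yi] := rt_all y ry; exists g, i => j aj.
  by apply: yP; rewrite yi /rt aE aj.
(* The product of the X - g(rt i) over the group descends to K and has the root [rt i]. It is a
   multiple of the irreducible F, hence vanishes at [rt i'], which is thus a conjugate. *)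
have tr i i' : exists g, a g i = i'.
  pose P := \prod_(g : ggroup S) ('X - (gact S g (rt i))%:P).
  have Pfix g : map_poly (gact S g) P = P.
    rewrite /P rmorph_prod [RHS](reindex_inj (mulIg g)) /=; apply: eq_bigr => g' _.
    by rewrite map_polyXsubC gactM.
  have /choice[q qE] z : exists q, P`_z = gbase S q.
    by apply: gact_fixed => g; rewrite -[in RHS](Pfix g) coef_map.
  pose Q := \poly_(z < size P) q z.
  have PQ : P = map_poly (gbase S) Q.
    apply/polyP => z; rewrite coef_map coef_poly; case: ltnP => [_|Pz]; first exact: qE.
    by rewrite nth_default //; apply/esym; apply: rmorph0.
  have P0 : evalp (gbase S) (rt i) Q = 0.
    rewrite /evalp -PQ /P horner_prod (bigD1 1%g) //= gact1 hornerXsubC subrr mul0r //.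
  have /dvdpP[q1 q1E] : F %| Q by apply: irreducible_minimal irr _ P0; apply/rootP/rtP.
  have : root P (rt i') by rewrite PQ q1E rmorphM /= rootM rtP orbT.
  rewrite /P /root horner_prod => /prodf_eq0[g _]; rewrite hornerXsubC subr_eq0 => /eqP E'.
  by exists g; apply: rt_inj; rewrite E' /rt aE.
have aY1 i : aY i 1%g = 1%g.
  by apply: (mulgI (aY i 1%g)); rewrite -aYM !mulg1.
(* The actions on the morphisms of all the [Ys] are gathered in one permutation of their disjoint
   union, whose cardinality bounds the primes to be avoided. *)
pose fW g (x : W) : W := Tagged (fun i => 'I_(ch_rank (dY i))) (aY (tag x) g (tagged x)).
have fWK g : cancel (fW g) (fW g^-1%g).
  move=> [i z]; rewrite /fW /=; congr (existT _ i _).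
  by rewrite -permM -aYM mulgV aY1 perm1.
pose aW g := perm (can_inj (fWK g)).
have aWM : {morph aW : g g' / (g * g')%g}.
  by move=> g g'; apply/permP => -[i z]; rewrite permM !permE /fW /= aYM permM.
have aW1 g : aW g = 1%g -> forall i, aY i g = 1%g.
  move=> g1 i; apply/permP => z; have := congr1 (fun f : {perm W} => f (Tagged (fun i => 'I_(ch_rank (dY i))) z)) g1.
  rewrite permE !perm1 -[fW _ _]/(Tagged (fun i => 'I_(ch_rank (dY i))) (aY i g z)) => /eqP.
  by rewrite -tag_eqE /tag_eq /= eqxx tagged_asE => /eqP.
have /choice[ix ixE] (x : fibre c E) : exists i, center phi (h i) (sval x).
  have [q qq qx] := fibre_hom ev0 evc phiE splE (svalP x); have [i iE] := hall q qq.
  by exists i; apply: center_ext qx.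
have ix_inj : injective ix.
  move=> x x' xx; apply: fibre_inj; apply: (center_unique (hh (ix x)) (svalP x) (svalP x') (ixE x)).
  by rewrite xx; apply: ixE.
have cT : #|'I_(ch_rank (d E))| = n by rewrite card_ord.
have [g [g1 gE]] := transitive_kernel aM aWM pl cT sl Wl Wc tr cyc ms
  (inj_comp ix_inj ei) (inj_comp ix_inj ei').
exists (Level phiE g); split=> [q qq sq|i y|i].
- by apply: Sspl; rewrite mem_cat mem_filter sq qq.
- have [q qq qy] := fibre_hom ev0 evc phiE (@splY i) (svalP y).
  (* The kernel condition concerns the charts [dY], whereas [lmoves] refers to the charts [d]. *)
  apply: (moves_natural ev0 phiE (id_cover (Ys i)) (dY := dY i) (d (Ys i)) (svalP y) (svalP y)).
  exists q; split=> //; apply: center_ext qy => b.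
  by rewrite /= (aYfix i g (aW1 g g1 i)).
- exists (h (ix (e i))); split=> //; apply: center_ext (ixE (e' i)) => b.
  by rewrite /= aE; congr (h _ b); apply/esym/gE.
Qed.

End Level.

(** * Embedding problems *)

Section AlmostOmegaFree.
Variables (k : closedFieldType) (p : nat) (hp : p \in [pchar k]).
Variables (C : scheme) (D : curve k C) (c : C) (cg : c <> gpt D).
Local Notation K := (cfield D).

(** The morphisms of the chart are pairwise distinct, hence so are their centres by [hom_index]. *)
Lemma fibre_points (Y : etale_cover C) (d : cover_chart c Y) :
  exists e : 'I_(ch_rank d) -> fibre c Y, injective e.
Proof.
have [ev [ev0 evc]] := exists_residue cg.
have [S spl] := exists_galois (chart_polys_separable D d).
have [phi phiE] := exists_local_place cg ev0 evc S.
have [h [a [hh hi _ _ _]]] := chart_action ev0 evc phiE spl.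
have /choice[e eE] l : exists y : fibre c Y, center phi (h l) (sval y).
  by have [y yc hy] := center_exists ev0 phiE (hh l); exists (exist _ y yc).
exists e => l m lm; apply: hi => i.
by apply: (hom_index ev0 evc phiE spl (hh l) (hh m) (eE l)); rewrite lm; apply: eE.
Qed.

Lemma coprime_addl l s q : (q %| s)%N -> coprime l q -> coprime (l + s) q.
Proof. by move=> /eqP qs lq; rewrite /coprime -(gcdn_modl (l + s)) -modnDmr qs addn0 gcdn_modl. Qed.

Lemma function_field_basis (z : K) : ~ algebraicOver (cconst D) z ->
  exists n (b : 'I_n -> K), [/\ (0 < n)%N, spans (fraction_val (evalp (cconst D) z)) b &
    indep (fraction_val (evalp (cconst D) z)) b].
Proof.
move=> /curve_finite[ys gen]; have [n [b sb]] := finite_spans (zariski gen) gen.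
have [[|m] [b' [sb' ib']]] := spans_basis sb; last by exists m.+1, b'.
by have [x /eqP] := sb' 1; rewrite big_ord0 oner_eq0.
Qed.

Lemma transitive_cover r (Ys : 'I_r -> etale_cover C) (m : nat) : exists E : etale_cover C,
  (exists e : 'I_m -> fibre c E, injective e) /\
  forall e e' : 'I_m -> fibre c E, injective e -> injective e' ->
    exists a : fibre_aut c, (forall i (y : fibre c (Ys i)), fa a y = y) /\ forall i, fa a (e i) = e' i.
Proof.
have [ev [ev0 evc]] := exists_residue cg.
pose d0 Y : cover_chart c Y := sval (cid (exists_chart c Y)).
pose t := ct D; have tt : ~ algebraicOver (cconst D) t := @ct_transcendental _ _ D.
have tVt : ~ algebraicOver (cconst D) t^-1 by move=> /algebraic_inv; rewrite invrK.
have [dt [bt [dt0 sbt ibt]]] := function_field_basis tt.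
have [dw [bw [_ sbw _]]] := function_field_basis tVt.
pose D' := #|{: {i : 'I_r & 'I_(ch_rank (d0 (Ys i)))}}|.
have pp : prime p by case/andP: hp.
pose s := (p * D'`! * dt * m.+1)%N.
have s0 : (0 < s)%N by rewrite !muln_gt0 prime_gt0 // fact_gt0 dt0.
have ms : (m <= s)%N by apply: (leq_trans (leqnSn m)); rewrite leq_pmull // !muln_gt0 prime_gt0 // fact_gt0 dt0.
have ps : (p %| s)%N by rewrite /s -!mulnA dvdn_mulr.
have Ds : (D'`! %| s)%N by rewrite /s -!mulnA dvdn_mull // dvdn_mulr.
have dts : (dt %| s)%N by rewrite /s -mulnA dvdn_mull // dvdn_mulr.
have [l ll pl] := prime_above (s + p + D' + dw + dt)%N.
have [sl lp' Dl dwl dtl] : [/\ (s < l)%N, (p < l)%N, (D' < l)%N, (dw < l)%N & (dt < l)%N].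
  by split; apply: leq_ltn_trans ll; rewrite -?addnA;
    do ?[exact: leqnn|exact: leq_addr|apply: leq_trans _ (leq_addl _ _)].
have lp : l != p by rewrite gtn_eqF.
have Dc : coprime (l + s) D'`!.
  apply: coprime_addl => //; rewrite prime_coprime //; apply/negP => /(prime_dvd_fact pl).
  by rewrite leqNgt Dl.
have dtc : coprime (l + s) dt by apply: coprime_addl => //; rewrite prime_coprime // gtnNdvd.
have sn : (s < l + s)%N by rewrite -[X in (X < _)%N]add0n ltn_add2r prime_gt0.
have pn : ~~ (p %| l + s)%N by rewrite dvdn_addl // dvdn_prime2 // eq_sym.
have irr := trinomial_irreducible s0 sn dtc tt sbt ibt.
have [E EP] := trinomial_cover hp (@ct_regular _ _ D) s0 sn ps pn cg irr.
have [V [Vc aV]] := sch_affine c; have [aE [Y0 [sbY rel]]] := EP V aV Vc.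
pose dE := CoverChart Vc aV aE sbY.
(* For [E] the chart whose basis consists of the powers of a root is needed. The ranks in D' refer
   to [d0], chosen before [l], so that the two families of charts differ if [E] happens to be among
   the [Ys]. *)
pose d Y : cover_chart c Y := match pselect (E = Y) with
  | left e => eq_rect E (cover_chart c) dE Y e | right _ => d0 Y end.
have dEE : d E = dE.
  by rewrite /d; case: pselect => // e; rewrite (Prop_irrelevance e erefl).
have gV : V (gpt D) := gptP D V _ Vc.
have [tV tVE] := regular_onP gV (fun x _ => @ct_regular _ _ D x).
have [Y1 [tV1 [h1 h2 h3 h4]]] : exists (Y1 : sec (mpreim (cov_map E) (ch_open (d E)))) (tV1 : sec (ch_open (d E))),
    [/\ ch_rank (d E) = (l + s)%N, (forall i, @ch_basis _ _ _ (d E) i = Y1 ^+ i),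
        chart_germ D (d E) tV1 = t &
        Y1 ^+ (l + s) - pull (cov_map E) (ch_open (d E)) tV1 * Y1 ^+ s + 1 = 0].
  rewrite dEE; exists Y0, tV; split=> //.
    by rewrite /chart_germ -[t]tVE; congr (germ D V _ tV); apply: Prop_irrelevance.
  exact: rel tVE.
exists E; split=> [|e e' ei ei'].
  have [e ei] := fibre_points (d E).
  have mr : (m <= ch_rank (d E))%N by rewrite h1 (leq_trans ms) // leq_addl.
  by exists (fun i => e (widen_ord mr i)) => i j /ei/(congr1 (@nat_of_ord _)) ij; apply: val_inj.
have /choice[lv lvP] qs := exists_level ev0 evc (d := d) (dY := fun i => d0 (Ys i)) h1 h2 h3 h4 tVt sbw pl s0 sl dwl hp ps lp Dl Dc irr
  qs cg (leqW ms) ei ei'.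
have [a aP] := lift_automorphism ev0 evc d (lv := lv) (fun qs => let: And3 h _ _ := lvP qs in h).
exists a; split=> [i y|i]; apply: aP => qs; have [_ hY hE] := lvP qs; [exact: hY|exact: hE].
Qed.

Section Problem.
Variable EP : embedding_problem (etale_pi1 c).
Local Notation G := (ep_G EP).
Local Notation Gam := (ep_Gamma EP).
Local Notation f := (@ep_f _ EP).
Local Notation alpha := (@ep_alpha _ EP).
Local Notation aut := (fibre_aut c).

Let alphaM (x y : aut) : alpha (fibre_autM x y) = (alpha x * alpha y)%g.
Proof. exact: (ep_alpha_hom EP).1. Qed.

Let alpha1 : alpha (fibre_aut1 c) = 1%g.
Proof. by apply: (mulgI (alpha (fibre_aut1 c))); rewrite -alphaM fibre_aut1M mulg1. Qed.

Lemma problem_solvable : exists (H : open_subgroup (etale_pi1 c))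
  (hs : forall g, exists x, @alpha_restr _ EP H x = g)
  (gamma : subgroup_topgroup H -> ep_Gamma (induced_problem hs)), proper_solution gamma.
Proof.
(* By continuity [alpha] is trivial on the elements that fix the fibres of finitely many covers. *)
have [r [Ys YsP]] := (ep_alpha_hom EP).2 [set 1%g] (fibre_aut1 c) alpha1.
have [E [[e0 e0i] ext]] := transitive_cover Ys #|Gam|.
pose e (g : Gam) : fibre c E := e0 (enum_rank g).
have ei : injective e by move=> g g' /e0i/enum_rank_inj.
have extG (e' : Gam -> fibre c E) : injective e' -> exists a : aut,
    (forall i (y : fibre c (Ys i)), fa a y = y) /\ forall g, fa a (e g) = e' g.
  move=> e'i; have [|a [a1 a2]] := ext e0 (fun i => e' (enum_val i)) e0i.
    by move=> i j /e'i/enum_val_inj.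
  by exists a; split=> // g; rewrite /e a2 enum_rankK.
have alpha_local (x b : aut) : agree_on Ys x b -> alpha b = alpha x.
  move=> xb; have -> : b = fibre_autM x (fibre_autM (fibre_autV x) b).
    by apply: fibre_aut_ext => Y y /=; rewrite faiK.
  rewrite alphaM (_ : alpha (fibre_autM (fibre_autV x) b) = 1%g) ?mulg1 //.
  by apply: YsP => i y /=; rewrite -xb faK.
pose sol (x : aut) (g : Gam) := f g = alpha x /\ forall h, fa x (e h) = e (g * h)%g.
have sol_unique x g g' : sol x g -> sol x g' -> g = g'.
  by move=> [_ /(_ 1%g) h1] [_ /(_ 1%g)]; rewrite h1 !mulg1 => /ei.
have sol_open (A : set Gam) : fibre_aut_open (fun x => exists2 g, A g & sol x g).
  (* The condition on [alpha x] is decided by the action on the [Ys] and the other one by the action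
     on [E], which gives r + 1 covers. *)
  move=> x [g Ag [gx gh]]; exists r.+1, (fun i => if unlift ord0 i is Some j then Ys j else E) => b xb.
  exists g => //; split; first by rewrite gx; apply/esym/alpha_local => i y; have := xb (lift ord0 i); rewrite liftK; apply.
  by move=> h; have := xb ord0; rewrite unlift_none => <-.
have solM x y g h : sol x g -> sol y h -> sol (fibre_autM x y) (g * h)%g.
  move=> [gx gh] [hy hh]; split; first by rewrite alphaM ep_f_hom gx hy.
  by move=> z /=; rewrite hh gh mulgA.
have f1 : f 1%g = 1%g by apply: (mulgI (f 1%g)); rewrite -ep_f_hom !mulg1.
have sol1 : sol (fibre_aut1 c) 1%g.
  by split=> [|h]; rewrite ?f1 ?alpha1 // mul1g.
have solV x g : sol x g -> sol (fibre_autV x) g^-1%g.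
  move=> [gx gh]; split.
    apply: (mulgI (f g)); rewrite -ep_f_hom mulgV f1 gx -alphaM.
    transitivity (alpha (fibre_aut1 c)); first by rewrite alpha1.
    congr (alpha _).
    by apply: fibre_aut_ext => Y y /=; rewrite faiK.
  by move=> h /=; rewrite -[h in LHS](mulKVg g) -gh faK.
pose Hp (x : aut) := exists g, sol x g.
have Ho : @tgopen (etale_pi1 c) Hp.
  move=> x [g xg]; have [|n [Y YP]] := sol_open setT x; first by exists g.
  by exists n, Y => b /YP[g' _ bg']; exists g'.
pose H : open_subgroup (etale_pi1 c) := @OpenSubgroup (etale_pi1 c) Hp Ho (ex_intro _ _ sol1)
  (fun x y => fun '(ex_intro g xg) '(ex_intro h yh) => ex_intro _ _ (solM x y g h xg yh))
  (fun x => fun '(ex_intro g xg) => ex_intro _ _ (solV x g xg)).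
have realize g : exists x : aut, sol x g.
  have [a aE] := ep_alpha_surj (f g).
  (* First [a] is any element over [f g]. It is corrected by some [b] with trivial image under
     [alpha] that sends each [e h] to the preimage of e(gh) under [a]. *)
  have [|b [b1 b2]] := extG (fun h => fai a (e (g * h)%g)).
    by move=> h h' /(congr1 (fa a (Y := E))); rewrite !faiK => /ei/mulgI.
  exists (fibre_autM a b); split; last by move=> h /=; rewrite b2 faiK.
  by rewrite alphaM (_ : alpha b = 1%g) ?mulg1 ?aE //; apply: YsP => i y /=; rewrite b1.
have hs g : exists x, @alpha_restr _ EP H x = g.
  have [g' <-] := ep_f_surj g; have [x xg] := realize g'.
  by exists (exist _ x (ex_intro _ g' xg)); rewrite /alpha_restr /= -xg.1.
pose gamma (x : subgroup_topgroup H) : ep_Gamma (induced_problem hs) := sval (cid (svalP x : Hp (sval x))).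
have gammaP (x : subgroup_topgroup H) : sol (sval x) (gamma x) := svalP (cid (svalP x : Hp (sval x))).
exists H, hs, gamma; split; last first.
  move=> g; have [x xg] := realize g; exists (exist _ x (ex_intro _ g xg)).
  have h := gammaP (exist _ x (ex_intro _ g xg)); exact: sol_unique h xg.
split; last by move=> x; rewrite [LHS](gammaP x).1.
split=> [x y|A]; first by have h := gammaP (tgM x y); exact: sol_unique h (solM _ _ _ _ (gammaP x) (gammaP y)).
exists (fun x => exists2 g, A g & sol x g); first exact: sol_open.
move=> x; split=> [Ax|[g Ag xg]]; first by exists (gamma x) => //; apply: gammaP.
by rewrite (sol_unique _ _ _ (gammaP x) xg).
Qed.

End Problem.

End AlmostOmegaFree.

Theorem theorem6 (k : closedFieldType) (p : nat) (hp : p \in [pchar k]%R)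
    (X : kscheme k) (hX : smooth_connected_projective_curve X)
    (Sigma : set X)
    (hfin : finite_set Sigma) (hne : (Sigma !=set0)%classic)
    (hcl : forall x : X, Sigma x -> closed_point x)
    (C : scheme) (j : scheme_morphism C X) (hj : open_immersion j)
    (hC : range j = (~` Sigma)%classic)
    (c : C) (hc : closed_point c) :
  almost_omega_free (etale_pi1 c).
Proof.
have [D hD] := open_curve hX hne hcl hj hC.
move=> EP; exact: (problem_solvable hp (hD c hc) EP).
Qed.
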